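(* Let $d\geq 2$, and let $r>1$ and $1\leq p<\infty$ be such that $p<\frac{d}{r-1}$. Then there is $\bar\mu=\bar\mu(r,p,d)<1$, depending only on $r,p,d$, such that for every $T>0$ and every $\sigma>0$ there exist a bounded divergence-free velocity field $v:[0,T]\times\mathbb{R}^d\to\mathbb{R}^d$ and a (weak) solution $\theta:[0,T]\times\mathbb{R}^d\to\mathbb{R}$ of the continuity equation $$\partial_t\theta+\operatorname{div}(v\,\theta)=0$$ with the following properties: (i) the velocity field $v$ is bounded in $\dot W^{r,p}(\mathbb{R}^d)$ uniformly in time, i.e. $\sup_{0\le t\le T}\|v(t,\cdot)\|_{\dot W^{r,p}(\mathbb{R}^d)}<\infty$; (ii) the initial datum $\bar\theta:=\theta(0,\cdot)$ belongs to $\dot H^\sigma(\mathbb{R}^d)$; (iii) the solution $\theta(t,\cdot)$ does not belong to $\dot H^\sigma(\mathbb{R}^d)$ for any $0<t\le T$; (iv) both $v$ and $\theta$ are compactly supported in space, and can be taken smooth on the complement of a point in $\mathbb{R}^d$ (i.e. on $[0,T]\times(\mathbb{R}^d\setminus\{x_0\})$ for some $x_0\in\mathbb{R}^d$); (v) for any $\mu>\bar\mu$ the solution $\theta(T,\cdot)$ does not belong to $\dot H^{\mu\sigma}(\mathbb{R}^d)$ at the final time $T$.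
   Context: Homogeneous Sobolev spaces: for $s\ge 0$ and $1<p<\infty$, a tempered distribution $f\in\mathcal{S}'(\mathbb{R}^d)$ belongs to $\dot{W}^{s,p}(\mathbb{R}^d)$ if its Fourier transform $\hat f$ belongs to $L^1_{\rm loc}(\mathbb{R}^d)$ and $\mathcal{F}^{-1}(|\xi|^s\hat f(\xi))\in L^p(\mathbb{R}^d)$; the norm $\|f\|_{\dot W^{s,p}(\mathbb{R}^d)}$ is the $L^p(\mathbb{R}^d)$ norm of this function. For $p=1$ the space $\dot W^{s,1}$ is understood via weak derivatives and interpolation: for integer $s$ the norm is the $L^1$ norm of the weak derivatives of order $s$; for noninteger $s=k+\alpha$ with $k\in\mathbb{N}\cup\{0\}$, $0<\alpha<1$, it is the sum over $|\beta|=k$ of $\int\int |\partial^\beta f(x)-\partial^\beta f(y)|\,|x-y|^{-d-\alpha}\,dx\,dy$. For $s\in\mathbb{R}$, $f\in\mathcal{S}'(\mathbb{R}^d)$ belongs to $\dot H^s(\mathbb{R}^d)$ if $\hat f\in L^1_{\rm loc}(\mathbb{R}^d)$ and $\|f\|^2_{\dot H^s(\mathbb{R}^d)}=\int_{\mathbb{R}^d}|\xi|^{2s}|\hat f(\xi)|^2\,d\xi<\infty$. For vector fields these notions are understood componentwise. Divergence is taken with respect to the space variable, in the sense of distributions. A solution of the continuity equation with initial datum $\bar\theta$ is understood in the weak sense: $\theta$ is locally integrable and $\int_0^T\int_{\mathbb{R}^d}\theta(\partial_t\varphi+v\cdot\nabla\varphi)\,dx\,dt+\int_{\mathbb{R}^d}\bar\theta\,\varphi(0,\cdot)\,dx=0$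 for all $\varphi\in C^\infty_c([0,T)\times\mathbb{R}^d)$, where $\theta(t,\cdot)$, $0\le t\le T$, denotes the representative that is continuous in $t$ with values in distributions on $\mathbb{R}^d$. *)

(* Defs.v *)
From HB Require Import structures.
From mathcomp Require Import all_boot all_order all_algebra.
From mathcomp Require Import all_classical all_reals all_analysis.
From mathcomp Require Import complex.

Set Implicit Arguments.
Unset Strict Implicit.
Unset Printing Implicit Defensive.
Import Order.TTheory GRing.Theory Num.Theory.
Import numFieldNormedType.Exports.
Import ComplexField.Normc.

Local Open Scope classical_set_scope.
Local Open Scope ring_scope.

(* The sigma-algebra generated by the coordinates, i.e. the Borel sets of R^n. *)
Definition rV_display : measure_display. Proof. exact: default_measure_display. Qed.

Section measurable_rV.
Context {R : realType} {n : nat}.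

Let coord (i : 'I_n) (x : 'rV[R]_n) : measurableTypeR R := x 0 i.

Let rV_set0 : g_sigma_preimage coord set0.
Proof. exact: sigma_algebra0. Qed.

Let rV_setC A : g_sigma_preimage coord A -> g_sigma_preimage coord (~` A).
Proof. exact: sigma_algebraC. Qed.

Let rV_bigcup (F : _^nat) : (forall i, g_sigma_preimage coord (F i)) ->
  g_sigma_preimage coord (\bigcup_i (F i)).
Proof. exact: sigma_algebra_bigcup. Qed.

HB.instance Definition _ := @isMeasurable.Build rV_display
  'rV[R]_n (g_sigma_preimage coord) rV_set0 rV_setC rV_bigcup.

Lemma measurable_coord (i : 'I_n) :
  measurable_fun [set: 'rV[R]_n] (fun x => x 0 i : measurableTypeR R).
Proof.
move=> _ Y mY; rewrite setTI; apply: sub_sigma_algebra => /=.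
rewrite -bigcup_seq/=; exists i => /=; first by rewrite mem_index_enum.
by exists Y => //; rewrite setTI.
Qed.

Lemma measurable_fun_rV d (T : measurableType d) (f : T -> 'rV[R]_n) :
  (forall i, measurable_fun [set: T] (fun x => f x 0 i : measurableTypeR R)) ->
  measurable_fun [set: T] f.
Proof.
move=> mf; apply: (measurability
  (\big[setU/set0]_(i < n) preimage_set_system setT (coord i) measurable)) => //.
move=> _ [A + <-]; rewrite -bigcup_seq => -[i _ [B mB <-]].
have := mf i measurableT B mB; rewrite !setTI; exact.
Qed.

End measurable_rV.

Section vcons.
Context {R : realType} {n : nat}.

Definition vcons (p : measurableTypeR R * 'rV[R]_n) : 'rV[R]_n.+1 :=
  \row_i oapp (fun j => p.2 0 j) p.1 (unlift ord0 i).

Let vuncons (x : 'rV[R]_n.+1) : measurableTypeR R * 'rV[R]_n :=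
  (x 0 ord0, \row_j x 0 (lift ord0 j)).

Let vconsK : cancel vcons vuncons.
Proof.
move=> [a y]; rewrite /vuncons/vcons mxE unlift_none /=; congr pair.
by apply/rowP => j; rewrite !mxE liftK.
Qed.

Lemma measurable_vcons : measurable_fun [set: _] vcons.
Proof.
apply: measurable_fun_rV => i.
under eq_fun do rewrite mxE.
case: unliftP => [j|] _ /=; last exact: measurable_fst.
exact: (measurableT_comp (measurable_coord j) measurable_snd).
Qed.

Let measurable_vuncons : measurable_fun [set: _] vuncons.
Proof.
apply/measurable_fun_pairP; split; first exact: measurable_coord.
apply: measurable_fun_rV => i /=.
under eq_fun do rewrite mxE.
exact: measurable_coord.
Qed.

Variable m : {sigma_finite_measure set 'rV[R]_n -> \bar R}.

Definition lebesgue_cons : set 'rV[R]_n.+1 -> \bar R :=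
  pushforward ((@lebesgue_measure R) \x m)%E vcons.

Let mP : {measure set (measurableTypeR R * 'rV[R]_n)%type -> \bar R} :=
  ((@lebesgue_measure R) \x m)%E.

Let lebesgue_cons0 : lebesgue_cons set0 = 0%E.
Proof. by rewrite /lebesgue_cons /pushforward preimage_set0 measure0. Qed.

Let lebesgue_cons_ge0 A : (0 <= lebesgue_cons A)%E.
Proof. exact: (measure_ge0 mP). Qed.

Let measurable_vcons_preimage A : measurable A -> measurable (vcons @^-1` A).
Proof. by move=> mA; rewrite -[X in measurable X]setTI; exact: measurable_vcons. Qed.

Let lebesgue_cons_sigma_additive : semi_sigma_additive lebesgue_cons.
Proof.
move=> F mF tF mUF; rewrite /lebesgue_cons /pushforward preimage_bigcup.
change ((fun k => \sum_(0 <= i < k) mP (vcons @^-1` F i))%E @ \oo -->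
  mP (\bigcup_i (vcons @^-1` F i))).
apply: measure_semi_sigma_additive.
- by move=> k; exact: measurable_vcons_preimage.
- apply/trivIsetP => /= i j _ _ ij; rewrite -preimage_setI.
  by move/trivIsetP : tF => /(_ _ _ _ _ ij) ->//; rewrite preimage_set0.
- by rewrite -preimage_bigcup; exact: measurable_vcons_preimage.
Qed.

HB.instance Definition _ := isMeasure.Build _ _ _ lebesgue_cons
  lebesgue_cons0 lebesgue_cons_ge0 lebesgue_cons_sigma_additive.

Let lebesgue_cons_sigma_finite : sigma_finite setT lebesgue_cons.
Proof.
have /sigma_finiteP[F [TF ndF Foo]] := sigma_finiteT (@lebesgue_measure R).
have /sigma_finiteP[G [TG ndG Goo]] := sigma_finiteT m.
exists (fun k => vuncons @^-1` (F k `*` G k)).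
  rewrite -preimage_bigcup -[LHS](preimage_setT vuncons); congr (_ @^-1` _).
  rewrite -setXTT TF TG predeqE => -[x y]; split.
    move=> [/= [k _ Fkx] [l _ Gly]]; exists (maxn k l) => //; split.
    - by move: x Fkx; exact/subsetPset/ndF/leq_maxl.
    - by move: y Gly; exact/subsetPset/ndG/leq_maxr.
  by move=> [k _ []/= ? ?]; split; exists k.
move=> k; have [mF Fk] := Foo k; have [mG Gk] := Goo k; split.
  rewrite -[X in measurable X]setTI; apply: measurable_vuncons => //.
  exact: measurableX.
rewrite /lebesgue_cons /pushforward -comp_preimage.
rewrite (_ : vuncons \o vcons = id); last exact/funext/vconsK.
by rewrite preimage_id product_measure1E// lte_mul_pinfty// ge0_fin_numE.
Qed.

HB.instance Definition _ := Measure_isSigmaFinite.Build _ _ _ lebesgue_cons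
  lebesgue_cons_sigma_finite.

End vcons.

Section lebesgue_rV.
Context {R : realType}.

(* Lebesgue measure on R^n, as the image of iterated products of the Lebesgue
   measure on R. *)
Fixpoint lebesgue_rV (n : nat) : {sigma_finite_measure set 'rV[R]_n -> \bar R} :=
  if n is k.+1 then lebesgue_cons (lebesgue_rV k) else \d_(0 : 'rV[R]_0).

End lebesgue_rV.

Section euclidean.
Context {R : realType} {n : nat}.
Implicit Types x y : 'rV[R]_n.

Definition dot x y : R := \sum_i x 0 i * y 0 i.

(* The library norm `|x| on matrices is the sup norm. *)
Definition enorm x : R := Num.sqrt (dot x x).

Definition basis_vec (i : 'I_n) : 'rV[R]_n := delta_mx 0 i.

End euclidean.

Section smooth.
Context {R : realType} {V W : normedModType R}.
Implicit Types (f : V -> W) (A U : set V).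

Definition iter_derive (ws : seq V) f : V -> W :=
  foldr (fun w g => 'D_w g) f ws.

(* C^infinity on an open set (V finite-dimensional): all iterated directional
   derivatives exist and are continuous there. *)
Definition smooth_on_open U f := forall (ws : seq V) (x : V), U x ->
  {for x, continuous (iter_derive ws f)} /\
  (forall w, derivable (iter_derive ws f) x w).

(* Smoothness on a set that need not be open, e.g. up to the boundary of
   [0, T]: existence of a smooth extension to an open neighbourhood. *)
Definition smooth_on_set A f := exists U F,
  [/\ open U, A `<=` U, smooth_on_open U F & {in A, F =1 f}].

Definition compactly_supported_in U f := exists K,
  [/\ compact K, K `<=` U & forall x, ~ K x -> f x = 0].

Definition test_function U f :=
  smooth_on_open setT f /\ compactly_supported_in U f.

End smooth.

Section distributions.
Context {R : realType} {n : nat}.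
Local Notation V := 'rV[R]_n.
Local Notation C := R[i].
Local Notation reC := (@complex.Re R).
Local Notation imC := (@complex.Im R).
Local Notation mu := (lebesgue_rV n : {measure set V -> \bar R}).
Implicit Types (phi g h : V -> C) (u w : (V -> C) -> C) (s p : R).

Definition cintegral g : C :=
  Complex (\int[mu]_x reC (g x)) (\int[mu]_x imC (g x)).

Definition locally_integrable_rV (f : V -> R) :=
  forall K : set V, compact K -> mu.-integrable K (EFin \o f).

Definition clocally_integrable g :=
  locally_integrable_rV (reC \o g) /\
  locally_integrable_rV (imC \o g).

Definition cpartial (js : seq 'I_n) phi : V -> C := fun x =>
  let ws := [seq basis_vec i | i <- js] in
  Complex (iter_derive ws (reC \o phi) x)
          (iter_derive ws (imC \o phi) x).

Definition csmooth phi :=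
  smooth_on_open setT (reC \o phi) /\ smooth_on_open setT (imC \o phi).

Definition ctest_function phi :=
  test_function setT (reC \o phi) /\
  test_function setT (imC \o phi).

Definition schwartz phi := csmooth phi /\
  forall (k : nat) (js : seq 'I_n), exists M : R,
    forall x, enorm x ^+ k * normc (cpartial js phi x) <= M.

(* Tempered distributions are represented by functionals on all functions
   V -> C; only their values on Schwartz functions are meaningful. *)
Definition tempered u :=
  (forall (a : C) phi psi, schwartz phi -> schwartz psi ->
     u (fun x => a * phi x + psi x) = a * u phi + u psi) /\
  exists (N : nat) (c : R), forall phi (M : R), schwartz phi ->
    (forall (k : nat) (js : seq 'I_n) x, (k <= N)%N -> (size js <= N)%N ->
       enorm x ^+ k * normc (cpartial js phi x) <= M) ->
    normc (u phi) <= c * M.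

Definition dist_of g : (V -> C) -> C :=
  fun phi => cintegral (fun x => g x * phi x).

Definition dist_of_real (f : V -> R) := dist_of (fun x => Complex (f x) 0).

(* The distribution u belongs to L^1_loc, and is the function g. *)
Definition represents g u := clocally_integrable g /\
  forall phi, ctest_function phi -> u phi = dist_of g phi.

Definition cis (a : R) : C := Complex (cos a) (sin a).

(* The Fourier transform is normalized as
     F phi (xi) = \int exp (- i x . xi) phi(x) dx. *)
Definition fourier_fun phi : V -> C := fun xi =>
  cintegral (fun x => cis (- dot x xi) * phi x).

Definition inv_fourier_fun phi : V -> C := fun x =>
  Complex (((2 * pi) ^+ n)^-1) 0 * cintegral (fun xi => cis (dot x xi) * phi xi).

Definition fourier u : (V -> C) -> C := fun phi => u (fourier_fun phi).

Definition inv_fourier u : (V -> C) -> C := fun phi => u (inv_fourier_fun phi).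

Definition dist_derive (js : seq 'I_n) u : (V -> C) -> C :=
  fun phi => (-1) ^+ size js * u (cpartial js phi).

Definition in_Hdot s u := tempered u /\ exists g, represents g (fourier u) /\
  (\int[mu]_xi (enorm xi `^ (2 * s) * normc (g xi) ^+ 2)%:E < +oo)%E.

(* h = F^-1 (|xi|^s F u), where |xi|^s F u is required to be a tempered
   distribution w. *)
Definition riesz_derivative s u h := exists g w,
  [/\ represents g (fourier u), tempered w,
      represents (fun xi => Complex (enorm xi `^ s) 0 * g xi) w &
      represents h (inv_fourier w)].

(* The infima below are over a set with at most one element (h and the weak
   derivatives are unique a.e.); the norm is +oo when u is not in the space. *)
Definition Wdot_norm_gt1 s p u : \bar R :=
  ereal_inf [set N | tempered u /\ exists2 h, riesz_derivative s u h &
    N = Lnorm mu p%:E (fun x => (normc (h x))%:E)].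

(* |beta| = k forces beta i <= k, whence the finite type of multi-indices. *)
Definition multi_index k := {ffun 'I_n -> 'I_k.+1}.

Definition multi_index_seq k (beta : multi_index k) : seq 'I_n :=
  flatten [seq nseq (beta i) i | i <- enum 'I_n].

Definition L1_norm g : \bar R := (\int[mu]_x (normc (g x))%:E)%E.

Definition gagliardo1 (alpha : R) g : \bar R :=
  (\int[mu]_x (\int[mu]_y
     (normc (g x - g y) / enorm (x - y) `^ (n%:R + alpha))%:E))%E.

Definition Wdot_norm_1 s u : \bar R :=
  let k := Num.truncn s in let alpha := s - k%:R in
  ereal_inf [set N | tempered u /\ exists2 g : multi_index k -> V -> C,
    (forall beta : multi_index k, (\sum_i beta i = k)%N ->
       represents (g beta) (dist_derive (multi_index_seq beta) u)) &
    N = (\sum_(beta : multi_index k | (\sum_i beta i)%N == k)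
          (if alpha == 0%R then L1_norm (g beta) else gagliardo1 alpha (g beta)))%E].

Definition Wdot_norm s p u : \bar R :=
  if p == 1 then Wdot_norm_1 s u else Wdot_norm_gt1 s p u.

Definition Wdot_norm_vec s p (v : V -> V) : \bar R :=
  \sum_(i < n) Wdot_norm s p (dist_of_real (fun x => v x 0%R i)).

End distributions.

Section continuity_equation.
Context {R : realType} {n : nat}.
Local Notation V := 'rV[R]_n.
Local Notation mu := (lebesgue_rV n : {sigma_finite_measure set V -> \bar R}).
Local Notation mu1 := (@lebesgue_measure R).
Implicit Types (T : R) (v : R -> V -> V) (theta : R -> V -> R).

Definition bounded_field T v :=
  (forall i, measurable_fun (`[0, T] `*` [set: V] : set (measurableTypeR R * V))
     (fun z => v z.1 z.2 0 i)) /\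
  exists M : R, forall t x, t \in `[0, T] -> enorm (v t x) <= M.

Definition divergence_free T v :=
  forall t (phi : V -> R), t \in `[0, T] -> test_function setT phi ->
    \int[mu]_x (\sum_i v t x 0 i * 'D_(basis_vec i) phi x) = 0.

Definition weak_formulation T v theta (theta0 : V -> R) :=
  forall phi : R * V -> R, test_function [set z | z.1 < T] phi ->
    \int[(mu1 \x mu)%E]_(z in `[0, T] `*` [set: V])
      (theta z.1 z.2 * ('D_((1, 0) : R * V) phi z +
         \sum_i v z.1 z.2 0 i * 'D_((0, basis_vec i) : R * V) phi z))
    + \int[mu]_x (theta0 x * phi (0, x)) = 0.

(* [theta] is itself the representative that is continuous in time with values
   in distributions. *)
Definition weak_solution T v theta :=
  [/\ forall K : set V, compact K ->
        (mu1 \x mu)%E.-integrable (`[0, T] `*` K)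
          (fun z => (theta z.1 z.2)%:E),
      forall t, t \in `[0, T] -> locally_integrable_rV (theta t),
      forall phi : V -> R, test_function setT phi ->
        {within `[0, T], continuous (fun t => \int[mu]_x (theta t x * phi x))} &
      weak_formulation T v theta (theta 0)].

End continuity_equation.

(* Main.v *)
Require Import Defs.
From HB Require Import structures.
From mathcomp Require Import all_boot all_order all_algebra.
From mathcomp Require Import all_classical all_reals all_analysis.
From mathcomp Require Import complex ring lra measurable_realfun.

Set Implicit Arguments.
Unset Strict Implicit.
Unset Printing Implicit Defensive.
Import Order.TTheory GRing.Theory Num.Theory.
Import numFieldNormedType.Exports.

Local Open Scope classical_set_scope.
Local Open Scope ring_scope.
Import ComplexField.Normc.

(* The velocity is a stationary sum v = sum_j 2^(-j a) psi(2^j x), where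
   psi(y) = G(|y|^2) (- y_1, y_0, 0, ..., 0) and G is supported in [2, 3]: the
   pieces live on disjoint annuli shrinking to the origin, and on the j-th one v
   rotates the (x_0, x_1)-plane with angular speed 2^(j(1 - a)) G(4^j |x|^2).
   The density is theta = sum_j 2^(-j b) Th(t 2^(j(1 - a)), 2^j x), with
   Th(la, .) the rotation of x_0 G(|x|^2) by the angle la G(|x|^2). Its pieces
   have s-th derivatives of size 2^(j(s - b - n/2)) (1 + t 2^(j(1 - a)))^s in L^2.
   Hence theta(0) is in H^s iff s < b + n/2, but for t > 0 theta(t) is in H^s only
   if (2 - a) s <= b + n/2. Taking max(0, r - n/p) < a < 1 puts v in W^(r, p);
   any mubar between 1/(2 - a) and 1 works, with b + n/2 = mubar (2 - a) sigma.

   For a fractional s the lower bound is obtained by duality: if theta(t) is in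
   H^s, the pairing of theta(t) with D_i^(2M) of its j-th piece is estimated on
   the Fourier side, splitting at the frequency L = 2^j (1 + t 2^(j(1 - a))) up to
   constants. Since the annuli are disjoint, this pairing is the L^2 norm squared
   of D_i^M of the piece, which is bounded below by log-convexity of the norms
   of successive derivatives.

   G is an iterated radial Laplacian of a bump function, so the Fourier
   transform of psi vanishes to high order at 0. Then F^-1(|xi|^r F psi) decays,
   and its dilates can be summed in L^p when 2^((r - a) p) < 2^n. For p = 1 the
   derivatives of integer order and the Gagliardo seminorm scale exactly.

   Th(la, .) and psi are odd, so their Fourier transforms reduce to sine transforms. *)

(** * Integrable functions *)

(** The two demands on a pull against each other: shear that grows as the annuli shrink asks for a <
    1, while summing the pieces of v in L^p asks for (r - a) p < n. They are compatible exactly when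
    p < n / (r - 1), and a, hence mubar, then depends on r, p, n alone; sigma enters only through b.
    For small sigma this b is negative and theta is unbounded at the origin. So limits are taken
    under integrable majorants, never under sup bounds, and the weak equation is proved for finite
    partial sums, which are smooth and solve it classically.

    Fractional norms are nonlocal, so disjoint supports give no orthogonality in H^s. Upper bounds
    therefore sum the scales by a weighted triangle inequality; lower bounds test one piece at a
    time, because the plain L^2 pairing does see disjointness. The test involves a free parameter
    and a free frequency, which are tuned to the piece at the end.

    Transforms are real cosine integrals with a phase, a quarter period standing for the factor i.
    Inversion rests on the kernel exp(- |x_1| - ... - |x_n|), whose transform has an elementary
    closed form. *)

Section L1.
Context d (T : measurableType d) (R : realType) (mu : {measure set T -> \bar R}).
Implicit Types f g : T -> R.

Definition L1 f := mu.-integrable setT (EFin \o f).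

Lemma L1_measurable f : L1 f -> measurable_fun setT f.
Proof. by move=> /integrableP[/measurable_EFinP]. Qed.

Lemma L1P f : measurable_fun setT f ->
  (\int[mu]_x `|f x|%:E < +oo)%E -> L1 f.
Proof. by move=> mf fi; apply/integrableP; split=> //; exact/measurable_EFinP. Qed.

Lemma L1_lty f : L1 f -> (\int[mu]_x `|f x|%:E < +oo)%E.
Proof. by move=> /integrableP[]. Qed.

Lemma L1_EFin f : L1 f -> (\int[mu]_x (f x)%:E = (\int[mu]_x f x)%:E)%E.
Proof. by move=> f1; rewrite /Rintegral fineK//; exact: integrable_fin_num. Qed.

Lemma eq_L1 f g : f =1 g -> L1 f -> L1 g.
Proof. by move=> /funext ->. Qed.

Lemma L1_dominated g f : measurable_fun setT f -> L1 g ->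
  (forall x, `|f x| <= g x) -> L1 f.
Proof.
move=> mf g1 fg; apply: (le_integrable _ _ _ g1) => //; first exact/measurable_EFinP.
by move=> x _ /=; rewrite lee_fin (le_trans (fg x))// ler_norm.
Qed.

Lemma L1D f g : L1 f -> L1 g -> L1 (fun x => f x + g x).
Proof. by move=> f1 g1; exact: (integrableD _ f1 g1). Qed.

Lemma L1B f g : L1 f -> L1 g -> L1 (fun x => f x - g x).
Proof. by move=> f1 g1; exact: (integrableB _ f1 g1). Qed.

Lemma L1Z (c : R) f : L1 f -> L1 (fun x => c * f x).
Proof. by move=> f1; have := integrableZl _ c f1; exact. Qed.

Lemma L1Zr (c : R) f : L1 f -> L1 (fun x => f x * c).
Proof. by move=> /(L1Z c); under eq_fun do rewrite mulrC. Qed.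

Lemma L1_abs f : L1 f -> L1 (fun x => `|f x|).
Proof. by move=> f1; apply: (L1_dominated (g := fun x => `|f x|)) => //;
  [exact/measurableT_comp/L1_measurable|exact: integrable_norm|move=> x; rewrite normr_id]. Qed.

Lemma L1_0 : L1 (fun=> 0).
Proof. exact: integrable0. Qed.

Lemma L1_sum (I : Type) (s : seq I) (P : pred I) (h : I -> T -> R) :
  (forall i, L1 (h i)) -> L1 (fun x => \sum_(i <- s | P i) h i x).
Proof.
move=> h1; elim: s => [|i s IH].
  by under eq_fun do rewrite big_nil; exact: L1_0.
under eq_fun do rewrite big_cons.
by case: (P i) => //; exact: L1D.
Qed.

Lemma L1_bounded (C : R) g f : L1 f -> measurable_fun setT g ->
  (forall x, `|g x| <= C) -> L1 (fun x => g x * f x).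
Proof.
move=> f1 mg gC; apply: (L1_dominated (g := fun x => C * `|f x|)).
- by apply: measurable_funM => //; exact: L1_measurable.
- exact/L1Z/L1_abs.
- by move=> x; rewrite normrM ler_wpM2r.
Qed.

Lemma IntD f g : L1 f -> L1 g ->
  \int[mu]_x (f x + g x) = \int[mu]_x f x + \int[mu]_x g x.
Proof. by move=> *; rewrite RintegralD. Qed.

Lemma IntB f g : L1 f -> L1 g ->
  \int[mu]_x (f x - g x) = \int[mu]_x f x - \int[mu]_x g x.
Proof. by move=> *; rewrite RintegralB. Qed.

Lemma IntZ c f : L1 f -> \int[mu]_x (c * f x) = c * \int[mu]_x f x.
Proof. by move=> *; rewrite RintegralZl. Qed.

Lemma IntN f : L1 f -> \int[mu]_x (- f x) = - \int[mu]_x f x.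
Proof. by move=> f1; rewrite -[RHS]mulN1r -IntZ//; under [RHS]eq_Rintegral do rewrite mulN1r. Qed.

Lemma Int0 : \int[mu]_(x in setT) (0 : R) = 0.
Proof. by rewrite /Rintegral integral0. Qed.

Lemma eq_Int f g : f =1 g -> \int[mu]_x f x = \int[mu]_x g x.
Proof. by move=> /funext ->. Qed.

Lemma Int_sum (I : Type) (s : seq I) (P : pred I) (h : I -> T -> R) :
  (forall i, L1 (h i)) ->
  \int[mu]_x (\sum_(i <- s | P i) h i x) = \sum_(i <- s | P i) \int[mu]_x h i x.
Proof.
move=> h1; elim: s => [|i s IH].
  by under eq_Rintegral do rewrite big_nil; rewrite big_nil Int0.
under eq_Rintegral do rewrite big_cons.
rewrite big_cons; case: (P i) => //; rewrite IntD ?IH//; exact: L1_sum.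
Qed.

Lemma le_Int f g : L1 f -> L1 g -> (forall x, f x <= g x) ->
  \int[mu]_x f x <= \int[mu]_x g x.
Proof. by move=> f1 g1 fg; apply: le_Rintegral. Qed.

Lemma Int_ge0 f : (forall x, 0 <= f x) -> 0 <= \int[mu]_x f x.
Proof. by move=> f0; exact: Rintegral_ge0. Qed.

Lemma le_norm_Int f : L1 f -> `|\int[mu]_x f x| <= \int[mu]_x `|f x|.
Proof. by move=> f1; exact: le_normr_Rintegral. Qed.

Lemma le_norm_Int_dom f g : L1 g -> measurable_fun setT f ->
  (forall x, `|f x| <= g x) -> `|\int[mu]_x f x| <= \int[mu]_x g x.
Proof.
move=> g1 mf fg; have f1 := L1_dominated mf g1 fg.
by apply: (le_trans (le_norm_Int f1)); apply: le_Int => //; exact: L1_abs.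
Qed.

Lemma Int_cvg (f_ : nat -> T -> R) f g : (forall k, measurable_fun setT (f_ k)) ->
  L1 g -> (forall k x, `|f_ k x| <= g x) ->
  (forall x, f_ ^~ x @ \oo --> f x) ->
  L1 f /\ (fun k => \int[mu]_x f_ k x) @ \oo --> \int[mu]_x f x.
Proof.
move=> mf_ g1 fg cf.
have mf : measurable_fun setT (EFin \o f).
  apply: (@emeasurable_fun_cvg _ _ _ _ (fun k => EFin \o f_ k)) => [k|x _].
    exact/measurable_EFinP.
  by apply: cvg_EFin; [exact: nearW|exact: cf].
have [|||||f1 _ fi] := @dominated_convergence _ _ _ mu setT measurableT
  (fun k => EFin \o f_ k) (EFin \o f) (EFin \o g).
- by move=> k; exact/measurable_EFinP.
- exact: mf.
- by apply: aeW => x _; apply: cvg_EFin; [exact: nearW|exact: cf].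
- exact: g1.
- by apply: aeW => x k _ /=; rewrite lee_fin.
split; first exact: f1.
apply: fine_cvg => /=; rewrite -/(Rintegral _ _ _) -(L1_EFin f1).
exact: fi.
Qed.

Lemma L1_le_lty f g : measurable_fun setT f -> (forall x, `|f x| <= g x) ->
  (\int[mu]_x (g x)%:E < +oo)%E -> measurable_fun setT g -> L1 f.
Proof.
move=> mf fg gi mg; apply: (L1_dominated (g := g)) => //.
apply: L1P => //; under eq_integral => x _.
  by rewrite ger0_norm ?(le_trans _ (fg x))//; over.
by [].
Qed.

End L1.

Section L1_prod.
Context d1 d2 (T1 : measurableType d1) (T2 : measurableType d2) (R : realType).
Variables (m1 : {sigma_finite_measure set T1 -> \bar R})
          (m2 : {sigma_finite_measure set T2 -> \bar R}).

Lemma L1_prod (f : T1 -> R) (g : T2 -> R) : L1 m1 f -> L1 m2 g ->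
  L1 (m1 \x m2)%E (fun z => f z.1 * g z.2).
Proof.
move=> f1 g1.
have mf := L1_measurable f1; have mg := L1_measurable g1.
apply/integrable12ltyP.
  apply/measurable_EFinP/measurable_funM; exact: measurableT_comp.
under eq_integral => x _.
  under eq_integral => y _ do rewrite /= normrM EFinM.
  rewrite ge0_integralZl//; first over.
  by apply/measurable_EFinP; exact: measurableT_comp.
rewrite ge0_integralZr//; last 2 first.
- by apply/measurable_EFinP; exact: measurableT_comp.
- by rewrite integral_ge0.
by rewrite lte_mul_pinfty ?integral_ge0 ?(L1_lty g1)// ge0_fin_numE ?integral_ge0 ?(L1_lty f1).
Qed.

Lemma L1_prodP (f : T1 * T2 -> R) : measurable_fun setT f ->
  (\int[m1]_x \int[m2]_y `|f (x, y)|%:E < +oo)%E -> L1 (m1 \x m2)%E f.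
Proof. by move=> mf fi; apply/integrable12ltyP => //; exact/measurable_EFinP. Qed.

(** Integrability of every section, and not only of almost every one, makes the real-valued inner
    integral agree everywhere with the extended one, so no null set has to be carried along. *)
Lemma L1_Int1 (f : T1 * T2 -> R) : L1 (m1 \x m2)%E f ->
  (forall y, L1 m1 (fun x => f (x, y))) ->
  L1 m2 (fun y => \int[m1]_x f (x, y)).
Proof.
move=> f1 fx.
have mf : measurable_fun setT (EFin \o f) by case/integrableP : f1.
suff : m2.-integrable setT (fun y => \int[m1]_x (f (x, y))%:E)%E.
  by apply: eq_integrable => // x _ /=; exact: L1_EFin.
apply/integrableP; split; first exact: measurable_fubini_G f1.
apply: (le_lt_trans _ ((integrable21ltyP _ _ mf).1 f1)).
apply: ge0_le_integral => //=.
- by apply: measurableT_comp => //; exact: measurable_fubini_G f1.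
- apply: (measurable_fun_fubini_tonelli_G (abse \o (EFin \o f))) => //.
  + exact: measurableT_comp.
  + by move=> z /=; rewrite lee_fin.
- move=> y _; apply: le_abse_integral => //.
  by apply/measurable_EFinP; exact: L1_measurable (fx y).
Qed.

Lemma Int_prod12 (f : T1 * T2 -> R) : L1 (m1 \x m2)%E f ->
  (forall x, L1 m2 (fun y => f (x, y))) ->
  \int[(m1 \x m2)%E]_z f z = \int[m1]_x \int[m2]_y f (x, y).
Proof.
move=> f1 fx; rewrite /Rintegral -(integral12_prod_meas1 f1); congr fine.
by apply: eq_integral => x _; exact: L1_EFin.
Qed.

Lemma Int_prod21 (f : T1 * T2 -> R) : L1 (m1 \x m2)%E f ->
  (forall y, L1 m1 (fun x => f (x, y))) ->
  \int[(m1 \x m2)%E]_z f z = \int[m2]_y \int[m1]_x f (x, y).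
Proof.
move=> f1 fy; rewrite /Rintegral -(integral21_prod_meas1 f1); congr fine.
by apply: eq_integral => x _; exact: L1_EFin.
Qed.

Lemma Int_swap (f : T1 * T2 -> R) : L1 (m1 \x m2)%E f ->
  (forall x, L1 m2 (fun y => f (x, y))) ->
  (forall y, L1 m1 (fun x => f (x, y))) ->
  \int[m1]_x \int[m2]_y f (x, y) = \int[m2]_y \int[m1]_x f (x, y).
Proof. by move=> f1 fx fy; rewrite -Int_prod12// Int_prod21. Qed.

End L1_prod.

(** * Lebesgue measure on R^n *)

Section affine1.
Context {R : realType}.
Local Notation mu := (@lebesgue_measure R).

Let mR := measurableTypeR R.

Lemma measurable_affine (k c : R) : measurable_fun [set: mR] (fun x : mR => k * x + c : mR).
Proof. by apply: measurable_funD => //; exact: measurable_funM. Qed.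

(** Lebesgue measure is determined by its values on half-open intervals, so it equals |k| times its
    image under the affine map. *)
Lemma ge0_integral_affine1 (k c : R) (f : mR -> \bar R) : k != 0 ->
  measurable_fun setT f -> (forall x, 0 <= f x)%E ->
  (\int[mu]_x f x = `|k|%:E * \int[mu]_x f (k * x + c)%R)%E.
Proof.
move=> k0 mf f0; pose phi := (fun x : mR => k * x + c : mR).
have mphi : measurable_fun setT phi by exact: measurable_affine.
pose pf : {measure set mR -> \bar R} :=
  measure_function_pushforward__canonical__measure_function_Measure mu mphi.
pose nu := mscale (NngNum (normr_ge0 k)) pf.
have munu A : measurable A -> mu A = nu A.
  move=> mA; apply: lebesgue_measure_unique => // _ [[a b] _ <-] /=.
  rewrite /nu /mscale /= /pushforward.
  have [kpos|kneg|] := ltgtP 0 k; last by move=> k0'; rewrite -k0' eqxx in k0.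
  - have -> : phi @^-1` `]a, b] = `](a - c) / k, (b - c) / k]%classic.
      apply/seteqP; split=> x /=; rewrite !in_itv /= /phi.
        by rewrite ltr_pdivrMr// ler_pdivlMr// ltrBlDr lerBrDr ![x * k]mulrC.
      by rewrite ltr_pdivrMr// ler_pdivlMr// ltrBlDr lerBrDr ![x * k]mulrC.
    rewrite !lebesgue_measure_itv /= !lte_fin gtr0_norm//.
    rewrite ltr_pM2r ?invr_gt0// ltrD2r; case: ifPn => _; last by rewrite mule0.
    by rewrite -!EFinB -EFinM; congr EFin; field.
  (* For k < 0 the closed end of the preimage is on the left; the length is the same. *)
  - have -> : phi @^-1` `]a, b] = `[(b - c) / k, (a - c) / k[%classic.
      apply/seteqP; split=> x /=; rewrite !in_itv /= /phi.
        by rewrite ler_ndivrMr// ltr_ndivlMr// ltrBlDr lerBrDr ![x * k]mulrC andbC.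
      by rewrite ler_ndivrMr// ltr_ndivlMr// ltrBlDr lerBrDr ![x * k]mulrC andbC.
    rewrite !lebesgue_measure_itv /= !lte_fin ltr0_norm//.
    rewrite ltr_nM2r ?invr_lt0// ltrD2r; case: ifPn => _; last by rewrite mule0.
    by rewrite -!EFinB -EFinM; congr EFin; field; lra.
rewrite (eq_measure_integral nu); last by move=> A mA _; exact: munu.
rewrite ge0_integral_mscale//= ?ge0_integral_pushforward//=.
Qed.

End affine1.

Section rV_integral.
Context {R : realType}.
Local Notation mu := (lebesgue_rV _).

Let mR := measurableTypeR R.

Lemma ge0_integral_rVS n (f : 'rV[R]_n.+1 -> \bar R) :
  measurable_fun setT f -> (forall x, 0 <= f x)%E ->
  (\int[lebesgue_rV n.+1]_x f x =
   \int[@lebesgue_measure R]_a \int[lebesgue_rV n]_y f (vcons (a, y)))%E.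
Proof.
move=> mf f0.
rewrite -(fubini_tonelli1 (f \o vcons))//=; last first.
  exact: measurableT_comp mf measurable_vcons.
by rewrite -(ge0_integral_pushforward measurable_vcons (@lebesgue_measure R \x lebesgue_rV n)%E measurableT).
Qed.

Lemma vcons_affine n (k : R) (c0 : R) (c : 'rV[R]_n) (a : mR) y :
  k *: vcons (a, y) + vcons (c0, c) = vcons (k * a + c0, k *: y + c).
Proof.
apply/rowP => i; rewrite !mxE; case: unliftP => [j|] _ //=; by rewrite !mxE.
Qed.

Lemma vcons_split n (x : 'rV[R]_n.+1) : x = vcons (x 0 ord0, \row_j x 0 (lift ord0 j)).
Proof.
by apply/rowP => i; rewrite !mxE; case: unliftP => [j ->|->] //=; rewrite mxE.
Qed.

Lemma measurable_affine_rV n (k : R) (c : 'rV[R]_n) :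
  measurable_fun [set: 'rV[R]_n] (fun x => k *: x + c).
Proof.
apply: measurable_fun_rV => i; under eq_fun do rewrite !mxE.
by apply: measurable_funD => //; apply: measurable_funM => //; exact: measurable_coord.
Qed.

(** Induction on the dimension: a map with scalar linear part splits along [vcons], and each
    coordinate contributes a factor |k|. *)
Lemma ge0_integral_affine n (k : R) (c : 'rV[R]_n) (f : 'rV[R]_n -> \bar R) : k != 0 ->
  measurable_fun setT f -> (forall x, 0 <= f x)%E ->
  (\int[lebesgue_rV n]_x f (k *: x + c)%R = (`|k| ^- n)%:E * \int[lebesgue_rV n]_x f x)%E.
Proof.
move=> k0.
have pk m : 0 < `|k| ^+ m by rewrite exprn_gt0 ?normr_gt0.
elim: n c f => [|n IH] c f mf f0.
  rewrite expr0 invr1 mul1e; apply: eq_integral => x _; congr f.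
  by rewrite [LHS]thinmx0 [RHS]thinmx0.
rewrite ge0_integral_rVS//; last first.
  by apply: measurableT_comp => //; exact: measurable_affine_rV.
rewrite ge0_integral_rVS//.
under eq_integral => a _.
  under eq_integral => y _.
    rewrite [X in _ + X](vcons_split c) vcons_affine; over.
  rewrite (IH _ (fun y => f (vcons (k * a + c 0 ord0, y))))//; last first.
    apply: (measurableT_comp mf); apply: (measurableT_comp measurable_vcons).
    exact: pair1_measurable.
  over.
have mF : measurable_fun setT (fun a : mR => \int[lebesgue_rV n]_y f (vcons (a, y)))%E.
  apply: (measurable_fun_fubini_tonelli_F (f \o vcons)) => //=.
  exact: measurableT_comp mf measurable_vcons.
rewrite ge0_integralZl//; last 2 first.
- apply: (measurableT_comp (f := fun a : mR => \int[lebesgue_rV n]_y f (vcons (a, y)))%E) => //.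
  exact: measurable_affine.
- by move=> a _; exact: integral_ge0.
rewrite [in RHS](ge0_integral_affine1 (c 0 ord0) k0)//; last first.
  by move=> a; exact: integral_ge0.
rewrite muleA -EFinM; congr (_%:E * _)%E.
by rewrite exprSr invfM -mulrA mulVf ?mulr1// normr_eq0.
Unshelve. all: exact: integral_ge0.
Qed.

End rV_integral.

Section rV_measurable.
Context {R : realType}.

(** Measurable sets are generated by the coordinates, so open sets must be reached by countable
    operations: an open set is the union of the boxes it contains among those with rational centre
    and radius 1 / (k + 1). This makes continuous functions measurable. *)
Lemma measurable_open_rV n (U : set 'rV[R]_n) : open U -> measurable U.
Proof.
move=> oU.
pose box (q : 'rV[rat]_n * nat) : set 'rV[R]_n :=
  [set x | forall i, `|x 0 i - ratr (q.1 0 i)| < q.2.+1%:R^-1].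
have mbox q : measurable (box q).
  have -> : box q = \bigcap_(i in [set: 'I_n])
      ((fun x : 'rV[R]_n => `|x 0 i - ratr (q.1 0 i)| : measurableTypeR R) @^-1`
        `]-oo, q.2.+1%:R^-1[%classic).
    by apply/seteqP; split=> [x xq i _ /=|x xq i]; [rewrite in_itv/=|have := xq i I; rewrite /= in_itv].
  apply: fin_bigcap_measurable => // i _.
  rewrite -[X in measurable X]setTI.
  have : measurable_fun setT (fun x : 'rV[R]_n => `|x 0 i - ratr (q.1 0 i)| : measurableTypeR R).
    apply: measurableT_comp => //; apply: measurable_funB => //; exact: measurable_coord.
  by apply => //; exact: measurable_itv.
have -> : U = \bigcup_(q in [set q | box q `<=` U]) box q.
  apply/seteqP; split=> [x Ux|x [q qU qx]]; last exact: qU.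
  have := open_nbhs_nbhs (conj oU Ux); rewrite -nbhs_ballE => -[e /= e0 eU].
  (* With a radius below e / 2, two points of the same box are at distance less than e. *)
  pose k := Num.truncn (2 / e).
  have ke : k.+1%:R^-1 < e / 2.
    rewrite -[ltRHS]invrK ltf_pV2 ?posrE ?invr_gt0 ?divr_gt0//.
    by rewrite invf_div; exact: truncnS_gt.
  have /choice[q qP] : forall i : 'I_n, exists q : rat, `|x 0 i - ratr q| < k.+1%:R^-1.
    move=> i; have k0 : 0 < k.+1%:R^-1 :> R by rewrite invr_gt0.
    have /rat_in_itvoo[q] : x 0 i - k.+1%:R^-1 < x 0 i + k.+1%:R^-1 by rewrite ltrBlDr -addrA ltrDl addr_gt0.
    by rewrite in_itv /= => /andP[? ?]; exists q; rewrite distrC ltr_distl; apply/andP; split.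
  exists (\row_i q i, k); last by move=> i /=; rewrite mxE.
  move=> y yq; apply: eU; split=> // i j; rewrite (ord1 i).
  have := yq j; have := qP j; rewrite /= mxE => h1 h2.
  rewrite /ball /= (_ : x 0 j - y 0 j = (x 0 j - ratr (q j)) - (y 0 j - ratr (q j))); last by ring.
  by apply: (le_lt_trans (ler_normB _ _)); rewrite (splitr e) ltrD// (lt_trans _ ke).
rewrite bigcup_mkcond; apply: countable_bigcupT_measurable => // q.
by case: ifPn.
Qed.

Lemma continuous_measurable_rV n (f : 'rV[R]_n -> R) : continuous f ->
  measurable_fun setT f.
Proof.
move=> cf; apply: (measurability _ (RGenOpens.measurableE R)).
move=> _ [_ [a [b ->]] <-]; rewrite setTI.
apply: measurable_open_rV; move/continuousP : cf; apply; exact: interval_open.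
Qed.

Lemma measurable_dot n (f g : 'rV[R]_n -> 'rV[R]_n) : measurable_fun setT f ->
  measurable_fun setT g -> measurable_fun setT (fun x => dot (f x) (g x)).
Proof.
move=> mf mg; apply: measurable_sum => i; apply: measurable_funM;
  exact: measurableT_comp (measurable_coord i) _.
Qed.

Lemma measurable_dot2 n : measurable_fun setT (fun z : 'rV[R]_n * 'rV[R]_n => dot z.1 z.2).
Proof.
by apply: measurable_sum => i; apply: measurable_funM;
  apply: (measurableT_comp (measurable_coord i)).
Qed.

Lemma measurable_enorm n : measurable_fun setT (@enorm R n).
Proof.
apply: (measurableT_comp (f := @Num.sqrt R)); last exact: measurable_dot.
apply: continuous_measurable_fun; exact: sqrt_continuous.
Qed.

Lemma measurable_norm_rV n : measurable_fun setT (fun x : 'rV[R]_n => `|x|).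
Proof. by apply: continuous_measurable_rV; exact: norm_continuous. Qed.

End rV_measurable.

Section rV_norm.
Context {R : realType} {n : nat}.
Implicit Types x y : 'rV[R]_n.

Lemma coord_le_norm x i : `|x 0 i| <= `|x|.
Proof.
rewrite [leRHS]/Num.norm/= mx_normrE.
by apply: (le_bigmax _ (fun ij : 'I_1 * 'I_n => `|x ij.1 ij.2|) (0, i)).
Qed.

Lemma norm_rV_le x (r : R) : 0 <= r -> (forall i, `|x 0 i| <= r) -> `|x| <= r.
Proof.
move=> r0 xr; rewrite [leLHS]/Num.norm/= mx_normrE; apply: bigmax_le => // -[i j] _ /=.
by rewrite (ord1 i).
Qed.

Lemma dot_ge0 x : 0 <= dot x x.
Proof. by apply: sumr_ge0 => i _; rewrite -expr2 sqr_ge0. Qed.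

Lemma enorm_ge0 x : 0 <= enorm x.
Proof. exact: sqrtr_ge0. Qed.

Lemma enorm_sqr x : enorm x ^+ 2 = dot x x.
Proof. by rewrite sqr_sqrtr ?dot_ge0. Qed.

Lemma coord_le_enorm x i : `|x 0 i| <= enorm x.
Proof.
rewrite -ler_sqr ?nnegrE ?enorm_ge0// enorm_sqr real_normK ?num_real//.
rewrite /dot (bigD1 i)//= -expr2 lerDl; apply: sumr_ge0 => j _.
by rewrite -expr2 sqr_ge0.
Qed.

Lemma norm_le_enorm x : `|x| <= enorm x.
Proof. by apply: norm_rV_le => [|i]; [exact: enorm_ge0|exact: coord_le_enorm]. Qed.

Lemma enorm_le_norm x : enorm x <= Num.sqrt n%:R * `|x|.
Proof.
rewrite -ler_sqr ?nnegrE ?enorm_ge0 ?mulr_ge0 ?sqrtr_ge0//.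
rewrite enorm_sqr exprMn sqr_sqrtr ?ler0n// /dot.
apply: (@le_trans _ _ (\sum_(i < n) `|x| ^+ 2)).
  apply: ler_sum => i _; rewrite -expr2 -(real_normK (num_real (x 0 i))).
  by rewrite ler_sqr ?nnegrE// coord_le_norm.
by rewrite sumr_const card_ord -(mulr_natl (`|x| ^+ 2)).
Qed.

Lemma enormZ (k : R) x : enorm (k *: x) = `|k| * enorm x.
Proof.
rewrite -sqrtr_sqr -sqrtrM ?sqr_ge0//; congr Num.sqrt.
by rewrite /dot mulr_sumr; apply: eq_bigr => i _; rewrite !mxE; ring.
Qed.

Lemma enorm_gt0 x : x != 0 -> 0 < enorm x.
Proof. by move=> x0; rewrite (lt_le_trans _ (norm_le_enorm x))// normr_gt0. Qed.

Lemma dotZl (k : R) x y : dot (k *: x) y = k * dot x y.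
Proof. by rewrite /dot mulr_sumr; apply: eq_bigr => i _; rewrite !mxE mulrA. Qed.

Lemma dotC x y : dot x y = dot y x.
Proof. by apply: eq_bigr => i _; rewrite mulrC. Qed.

Lemma dotZr (k : R) x y : dot x (k *: y) = k * dot x y.
Proof. by rewrite dotC dotZl dotC. Qed.

Lemma dotDl x y z : dot (x + y) z = dot x z + dot y z.
Proof. by rewrite /dot -big_split; apply: eq_bigr => i _; rewrite !mxE mulrDl. Qed.

Lemma dotDr x y z : dot x (y + z) = dot x y + dot x z.
Proof. by rewrite dotC dotDl ![dot _ x]dotC. Qed.

End rV_norm.

Section rV_L1.
Context {R : realType}.
Let mR := measurableTypeR R.

Lemma L1_affine n (k : R) (c : 'rV[R]_n) (f : 'rV[R]_n -> R) : k != 0 ->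
  L1 (lebesgue_rV n) f -> L1 (lebesgue_rV n) (fun x => f (k *: x + c)).
Proof.
move=> k0 f1; have mf := L1_measurable f1.
apply: L1P; first exact: measurableT_comp mf (measurable_affine_rV _ _).
rewrite (ge0_integral_affine c k0 (f := fun x => `|f x|%:E))//; last first.
  by apply/measurable_EFinP; exact: measurableT_comp.
by apply: lte_mul_pinfty; rewrite ?lee_fin ?invr_ge0 ?exprn_ge0// L1_lty.
Qed.

Lemma Int_affine n (k : R) (c : 'rV[R]_n) (f : 'rV[R]_n -> R) : k != 0 ->
  L1 (lebesgue_rV n) f ->
  \int[lebesgue_rV n]_x f (k *: x + c) = `|k| ^- n * \int[lebesgue_rV n]_x f x.
Proof.
move=> k0 f1; have mf := L1_measurable f1.
have pos (g : 'rV[R]_n -> R) : L1 (lebesgue_rV n) g -> (forall x, 0 <= g x) ->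
    \int[lebesgue_rV n]_x g (k *: x + c) = `|k| ^- n * \int[lebesgue_rV n]_x g x.
  move=> g1 g0; rewrite /Rintegral (ge0_integral_affine c k0 (f := fun x => (g x)%:E))//; last first.
    by apply/measurable_EFinP; exact: L1_measurable g1.
  by rewrite fineM//; exact: integrable_fin_num g1.
(* A difference of nonnegative integrable functions, for which the change of variables is already
   known. *)
have fE x : f x = (`|f x| + f x) - `|f x| by rewrite addrAC subrr add0r.
have g1 : L1 (lebesgue_rV n) (fun x => `|f x| + f x) by apply: L1D => //; exact: L1_abs.
have h1 := L1_abs f1.
under eq_Rintegral => x _ do rewrite fE.
rewrite IntB; [|exact: (L1_affine _ _ g1)|exact: (L1_affine _ _ h1)].
rewrite (pos _ g1); last by move=> x; rewrite -lerBlDl sub0r lerNl -normrN ler_norm.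
rewrite (pos _ h1)//; under [in RHS]eq_Rintegral => x _ do rewrite fE.
by rewrite IntB// mulrBr.
Qed.

Lemma L1_shift n (c : 'rV[R]_n) (f : 'rV[R]_n -> R) :
  L1 (lebesgue_rV n) f -> L1 (lebesgue_rV n) (fun x => f (x + c)).
Proof. by move=> /(L1_affine c (oner_neq0 _)); under eq_fun do rewrite scale1r. Qed.

Lemma Int_shift n (c : 'rV[R]_n) (f : 'rV[R]_n -> R) : L1 (lebesgue_rV n) f ->
  \int[lebesgue_rV n]_x f (x + c) = \int[lebesgue_rV n]_x f x.
Proof.
move=> /(Int_affine c (oner_neq0 _)); rewrite normr1 expr1n invr1 mul1r => <-.
by apply: eq_Rintegral => x _; rewrite scale1r.
Qed.

Lemma L1_scale n (k : R) (f : 'rV[R]_n -> R) : k != 0 ->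
  L1 (lebesgue_rV n) f -> L1 (lebesgue_rV n) (fun x => f (k *: x)).
Proof. by move=> k0 /(L1_affine 0 k0); under eq_fun do rewrite addr0. Qed.

Lemma Int_scale n (k : R) (f : 'rV[R]_n -> R) : k != 0 -> L1 (lebesgue_rV n) f ->
  \int[lebesgue_rV n]_x f (k *: x) = `|k| ^- n * \int[lebesgue_rV n]_x f x.
Proof.
move=> k0 /(Int_affine 0 k0) <-; by apply: eq_Rintegral => x _; rewrite addr0.
Qed.

Lemma Int_rVS n (f : 'rV[R]_n.+1 -> R) : L1 (lebesgue_rV n.+1) f ->
  (forall a, L1 (lebesgue_rV n) (fun y => f (vcons (a, y)))) ->
  \int[lebesgue_rV n.+1]_x f x =
  \int[@lebesgue_measure R]_a \int[lebesgue_rV n]_y f (vcons (a, y)).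
Proof.
move=> f1 fa; have mf := L1_measurable f1.
have g1 : L1 (@lebesgue_measure R \x lebesgue_rV n)%E (f \o vcons).
  apply: L1_prodP; first exact: measurableT_comp mf measurable_vcons.
  have := L1_lty f1; rewrite ge0_integral_rVS//.
  by apply/measurable_EFinP; exact: measurableT_comp.
rewrite -(Int_prod12 (f := f \o vcons))// /Rintegral; congr fine.
rewrite -(integral_pushforward measurable_vcons (mu := (@lebesgue_measure R \x lebesgue_rV n)%E)
  (D := setT) (f := EFin \o f))//.
by apply/measurable_EFinP.
Qed.

Lemma ge0_integral_prodc n (f : R -> R) : measurable_fun [set: mR] f -> (forall x, 0 <= f x) ->
  (\int[lebesgue_rV n]_x (\prod_i f (x 0 i))%:E =
   (\int[@lebesgue_measure R]_x (f x)%:E) ^+ n)%E.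
Proof.
move=> mf f0; elim: n => [|n IH].
  under eq_integral do rewrite big_ord0.
  by rewrite integral_dirac//= diracT mul1e.
have mp m : measurable_fun setT (fun x : 'rV[R]_m => \prod_i f (x 0 i)).
  by apply: measurable_prod => i _; apply: (measurableT_comp mf); exact: measurable_coord.
rewrite ge0_integral_rVS//; last 2 first.
- by apply/measurable_EFinP; exact: mp.
- by move=> x; rewrite lee_fin prodr_ge0.
under eq_integral => a _.
  under eq_integral => y _.
    rewrite big_ord_recl mxE unlift_none /= EFinM.
    under eq_bigr do rewrite mxE liftK /=.
    over.
  rewrite ge0_integralZl//; first over.
  - by apply/measurable_EFinP; exact: mp.
  - by move=> y _; rewrite lee_fin prodr_ge0.
  - by rewrite lee_fin.
rewrite ge0_integralZr//; first last.
- by apply: integral_ge0 => y _; rewrite lee_fin prodr_ge0.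
- by move=> x _; rewrite lee_fin.
- by apply/measurable_EFinP.
by rewrite IH expeS.
Qed.

Lemma box_measure n (r : R) : 0 <= r ->
  lebesgue_rV n [set x : 'rV[R]_n | `|x| <= r] = ((2 * r) ^+ n)%:E.
Proof.
move=> r0.
have mA : measurable [set x : 'rV[R]_n | `|x| <= r].
  rewrite -[X in measurable X]setTI.
  rewrite (_ : [set x : 'rV[R]_n | `|x| <= r] = (fun x : 'rV[R]_n => `|x|) @^-1` `]-oo, r]); last first.
    by apply/seteqP; split=> x /=; rewrite in_itv.
  by apply: measurable_norm_rV => //; exact: measurable_itv.
rewrite -[X in lebesgue_rV n X]setIT -integral_indic//.
transitivity (\int[lebesgue_rV n]_x (\prod_i (\1_(`[- r, r]%classic) (x 0 i) : R))%:E)%E.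
  apply: eq_integral => x _; congr EFin; rewrite indicE.
  case: (boolP (`|x| <= r)) => xr.
    rewrite mem_set// big1// => i _; rewrite indicE mem_set//= in_itv /= -ler_norml.
    exact: le_trans (coord_le_norm _ _) xr.
  rewrite memNset /=; last exact/negP.
  have : exists i, r < `|x 0 i|.
    apply: contrapT => /forallNP h; move/negP : xr; apply.
    by apply: norm_rV_le => // i; rewrite leNgt; apply/negP; exact: h.
  move=> [i ri]; rewrite (bigD1 i)//= indicE memNset ?mul0r//= in_itv /= -ler_norml.
  by apply/negP; rewrite -ltNge.
rewrite ge0_integral_prodc// integral_indic// setIT /= lebesgue_measure_itv/= lte_fin.
have [r1|r1] := ltP (- r) r; first by rewrite -EFinB -EFin_expe; congr ((_ ^+ _)%:E); ring.
have -> : r = 0 by apply/eqP; rewrite eq_le r0; lra.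
by rewrite mulr0 -EFin_expe.
Qed.

End rV_L1.

Section swap01.
Context {R : realType} (n : nat).
Let mR := measurableTypeR R.

(** Quarter turn in the plane of the first two coordinates. Its invariance will equate the energies
    of two oscillating factors that are a quarter period apart. *)
Definition rot01 (x : 'rV[R]_n.+2) : 'rV[R]_n.+2 :=
  vcons (- x 0 (lift ord0 ord0), vcons (x 0 ord0, \row_j x 0 (lift ord0 (lift ord0 j)))).

Lemma rot01E0 x : rot01 x 0 ord0 = - x 0 (lift ord0 ord0).
Proof. by rewrite mxE unlift_none. Qed.

Lemma rot01E1 x : rot01 x 0 (lift ord0 ord0) = x 0 ord0.
Proof. by rewrite mxE liftK /= mxE unlift_none. Qed.

Lemma rot01E2 x j : rot01 x 0 (lift ord0 (lift ord0 j)) = x 0 (lift ord0 (lift ord0 j)).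
Proof. by rewrite mxE liftK /= mxE liftK /= mxE. Qed.

Lemma rot01_vcons (a b : mR) (y : 'rV[R]_n) :
  rot01 (vcons (a, vcons (b, y))) = vcons (- b, vcons (a, y)).
Proof.
rewrite /rot01; congr (vcons (_, vcons (_, _))).
- by rewrite !mxE liftK /= mxE unlift_none.
- by rewrite mxE unlift_none.
- by apply/rowP => j; rewrite !mxE !liftK /= mxE liftK.
Qed.

Lemma measurable_rot01 : measurable_fun setT rot01.
Proof.
apply: measurable_fun_rV => i.
case: (unliftP ord0 i) => [i' ->|->].
  case: (unliftP ord0 i') => [j ->|->].
    by under eq_fun do rewrite rot01E2; exact: measurable_coord.
  by under eq_fun do rewrite rot01E1; exact: measurable_coord.
by under eq_fun do rewrite rot01E0; apply: measurable_funN; exact: measurable_coord.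
Qed.

(** In the first two coordinates the quarter turn is an exchange combined with a reflection: Tonelli
    handles the former, the affine change of variables with factor -1 the latter. *)
Lemma ge0_integral_rot01 (f : 'rV[R]_n.+2 -> \bar R) :
  measurable_fun setT f -> (forall x, 0 <= f x)%E ->
  (\int[lebesgue_rV n.+2]_x f (rot01 x) = \int[lebesgue_rV n.+2]_x f x)%E.
Proof.
move=> mf f0.
have mF m (g : 'rV[R]_m.+1 -> \bar R) : measurable_fun setT g ->
    (forall x, 0 <= g x)%E ->
    measurable_fun setT (fun a : mR => \int[lebesgue_rV m]_y g (vcons (a, y)))%E.
  move=> mg g0; apply: (measurable_fun_fubini_tonelli_F (g \o vcons)) => //=.
  exact: measurableT_comp mg measurable_vcons.
have mv m (a : mR) : measurable_fun setT (fun y : 'rV[R]_m => vcons (a, y)).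
  exact: measurableT_comp measurable_vcons (pair1_measurable _).
have E (g : 'rV[R]_n.+2 -> \bar R) : measurable_fun setT g ->
    (forall x, 0 <= g x)%E ->
    (\int[lebesgue_rV n.+2]_x g x = \int[@lebesgue_measure R]_a \int[@lebesgue_measure R]_b
      \int[lebesgue_rV n]_y g (vcons (a, vcons (b, y))))%E.
  move=> mg g0; rewrite ge0_integral_rVS//; apply: eq_integral => a _.
  by rewrite ge0_integral_rVS//; exact: measurableT_comp mg (mv _ a).
have ER := E (fun x => f (rot01 x)) (measurableT_comp mf measurable_rot01)
  (fun x => f0 (rot01 x)).
rewrite [LHS]ER [RHS](E f mf f0).
under eq_integral => a _.
  under eq_integral => b _.
    under eq_integral => y _ do rewrite rot01_vcons.
    over.
  over.
have mG : measurable_fun setT (fun z : mR * mR =>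
    \int[lebesgue_rV n]_y f (vcons (z.1, vcons (z.2, y))))%E.
  apply: (measurable_fun_fubini_tonelli_F
    (fun w : (mR * mR) * 'rV[R]_n => f (vcons (w.1.1, vcons (w.1.2, w.2))))) => //.
  apply: (measurableT_comp mf); apply: (measurableT_comp measurable_vcons).
  apply: measurable_fun_pair; first exact: measurableT_comp measurable_fst measurable_fst.
  apply: (measurableT_comp measurable_vcons); apply: measurable_fun_pair => //.
  exact: measurableT_comp measurable_snd measurable_fst.
pose G (z : mR * mR) := (\int[lebesgue_rV n]_y f (vcons (z.1, vcons (z.2, y))))%E.
have G0 z : (0 <= G z)%E by exact: integral_ge0.
transitivity (\int[@lebesgue_measure R]_b \int[@lebesgue_measure R]_a G (- b, a)%R)%E.
  have mG' : measurable_fun setT (fun z : mR * mR => G (- z.2, z.1)%R).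
    apply: (measurableT_comp mG); apply: measurable_fun_pair => //.
    exact: measurableT_comp.
  exact: (fubini_tonelli (m1 := @lebesgue_measure R) (m2 := @lebesgue_measure R)
    _ mG' (fun z => G0 _)).
have mG1 : measurable_fun setT (fun a : mR => \int[@lebesgue_measure R]_b G (a, b))%E.
  by apply: (measurable_fun_fubini_tonelli_F G).
have N10 : -1 != 0 :> R by rewrite oppr_eq0 oner_neq0.
have H := ge0_integral_affine1 0 N10 mG1 (fun a => integral_ge0 _ (fun b _ => G0 (a, b))).
rewrite normrN1 mul1e in H; apply: etrans (esym H).
by apply: eq_integral => b _; rewrite mulN1r addr0.
Qed.

Lemma ge0_Int_rot01 (f : 'rV[R]_n.+2 -> R) : measurable_fun setT f -> (forall x, 0 <= f x) ->
  \int[lebesgue_rV n.+2]_x f (rot01 x) = \int[lebesgue_rV n.+2]_x f x.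
Proof.
move=> mf f0; rewrite /Rintegral; congr fine.
by rewrite (ge0_integral_rot01 (f := fun x => (f x)%:E))//; exact/measurable_EFinP.
Qed.

End swap01.

Section weight.
Context {R : realType}.
Let mR := measurableTypeR R.

(** Product of Cauchy densities, up to the factor pi^n. It is the standard integrable majorant for
    rapidly decaying functions, and also the transform of [pois] up to a constant, which makes it
    the approximate identity of the inversion formula. *)
Definition weight n (x : 'rV[R]_n) : R := \prod_i (oneDsqr (x 0 i))^-1.

Lemma measurable_oneDsqrV : measurable_fun [set: mR] (fun x : R => (oneDsqr x)^-1).
Proof. exact: continuous_measurable_fun (@continuous_oneDsqrV R). Qed.

Lemma oneDsqrV_ge0 (x : R) : 0 <= (oneDsqr x)^-1.
Proof. by rewrite invr_ge0 (le_trans ler01) ?oneDsqr_ge1. Qed.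

Lemma integral_oneDsqrV :
  (\int[@lebesgue_measure R]_x ((oneDsqr x)^-1)%:E = pi%:E)%E.
Proof.
rewrite (ge0_symfun_integralT oneDsqrV_ge0)//; last 2 first.
- exact: continuous_oneDsqrV.
- by move=> x /=; rewrite /oneDsqr sqrrN.
have -> : [set x : R | 0 <= x] = `[0, +oo[%classic by rewrite set_itvcy.
by rewrite integral0y_oneDsqr -EFinM mulrC divfK.
Qed.

Lemma measurable_weight n : measurable_fun setT (@weight n).
Proof.
by apply: measurable_prod => i _; apply: (measurableT_comp measurable_oneDsqrV);
  exact: measurable_coord.
Qed.

Lemma weight_ge0 n (x : 'rV[R]_n) : 0 <= weight x.
Proof. by apply: prodr_ge0 => i _; exact: oneDsqrV_ge0. Qed.

Lemma weight_le1 n (x : 'rV[R]_n) : weight x <= 1.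
Proof.
apply: prodr_ile1 => i _; rewrite oneDsqrV_ge0 /=.
by rewrite invf_le1 ?oneDsqr_ge1// (lt_le_trans ltr01) ?oneDsqr_ge1.
Qed.

Lemma weight_gt0 n (x : 'rV[R]_n) : 0 < weight x.
Proof. by apply: prodr_gt0 => i _; rewrite invr_gt0 (lt_le_trans ltr01) ?oneDsqr_ge1. Qed.

Lemma integral_weight n : (\int[lebesgue_rV n]_x (weight x)%:E = (pi ^+ n)%:E)%E.
Proof.
have := ge0_integral_prodc n measurable_oneDsqrV oneDsqrV_ge0.
by rewrite integral_oneDsqrV -EFin_expe.
Qed.

Lemma L1_weight n : L1 (lebesgue_rV n) (@weight n).
Proof.
apply: L1P; first exact: measurable_weight.
under eq_integral => x _ do rewrite ger0_norm ?weight_ge0//.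
by rewrite integral_weight ltry.
Qed.

(** Each factor satisfies 1 + x_i^2 <= (1 + |x|)^2, so decay of order 2 n gives integrability. This
    is the origin of the exponent [2 * n] in the decay estimates. *)
Lemma weight_lower n (x : 'rV[R]_n) : 1 <= (1 + `|x|) ^+ (2 * n) * weight x.
Proof.
rewrite exprM -[X in _ ^+ X]card_ord -prodr_const -big_split /=.
rewrite [leLHS](_ : 1 = \prod_(i in 'I_n) 1); last by rewrite big1.
apply: ler_prod => i _.
rewrite ler01 /= ler_pdivlMr ?mul1r ?(lt_le_trans ltr01) ?oneDsqr_ge1//.
rewrite /oneDsqr; have := coord_le_norm x i; have := normr_ge0 (x 0 i).
rewrite -(real_normK (num_real (x 0 i))); set a := `|_|; set b := `|x|; nra.
Qed.

End weight.

(** * Classes of differentiable functions *)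

Section directional.
Context {R : realType} {E : normedModType R}.
Implicit Types (f g : E -> R) (w x : E).

(** Along a line a directional derivative is an ordinary one; through this the chain rule and the
    mean value theorem in one variable serve on any normed space. *)
Lemma is_derive_line f w x (t l : R) :
  is_derive t 1 (fun h : R => f (h *: w + x)) l <-> is_derive (t *: w + x) w f l.
Proof.
have H : (fun h : R => h^-1 *: (((fun h : R => f (h *: w + x)) \o shift t) (h *: 1) -
      (fun h : R => f (h *: w + x)) t)) =
    (fun h : R => h^-1 *: ((f \o shift (t *: w + x)) (h *: w) - f (t *: w + x))).
  apply/funext => h; congr (_ *: (f _ - _)) => /=.
  by rewrite [h *: 1]mulr1 scalerDl addrA.
split=> -[d <-]; apply: DeriveDef; move: d; rewrite /derivable /derive;
  have -> : (fun h : R => h^-1 *: (((fun h : R => f (h *: w + x)) \o shift t) (h *: 1) -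
      f (t *: w + x))) =
    (fun h : R => h^-1 *: ((f \o shift (t *: w + x)) (h *: w) - f (t *: w + x))) by exact: H.
all: by [].
Qed.

Lemma is_derive_line0 f w x (l : R) :
  is_derive (0 : R) 1 (fun h : R => f (h *: w + x)) l <-> is_derive x w f l.
Proof. by rewrite is_derive_line scale0r add0r. Qed.

Lemma is_derive_compR (h : R -> R) f w x (dh df : R) :
  is_derive (f x) 1 h dh -> is_derive x w f df ->
  is_derive x w (fun y => h (f y)) (dh * df).
Proof.
move=> hd /is_derive_line0 fd; apply/is_derive_line0.
have fx : f x = (fun t : R => f (t *: w + x)) 0 by rewrite /= scale0r add0r.
rewrite fx in hd.
exact: (@is_derive1_comp _ h (fun t : R => f (t *: w + x))).
Qed.

Lemma is_deriveMR f g w x (df dg : R) :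
  is_derive x w f df -> is_derive x w g dg ->
  is_derive x w (fun y => f y * g y) (f x * dg + df * g x).
Proof.
move=> fd gd; apply: (is_derive_eq (is_deriveM fd gd)).
by rewrite /GRing.scale /= [g x * _]mulrC.
Qed.

Lemma is_deriveDR f g w x (df dg : R) :
  is_derive x w f df -> is_derive x w g dg ->
  is_derive x w (fun y => f y + g y) (df + dg).
Proof. by move=> fd gd; exact: is_deriveD. Qed.

Lemma is_deriveZR (c : R) f w x (df : R) :
  is_derive x w f df -> is_derive x w (fun y => c * f y) (c * df).
Proof.
move=> fd; apply: (is_derive_eq (is_deriveMR (is_derive_cst c x w) fd)).
by rewrite mul0r addr0.
Qed.

Lemma is_derive_sumR (I : Type) (s : seq I) (P : pred I) (h : I -> E -> R) (dh : I -> R) w x :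
  (forall i, is_derive x w (h i) (dh i)) ->
  is_derive x w (fun y => \sum_(i <- s | P i) h i y) (\sum_(i <- s | P i) dh i).
Proof.
move=> hd; elim: s => [|i s IH].
  under eq_fun do rewrite big_nil; rewrite big_nil; exact: is_derive_cst.
under eq_fun do rewrite big_cons; rewrite big_cons.
by case: (P i) => //; exact: is_deriveDR.
Qed.

End directional.

Section lines.
Context {R : realType} {E : normedModType R}.
Implicit Types (f g : E -> R) (w x : E).

Lemma is_derive_linR f w x : (forall (h : R) u v, f (h *: u + v) = h * f u + f v) ->
  is_derive x w f (f w).
Proof.
move=> fl; apply/is_derive_line0.
have -> : (fun h : R => f (h *: w + x)) = (fun h : R => h * f w + f x).
  by apply/funext => h; exact: fl.
apply: (is_derive_eq (is_deriveDR (is_deriveMR (is_derive_id (0 : R) 1)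
  (is_derive_cst (f w) (0 : R) 1)) (is_derive_cst (f x) (0 : R) 1))).
by rewrite mulr0 add0r mul1r addr0.
Qed.

Lemma MVT_dir f w x (h : R) : 0 <= h -> (forall y, derivable f y w) ->
  exists2 t : R, 0 <= t <= h & f (x + h *: w) - f x = h * 'D_w f (x + t *: w).
Proof.
move=> h0 fd.
have gd (t : R) : is_derive t 1 (fun h : R => f (h *: w + x)) ('D_w f (t *: w + x)).
  by apply/is_derive_line; exact: derivableP.
have [|t] := @MVT_segment R (fun h : R => f (h *: w + x)) (fun t => 'D_w f (t *: w + x)) 0 h h0
    (fun t _ => gd t).
  apply: continuous_subspaceT => t.
  by apply/differentiable_continuous/derivable1_diffP; case: (gd t).
rewrite in_itv /= => t01 e; exists t => //.
by move: e; rewrite subr0 scale0r add0r [_ + x]addrC [t *: w + x]addrC mulrC.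
Qed.

End lines.

Section regularity.
Context {R : realType} {E : normedModType R}.
Implicit Types (f g : E -> R) (B : (E -> R) -> Prop).

(** All directional derivatives up to order k, and the function itself, lie in the class [B]. With
    [B] the continuous, rapidly decaying, polynomially bounded or supported functions, one set of
    closure lemmas serves for every function class of the proof. *)
Fixpoint reg B (k : nat) f : Prop :=
  B f /\ if k is k'.+1 then
    forall w, (forall x, derivable f x w) /\ reg B k' ('D_w f) else True.

Lemma reg_base B k f : reg B k f -> B f.
Proof. by case: k => [|k] []. Qed.

Lemma reg_derivable B k f w x : reg B k.+1 f -> derivable f x w.
Proof. by move=> [_ /(_ w)[]]. Qed.

Lemma reg_derive B k f w : reg B k.+1 f -> reg B k ('D_w f).
Proof. by move=> [_ /(_ w)[]]. Qed.

Lemma reg_is_derive B k f w x : reg B k.+1 f -> is_derive x w f ('D_w f x).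
Proof. by move=> /(@reg_derivable _ _ _ w x) /derivableP. Qed.

Lemma regW B k f : reg B k.+1 f -> reg B k f.
Proof.
elim: k f => [|k IH] f [Bf H]; split=> // w; have [d r] := H w; split=> //.
exact: IH.
Qed.

Lemma reg_le B k l f : (k <= l)%N -> reg B l f -> reg B k f.
Proof.
move=> /subnK <-; elim: (l - k)%N => // m IH; rewrite addSn => /regW; exact: IH.
Qed.

Lemma reg_mono B B' k f : (forall g, B g -> B' g) -> reg B k f -> reg B' k f.
Proof.
move=> BB'; elim: k f => [|k IH] f [Bf H]; split=> //; first exact: BB'.
  exact: BB'.
by move=> w; have [d r] := H w; split=> //; exact: IH.
Qed.

Lemma reg_intro B k f (df : E -> E -> R) : B f ->
  (forall w x, is_derive x w f (df w x)) -> (forall w, reg B k (df w)) -> reg B k.+1 f.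
Proof.
move=> Bf fd rd; split=> // w; split; first by move=> x; case: (fd w x).
rewrite (_ : 'D_w f = df w)//; apply/funext => x.
by have [_ <-] := fd w x.
Qed.

Lemma reg_cst B k (c : R) : (forall c, B (fun=> c)) -> reg B k (fun=> c).
Proof.
move=> Bc; elim: k c => [|k IH] c; first by split.
apply: (reg_intro (df := fun _ _ => 0)) => // w x; exact: is_derive_cst.
Qed.

Lemma reg_add B k f g : (forall f g, B f -> B g -> B (fun x => f x + g x)) ->
  reg B k f -> reg B k g -> reg B k (fun x => f x + g x).
Proof.
move=> BD; elim: k f g => [|k IH] f g rf rg.
  by split=> //; apply: BD; [exact: reg_base rf|exact: reg_base rg].
apply: (reg_intro (df := fun w x => 'D_w f x + 'D_w g x)).
- by apply: BD; [exact: reg_base rf|exact: reg_base rg].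
- by move=> w x; apply: is_deriveDR; [exact: reg_is_derive rf|exact: reg_is_derive rg].
- by move=> w; apply: IH; exact: reg_derive.
Qed.

(** Leibniz rule with three classes, so that a polynomially bounded factor times a rapidly decaying
    one is rapidly decaying together with its derivatives. *)
Lemma reg_mul B1 B2 B3 k f g :
  (forall f g, B1 f -> B2 g -> B3 (fun x => f x * g x)) ->
  (forall f g, B3 f -> B3 g -> B3 (fun x => f x + g x)) ->
  reg B1 k f -> reg B2 k g -> reg B3 k (fun x => f x * g x).
Proof.
move=> BM BD; elim: k f g => [|k IH] f g rf rg.
  by split=> //; apply: BM; [exact: reg_base rf|exact: reg_base rg].
apply: (reg_intro (df := fun w x => f x * 'D_w g x + 'D_w f x * g x)).
- by apply: BM; [exact: reg_base rf|exact: reg_base rg].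
- by move=> w x; apply: is_deriveMR; [exact: reg_is_derive rf|exact: reg_is_derive rg].
- move=> w; apply: reg_add => //; apply: IH.
  + exact: regW.
  + exact: reg_derive.
  + exact: reg_derive.
  + exact: regW.
Qed.

Lemma reg_scale B k (c : R) f : (forall c f, B f -> B (fun x => c * f x)) ->
  reg B k f -> reg B k (fun x => c * f x).
Proof.
move=> BZ; elim: k f => [|k IH] f rf.
  by split=> //; apply: BZ; exact: reg_base rf.
apply: (reg_intro (df := fun w x => c * 'D_w f x)).
- by apply: BZ; exact: reg_base rf.
- by move=> w x; apply: is_deriveZR; exact: reg_is_derive rf.
- by move=> w; apply: IH; exact: reg_derive.
Qed.

Lemma reg_sum B k (I : Type) (s : seq I) (P : pred I) (h : I -> E -> R) :
  B (fun=> 0) -> (forall f g, B f -> B g -> B (fun x => f x + g x)) ->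
  (forall i, reg B k (h i)) -> reg B k (fun x => \sum_(i <- s | P i) h i x).
Proof.
move=> B0 BD hr; elim: s => [|i s IH].
  under eq_fun do rewrite big_nil.
  elim: k {hr} => [|k IH]; first by split.
  by apply: (reg_intro (df := fun _ _ => 0)) => // w x; exact: is_derive_cst.
under eq_fun do rewrite big_cons.
by case: (P i) => //; exact: reg_add.
Qed.

Lemma reg_linear B k f : (forall (h : R) u v, f (h *: u + v) = h * f u + f v) ->
  B f -> (forall c, B (fun=> c)) -> reg B k f.
Proof.
move=> fl Bf Bc; case: k => [|k]; first by split.
apply: (reg_intro (df := fun w _ => f w)) => // w.
  by move=> x; exact: is_derive_linR.
exact: reg_cst.
Qed.

Lemma reg_ext B k f g : f =1 g -> reg B k f -> reg B k g.
Proof. by move=> /funext ->. Qed.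

End regularity.

(** A function of one variable given with all its derivatives. The chain rule only raises the index
    by one, so smoothness of a composition follows by induction without a formula for higher
    derivatives. *)
Definition tower {R : realType} (H : nat -> R -> R) :=
  forall k (x : R), is_derive x 1 (H k) (H k.+1 x).

Lemma tower_continuous {R : realType} (H : nat -> R -> R) k : tower H -> continuous (H k).
Proof.
by move=> tH x; apply/differentiable_continuous/derivable1_diffP; case: (tH k x).
Qed.

Section smooth_functions.
Context {R : realType} {E : normedModType R}.
Implicit Types (f g : E -> R).

Definition C0 f := continuous f.

Definition smooth f := forall k, reg C0 k f.

Lemma C0D f g : C0 f -> C0 g -> C0 (fun x => f x + g x).
Proof. by move=> cf cg x; apply: continuousD; [exact: cf|exact: cg]. Qed.

Lemma C0M f g : C0 f -> C0 g -> C0 (fun x => f x * g x).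
Proof. by move=> cf cg x; apply: continuousM; [exact: cf|exact: cg]. Qed.

Lemma C0_cst (c : R) : C0 (fun=> c).
Proof. by move=> x; exact: cst_continuous. Qed.

Lemma C0Z (c : R) f : C0 f -> C0 (fun x => c * f x).
Proof. by move=> cf; apply: C0M => //; exact: C0_cst. Qed.

Lemma C0_sum (I : Type) (s : seq I) (P : pred I) (h : I -> E -> R) :
  (forall i, C0 (h i)) -> C0 (fun x => \sum_(i <- s | P i) h i x).
Proof.
move=> ch; elim: s => [|i s IH].
  by under eq_fun do rewrite big_nil; exact: C0_cst.
under eq_fun do rewrite big_cons.
by case: (P i) => //; exact: C0D.
Qed.

Lemma smooth_cst (c : R) : smooth (fun=> c).
Proof. by move=> k; apply: reg_cst; exact: C0_cst. Qed.

Lemma smoothD f g : smooth f -> smooth g -> smooth (fun x => f x + g x).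
Proof. by move=> sf sg k; apply: reg_add => //; exact: C0D. Qed.

Lemma smoothM f g : smooth f -> smooth g -> smooth (fun x => f x * g x).
Proof. by move=> sf sg k; apply: (@reg_mul _ _ C0 C0) => //; [exact: C0M|exact: C0D]. Qed.

Lemma smoothZ (c : R) f : smooth f -> smooth (fun x => c * f x).
Proof. by move=> sf; apply: smoothM => //; exact: smooth_cst. Qed.

Lemma smooth_sum (I : Type) (s : seq I) (P : pred I) (h : I -> E -> R) :
  (forall i, smooth (h i)) -> smooth (fun x => \sum_(i <- s | P i) h i x).
Proof. by move=> sh k; apply: reg_sum => [||i]; [exact: C0_cst|exact: C0D|exact: sh]. Qed.

Lemma smooth_linear f : (forall (h : R) u v, f (h *: u + v) = h * f u + f v) ->
  continuous f -> smooth f.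
Proof. by move=> fl cf k; apply: reg_linear => //; exact: C0_cst. Qed.

Lemma smooth_comp (H : nat -> R -> R) f m : tower H -> smooth f ->
  smooth (fun x => H m (f x)).
Proof.
move=> tH sf k; elim: k m => [|k IH] m.
  split=> // x; apply: continuous_comp; first exact: (reg_base (sf 0%N)).
  exact: tower_continuous.
apply: (reg_intro (df := fun w x => H m.+1 (f x) * 'D_w f x)).
- move=> x; apply: continuous_comp; first exact: (reg_base (sf 0%N)).
  exact: tower_continuous.
- by move=> w x; apply: is_derive_compR; [exact: tH|exact: reg_is_derive (sf 1%N)].
- move=> w; apply: (@reg_mul _ _ C0 C0); [exact: C0M|exact: C0D|exact: IH|].
  exact: reg_derive (sf k.+1).
Qed.

Lemma smooth_continuous f : smooth f -> continuous f.
Proof. by move=> /(_ 0%N)/reg_base. Qed.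

Lemma smooth_derive f w : smooth f -> smooth ('D_w f).
Proof. by move=> sf k; exact: reg_derive (sf k.+1). Qed.

Lemma smooth_is_derive f w x : smooth f -> is_derive x w f ('D_w f x).
Proof. by move=> /(_ 1%N)/reg_is_derive. Qed.

Lemma smooth_derivable f w x : smooth f -> derivable f x w.
Proof. by move=> /(_ 1%N)/reg_derivable. Qed.

Lemma smooth_iter_derive ws f : smooth f -> smooth (iter_derive ws f).
Proof. by move=> sf; elim: ws => //= w ws IH; exact: smooth_derive. Qed.

Lemma smooth_smooth_on U f : smooth f -> smooth_on_open U f.
Proof.
move=> sf ws x _; have sw := smooth_iter_derive ws sf.
by split=> [|w]; [exact: smooth_continuous|exact: smooth_derivable].
Qed.

Lemma smooth_on_smooth f : smooth_on_open setT f -> smooth f.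
Proof.
move=> sf k; elim: k f sf => [|k IH] f sf.
  by split=> // x; have [] := sf [::] x I.
split; first by move=> x; have [] := sf [::] x I.
move=> w; split; first by move=> x; have [_] := sf [::] x I; exact.
by apply: IH => ws x _; rewrite /iter_derive -foldr_rcons; exact: sf.
Qed.

(** Derivatives at a point depend only on the germ there. The dyadic sums are finite near each point
    off the origin, which is how they become smooth there. *)
Lemma smooth_on_local (W : normedModType R) (U : set E) (f : E -> W) :
  (forall x, U x -> exists g : E -> W, (\near x, f x = g x) /\ smooth_on_open setT g) ->
  smooth_on_open U f.
Proof.
move=> H ws x Ux; have [g [fg sg]] := H x Ux.
have fgw : \near x, iter_derive ws f x = iter_derive ws g x.
  elim: ws => //= w ws IH.
  move/nbhs_interior : IH; apply: filterS => y ny.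
  exact: near_eq_derive.
have [cg dg] := sg ws x I; split; last first.
  by move=> w; apply: near_eq_derivable (dg w); apply: filterS fgw => y ->.
rewrite /prop_for /continuous_at (nbhs_singleton fgw).
by apply: cvg_trans cg; apply: near_eq_cvg; apply: filterS fgw.
Qed.

Lemma lipschitz_continuous (C : R) f : 0 <= C ->
  (forall x y, `|f x - f y| <= C * `|x - y|) -> continuous f.
Proof.
move=> C0 lip x; apply/cvgrPdist_le => e e0; near=> y.
apply: (le_trans (lip x y)).
apply: (@le_trans _ _ ((C + 1) * (e / (C + 1)))).
  apply: ler_pM => //; first by rewrite lerDl.
  near: y; have e' : 0 < e / (C + 1) by rewrite divr_gt0// ltr_wpDl.
  by move: e'; apply: cvgr_dist_le; exact: cvg_id.
by rewrite mulrC divfK// gt_eqF// ltr_wpDl.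
Unshelve. all: by end_near. Qed.

End smooth_functions.

Section growth.
Context {R : realType} {n : nat}.
Local Notation V := 'rV[R]_n.
Implicit Types (f g : V -> R) (x w : V).
Local Notation mu := (lebesgue_rV n).

Definition rapid f := continuous f /\
  forall K : nat, exists C : R, forall x, (1 + `|x|) ^+ K * `|f x| <= C.

Definition moderate f := continuous f /\
  exists (K : nat) (C : R), forall x, `|f x| <= C * (1 + `|x|) ^+ K.

Definition supported (r : R) f := continuous f /\ forall x, r < `|x| -> f x = 0.

Lemma bracket_ge1 x : 1 <= 1 + `|x|.
Proof. by rewrite lerDl. Qed.

Lemma bracketX_ge1 x K : 1 <= (1 + `|x|) ^+ K.
Proof. by rewrite exprn_ege1// bracket_ge1. Qed.

Lemma bracketX_gt0 x K : 0 < (1 + `|x|) ^+ K.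
Proof. by rewrite (lt_le_trans ltr01)// bracketX_ge1. Qed.

Lemma rapidD f g : rapid f -> rapid g -> rapid (fun x => f x + g x).
Proof.
move=> [cf Hf] [cg Hg]; split; first exact: C0D.
move=> K; have [C1 h1] := Hf K; have [C2 h2] := Hg K; exists (C1 + C2) => x.
apply: le_trans (lerD (h1 x) (h2 x)); rewrite -mulrDr ler_wpM2l ?ler_normD//.
Qed.

Lemma moderate_rapid f g : moderate f -> rapid g -> rapid (fun x => f x * g x).
Proof.
move=> [cf [K [C H]]] [cg Hg]; split; first exact: C0M.
move=> L; have [D h] := Hg (K + L)%N; exists (C * D) => x.
have C0 : 0 <= C.
  by have := H 0; rewrite normr0 addr0 expr1n mulr1; apply: le_trans.
apply: le_trans (ler_wpM2l C0 (h x)).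
have -> : C * ((1 + `|x|) ^+ (K + L) * `|g x|) =
    (1 + `|x|) ^+ L * ((C * (1 + `|x|) ^+ K) * `|g x|) by rewrite exprD; ring.
by rewrite normrM ler_wpM2l ?ler_wpM2r// ltW// bracketX_gt0.
Qed.

Lemma rapid_moderate f : rapid f -> moderate f.
Proof.
move=> [cf Hf]; split => //; have [C h] := Hf 0%N; exists 0%N, C => x.
by have := h x; rewrite !expr0 mul1r mulr1.
Qed.

Lemma moderateD f g : moderate f -> moderate g -> moderate (fun x => f x + g x).
Proof.
move=> [cf [K [C H]]] [cg [L [D G]]]; split; first exact: C0D.
have C0 : 0 <= C.
  by have := H 0; rewrite normr0 addr0 expr1n mulr1; apply: le_trans.
have D0 : 0 <= D.
  by have := G 0; rewrite normr0 addr0 expr1n mulr1; apply: le_trans.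
exists (K + L)%N, (C + D) => x.
apply: (le_trans (ler_normD _ _)); rewrite mulrDl lerD//.
  by apply: (le_trans (H x)); rewrite ler_wpM2l// ler_weXn2l ?bracket_ge1// leq_addr.
by apply: (le_trans (G x)); rewrite ler_wpM2l// ler_weXn2l ?bracket_ge1// leq_addl.
Qed.

Lemma moderateM f g : moderate f -> moderate g -> moderate (fun x => f x * g x).
Proof.
move=> [cf [K [C H]]] [cg [L [D G]]]; split; first exact: C0M.
exists (K + L)%N, (C * D) => x.
by rewrite normrM exprD mulrACA ler_pM.
Qed.

Lemma moderate_cst (c : R) : moderate (fun=> c).
Proof. by split; [exact: C0_cst|exists 0%N, `|c| => x; rewrite expr0 mulr1]. Qed.

Lemma moderate_coord i : moderate (fun x => x 0 i).
Proof.
split; first by move=> x; exact: coord_continuous.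
exists 1%N, 1 => x; rewrite expr1 mul1r (le_trans (coord_le_norm _ _))//.
by rewrite lerDr.
Qed.

Lemma continuous_dotl w : continuous (fun x => dot x w).
Proof.
apply: C0_sum => i; apply: C0M; last exact: C0_cst.
by move=> x; exact: coord_continuous.
Qed.

Lemma dot_linear w (h : R) x y : dot (h *: x + y) w = h * dot x w + dot y w.
Proof. by rewrite dotDl dotZl. Qed.

Lemma moderate_dot w : moderate (fun x => dot x w).
Proof.
split; first exact: continuous_dotl.
exists 1%N, (\sum_i `|w 0 i|) => x; rewrite expr1 mulrC.
apply: (le_trans (ler_norm_sum _ _ _)); rewrite mulr_sumr; apply: ler_sum => i _.
rewrite normrM ler_wpM2r// (le_trans (coord_le_norm _ _))// lerDr//.
Qed.

Lemma norm_bounded_compact (r : R) : compact [set x : V | `|x| <= r].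
Proof.
apply: bounded_closed_compact.
  by exists r; split; [exact: num_real|move=> M rM x /= xr; rewrite (le_trans xr)// ltW].
rewrite (_ : [set x | _] = (fun x : V => `|x|) @^-1` [set y | y <= r])//.
by apply: preimage_closed (@closed_le _ _) => x _; exact: norm_continuous.
Qed.

Lemma supported_rapid r f : supported r f -> rapid f.
Proof.
move=> [cf sf]; split=> // K.
pose g x := (1 + `|x|) ^+ K * `|f x|.
have cg : continuous g.
  apply: C0M => x; last first.
    by apply: (@continuous_comp _ _ _ f Num.norm); [exact: cf|exact: norm_continuous].
  apply: (@continuous_comp _ _ _ (fun x : V => 1 + `|x|) (fun y : R => y ^+ K)).
    by apply: continuousD; [exact: cst_continuous|exact: norm_continuous].
  exact: exprn_continuous.
have [r0|r0] := ltP r 0.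
  exists 0 => x; rewrite sf ?normr0 ?mulr0//; exact: lt_le_trans (normr_ge0 _).
have [c _ cmax] := @EVT_max_rV R n g [set x | `|x| <= r] (ex_intro _ 0 (eq_ind_r (fun z => z <= r) r0 (normr0 _)))
  (@norm_bounded_compact r) (continuous_subspaceT cg).
exists (Num.max 0 (g c)) => x; have [xr|xr] := leP `|x| r.
  by rewrite le_max (cmax x) ?orbT// inE.
by rewrite sf// normr0 mulr0 le_max lexx.
Qed.

Lemma derive_outside r f w : (forall x, r < `|x| -> f x = 0) ->
  forall x, r < `|x| -> 'D_w f x = 0.
Proof.
move=> sf x rx; rewrite -(derive_cst (0 : R) x w); apply: near_eq_derive.
have oU : open ((fun x : V => `|x|) @^-1` [set y : R | r < y]).
  by apply: open_comp; [move=> y _; exact: norm_continuous|exact: open_gt].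
have Ux : nbhs x ((fun x : V => `|x|) @^-1` [set y : R | r < y]).
  by apply: open_nbhs_nbhs; split.
by apply: filterS Ux => y /sf.
Qed.

Lemma reg_supported r f k : smooth f -> (forall x, r < `|x| -> f x = 0) -> reg (supported r) k f.
Proof.
elim: k f => [|k IH] f sm sf; first by split=> //; split=> //; exact: smooth_continuous.
split; first by split=> //; exact: smooth_continuous.
move=> w; split; first by move=> x; exact: smooth_derivable.
by apply: IH; [exact: smooth_derive|exact: derive_outside].
Qed.

Lemma reg_rapid_of_supported r f k : smooth f -> (forall x, r < `|x| -> f x = 0) -> reg rapid k f.
Proof.
by move=> sm sf; apply: reg_mono (reg_supported k sm sf) => g; exact: supported_rapid.
Qed.

Lemma rapid_le_weight f : rapid f -> exists2 C : R, 0 <= C & forall x, `|f x| <= C * weight x.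
Proof.
move=> [_ /(_ (2 * n)%N)[C h]].
have C0 : 0 <= C by apply: le_trans (h 0); rewrite mulr_ge0// ltW// bracketX_gt0.
exists C => // x; rewrite -[leLHS]mul1r.
apply: le_trans (ler_wpM2r (weight_ge0 x) (h x)).
by rewrite mulrAC ler_wpM2r// weight_lower.
Qed.

Lemma rapid_L1 f : rapid f -> L1 mu f.
Proof.
move=> rf; have [C C0 h] := rapid_le_weight rf.
apply: (L1_dominated (g := fun x => C * weight x)) => //.
  by apply: continuous_measurable_rV; case: rf.
by apply: L1Z; exact: L1_weight.
Qed.

Lemma bracket_shift x w : 1 + `|x| <= (1 + `|x + w|) * (1 + `|w|).
Proof.
have := ler_normB (x + w) w; rewrite addrK.
have := normr_ge0 (x + w); have := normr_ge0 w.
set a := `|_|; set b := `|_|; nra.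
Qed.

(** Difference quotients have zero integral by translation invariance. They tend to the derivative,
    and by the mean value theorem they are values of the derivative at a point within |w|, which
    gives an integrable majorant independent of the step. *)
Lemma Int_derive_eq0 f w : reg rapid 1 f -> \int[mu]_x 'D_w f x = 0.
Proof.
move=> rf; have f1 := rapid_L1 (reg_base rf).
have rd : rapid ('D_w f) := reg_base (reg_derive w rf).
pose h k : R := k.+1%:R^-1.
have h01 k : 0 < h k <= 1 by rewrite invr_gt0 ltr0n /= invf_le1 ?ler1n ?ltr0n.
pose g k x := (h k)^-1 * (f (x + h k *: w) - f x).
have [C HC] := rd.2 (2 * n)%N.
have C0 : 0 <= C by apply: le_trans (HC 0); rewrite mulr_ge0// ltW// bracketX_gt0.
have g1 k : L1 mu (g k) by apply/L1Z/L1B => //; exact: L1_shift.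
have gb k x : `|g k x| <= C * (1 + `|w|) ^+ (2 * n) * weight x.
  have /andP[hk0 hk1] := h01 k.
  have [t /andP[t0 tk] e] := MVT_dir x (ltW hk0) (fun y => @reg_derivable _ _ _ _ _ w y rf).
  rewrite /g e mulKf ?gt_eqF//.
  have w0 : `|t *: w| <= `|w|.
    by rewrite normrZ ger0_norm// ler_piMl// (le_trans tk).
  have H1 : 1 + `|x| <= (1 + `|x + t *: w|) * (1 + `|w|).
    apply: (le_trans (bracket_shift x (t *: w))); rewrite ler_wpM2l ?lerD2l//.
  rewrite -[leLHS]mul1r.
  apply: (@le_trans _ _ ((1 + `|x|) ^+ (2 * n) * weight x * `|'D_w f (x + t *: w)|)).
    by rewrite ler_wpM2r// weight_lower.
  rewrite mulrAC ler_wpM2r ?weight_ge0//.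
  apply: (@le_trans _ _ (((1 + `|x + t *: w|) * (1 + `|w|)) ^+ (2 * n) * `|'D_w f (x + t *: w)|)).
    by rewrite ler_wpM2r// lerXn2r// nnegrE ?mulr_ge0 ?addr_ge0.
  rewrite exprMn mulrAC ler_wpM2r//; exact: HC.
have cg x : g ^~ x @ \oo --> 'D_w f x.
  have := @reg_derivable _ _ _ _ _ w x rf; rewrite /derivable => dfx.
  have : h^-1 *: ((f \o shift x) (h *: w) - f x) @[h --> 0^'] --> 'D_w f x by [].
  move/cvgr_dnbhsP => /(_ h); rewrite /= => H.
  have : (fun k => h k *: 0 + 0) = (fun k => h k *: 0 + 0 :> R) by [].
  move=> _; apply: cvg_trans (H _); last first.
    by split; [move=> k; rewrite gt_eqF//; case/andP: (h01 k)|exact: cvg_harmonic].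
  apply: near_eq_cvg; apply: nearW => k /=.
  by rewrite /g [x + _]addrC.
have [_ cI] := Int_cvg (fun k => L1_measurable (g1 k))
  (L1Z (C * (1 + `|w|) ^+ (2 * n)) (L1_weight n)) gb cg.
have I0 : (fun k => \int[mu]_x g k x) = fun=> 0.
  apply/funext => k; rewrite /g IntZ; last by apply: L1B => //; exact: L1_shift.
  by rewrite IntB ?Int_shift ?subrr ?mulr0//; exact: L1_shift.
rewrite I0 in cI.
rewrite -(cvg_lim (@Rhausdorff R) cI); apply: cvg_lim; first exact: Rhausdorff.
exact: cvg_cst.
Qed.

Lemma Int_by_parts f g w : reg moderate 1 f -> reg rapid 1 g ->
  \int[mu]_x (f x * 'D_w g x) = - \int[mu]_x ('D_w f x * g x).
Proof.
move=> rf rg.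
have rfg : reg rapid 1 (fun x => f x * g x).
  by apply: (@reg_mul _ _ moderate rapid) => //; [exact: moderate_rapid|exact: rapidD].
have := Int_derive_eq0 w rfg.
have E : 'D_w (fun x => f x * g x) =1 (fun x => f x * 'D_w g x + 'D_w f x * g x).
  by move=> x; have [_ ->] := is_deriveMR (reg_is_derive w x rf) (reg_is_derive w x rg).
rewrite (eq_Int _ E) IntD.
- by move/eqP; rewrite addr_eq0 => /eqP.
- apply: rapid_L1; apply: moderate_rapid; [exact: reg_base rf|exact: reg_base (reg_derive w rg)].
- apply: rapid_L1; apply: moderate_rapid; [exact: reg_base (reg_derive w rf)|exact: reg_base rg].
Qed.

End growth.

(** * Real Fourier transform *)

Section transform.
Context {R : realType} {n : nat}.
Local Notation V := 'rV[R]_n.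
Implicit Types (f g : V -> R) (x w xi : V) (al be : R).
Local Notation mu := (lebesgue_rV n).

(* [al = 0] gives the real part of the Fourier transform of a real function,
   and [al = pi / 2] its imaginary part. *)
Definition Tr al f xi : R := \int[mu]_x (cos (dot x xi + al) * f x).

Lemma cosD_pihalf (t : R) : cos (t + pi / 2) = - sin t.
Proof. by rewrite cosD cos_pihalf sin_pihalf mulr0 mulr1 sub0r. Qed.

Lemma is_derive_cos_shift al (t : R) :
  is_derive t 1 (fun t => cos (t + al)) (cos (t + (al + pi / 2))).
Proof.
rewrite addrA cosD_pihalf.
have : is_derive t 1 (fun t => t + al) 1.
  by apply: (is_derive_eq (is_deriveDR (is_derive_id t 1) (is_derive_cst al t 1))); rewrite addr0.
move=> H; have := is_derive_compR (f := fun t => t + al) (is_derive_cos (t + al)) H.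
by rewrite mulr1.
Qed.

Lemma cos_lipschitz (a b : R) : `|cos a - cos b| <= `|a - b|.
Proof.
wlog ab : a b / a <= b.
  move=> W; case: (leP a b) => [|/ltW] ab; first exact: W.
  by rewrite distrC [leRHS]distrC; exact: W.
have [t|t t01 e] := @MVT_segment R cos (fun t => - sin t) a b ab (fun t _ => is_derive_cos t).
  apply: continuous_subspaceT; exact: continuous_cos.
by rewrite distrC e normrM normrN [leRHS]distrC ler_piMl// sin_max.
Qed.

Lemma continuous_cos_dot al xi : continuous (fun x => cos (dot x xi + al)).
Proof.
move=> x; apply: (@continuous_comp _ _ _ (fun x => dot x xi + al) cos).
  by apply: C0D; [exact: continuous_dotl|exact: C0_cst].
exact: continuous_cos.
Qed.

Lemma norm_cos_le1 (t : R) : `|cos t| <= 1.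
Proof. by rewrite ler_norml cos_geN1 cos_le1. Qed.

Lemma L1_cos al f xi : L1 mu f -> L1 mu (fun x => cos (dot x xi + al) * f x).
Proof.
move=> f1; apply: (L1_bounded (C := 1)) => //.
  by apply: continuous_measurable_rV; exact: continuous_cos_dot.
by move=> x; exact: norm_cos_le1.
Qed.

Lemma Tr_bound al f xi : L1 mu f -> `|Tr al f xi| <= \int[mu]_x `|f x|.
Proof.
move=> f1; apply: le_norm_Int_dom; first exact: L1_abs.
  exact: L1_measurable (L1_cos _ _ f1).
by move=> x; rewrite normrM ler_piMl// norm_cos_le1.
Qed.

Lemma TrZ al c f xi : L1 mu f -> Tr al (fun x => c * f x) xi = c * Tr al f xi.
Proof.
move=> f1; rewrite /Tr -IntZ; last exact: L1_cos.
by apply: eq_Int => x; rewrite mulrCA.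
Qed.

Lemma Tr_sum (I : Type) (s : seq I) (P : pred I) (h : I -> V -> R) al xi :
  (forall i, L1 mu (h i)) ->
  Tr al (fun x => \sum_(i <- s | P i) h i x) xi = \sum_(i <- s | P i) Tr al (h i) xi.
Proof.
move=> h1; rewrite /Tr -Int_sum; last by move=> i; exact: L1_cos.
by apply: eq_Int => x; rewrite mulr_sumr.
Qed.

Lemma L1_cos_prod al f g : L1 mu f -> L1 mu g ->
  L1 (mu \x mu)%E (fun z => cos (dot z.1 z.2 + al) * (f z.1 * g z.2)).
Proof.
move=> f1 g1; apply: (L1_bounded (C := 1)); first exact: L1_prod.
  apply: (measurableT_comp (f := cos)).
    exact: continuous_measurable_fun (@continuous_cos R).
  by apply: measurable_funD => //; exact: measurable_dot2.
by move=> z; exact: norm_cos_le1.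
Qed.

Lemma L1_Tr_mul al f g : L1 mu f -> L1 mu g -> L1 mu (fun xi => Tr al f xi * g xi).
Proof.
move=> f1 g1.
have := L1_Int1 (L1_cos_prod al f1 g1).
have -> : (fun y => \int[mu]_x (cos (dot (x, y).1 (x, y).2 + al) * (f (x, y).1 * g (x, y).2))) =
    (fun xi => Tr al f xi * g xi).
  apply/funext => xi; rewrite /Tr mulrC -IntZ; last exact: L1_cos.
  by apply: eq_Int => x /=; ring.
apply=> xi /=; have := L1Zr (g xi) (L1_cos al xi f1).
by under eq_fun do rewrite -mulrA.
Qed.

(** Times [weight], the transform is the partial integral of a function integrable on the product,
    hence measurable by Fubini; [weight] is positive and can be divided out. *)
Lemma measurable_Tr al f : L1 mu f -> measurable_fun setT (Tr al f).
Proof.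
move=> f1; have := L1_measurable (L1_Tr_mul al f1 (@L1_weight R n)) => mT.
have -> : Tr al f = (fun xi => Tr al f xi * weight xi * (weight xi)^-1).
  by apply/funext => xi; rewrite mulfK// gt_eqF// weight_gt0.
apply: measurable_funM => //.
have -> : (fun xi : V => (weight xi)^-1) = (fun xi => \prod_i oneDsqr (xi 0 i)).
  apply/funext => xi; rewrite /weight -prodfV; apply: eq_bigr => i _; exact: invrK.
apply: measurable_prod => i _.
apply: (measurableT_comp (f := @oneDsqr R)); last exact: measurable_coord.
exact: continuous_measurable_fun (@continuous_oneDsqr R).
Qed.

Lemma Tr_swap al f g : L1 mu f -> L1 mu g ->
  \int[mu]_x (Tr al f x * g x) = \int[mu]_x (f x * Tr al g x).
Proof.
move=> f1 g1.
transitivity (\int[mu]_y \int[mu]_x (cos (dot x y + al) * (f x * g y))).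
  apply: eq_Int => y; rewrite /Tr mulrC -IntZ; last exact: L1_cos.
  by apply: eq_Int => x; ring.
rewrite -(Int_swap (L1_cos_prod al f1 g1)) /=; last 2 first.
- move=> x; have := L1Z (f x) (L1_cos al x g1).
  by under eq_fun do rewrite mulrCA dotC.
- move=> y; have := L1Zr (g y) (L1_cos al y f1).
  by under eq_fun do rewrite -mulrA.
apply: eq_Int => x; rewrite /Tr -IntZ; last exact: L1_cos.
by apply: eq_Int => y; rewrite dotC; ring.
Qed.

(** A phase shift by pi / 2 plays the role of multiplication by i, so that derivatives and
    multiplications by coordinates are exchanged inside the real family [Tr]. *)
Lemma Tr_derive_fun al f w xi : reg rapid 1 f ->
  Tr al ('D_w f) xi = - (dot w xi * Tr (al + pi / 2) f xi).
Proof.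
move=> rf; have f1 := rapid_L1 (reg_base rf).
have cd x : is_derive x w (fun x => cos (dot x xi + al))
    (cos (dot x xi + (al + pi / 2)) * dot w xi).
  apply: (is_derive_compR (h := fun t => cos (t + al)) (f := fun x => dot x xi)).
    exact: is_derive_cos_shift.
  by apply: is_derive_linR; exact: dot_linear.
have mc be c : moderate (fun x => cos (dot x xi + be) * c).
  split; first by apply: C0M; [exact: continuous_cos_dot|exact: C0_cst].
  by exists 0%N, `|c| => x; rewrite expr0 mulr1 normrM ler_piMl// norm_cos_le1.
have rc : reg moderate 1 (fun x => cos (dot x xi + al)).
  have E w' x : is_derive x w' (fun x => cos (dot x xi + al))
    (cos (dot x xi + (al + pi / 2)) * dot w' xi).
    apply: (is_derive_compR (h := fun t => cos (t + al)) (f := fun x => dot x xi)).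
      exact: is_derive_cos_shift.
    by apply: is_derive_linR; exact: dot_linear.
  apply: (reg_intro (df := fun w x => cos (dot x xi + (al + pi / 2)) * dot w xi)).
  - by have := mc al 1; under eq_fun do rewrite mulr1.
  - by move=> w'; split=> //; exact: mc.
rewrite /Tr (Int_by_parts _ rc rf) -IntZ; last exact: L1_cos.
congr (- _); apply: eq_Int => x.
by have [_ ->] := cd x; ring.
Qed.

Lemma Tr_mul_dot al f w xi : reg rapid 1 f ->
  dot w xi * Tr al f xi = Tr (al + pi / 2) ('D_w f) xi.
Proof.
move=> rf; rewrite (Tr_derive_fun _ _ _ rf) -mulrN; congr (_ * _).
rewrite /Tr -IntN; last exact: L1_cos (rapid_L1 (reg_base rf)).
apply: eq_Int => x; rewrite -mulNr; congr (_ * _).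
by rewrite !addrA cosD_pihalf sinD cos_pihalf sin_pihalf mulr0 mulr1 add0r opprK.
Qed.

Lemma rapid_mul_dot w f : rapid f -> rapid (fun x => dot x w * f x).
Proof. by apply: moderate_rapid; exact: moderate_dot. Qed.

Lemma reg_rapid_mul_dot w f k : reg rapid k f -> reg rapid k (fun x => dot x w * f x).
Proof.
move=> rf; apply: (@reg_mul _ _ moderate rapid) => //.
- exact: moderate_rapid.
- exact: rapidD.
- apply: reg_linear; [exact: dot_linear|exact: moderate_dot|exact: moderate_cst].
Qed.

Lemma is_derive_Tr al f w xi : rapid f ->
  is_derive xi w (Tr al f) (Tr (al + pi / 2) (fun x => dot x w * f x) xi).
Proof.
move=> rf; apply/is_derive_line0.
have f1 := rapid_L1 rf; have fw1 := rapid_L1 (rapid_mul_dot w rf).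
pose F (h : R) x := cos (dot x (h *: w + xi) + al) * f x.
have dF (h : R) x : is_derive h 1 (F ^~ x)
    (cos (dot x (h *: w + xi) + (al + pi / 2)) * (dot x w * f x)).
  have d1 : is_derive h 1 (fun h => dot x (h *: w + xi)) (dot x w).
    have -> : (fun h => dot x (h *: w + xi)) = (fun h => h * dot x w + dot x xi).
      by apply/funext => t; rewrite dotDr dotZr.
    apply: (is_derive_eq (is_deriveDR (is_deriveMR (is_derive_id h 1)
      (is_derive_cst (dot x w) h 1)) (is_derive_cst (dot x xi) h 1))).
    by rewrite mulr0 add0r mul1r addr0.
  have d2 := is_derive_compR (h := fun t => cos (t + al)) (f := fun h : R => dot x (h *: w + xi))
    (is_derive_cos_shift al (dot x (h *: w + xi))) d1.
  apply: (is_derive_eq (is_deriveMR d2 (is_derive_cst (f x) h 1))).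
  by rewrite mulr0 add0r mulrA.
have p1E h x : partial1of2 F h x = cos (dot x (h *: w + xi) + (al + pi / 2)) * (dot x w * f x).
  by rewrite partial1of2E; have [_ ->] := dF h x.
have I0 : (`]-1, 1[%classic : set R) 0 by rewrite /= in_itv /=; lra.
have intF h : (`]-1, 1[%classic : set R) h -> mu.-integrable setT (EFin \o F h).
  by move=> _; exact: L1_cos.
have derF h x : (`]-1, 1[%classic : set R) h -> setT x -> derivable (F ^~ x) h 1.
  by move=> _ _; case: (dF h x).
have Gub h x : (`]-1, 1[%classic : set R) h -> setT x -> `|partial1of2 F h x| <= `|dot x w * f x|.
  by move=> _ _; rewrite p1E normrM ler_piMl// norm_cos_le1.
have D1 := @derivable_under_integral R _ _ mu F setT measurableT 0 (-1) 1 I0 intF derF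
  (fun x => `|dot x w * f x|) (fun x => normr_ge0 _) (L1_abs fw1) Gub.
have D2 := @differentiation_under_integral R _ _ mu F setT measurableT 0 (-1) 1 I0 intF derF
  (fun x => `|dot x w * f x|) (fun x => normr_ge0 _) (L1_abs fw1) Gub.
apply: DeriveDef; first exact: D1.
rewrite -derive1E [LHS]D2; apply: eq_Int => x; rewrite p1E.
by rewrite scale0r add0r.
Qed.

Lemma continuous_Tr al f : rapid f -> continuous (Tr al f).
Proof.
move=> rf; have f1 := rapid_L1 rf.
pose g x := (\sum_i `|x 0 i|) * `|f x|.
have g1 : L1 mu g.
  have : L1 mu (fun x => \sum_i `|x 0 i * f x|).
    apply: L1_sum => i; apply: L1_abs; apply: rapid_L1.
    by apply: moderate_rapid => //; exact: moderate_coord.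
  by under eq_fun do (under eq_bigr do rewrite normrM); under eq_fun do rewrite -mulr_suml.
have C0 : 0 <= \int[mu]_x g x.
  by apply: Int_ge0 => x; rewrite mulr_ge0// sumr_ge0.
apply: (lipschitz_continuous C0) => xi eta.
rewrite /Tr -IntB; [|exact: L1_cos..].
  rewrite mulrC -IntZ//; apply: le_norm_Int_dom; first exact: L1Z.
    by apply: measurable_funB; apply: L1_measurable (L1_cos _ _ f1).
  move=> x; rewrite -mulrBl normrM /g mulrA ler_wpM2r//.
  apply: (le_trans (cos_lipschitz _ _)).
  have -> : dot x xi + al - (dot x eta + al) = dot x (xi - eta).
    have dN : dot x (- eta) = - dot x eta by rewrite -[- eta]scaleN1r dotZr mulN1r.
    by rewrite dotDr dN; ring.
  apply: (le_trans (ler_norm_sum _ _ _)); rewrite mulr_sumr; apply: ler_sum => i _.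
  by rewrite normrM mulrC ler_wpM2r// coord_le_norm.
Qed.

(** Each power of the coordinate costs one derivative and a quarter period of phase. The function g
    is common to all phases, since along the induction only the phase changes. *)
Lemma Tr_coord_pow k al f i xi : reg rapid k f ->
  exists g, rapid g /\ forall be, exists be', forall xi, xi 0 i ^+ k * Tr be f xi = Tr be' g xi.
Proof.
elim: k f => [|k IH] f rf.
  exists f; split; first exact: reg_base rf.
  by move=> be; exists be => xi'; rewrite expr0 mul1r.
have [g [rg H]] := IH _ (reg_derive (basis_vec i) rf).
exists g; split=> // be; have [be' E] := H (be + pi / 2).
exists be' => eta; rewrite exprSr -mulrA -E; congr (_ * _).
have rf1 : reg rapid 1 f by apply: reg_le rf.
rewrite -(Tr_mul_dot _ _ _ rf1); congr (_ * _).
rewrite /dot (bigD1 i)//= mxE !eqxx mul1r big1 ?addr0// => j ji.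
by rewrite mxE eqxx (negbTE ji) mul0r.
Qed.

(** For |xi| > 1 the coordinate that realizes the sup norm carries the whole power of |xi|; for |xi|
    <= 1 the L^1 norm of f is enough. *)
Lemma Tr_decay k al f : reg rapid k f ->
  exists C : R, forall xi, (1 + `|xi|) ^+ k * `|Tr al f xi| <= C.
Proof.
move=> rf; have f1 := rapid_L1 (reg_base rf).
have /choice[c Hc] : forall i : 'I_n, exists c : R, forall xi, `|xi 0 i| ^+ k * `|Tr al f xi| <= c.
  move=> i; have [g [rg /(_ al)[be E]]] := Tr_coord_pow al i 0 rf.
  exists (\int[mu]_x `|g x|) => xi.
  by rewrite -normrX -normrM E; apply: Tr_bound; exact: rapid_L1.
pose C0 := \int[mu]_x `|f x|.
exists (2 ^+ k * (C0 + \sum_i `|c i|)) => xi.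
have T0 : `|Tr al f xi| <= C0 by exact: Tr_bound.
have c0 : 0 <= \sum_i `|c i| by apply: sumr_ge0.
have C00 : 0 <= C0 by apply: le_trans T0.
have [x1|x1] := leP `|xi| 1.
  apply: ler_pM => //.
  - by rewrite lerXn2r ?nnegrE ?addr_ge0// (_ : 2 = 1 + 1) ?lerD2l//; ring.
  - by rewrite (le_trans T0)// lerDl.
apply: (@le_trans _ _ (2 ^+ k * (`|xi| ^+ k * `|Tr al f xi|))).
  rewrite mulrA -exprMn ler_wpM2r// lerXn2r ?nnegrE ?addr_ge0 ?mulr_ge0//; lra.
rewrite ler_wpM2l ?exprn_ge0//.
have [i xii] : exists i, `|xi| = `|xi 0 i|.
  have [|[j i] e] := @mx_norm_neq0 _ _ _ xi.
    by rewrite -[mx_norm xi]/(`|xi|) gt_eqF// (lt_trans ltr01).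
  by exists i; move: e; rewrite (ord1 j) /=.
rewrite xii; apply: (le_trans (Hc i xi)).
rewrite (bigD1 i)//= (le_trans (ler_norm _))// [leRHS]addrCA lerDl.
by rewrite addr_ge0// sumr_ge0.
Qed.

Definition schw f := forall k, reg rapid k f.

Lemma schw_L1 f : schw f -> L1 mu f.
Proof. by move=> /(_ 0%N)/reg_base/rapid_L1. Qed.

Lemma rapid_Tr al f : schw f -> rapid (Tr al f).
Proof.
move=> sf; split; first exact: continuous_Tr (reg_base (sf 0%N)).
by move=> K; apply: Tr_decay; exact: sf.
Qed.

Lemma schw_mul_dot w f : schw f -> schw (fun x => dot x w * f x).
Proof. by move=> sf k; apply: reg_rapid_mul_dot. Qed.

Lemma schw_Tr al f : schw f -> schw (Tr al f).
Proof.
move=> sf k; elim: k al f sf => [|k IH] al f sf; first by split=> //; exact: rapid_Tr.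
apply: (reg_intro (df := fun w => Tr (al + pi / 2) (fun x => dot x w * f x))).
- exact: rapid_Tr.
- by move=> w x; apply: is_derive_Tr; exact: reg_base (sf 0%N).
- by move=> w; apply: IH; exact: schw_mul_dot.
Qed.

Lemma schw_smooth f : schw f -> smooth f.
Proof. by move=> sf k; apply: reg_mono (sf k) => g []. Qed.

Lemma schw_of_supported r f : smooth f -> (forall x, r < `|x| -> f x = 0) -> schw f.
Proof. by move=> sm sf k; exact: reg_rapid_of_supported sf. Qed.

Lemma Tr_scale al f (k : R) xi : 0 < k -> L1 mu f ->
  Tr al (fun x => f (k *: x)) xi = k ^- n * Tr al f (k^-1 *: xi).
Proof.
move=> k0 f1; rewrite /Tr -[X in X ^- n]gtr0_norm// -Int_scale ?gt_eqF//; last exact: L1_cos.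
by apply: eq_Int => x; rewrite dotZl dotZr mulrA mulfV ?gt_eqF// mul1r.
Qed.

End transform.

(** * Inversion and Plancherel *)

Section poisson1.
Context {R : realType}.
Let mR := measurableTypeR R.
Local Notation mu := (@lebesgue_measure R).

Lemma continuous_expN_norm : continuous (fun x : R => expR (- `|x|)).
Proof.
move=> x; apply: (@continuous_comp _ _ _ (fun x : R => - `|x|) expR).
  by apply: continuousN; exact: norm_continuous.
exact: continuous_expR.
Qed.

Lemma continuous_cosZ (z : R) : continuous (fun x : R => cos (z * x)).
Proof.
move=> x; apply: (@continuous_comp _ _ _ (fun x : R => z * x) cos).
  by apply: continuousM; [exact: cst_continuous|exact: cvg_id].
exact: continuous_cos.
Qed.

Lemma continuous_sinZ (z : R) : continuous (fun x : R => sin (z * x)).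
Proof.
move=> x; apply: (@continuous_comp _ _ _ (fun x : R => z * x) sin).
  by apply: continuousM; [exact: cst_continuous|exact: cvg_id].
exact: continuous_sin.
Qed.

Lemma continuous_expN_norm1 (g : R -> R) : continuous g ->
  continuous (fun x : R => expR (- `|x|) * (1 + g x)).
Proof.
move=> cg; apply: C0M; first exact: continuous_expN_norm.
by apply: C0D; [exact: C0_cst|exact: cg].
Qed.

Lemma measurable_expN_norm1 (g : R -> R) : continuous g ->
  measurable_fun [set: mR] (fun x : R => expR (- `|x|) * (1 + g x)).
Proof.
by move=> cg; apply: continuous_measurable_fun; exact: continuous_expN_norm1.
Qed.

Let primitive (z x : R) : R :=
  expR (- x) * ((z * sin (z * x) - cos (z * x)) / (1 + z ^+ 2) - 1).

Let is_derive_primitive (z x : R) :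
  is_derive x 1 (primitive z) (expR (- x) * (1 + cos (z * x))).
Proof.
have z1 : 1 + z ^+ 2 != 0 by rewrite gt_eqF// ltr_pwDl// sqr_ge0.
have dx : is_derive x 1 (fun x : R => z * x) z.
  by apply: (is_derive_eq (is_deriveZR z (is_derive_id x 1))); rewrite mulr1.
have ds := is_derive_compR (f := fun x => z * x) (is_derive_sin (z * x)) dx.
have dc := is_derive_compR (f := fun x => z * x) (is_derive_cos (z * x)) dx.
have dN : is_derive x 1 (fun x : R => - x) (-1).
  by apply: (is_derive_eq (is_deriveN (is_derive_id x 1))).
have de := is_derive_compR (f := fun x => - x) (is_derive_expR (- x)) dN.
have d1 := is_deriveDR (is_deriveZR (1 + z ^+ 2)^-1 (is_deriveDR (is_deriveZR z ds)
  (is_deriveZR (-1) dc))) (is_derive_cst (-1 : R) x 1).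
have d2 := is_deriveMR de d1.
have E : primitive z = (fun y => expR (- y) *
   ((1 + z ^+ 2)^-1 * (z * sin (z * y) + -1 * cos (z * y)) + cst (-1) y)).
  by apply/funext => y; rewrite /primitive /cst; congr (_ * _); ring.
rewrite E; apply: (is_derive_eq d2).
by rewrite /cst; field.
Qed.

(** The added 1 makes the integrand nonnegative, so the fundamental theorem on a half-line for
    nonnegative functions applies to [primitive]. It is subtracted again once integrability is
    known. *)
Lemma integral_expN_norm_cos (z : R) :
  (\int[mu]_x (expR (- `|x|) * (1 + cos (z * x)))%:E =
   (2 * (1 + (1 + z ^+ 2)^-1))%:E)%E.
Proof.
have f0 (x : R) : 0 <= expR (- `|x|) * (1 + cos (z * x)).
  by rewrite mulr_ge0 ?expR_ge0// -lerBlDl sub0r cos_geN1.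
have cf : continuous (fun x : R => expR (- `|x|) * (1 + cos (z * x))).
  apply: C0M; first exact: continuous_expN_norm.
  by apply: C0D; [exact: C0_cst|exact: continuous_cosZ].
rewrite (ge0_symfun_integralT f0 cf); last first.
  by move=> x /=; rewrite normrN mulrN cosN.
rewrite EFinM; congr (_ * _)%E.
have -> : [set x : R | 0 <= x] = `[0, +oo[%classic by rewrite set_itvcy.
have z1 : 1 + z ^+ 2 != 0 by rewrite gt_eqF// ltr_pwDl// sqr_ge0.
rewrite (@ge0_continuous_FTC2y R _ (primitive z) 0 0).
- rewrite -EFinB /primitive; congr EFin.
  by rewrite oppr0 expR0 mulr0 sin0 cos0; field.
- by move=> x _; exact: f0.
- exact: continuous_subspaceT.
- have M0 x : `|(z * sin (z * x) - cos (z * x)) / (1 + z ^+ 2) - 1| <= `|z| + 2.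
    have H : `|(z * sin (z * x) - cos (z * x)) / (1 + z ^+ 2)| <= `|z| + 1.
      rewrite normf_div ler_pdivrMr ?normr_gt0//.
      apply: (@le_trans _ _ (`|z| + 1)).
        apply: (le_trans (ler_normB _ _)); rewrite lerD ?norm_cos_le1//.
        by rewrite normrM ler_piMr// sin_max.
      rewrite ler_peMr ?addr_ge0// ger0_norm ?lerDl ?sqr_ge0//.
      by rewrite addr_ge0// sqr_ge0.
    apply: (le_trans (ler_normB _ _)); rewrite normr1 (_ : `|z| + 2 = `|z| + 1 + 1) ?lerD2r//.
    by ring.
  apply/norm_cvg0P.
  apply: (@squeeze_cvgr _ _ _ _ (cst 0) (fun x : R => (`|z| + 2) * expR (- x))).
  + near=> x; rewrite normr_ge0 /= /primitive normrM mulrC (ger0_norm (expR_ge0 _)).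
    by rewrite ler_wpM2r ?expR_ge0.
  + exact: cvg_cst.
  + rewrite -[X in _ --> X](mulr0 (`|z| + 2)); apply: cvgM; first exact: cvg_cst.
    exact: cvgr_expR.
- by move=> x _; case: (is_derive_primitive z x).
- apply: cvg_at_right_filter.
  by apply/differentiable_continuous/derivable1_diffP; case: (is_derive_primitive z 0).
- move=> x; rewrite in_itv /= andbT => x0; rewrite derive1E.
  by have [_ ->] := is_derive_primitive z x; rewrite gtr0_norm.
Unshelve. all: by end_near. Qed.

Lemma L1_expN_norm : L1 mu (fun x : R => expR (- `|x|)).
Proof.
have M : measurable_fun [set: mR] (fun x : R => expR (- `|x|) * (1 + cos (0 * x))) :=
  measurable_expN_norm1 (@continuous_cosZ 0).
apply: L1_le_lty.
- exact: continuous_measurable_fun continuous_expN_norm.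
- move=> x; rewrite ger0_norm ?expR_ge0//.
  have -> : expR (- `|x|) = 2^-1 * (expR (- `|x|) * (1 + cos (0 * x))).
    by rewrite mul0r cos0; field.
  exact: lexx.
- under eq_integral do rewrite EFinM.
  rewrite ge0_integralZl//.
  + by rewrite integral_expN_norm_cos -EFinM ltry.
  + apply/measurable_EFinP; exact: M.
- by apply: measurable_funM.
Qed.

Lemma L1_expN_norm_mul (g : R -> R) : continuous g -> (forall x, `|g x| <= 1) ->
  L1 mu (fun x : R => expR (- `|x|) * g x).
Proof.
move=> cg g1; under eq_fun do rewrite mulrC.
by apply: (L1_bounded (C := 1)) => //; [exact: L1_expN_norm|exact: continuous_measurable_fun].
Qed.

Lemma Int_expN_norm_cos z :
  \int[mu]_x (expR (- `|x|) * cos (z * x)) = 2 / (1 + z ^+ 2).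
Proof.
have I2 : \int[mu]_x expR (- `|x|) = 2.
  have := integral_expN_norm_cos 0.
  have -> : (fun x : R => (expR (- `|x|) * (1 + cos (0 * x)))%:E) =
      (fun x => (2 * expR (- `|x|))%:E).
    by apply/funext => x; rewrite mul0r cos0; congr EFin; ring.
  rewrite L1_EFin; last exact: L1Z L1_expN_norm.
  by rewrite IntZ; [move=> [] H; apply: (mulfI (x := 2)) => //; rewrite H; field|exact: L1_expN_norm].
have c1 : L1 mu (fun x : R => expR (- `|x|) * cos (z * x)).
  by apply: L1_expN_norm_mul => [|x]; [exact: continuous_cosZ|exact: norm_cos_le1].
have := integral_expN_norm_cos z.
under eq_integral do rewrite mulrDr mulr1.
rewrite L1_EFin; last exact: (L1D L1_expN_norm c1).
rewrite IntD ?I2//; last exact: L1_expN_norm.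
by move=> [] H; lra.
Qed.

Lemma Int_expN_norm_sin z : \int[mu]_x (expR (- `|x|) * sin (z * x)) = 0.
Proof.
have s1 : L1 mu (fun x : R => expR (- `|x|) * sin (z * x)).
  by apply: L1_expN_norm_mul => [|x]; [exact: continuous_sinZ|exact: sin_max].
have mf : measurable_fun [set: mR] (fun x : mR => (expR (- `|x|) * (1 + sin (z * x)))%:E).
  have M : measurable_fun [set: mR] (fun x : R => expR (- `|x|) * (1 + sin (z * x))) :=
    measurable_expN_norm1 (@continuous_sinZ z).
  by apply/measurable_EFinP; exact: M.
have f0 (x : mR) : (0 <= (expR (- `|x|) * (1 + sin (z * x)))%:E)%E.
  by rewrite lee_fin mulr_ge0 ?expR_ge0// -lerBlDl sub0r sin_geN1.
have N10 : -1 != 0 :> R by rewrite oppr_eq0 oner_neq0.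
have := ge0_integral_affine1 0 N10 mf f0.
rewrite normrN1 mul1e.
have -> : (fun x : mR => (expR (- `|x|) * (1 + sin (z * x)))%:E) =
   (fun x => (expR (- `|x|) + expR (- `|x|) * sin (z * x))%:E).
  by apply/funext => x; rewrite mulrDr mulr1.
have -> : (fun x : mR => (expR (- `|-1 * x + 0|) * (1 + sin (z * (-1 * x + 0))))%:E) =
   (fun x => (expR (- `|x|) - expR (- `|x|) * sin (z * x))%:E).
  by apply/funext => x; rewrite addr0 mulN1r normrN mulrN sinN mulrDr mulr1 mulrN.
rewrite (L1_EFin (L1D L1_expN_norm s1)) (L1_EFin (L1B L1_expN_norm s1)).
rewrite (IntD L1_expN_norm s1) (IntB L1_expN_norm s1) => -[] H.
by lra.
Qed.

Lemma Int_expN_norm_cosD z al :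
  \int[mu]_x (cos (z * x + al) * expR (- `|x|)) = cos al * (2 / (1 + z ^+ 2)).
Proof.
have c1 : L1 mu (fun x : R => expR (- `|x|) * cos (z * x)).
  by apply: L1_expN_norm_mul => [|x]; [exact: continuous_cosZ|exact: norm_cos_le1].
have s1 : L1 mu (fun x : R => expR (- `|x|) * sin (z * x)).
  by apply: L1_expN_norm_mul => [|x]; [exact: continuous_sinZ|exact: sin_max].
transitivity (\int[mu]_x (cos al * (expR (- `|x|) * cos (z * x)) -
    sin al * (expR (- `|x|) * sin (z * x)))).
  by apply: eq_Int => x; rewrite cosD; ring.
rewrite IntB; [|exact: L1Z..].
by rewrite !IntZ// Int_expN_norm_cos Int_expN_norm_sin mulr0 subr0.
Qed.

End poisson1.

Section poisson.
Context {R : realType}.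
Let mR := measurableTypeR R.

(** The exponential of minus the l^1 norm. Being a product, it has a transform that reduces to one
    variable, where an elementary primitive computes it. It takes the place of the customary
    Gaussian in the inversion formula. *)
Definition pois n (x : 'rV[R]_n) : R := \prod_i expR (- `|x 0 i|).

Lemma measurable_pois n : measurable_fun setT (@pois n).
Proof.
apply: measurable_prod => i _; apply: (measurableT_comp (f := fun x : R => expR (- `|x|))).
  exact: continuous_measurable_fun continuous_expN_norm.
exact: measurable_coord.
Qed.

Lemma pois_ge0 n (x : 'rV[R]_n) : 0 <= pois x.
Proof. by apply: prodr_ge0 => i _; exact: expR_ge0. Qed.

Lemma pois_le1 n (x : 'rV[R]_n) : pois x <= 1.
Proof. by apply: prodr_ile1 => i _; rewrite expR_ge0 /= -expR0 ler_expR oppr_le0. Qed.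

Lemma L1_pois n : L1 (lebesgue_rV n) (@pois n).
Proof.
apply: L1P; first exact: measurable_pois.
under eq_integral => x _ do rewrite ger0_norm ?pois_ge0//.
have := ge0_integral_prodc n (f := fun x : R => expR (- `|x|)) => /(_ _ (fun x => expR_ge0 _)) ->.
  rewrite L1_EFin; last exact: L1_expN_norm.
  by rewrite -EFin_expe ltry.
exact: continuous_measurable_fun continuous_expN_norm.
Qed.

Lemma pois_vcons n (a : mR) (y : 'rV[R]_n) : pois (vcons (a, y)) = expR (- `|a|) * pois y.
Proof.
rewrite /pois big_ord_recl mxE unlift_none /=; congr (_ * _).
by apply: eq_bigr => i _; rewrite mxE liftK.
Qed.

Lemma dot_vcons n (a : mR) (y : 'rV[R]_n) (z : 'rV[R]_n.+1) :
  dot (vcons (a, y)) z = a * z 0 ord0 + dot y (\row_j z 0 (lift ord0 j)).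
Proof.
rewrite /dot big_ord_recl mxE unlift_none /=; congr (_ + _).
by apply: eq_bigr => i _; rewrite !mxE liftK.
Qed.

Lemma Tr_pois n (z : 'rV[R]_n) al : Tr al (@pois n) z = cos al * 2 ^+ n * weight z.
Proof.
elim: n z al => [|n IH] z al.
  rewrite /Tr /weight big_ord0 expr0 !mulr1 /Rintegral.
  rewrite integral_dirac//; last first.
    exact/measurable_EFinP/L1_measurable/L1_cos/L1_pois.
  by rewrite diracT mul1e /= /pois /dot !big_ord0 mulr1 add0r.
rewrite {1}/Tr Int_rVS; last 2 first.
- exact: L1_cos (@L1_pois _).
- move=> a; have := L1Z (expR (- `|a|)) (L1_cos (a * z 0 ord0 + al) (\row_j z 0 (lift ord0 j)) (@L1_pois n)).
  by apply: eq_L1 => y; rewrite pois_vcons dot_vcons mulrCA addrCA addrA.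
transitivity (\int[@lebesgue_measure R]_a ((2 ^+ n * weight (\row_j z 0 (lift ord0 j))) *
   (cos (z 0 ord0 * a + al) * expR (- `|a|)))).
  apply: eq_Int => a.
  transitivity (\int[lebesgue_rV n]_y (expR (- `|a|) *
     (cos (dot y (\row_j z 0 (lift ord0 j)) + (a * z 0 ord0 + al)) * pois y))).
    by apply: eq_Int => y; rewrite pois_vcons dot_vcons mulrCA addrCA addrA.
  rewrite IntZ; last exact: L1_cos (@L1_pois _).
  by rewrite -/(Tr _ _ _) IH [_ * a]mulrC; ring.
rewrite IntZ; last first.
  apply: (eq_L1 (f := fun a : mR => expR (- `|a|) * cos (z 0 ord0 * a + al))).
    by move=> a; rewrite mulrC.
  apply: (L1_expN_norm_mul (g := fun a => cos (z 0 ord0 * a + al))) => a; last exact: norm_cos_le1.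
  apply: (@continuous_comp _ _ _ (fun a : R => z 0 ord0 * a + al) cos); last exact: continuous_cos.
  apply: continuousD; last exact: cst_continuous.
  by apply: continuousM; [exact: cst_continuous|exact: cvg_id].
rewrite Int_expN_norm_cosD /weight big_ord_recl [2 ^+ n.+1]exprS /oneDsqr.
under eq_bigr do rewrite mxE.
by ring.
Qed.

End poisson.

Section inversion.
Context {R : realType} {n : nat}.
Local Notation V := 'rV[R]_n.
Local Notation mu := (lebesgue_rV n).
Implicit Types (f g : V -> R) (x y : V) (al be : R).

Let h (k : nat) : R := k.+1%:R^-1.

Let h_gt0 k : 0 < h k.
Proof. by rewrite invr_gt0 ltr0n. Qed.

Let h_neq0 k : h k != 0.
Proof. by rewrite gt_eqF. Qed.

Let cvg_h x y : (fun k => h k *: x + y) @ \oo --> y.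
Proof.
have -> : y = 0 *: x + y by rewrite scale0r add0r.
apply: cvgD; last first.
  by rewrite scale0r add0r; exact: cvg_cst.
by apply: cvgZr_tmp; exact: cvg_harmonic.
Qed.

(** The substitution y = h z + x freezes the kernel and moves the dependence on h into f; pi^n is
    the integral of [weight]. *)
Lemma approximate_identity f x : rapid f ->
  (fun k => h k ^- n * \int[mu]_y (f y * weight ((h k)^-1 *: (y - x)))) @ \oo -->
  pi ^+ n * f x.
Proof.
move=> rf; have cf : continuous f by case: rf.
have [C C0 hC] := rapid_le_weight rf.
have fC y : `|f y| <= C by rewrite (le_trans (hC y))// ler_piMr// weight_le1.
have E k : h k ^- n * \int[mu]_y (f y * weight ((h k)^-1 *: (y - x))) =
    \int[mu]_z (f (h k *: z + x) * weight z).
  have L : L1 mu (fun y => f y * weight ((h k)^-1 *: (y - x))).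
    have : L1 mu (fun y => weight ((h k)^-1 *: (y - x)) * f y).
      apply: (L1_bounded (C := 1)); first exact: rapid_L1.
        have := measurable_affine_rV (h k)^-1 (- ((h k)^-1 *: x)).
        under eq_fun do rewrite -scalerBr.
        exact: measurableT_comp (@measurable_weight R n).
      by move=> y; rewrite ger0_norm ?weight_ge0// weight_le1.
    by apply: eq_L1 => y; rewrite mulrC.
  have := Int_affine x (h_neq0 k) L; rewrite gtr0_norm// => <-.
  by apply: eq_Int => z; rewrite addrK scalerA mulVf// scale1r.
under eq_fun do rewrite E.
have <- : \int[mu]_z (f x * weight z) = pi ^+ n * f x.
  rewrite IntZ; last exact: L1_weight.
  by rewrite mulrC /Rintegral integral_weight.
have m k : measurable_fun setT (fun z : V => f (h k *: z + x) * weight z).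
  apply: measurable_funM; last exact: measurable_weight.
  apply: (measurableT_comp (continuous_measurable_rV cf)); exact: measurable_affine_rV.
have b k z : `|f (h k *: z + x) * weight z| <= C * weight z.
  by rewrite normrM [X in _ * X]ger0_norm ?weight_ge0// ler_wpM2r ?weight_ge0.
have c z : (fun k => f (h k *: z + x) * weight z) @ \oo --> f x * weight z.
  apply: cvgM; last exact: cvg_cst.
  by apply: (cvg_comp _ _ (@cvg_h z x)); exact: cf.
exact: (Int_cvg m (L1Z C (@L1_weight R n)) b c).2.
Qed.

Lemma cosM (a b : R) : cos a * cos b = 2^-1 * (cos (a + b) + cos (a - b)).
Proof. by rewrite cosD cosB; field. Qed.

Lemma dotBr x y z : dot x (y - z) = dot x y - dot x z.
Proof. by rewrite dotDr -(scaleN1r z) dotZr mulN1r. Qed.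

Lemma continuous_pois : continuous (@pois R n).
Proof.
rewrite /pois; elim: (index_enum _) => [|i s IH].
  by under eq_fun do rewrite big_nil; exact: C0_cst.
under eq_fun do rewrite big_cons.
apply: C0M IH => x.
apply: (@continuous_comp _ _ _ (fun x : V => x 0 i) (fun x : R => expR (- `|x|))).
  exact: coord_continuous.
exact: continuous_expN_norm.
Qed.

(** The outer integral is damped by a dilated [pois] and exchanged with the inner one. The product
    of two cosines splits into phase al + be at y + x and phase al - be at y - x, so the damped
    integral is a combination of approximate identities centred at - x and x. Removing the damping
    leaves the two terms. *)
Theorem Tr_inversion al be f x : schw f ->
  Tr be (Tr al f) x =
  (2 * pi) ^+ n / 2 * (cos (al + be) * f (- x) + cos (al - be) * f x).
Proof.
move=> sf; have f1 := schw_L1 sf; have rf := reg_base (sf 0%N).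
have T1 : L1 mu (Tr al f) by apply: schw_L1; exact: schw_Tr.
pose p k (xi : V) := pois (h k *: xi).
have mp k : measurable_fun setT (p k).
  apply: (measurableT_comp (@measurable_pois R n)); apply: measurable_fun_rV => i.
  by under eq_fun do rewrite mxE; apply: measurable_funM => //; exact: measurable_coord.
have p1 k : L1 mu (p k) by apply: L1_scale => //; exact: L1_pois.
have TrP k ga z : Tr ga (p k) z = h k ^- n * (cos ga * 2 ^+ n * weight ((h k)^-1 *: z)).
  by rewrite Tr_scale ?Tr_pois//; exact: L1_pois.
pose A k := \int[mu]_xi (p k xi * (cos (dot xi x + be) * Tr al f xi)).
have c1 : A @ \oo --> Tr be (Tr al f) x.
  have m k : measurable_fun setT (fun xi => p k xi * (cos (dot xi x + be) * Tr al f xi)).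
    by apply: measurable_funM => //; exact: L1_measurable (L1_cos _ _ T1).
  have b k xi : `|p k xi * (cos (dot xi x + be) * Tr al f xi)| <= `|Tr al f xi|.
    rewrite normrM normrM mulrA ler_piMl//.
    by rewrite mulr_ile1// ?norm_cos_le1// ger0_norm ?pois_ge0 ?pois_le1.
  have c xi : (fun k => p k xi * (cos (dot xi x + be) * Tr al f xi)) @ \oo -->
      cos (dot xi x + be) * Tr al f xi.
    rewrite -[X in _ --> X]mul1r; apply: cvgM; last exact: cvg_cst.
    have <- : pois (0 : V) = 1.
      by rewrite /pois big1// => i _; rewrite mxE normr0 oppr0 expR0.
    have := @cvg_h xi 0; under eq_fun do rewrite addr0.
    by move=> H; apply: (cvg_comp _ _ H); exact: continuous_pois.
  exact: (Int_cvg m (L1_abs T1) b c).2.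
pose B z k := h k ^- n * \int[mu]_y (f y * weight ((h k)^-1 *: (y - z))).
have LB k z : L1 mu (fun y => f y * weight ((h k)^-1 *: (y - z))).
  have : L1 mu (fun y => weight ((h k)^-1 *: (y - z)) * f y).
    apply: (L1_bounded (C := 1)) => //.
      have := measurable_affine_rV (h k)^-1 (- ((h k)^-1 *: z)).
      under eq_fun do rewrite -scalerBr.
      exact: measurableT_comp (@measurable_weight R n).
    by move=> y; rewrite ger0_norm ?weight_ge0// weight_le1.
  by apply: eq_L1 => y; rewrite mulrC.
have AE k : A k = 2 ^+ n / 2 * (cos (al + be) * B (- x) k + cos (al - be) * B x k).
  have g1 : L1 mu (fun xi => cos (dot xi x + be) * p k xi) by exact: L1_cos.
  transitivity (\int[mu]_xi (Tr al f xi * (cos (dot xi x + be) * p k xi))).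
    by apply: eq_Int => xi; ring.
  rewrite Tr_swap//.
  have E y : Tr al (fun xi => cos (dot xi x + be) * p k xi) y =
      2^-1 * (Tr (al + be) (p k) (y + x) + Tr (al - be) (p k) (y - x)).
    rewrite /Tr -IntD; [|exact: L1_cos..].
    rewrite -IntZ; last by apply: L1D; exact: L1_cos.
    apply: eq_Int => xi; rewrite mulrA cosM dotDr dotBr.
    have -> : dot xi y + al + (dot xi x + be) = dot xi y + dot xi x + (al + be) by ring.
    have -> : dot xi y + al - (dot xi x + be) = dot xi y - dot xi x + (al - be) by ring.
    by ring.
  transitivity (\int[mu]_y (h k ^- n * 2 ^+ n / 2 * (cos (al + be) * (f y * weight ((h k)^-1 *: (y - - x))) +
      cos (al - be) * (f y * weight ((h k)^-1 *: (y - x)))))).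
    by apply: eq_Int => y; rewrite E !TrP opprK; ring.
  rewrite IntZ; last by apply: L1D; exact: L1Z.
  rewrite IntD; [|exact: (L1Z _ (LB k (- x)))|exact: (L1Z _ (LB k x))].
  rewrite (IntZ _ (LB k (- x))) (IntZ _ (LB k x)) /B.
  set I1 := Rintegral _ _ _; set I2 := Rintegral _ _ _; set c1' := cos _; set c2' := cos _.
  by ring.
have c2 : A @ \oo --> (2 * pi) ^+ n / 2 * (cos (al + be) * f (- x) + cos (al - be) * f x).
  have -> : (2 * pi) ^+ n / 2 * (cos (al + be) * f (- x) + cos (al - be) * f x) =
    2 ^+ n / 2 * (cos (al + be) * (pi ^+ n * f (- x)) + cos (al - be) * (pi ^+ n * f x)).
    by rewrite exprMn; ring.
  rewrite (_ : A = fun k => 2 ^+ n / 2 * (cos (al + be) * B (- x) k + cos (al - be) * B x k)); last first.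
    exact/funext.
  apply: cvgM; first exact: cvg_cst.
  apply: cvgD; (apply: cvgM; [exact: cvg_cst|exact: approximate_identity]).
by rewrite -(cvg_lim (@Rhausdorff R) c1) (cvg_lim (@Rhausdorff R) c2).
Qed.

(** With both phases equal to pi / 2 the two coefficients are -1 and 1, and their terms add up on an
    odd function. *)
Lemma Tr_inversion_odd f x : schw f -> (forall x, f (- x) = - f x) ->
  Tr (pi / 2) (Tr (pi / 2) f) x = (2 * pi) ^+ n * f x.
Proof.
move=> sf fo; rewrite Tr_inversion// fo subrr cos0 -splitr cospi.
by field.
Qed.

Lemma Plancherel_odd f : schw f -> (forall x, f (- x) = - f x) ->
  \int[mu]_x (Tr (pi / 2) f x ^+ 2) = (2 * pi) ^+ n * \int[mu]_x (f x ^+ 2).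
Proof.
move=> sf fo; have f1 := schw_L1 sf.
have T1 : L1 mu (Tr (pi / 2) f) by apply: schw_L1; exact: schw_Tr.
transitivity (\int[mu]_x (Tr (pi / 2) f x * Tr (pi / 2) f x)); first exact: eq_Int.
rewrite Tr_swap// -IntZ; last first.
  have rf := reg_base (sf 0%N).
  have := rapid_L1 (moderate_rapid (rapid_moderate rf) rf).
  by apply: eq_L1 => x; rewrite expr2.
by apply: eq_Int => x; rewrite Tr_inversion_odd// expr2; ring.
Qed.

End inversion.

Section affine_comp.
Context {R : realType} {E E' : normedModType R}.

Lemma smooth_affine_comp (l lin : E' -> E) (f : E -> R) :
  (forall (h : R) w x, l (h *: w + x) = h *: lin w + l x) -> continuous l ->
  smooth f -> smooth (fun x => f (l x)).
Proof.
move=> la cl sf k; elim: k f sf => [|k IH] f sf.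
  split=> // x; apply: (@continuous_comp _ _ _ l f); [exact: cl|exact: smooth_continuous].
have sd w x : is_derive x w (fun x => f (l x)) ('D_(lin w) f (l x)).
  apply/is_derive_line0; under eq_fun do rewrite la.
  by apply/is_derive_line0; exact: smooth_is_derive.
apply: (reg_intro (df := fun w x => 'D_(lin w) f (l x))) => //.
- move=> x; apply: (@continuous_comp _ _ _ l f); [exact: cl|exact: smooth_continuous].
- by move=> w; exact: (IH _ (smooth_derive (lin w) sf)).
Qed.

End affine_comp.

(** * Radial profiles *)

Section smooth1.
Context {R : realType}.
Implicit Types (f g : R -> R).

Lemma smooth_id : smooth (fun x : R => x).
Proof. by apply: smooth_linear => // x; exact: cvg_id. Qed.

Lemma smooth_tower f : smooth f -> tower (fun k => derive1n k f).
Proof.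
move=> sf k x; have sk : smooth (derive1n k f).
  elim: k => // k IH; rewrite derive1nS.
  have -> : derive1 (derive1n k f) = 'D_1 (derive1n k f) by apply/funext => y; rewrite derive1E.
  exact: smooth_derive.
by rewrite derive1nS derive1E; exact: smooth_is_derive.
Qed.

Lemma smooth_comp1 {E : normedModType R} f (g : E -> R) : smooth f -> smooth g ->
  smooth (fun x => f (g x)).
Proof. by move=> sf sg; exact: (smooth_comp 0 (smooth_tower sf) sg). Qed.

Lemma smooth_cos : smooth (@cos R).
Proof.
have T : tower (fun k (x : R) => cos (x + k%:R * (pi / 2))).
  move=> k x; have := is_derive_cos_shift (k%:R * (pi / 2)) x.
  have -> : k.+1%:R * (pi / 2) = k%:R * (pi / 2) + pi / 2 :> R by rewrite -natr1; ring.
  by [].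
apply: (_ : smooth (fun x : R => cos x)).
have -> : (fun x : R => cos x) = (fun x => (fun k (x : R) => cos (x + k%:R * (pi / 2))) 0%N x).
  by apply/funext => x /=; rewrite mul0r addr0.
exact: (smooth_comp 0 T smooth_id).
Qed.

Lemma smooth_sin : smooth (@sin R).
Proof.
have -> : @sin R = (fun x => cos (x + - (pi / 2))).
  by apply/funext => x; rewrite cosD cosN sinN cos_pihalf sin_pihalf; ring.
apply: (smooth_comp1 smooth_cos); apply: smoothD; [exact: smooth_id|exact: smooth_cst].
Qed.

(** From exp(s) = exp(s / k)^k >= (s / k)^k. *)
Lemma powM_expN_bounded (k : nat) (s : R) : 0 <= s -> s ^+ k * expR (- s) <= (k%:R) ^+ k.
Proof.
move=> s0; case: k => [|k]; first by rewrite !expr0 mul1r -expR0 ler_expR oppr_le0.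
rewrite expRN ler_pdivrMr ?expR_gt0//.
have -> : expR s = expR (s / k.+1%:R) ^+ k.+1.
  by rewrite -expRM_natl mulrC divfK.
rewrite -exprMn lerXn2r ?nnegrE ?mulr_ge0 ?expR_ge0//.
apply: (@le_trans _ _ (k.+1%:R * (s / k.+1%:R))).
  by rewrite mulrC divfK.
rewrite ler_wpM2l//; apply: le_trans (expR_ge1Dx _); by rewrite lerDr.
Qed.

Lemma poly_expN_bounded (p : {poly R}) : exists2 C : R, 0 <= C &
  forall s : R, 0 <= s -> `|p.[s]| * expR (- s) <= C.
Proof.
exists (\sum_(i < size p) `|p`_i| * (nat_of_ord i)%:R ^+ i).
  by apply: sumr_ge0 => i _; rewrite mulr_ge0// exprn_ge0.
move=> s s0; rewrite horner_coef.
apply: (@le_trans _ _ (\sum_(i < size p) (`|p`_i| * s ^+ i) * expR (- s))).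
  rewrite -mulr_suml ler_wpM2r ?expR_ge0//.
  apply: (le_trans (ler_norm_sum _ _ _)); apply: ler_sum => i _.
  by rewrite normrM [X in _ * X]ger0_norm// exprn_ge0.
apply: ler_sum => i _; rewrite -mulrA ler_wpM2l//.
exact: powM_expN_bounded.
Qed.

(** The derivative of p(1 / t) exp(- 1 / t) is q(1 / t) exp(- 1 / t) with q = X^2 (p - p'). *)
Fixpoint flat_poly (k : nat) : {poly R} :=
  if k is k'.+1 then 'X ^+ 2 * (flat_poly k' - (flat_poly k')^`()) else 1.

(* [flat k] is the [k]-th derivative of [exp (- 1 / t)], extended by [0] to [t <= 0]. *)
Definition flat (k : nat) (t : R) : R :=
  if 0 < t then (flat_poly k).[t^-1] * expR (- t^-1) else 0.

(** Only t = 0 is delicate: there the exponential beats the polynomial even after multiplication by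
    h^(- 2), so the function is O(h^2) and its difference quotient tends to 0. *)
Lemma tower_flat : tower flat.
Proof.
move=> k t; have [t0|t0|t0] := ltgtP t 0.
- have F : \near t, 0 = flat k t.
    near=> y; rewrite /flat ifF//; apply/negbTE; rewrite -leNgt ltW//.
    by near: y; exact: lt_nbhsl.
  rewrite {2}/flat ltNge ltW//=.
  exact: near_eq_is_derive F (is_derive_cst (0 : R) t 1).
- have F : \near t, (flat_poly k).[t^-1] * expR (- t^-1) = flat k t.
    near=> y; rewrite /flat ifT//.
    by near: y; exact: lt_nbhsr.
  apply: (near_eq_is_derive F); rewrite /flat t0.
  have tn0 : t != 0 by rewrite gt_eqF.
  have dV : is_derive t 1 (fun y : R => y^-1) (- t ^- 2).
    apply: (is_derive_eq (is_deriveV tn0 (is_derive_id t 1))).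
    by rewrite /GRing.scale /= mulr1.
  have dp : is_derive t^-1 1 (horner (flat_poly k)) ((flat_poly k)^`()).[t^-1].
    apply: DeriveDef; first exact: derivable_horner.
    by rewrite -derive1E -derivE.
  have d1 := is_derive_compR (h := horner (flat_poly k)) dp dV.
  have dN : is_derive t 1 (fun y : R => - y^-1) (t ^- 2).
    by have := is_deriveN dV; rewrite opprK.
  have d2 := is_derive_compR (f := fun y : R => - y^-1) (is_derive_expR (- t^-1)) dN.
  apply: (is_derive_eq (is_deriveMR d1 d2)).
  rewrite /= hornerM hornerXn hornerD hornerN exprVn.
  set A := _.[_]; set B := _.[_]; set C := expR _.
  by ring.
- rewrite t0 {2}/flat ltxx.
  have [C C0 HC] := poly_expN_bounded ('X ^+ 2 * flat_poly k).
  have L (h : R) : `|flat k h| <= C * h ^+ 2.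
    rewrite /flat; case: ifPn => h0; last by rewrite normr0 mulr_ge0 ?sqr_ge0.
    have := HC h^-1; rewrite invr_ge0 (ltW h0) => /(_ isT).
    rewrite hornerM hornerXn normrM [`|_ ^+ 2|]ger0_norm ?sqr_ge0// => H.
    rewrite normrM [X in _ * X]ger0_norm ?expR_ge0//.
    rewrite -ler_pdivrMr ?exprn_gt0//; apply: le_trans H.
    by rewrite exprVn mulrC mulrA.
  have lim : (fun h : R => h^-1 *: ((flat k \o shift (0 : R)) (h *: 1) - flat k 0)) @ 0^' --> (0 : R).
    apply/norm_cvg0P.
    apply: (@squeeze_cvgr _ _ _ _ (cst 0) (fun h : R => C * `|h|)).
    + near=> h; rewrite normr_ge0 /= addr0 [h *: 1]mulr1.
      have -> : flat k 0 = 0 by rewrite /flat ltxx.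
      have h0 : 0 < `|h| by rewrite normr_gt0; near: h; exact: nbhs_dnbhs_neq.
      rewrite subr0 normrM normfV mulrC ler_pdivrMr// -mulrA -expr2.
      by rewrite real_normK ?num_real// L.
    + exact: cvg_cst.
    + rewrite -[X in _ --> X](mulr0 C); apply: cvgM; first exact: cvg_cst.
      rewrite -[X in _ --> X](normr0 R); apply: cvg_norm; exact: cvg_within_filter.
  apply: DeriveDef; first by apply/cvg_ex; exists 0.
  by apply: cvg_lim => //; exact: lim.
Unshelve. all: by end_near. Qed.

Definition bumpf (u : R) : R := flat 0 (u - 2) * flat 0 (3 - u).

Lemma smooth_bump : smooth bumpf.
Proof.
apply: smoothM; apply: (smooth_comp 0 tower_flat).
- by apply: smoothD; [exact: smooth_id|exact: smooth_cst].
- apply: smoothD; first exact: smooth_cst.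
  have -> : (-%R : R -> R) = (fun x => -1 * x) by apply/funext => x; rewrite mulN1r.
  by apply: smoothZ; exact: smooth_id.
Qed.

(* The dilates of [2, 3] by powers of 4 are pairwise disjoint. *)
Definition ann (f : R -> R) := forall u, (u < 2) || (3 < u) -> f u = 0.

Lemma ann_bump : ann bumpf.
Proof.
move=> u /orP[]h; rewrite /bumpf /flat.
  by rewrite subr_gt0 ltNge (ltW h)/= mul0r.
by rewrite [0 < 3 - u]subr_gt0 [u < 3]ltNge (ltW h)/= mulr0.
Qed.

Lemma bump_neq0 : bumpf (5 / 2) != 0.
Proof.
rewrite /bumpf /flat.
have -> : (0 : R) < 5 / 2 - 2 by lra.
have -> : (0 : R) < 3 - 5 / 2 by lra.
have p0 : flat_poly 0 = 1 by [].
by rewrite !p0 -polyC1 !hornerC !mul1r mulf_neq0// gt_eqF// expR_gt0.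
Qed.

Lemma ann_derive f : ann f -> ann ('D_1 f).
Proof.
move=> af u uu; rewrite -(derive_cst (0 : R) u 1); apply: near_eq_derive.
move/orP : uu => [h|h].
  by near=> y; rewrite af//; apply/orP; left; near: y; exact: lt_nbhsl.
by near=> y; rewrite af//; apply/orP; right; near: y; exact: lt_nbhsr.
Unshelve. all: by end_near. Qed.

(* The Laplacian of [l(x) F(|x|^2)], [l] linear, on R^d is [l(x) (lap d F)(|x|^2)]. *)
Definition lap (d : nat) f : R -> R := fun u =>
  4 * u * 'D_1 ('D_1 f) u + (2 * d%:R + 4) * 'D_1 f u.

Lemma smooth_lap d f : smooth f -> smooth (lap d f).
Proof.
move=> sf; have s1 := smooth_derive (1 : R) sf; have s2 := smooth_derive (1 : R) s1.
apply: smoothD; last exact: smoothZ.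
by apply: smoothM => //; apply: smoothZ; exact: smooth_id.
Qed.

Lemma ann_lap d f : ann f -> ann (lap d f).
Proof.
move=> af u uu; have a1 := ann_derive af; have a2 := ann_derive a1.
by rewrite /lap a1// a2// !mulr0 addr0.
Qed.

Lemma derive_eq0_eq0 f : (forall x : R, is_derive x 1 f 0) -> f 0 = 0 -> f = fun=> 0.
Proof.
by move=> fd f0; apply/funext => x; rewrite -f0; exact: is_derive_0_is_cst.
Qed.

(** A vanishing [lap d f] is a first-order linear equation for f' with solutions proportional to
    u^(- (d + 2) / 2). So u^(d + 2) f'^2 is constant, the square avoiding a half-integer power, and
    it is 0 at u = 0. Then f is constant, and it vanishes outside [2, 3]. *)
Lemma lap_eq0 d f : smooth f -> ann f -> (forall u, lap d f u = 0) -> forall u, f u = 0.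
Proof.
move=> sf af lf; have s1 := smooth_derive (1 : R) sf.
pose w (u : R) := u ^+ (d + 2) * ('D_1 f u) ^+ 2.
have w0 : w = fun=> 0.
  apply: derive_eq0_eq0; last by rewrite /w addn2 exprS !mul0r.
  move=> u.
  have dX : is_derive u 1 (fun u : R => u ^+ (d + 2)) ((d + 2)%:R * u ^+ (d + 1)).
    apply: DeriveDef; first exact: exprn_derivable.
    by rewrite exp_derive addn1 addn2 /= /GRing.scale /= mulr1.
  have df := smooth_is_derive (1 : R) u s1.
  have dd := is_deriveMR dX (is_deriveMR df df).
  have -> : w = (fun u => u ^+ (d + 2) * ('D_1 f u * 'D_1 f u)).
    by apply/funext => y; rewrite /w expr2.
  apply: (is_derive_eq dd).
  have L := lf u; rewrite /lap in L.
  have -> : u ^+ (d + 2) = u * u ^+ (d + 1) by rewrite -exprS addn1 addn2.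
  set A := 'D_1 f u in L *; set B := 'D_1 ('D_1 f) u in L *.
  have -> : u * u ^+ (d + 1) * (A * B + B * A) + (d + 2)%:R * u ^+ (d + 1) * (A * A) =
    u ^+ (d + 1) * A / 2 * (4 * u * B + (2 * d%:R + 4) * A).
    by rewrite natrD; field.
  by rewrite L mulr0.
have f10 u : 'D_1 f u = 0.
  have [u0|u0] := leP u 0.
    by apply: ann_derive => //; rewrite (le_lt_trans u0).
  have : w u = 0 by rewrite w0.
  move=> /eqP; rewrite /w mulf_eq0 expf_eq0 (gt_eqF u0) andbF orFb.
  by rewrite sqrf_eq0 => /eqP.
have -> // : f = fun=> 0.
apply: derive_eq0_eq0; last by apply: af; rewrite ltr0n.
by move=> x; rewrite -(f10 x); exact: smooth_is_derive.
Qed.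

Definition prof (d N : nat) : R -> R := iter N (lap d) bumpf.

Lemma smooth_prof d N : smooth (prof d N).
Proof. by elim: N => [|N IH]; [exact: smooth_bump|exact: smooth_lap]. Qed.

Lemma ann_prof d N : ann (prof d N).
Proof. by elim: N => [|N IH]; [exact: ann_bump|exact: ann_lap]. Qed.

Lemma prof_neq0 d N : exists u, prof d N u != 0.
Proof.
elim: N => [|N [u0 IH]]; first by exists (5 / 2); exact: bump_neq0.
apply: contrapT => /forallNP H; move/negP: IH; apply; apply/eqP.
apply: (@lap_eq0 d); [exact: smooth_prof|exact: ann_prof|].
by move=> u; apply/eqP; apply: contrapT => /negP; exact: H.
Qed.

(** If f f' vanished identically, f^2 would be constant, hence 0. At the point found here both the
    profile and its radial derivative are nonzero, so the rotation really shears the density; the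
    lower bound starts from it. *)
Lemma prof_derive_neq0 d N : exists2 u, 0 < u & prof d N u * 'D_1 (prof d N) u != 0.
Proof.
have sp := smooth_prof d N; have ap := ann_prof d N.
have [u0 pu0] := prof_neq0 d N.
suff [u pu] : exists u, prof d N u * 'D_1 (prof d N) u != 0.
  exists u => //; rewrite ltNge; apply/negP => u_le0; move/negP: pu; apply.
  by rewrite ap ?mul0r// (le_lt_trans u_le0).
apply: contrapT => /forallNP H.
have sq0 : (fun u => prof d N u * prof d N u) = fun=> 0.
  apply: derive_eq0_eq0; last by rewrite ap ?mul0r// ltr0n.
  move=> u; have du := smooth_is_derive (1 : R) u sp.
  apply: (is_derive_eq (is_deriveMR du du)); rewrite [X in _ + X]mulrC.
  have -> : prof d N u * 'D_1 (prof d N) u = 0.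
    by apply/eqP; apply: contrapT => /negP; exact: H.
  by rewrite addr0.
have /eqP : prof d N u0 * prof d N u0 = 0 by exact: (congr1 (@^~ u0) sq0).
by rewrite mulf_eq0 orbb => /eqP pu; rewrite pu eqxx in pu0.
Qed.

End smooth1.

(** * Dyadic sums of annular pieces *)

Section annular.
Context {R : realType} {n : nat}.
Local Notation V := 'rV[R]_n.
Implicit Types (x y : V) (P Q : nat -> V -> R).

Definition usq x : R := dot x x.

Lemma usq_ge0 x : 0 <= usq x. Proof. exact: dot_ge0. Qed.

Lemma usqZ (k : R) x : usq (k *: x) = k ^+ 2 * usq x.
Proof. by rewrite /usq dotZl dotZr; ring. Qed.

Lemma usq_gt0 x : x != 0 -> 0 < usq x.
Proof. by move=> x0; rewrite /usq -enorm_sqr exprn_gt0// enorm_gt0. Qed.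

Lemma usq2X j x : usq (2 ^+ j *: x) = 4 ^+ j * usq x.
Proof. by rewrite usqZ exprAC (_ : 2 ^+ 2 = 4)//; ring. Qed.

Lemma continuous_usq : continuous usq.
Proof.
by apply: C0_sum => i; apply: C0M => x; exact: coord_continuous.
Qed.

Definition annular P := forall j x, P j x != 0 -> 2 <= 4 ^+ j * usq x <= 3.

Definition psum P J x : R := \sum_(j < J) P j x.

(** Since 4^j >= 3 j, no annulus of index j > 1 / |x|^2 contains x. At the origin the inverse is 0
    by convention and one term is kept; it vanishes for an annular family. *)
Definition aidx x := (Num.truncn (usq x)^-1).+1.

(* At each point an annular series has at most one nonzero term, of index less than [aidx x]. *)
Definition asum P x : R := psum P (aidx x) x.

Lemma annular_usq_gt0 P j x : annular P -> P j x != 0 -> 0 < usq x.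
Proof.
move=> aP /aP/andP[h _]; rewrite lt_neqAle usq_ge0 andbT; apply/eqP => u0.
by move: h; rewrite -u0 mulr0 lern0.
Qed.

Lemma annular_tail P j x : annular P -> (aidx x <= j)%N -> P j x = 0.
Proof.
move=> aP jx; apply/eqP; apply: contraT => Pj.
have u0 := annular_usq_gt0 aP Pj; have /andP[_] := aP _ _ Pj.
have ju : 1 < j%:R * usq x.
  rewrite -ltr_pdivrMr// mul1r (lt_le_trans (truncnS_gt _))// ler_nat//.
have : 3 * (j%:R * usq x) <= 4 ^+ j * usq x.
  rewrite mulrA ler_wpM2r ?usq_ge0//.
  rewrite -natrX -natrM ler_nat; elim: {jx Pj ju} j => // j IH.
  by rewrite expnS mulnS mulSn addnC leq_add// leq_pmulr// expn_gt0.
lra.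
Qed.

Lemma psumE P J x : annular P -> (aidx x <= J)%N -> psum P J x = asum P x.
Proof.
move=> aP xJ; rewrite /asum /psum -(subnKC xJ).
rewrite big_split_ord /= [X in _ + X]big1 ?addr0// => i _.
by apply: annular_tail => //; rewrite leq_addr.
Qed.

Lemma cvg_psum P x : annular P -> psum P ^~ x @ \oo --> asum P x.
Proof.
move=> aP; apply: cvg_near_cst; exists (aidx x) => // J /= xJ.
exact: psumE.
Qed.

(** Consecutive annuli are separated because 4 * 2 > 3. Two families are allowed, so that velocity
    pieces can be compared with density pieces. *)
Lemma annular_disjoint P Q i j x : annular P -> annular Q -> i != j -> P i x * Q j x = 0.
Proof.
wlog ij : P Q i j / (i < j)%N.
  move=> W aP aQ ij; have [lij|lij|eij] := ltngtP i j; first exact: W.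
    by rewrite mulrC; apply: W => //; rewrite eq_sym.
  by rewrite eij eqxx in ij.
move=> aP aQ _; apply/eqP; rewrite mulf_eq0; apply: contraT.
rewrite negb_or => /andP[Pi Qj]; have u0 := annular_usq_gt0 aP Pi.
have /andP[h1 _] := aP _ _ Pi; have /andP[_ h2] := aQ _ _ Qj.
have : 4 ^+ i.+1 * usq x <= 4 ^+ j * usq x.
  by rewrite ler_wpM2r ?usq_ge0// ler_weXn2l// ler1n.
rewrite exprS -mulrA; lra.
Qed.

Lemma psum_mul P Q J x : annular P -> annular Q ->
  psum P J x * psum Q J x = psum (fun j x => P j x * Q j x) J x.
Proof.
move=> aP aQ; rewrite /psum mulr_suml; apply: eq_bigr => i _.
rewrite mulr_sumr (bigD1 i)//= big1 ?addr0// => j ji.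
by apply: annular_disjoint => //; rewrite eq_sym.
Qed.

Lemma psum_single P Q j J x : annular P -> annular Q -> (j < J)%N ->
  psum P J x * Q j x = P j x * Q j x.
Proof.
move=> aP aQ jJ; rewrite /psum mulr_suml (bigD1 (Ordinal jJ))//= big1 ?addr0// => i ij.
by apply: annular_disjoint => //; apply: contra ij => /eqP e; apply/eqP/val_inj.
Qed.

Lemma asum_single P Q j x : annular P -> annular Q -> asum P x * Q j x = P j x * Q j x.
Proof.
move=> aP aQ; rewrite -(psumE aP (leq_maxl (aidx x) j.+1)).
by apply: psum_single => //; rewrite leq_max ltnSn orbT.
Qed.

Lemma asum_norm P x : annular P -> `|asum P x| = asum (fun j x => `|P j x|) x.
Proof.
move=> aP; rewrite /asum /psum.
have [/existsP[j Pj]|/existsPn H] := boolP [exists j : 'I_(aidx x), P j x != 0]; last first.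
- have P0 (j : 'I_(aidx x)) : P j x = 0 by apply/eqP; have := H j; rewrite negbK.
  by rewrite !big1 ?normr0// => j _; rewrite P0 ?normr0.
- rewrite (bigD1 j)//= [in RHS](bigD1 j)//= !big1 ?addr0// => i ij.
    have /eqP := annular_disjoint x aP aP (i := i) (j := j) ij.
    by rewrite mulf_eq0 (negbTE Pj) orbF => /eqP ->; rewrite normr0.
  have /eqP := annular_disjoint x aP aP (i := i) (j := j) ij.
  by rewrite mulf_eq0 (negbTE Pj) orbF => /eqP.
Qed.

Lemma le_asum P Q x : (forall j, P j x <= Q j x) -> asum P x <= asum Q x.
Proof. by move=> PQ; apply: ler_sum => j _; exact: PQ. Qed.

Lemma psum_norm_le P J x : annular P -> `|psum P J x| <= asum (fun j x => `|P j x|) x.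
Proof.
move=> aP; apply: (le_trans (ler_norm_sum _ _ _)).
have aN : annular (fun j x => `|P j x|) by move=> j y; rewrite normr_eq0 => /aP.
rewrite -(psumE aN (leq_maxl _ J)) /psum.
rewrite -(subnKC (leq_maxr (aidx x) J)) big_split_ord /= lerDl.
by apply: sumr_ge0.
Qed.

Lemma aidx_locally x : x != 0 -> exists J, \near x, (aidx x <= J)%N.
Proof.
move=> x0; have u0 := usq_gt0 x0.
exists (Num.truncn (2 / usq x)).+1; near=> y.
have uy : usq x / 2 < usq y.
  near: y; have := @continuous_usq x => /cvgr_gt; apply.
  by rewrite ltr_pdivrMr// ltr_pMr// ltr1n.
rewrite ltnS; apply: le_truncn.
rewrite -invf_div lef_pV2 ?posrE ?divr_gt0//; first exact: ltW.
by rewrite (lt_trans _ uy)// divr_gt0.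
Unshelve. all: by end_near. Qed.

Lemma measurable_asum P : annular P -> (forall j, measurable_fun setT (P j)) ->
  measurable_fun setT (asum P).
Proof.
move=> aP mP; apply/measurable_EFinP.
apply: (@emeasurable_fun_cvg _ _ _ _ (fun J => EFin \o psum P J)) => [J|x _].
  by apply/measurable_EFinP; apply: measurable_sum.
by apply: cvg_EFin; [exact: nearW|exact: cvg_psum].
Qed.

Lemma asum_le_nneseries P x : (forall j, 0 <= P j x) ->
  ((asum P x)%:E <= \sum_(0 <= j <oo) (P j x)%:E)%E.
Proof.
move=> P0; rewrite /asum /psum -sumEFin -(big_mkord xpredT (fun j => (P j x)%:E)).
by apply: nneseries_lim_ge => j _ _; rewrite lee_fin.
Qed.

End annular.

Section dilates.
Context {R : realType} {n : nat}.
Local Notation V := 'rV[R]_n.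

Definition ann_supp (F : V -> R) := forall y, F y != 0 -> 2 <= usq y <= 3.

Definition dil (c : R) (F : nat -> V -> R) (j : nat) (x : V) : R := c ^+ j * F j (2 ^+ j *: x).

Lemma annular_dil c F : (forall j, ann_supp (F j)) -> annular (dil c F).
Proof.
move=> aF j x; rewrite /dil mulf_eq0 negb_or => /andP[_ /aF].
by rewrite usq2X.
Qed.

Lemma ann_supp_norm F y : ann_supp F -> 2 < `|y| -> F y = 0.
Proof.
move=> aF y2; apply/eqP; apply: contraT => /aF/andP[_].
have := norm_le_enorm y; rewrite /usq -enorm_sqr.
have := enorm_ge0 y; set e := enorm y; nra.
Qed.

Lemma dil_outside c F j x : (forall j, ann_supp (F j)) -> 2 < `|x| -> dil c F j x = 0.
Proof.
move=> aF x2; rewrite /dil ann_supp_norm ?mulr0//.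
rewrite normrZ ger0_norm ?exprn_ge0// (lt_le_trans x2)// ler_peMl//.
by rewrite exprn_ege1// ler1n.
Qed.

Lemma asum_outside P (x : V) : (forall j, P j x = 0) -> asum P x = 0.
Proof. by move=> P0; rewrite /asum /psum big1. Qed.

End dilates.

Section dilation.
Context {R : realType} {n : nat}.
Local Notation V := 'rV[R]_n.

Lemma continuous_scale (k : R) : continuous (fun x : V => k *: x).
Proof.
by move=> x; exact: (@cvgZl_tmp _ _ _ (nbhs x) _ k id x cvg_id).
Qed.

Lemma smooth_dilate (F : V -> R) (k : R) : smooth F -> smooth (fun x => F (k *: x)).
Proof.
apply: (smooth_affine_comp (l := fun x : V => k *: x) (lin := fun x : V => k *: x)).
  by move=> h w x; rewrite scalerDr !scalerA mulrC.
exact: continuous_scale.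
Qed.

End dilation.

(** * The vortex and the transported density *)

Section vortex.
Context {R : realType} {m : nat}.
Local Notation n := m.+2.
Local Notation V := 'rV[R]_n.
Implicit Types (x y w : V).
Variables (G : R -> R).
Hypotheses (sG : smooth G) (aG : ann G).
Variables (A B : R).

Local Notation i0 := (ord0 : 'I_n).
Local Notation i1 := (lift ord0 ord0 : 'I_n).

(* Generator of the rotations of the first two coordinates. *)
Definition lrot (i : 'I_n) (y : V) : R :=
  if i == i0 then - y 0 i1 else if i == i1 then y 0 i0 else 0.

Definition psi (i : 'I_n) (y : V) : R := lrot i y * G (usq y).

Definition vth (la : R) (y : V) : R :=
  G (usq y) * (y 0 i0 * cos (la * G (usq y)) + y 0 i1 * sin (la * G (usq y))).

(** [A] will be 2^(- a) and [B] will be 2^(- b). A velocity of size A^j at length scale 2^(- j)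
    turns at the rate 2^(j (1 - a)), which is the factor [(2 * A) ^+ j] multiplying time in [tp]. *)
Definition vp (i : 'I_n) : nat -> V -> R := dil A (fun=> psi i).

Definition tp (t : R) : nat -> V -> R := dil B (fun j => vth (t * (2 * A) ^+ j)).

Definition vfield (x : V) : V := \row_i asum (vp i) x.

Definition theta (t : R) (x : V) : R := asum (tp t) x.

Lemma G_eq0 (u : R) : G u != 0 -> 2 <= u <= 3.
Proof.
by apply: contraR; rewrite negb_and -!ltNge => h; rewrite aG.
Qed.

Lemma ann_psi i : ann_supp (psi i).
Proof. by move=> y; rewrite mulf_eq0 negb_or => /andP[_ /G_eq0]. Qed.

Lemma ann_vth la : ann_supp (vth la).
Proof. by move=> y; rewrite mulf_eq0 negb_or => /andP[/G_eq0]. Qed.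

Lemma annular_vp i : annular (vp i).
Proof. by apply: annular_dil => j; exact: ann_psi. Qed.

Lemma annular_tp t : annular (tp t).
Proof. by apply: annular_dil => j; exact: ann_vth. Qed.

Lemma lrot_linear i (h : R) x y : lrot i (h *: x + y) = h * lrot i x + lrot i y.
Proof.
by rewrite /lrot !mxE; case: eqP => _; [|case: eqP => _]; ring.
Qed.

Lemma lrotN i y : lrot i (- y) = - lrot i y.
Proof.
by rewrite -(addr0 (- y)) -scaleN1r lrot_linear; have := lrot_linear i 0 0 0;
   rewrite scale0r add0r mul0r add0r; rewrite /lrot !mxE; case: eqP => _; [|case: eqP => _]; lra.
Qed.

Lemma i10 : (i1 == i0) = false. Proof. by []. Qed.

Lemma sum_lrot (F : 'I_n -> R) y :
  \sum_i lrot i y * F i = - y 0 i1 * F i0 + y 0 i0 * F i1.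
Proof.
rewrite (bigD1 i0)//= (bigD1 i1)//= big1 ?addr0; last first.
  by move=> i /andP[/negbTE i0' /negbTE i1']; rewrite /lrot i0' i1' mul0r.
by rewrite /lrot eqxx i10 eqxx.
Qed.

Lemma sum_lrot_orth y : \sum_i lrot i y * y 0 i = 0.
Proof. by rewrite sum_lrot; ring. Qed.

Lemma lrot_basis i : lrot i (basis_vec i) = 0.
Proof.
rewrite /lrot !mxE /=; case: eqP => [->|/eqP h] /=; first by rewrite oppr0.
by case: eqP => [->|].
Qed.

Lemma smooth_coord i : smooth (fun y : V => y 0 i).
Proof.
apply: smooth_linear => [h u v|y]; first by rewrite !mxE.
exact: coord_continuous.
Qed.

Lemma smooth_lrot i : smooth (lrot i).
Proof.
apply: smooth_linear; first exact: lrot_linear.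
rewrite /lrot; case: eqP => _; first by move=> y; apply: continuousN; exact: coord_continuous.
by case: eqP => _; [move=> y; exact: coord_continuous|exact: C0_cst].
Qed.

Lemma smooth_usq : smooth (@usq R n).
Proof. by apply: smooth_sum => i; apply: smoothM; exact: smooth_coord. Qed.

Lemma smooth_Gusq : smooth (fun y : V => G (usq y)).
Proof. exact: smooth_comp1 sG smooth_usq. Qed.

Lemma smooth_psi i : smooth (psi i).
Proof. by apply: smoothM; [exact: smooth_lrot|exact: smooth_Gusq]. Qed.

Lemma is_derive_usq y w : is_derive y w (@usq R n) (2 * dot y w).
Proof.
have H : is_derive y w (fun y => \sum_i y 0 i * y 0 i) (\sum_i (y 0 i * w 0 i + w 0 i * y 0 i)).
  apply: is_derive_sumR => i; apply: is_deriveMR; apply: is_derive_linR => h u v; by rewrite !mxE.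
apply: (is_derive_eq H); rewrite /dot mulr_sumr; apply: eq_bigr => i _; ring.
Qed.

Lemma is_derive_Gusq y w : is_derive y w (fun y => G (usq y)) ('D_1 G (usq y) * (2 * dot y w)).
Proof. exact: is_derive_compR (smooth_is_derive (1 : R) _ sG) (is_derive_usq y w). Qed.

Definition vthz (z : R * V) : R := vth z.1 z.2.

Lemma smooth_fst : smooth (fun z : R * V => z.1).
Proof. by apply: smooth_linear => [h u v|z] //; exact: cvg_fst. Qed.

Lemma smooth_comp_snd (F : V -> R) : smooth F -> smooth (fun z : R * V => F z.2).
Proof.
by apply: (smooth_affine_comp (l := snd) (lin := snd)) => // z; exact: cvg_snd.
Qed.

Lemma smooth_vthz : smooth vthz.
Proof.
have sg := smooth_comp_snd smooth_Gusq.
have sa : smooth (fun z : R * V => z.1 * G (usq z.2)) by apply: smoothM => //; exact: smooth_fst.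
apply: smoothM => //; apply: smoothD; apply: smoothM.
- exact: (smooth_comp_snd (smooth_coord i0)).
- exact: (smooth_comp1 smooth_cos sa).
- exact: (smooth_comp_snd (smooth_coord i1)).
- exact: (smooth_comp1 smooth_sin sa).
Qed.

(** The derivative of [vmain] with respect to its phase, that is, the other coordinate of the
    rotated point. *)
Definition vphase (la : R) y : R :=
  - y 0 i0 * sin (la * G (usq y)) + y 0 i1 * cos (la * G (usq y)).

Definition vmain (la : R) y : R :=
  y 0 i0 * cos (la * G (usq y)) + y 0 i1 * sin (la * G (usq y)).

Lemma is_derive_vthz (z w : R * V) : is_derive z w vthz
  ('D_1 G (usq z.2) * (2 * dot z.2 w.2) * vmain z.1 z.2 +
   G (usq z.2) * (w.2 0 i0 * cos (z.1 * G (usq z.2)) + w.2 0 i1 * sin (z.1 * G (usq z.2)) +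
     vphase z.1 z.2 * (w.1 * G (usq z.2) + z.1 * ('D_1 G (usq z.2) * (2 * dot z.2 w.2))))).
Proof.
have dG : is_derive z w (fun z : R * V => G (usq z.2)) ('D_1 G (usq z.2) * (2 * dot z.2 w.2)).
  by apply/is_derive_line0 => /=; apply/(is_derive_line0 (fun y : V => G (usq y))); exact: is_derive_Gusq.
have d1 : is_derive z w (fun z : R * V => z.1) w.1 by apply: is_derive_linR.
have dc i : is_derive z w (fun z : R * V => z.2 0 i) (w.2 0 i).
  by apply: (is_derive_linR (f := fun z : R * V => z.2 0 i)) => h u v; rewrite !mxE.
have da := is_deriveMR d1 dG.
have dcos := is_derive_compR (f := fun z : R * V => z.1 * G (usq z.2)) (is_derive_cos _) da.
have dsin := is_derive_compR (f := fun z : R * V => z.1 * G (usq z.2)) (is_derive_sin _) da.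
apply: (is_derive_eq (is_deriveMR dG (is_deriveDR (is_deriveMR (dc i0) dcos) (is_deriveMR (dc i1) dsin)))).
by rewrite /vmain /vphase; ring.
Qed.

Lemma ann_derive_vthz (w : R * V) la : ann_supp (fun y => 'D_w vthz (la, y)).
Proof.
move=> y; apply: contraR => h.
have [_ ->] := is_derive_vthz (la, y) w => /=.
have hu : (usq y < 2) || (3 < usq y) by move: h; rewrite negb_and -!ltNge.
by rewrite (aG hu) (ann_derive aG hu) !(mul0r, mulr0) addr0.
Qed.

(** The rotation field is orthogonal to y, so it annihilates all radial factors, the phase la
    G(|y|^2) included. Acting on the coordinates y_0 and y_1 alone it turns [vmain] into - [vphase],
    which cancels the derivative in la. *)
Lemma vthz_transport la y :
  'D_((1, 0) : R * V) vthz (la, y) +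
  G (usq y) * \sum_i lrot i y * 'D_((0, basis_vec i) : R * V) vthz (la, y) = 0.
Proof.
have [_ ->] := is_derive_vthz (la, y) (1, 0) => /=.
have dE i : 'D_((0, basis_vec i) : R * V) vthz (la, y) =
  (2 * 'D_1 G (usq y) * (vmain la y + G (usq y) * vphase la y * la)) * y 0 i +
   G (usq y) * ((i == i0)%:R * cos (la * G (usq y)) + (i == i1)%:R * sin (la * G (usq y))).
  have [_ ->] := is_derive_vthz (la, y) (0, basis_vec i) => /=.
  have -> : dot y (basis_vec i) = y 0 i.
    rewrite /dot (bigD1 i)//= !mxE !eqxx mulr1 big1 ?addr0// => j ji.
    by rewrite !mxE eqxx (negbTE ji) mulr0.
  rewrite !mxE eqxx /= [i0 == i]eq_sym [i1 == i]eq_sym.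
  by ring.
under eq_bigr do rewrite dE mulrDr mulrCA.
rewrite big_split /= -mulr_sumr sum_lrot_orth mulr0 add0r sum_lrot i10 !eqxx.
have -> : dot y (0 : V) = 0 by rewrite -(scale0r (0 : V)) dotZr mul0r.
rewrite !mxE /vphase [i0 == i1]eq_sym i10 /= ?mulr1n ?mulr0n.
by ring.
Qed.

Definition tlift (j : nat) (z : R * V) : R * V := (z.1 * (2 * A) ^+ j, 2 ^+ j *: z.2).

Lemma tlift_affine j (h : R) (w x : R * V) : tlift j (h *: w + x) = h *: tlift j w + tlift j x.
Proof.
apply: injective_projections => /=; first by rewrite mulrDl -mulrA.
by rewrite scalerDr !scalerA [_ * h]mulrC.
Qed.

Lemma smooth_tp j : smooth (fun z : R * V => tp z.1 j z.2).
Proof.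
have sc i := smooth_comp_snd (@smooth_dilate R n _ (2 ^+ j) (smooth_coord i)).
have sg := smooth_comp_snd (@smooth_dilate R n _ (2 ^+ j) smooth_Gusq).
have sa : smooth (fun z : R * V => z.1 * (2 * A) ^+ j * G (usq (2 ^+ j *: z.2))).
  by apply: smoothM => //; apply: smoothM; [exact: smooth_fst|exact: smooth_cst].
apply: smoothZ; apply: smoothM; first exact: sg.
apply: smoothD; apply: smoothM.
- exact: sc.
- exact: (smooth_comp1 smooth_cos sa).
- exact: sc.
- exact: (smooth_comp1 smooth_sin sa).
Qed.

Lemma is_derive_tp j (z w : R * V) : is_derive z w (fun z : R * V => tp z.1 j z.2)
  (B ^+ j * 'D_(tlift j w) vthz (tlift j z)).
Proof.
apply: is_deriveZR; apply/is_derive_line0.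
have -> : (fun h : R => vthz (tlift j (h *: w + z))) =
    (fun h : R => vthz (h *: tlift j w + tlift j z)).
  by apply/funext => h; rewrite tlift_affine.
by apply/is_derive_line0; apply: smooth_is_derive; exact: smooth_vthz.
Qed.

Definition thetaJ J (z : R * V) : R := psum (tp z.1) J z.2.

Definition vJ J (i : 'I_n) (x : V) : R := psum (vp i) J x.

Lemma smooth_thetaJ J : smooth (thetaJ J).
Proof. by apply: smooth_sum => j; exact: smooth_tp. Qed.

Lemma smooth_vp i j : smooth (vp i j).
Proof. by apply: smoothZ; apply: (smooth_dilate (F := psi i)); exact: smooth_psi. Qed.

Lemma smooth_vJ J i : smooth (vJ J i).
Proof. by apply: smooth_sum => j; exact: smooth_vp. Qed.

Lemma derive_vthz_scale (c : R) (z w : R * V) : 'D_(c *: w) vthz z = c * 'D_w vthz z.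
Proof.
have [_ ->] := is_derive_vthz z (c *: w); have [_ ->] := is_derive_vthz z w.
have -> : (c *: w).2 = c *: w.2 by [].
have -> : (c *: w).1 = c * w.1 by [].
by rewrite dotZr !mxE; ring.
Qed.

(** No velocity piece acts on a density piece of another index, because the annuli are disjoint.
    Each diagonal term is [vthz_transport] after the rescaling [tlift]: A^j from the velocity and
    2^j from the gradient make up the speed of the phase. *)
Lemma thetaJ_transport J (z : R * V) :
  'D_((1, 0) : R * V) (thetaJ J) z +
  \sum_i vJ J i z.2 * 'D_((0, basis_vec i) : R * V) (thetaJ J) z = 0.
Proof.
have D (w : R * V) : 'D_w (thetaJ J) z = \sum_(j < J) B ^+ j * 'D_(tlift j w) vthz (tlift j z).
  by have [_ ->] := is_derive_sumR (index_enum 'I_J) xpredT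
    (fun j : 'I_J => is_derive_tp j z w).
have E i : vJ J i z.2 * 'D_((0, basis_vec i) : R * V) (thetaJ J) z =
   \sum_(j < J) vp i j z.2 * (B ^+ j * 'D_(tlift j (0, basis_vec i)) vthz (tlift j z)).
  rewrite D; pose Q j x := B ^+ j * 'D_(tlift j (0, basis_vec i)) vthz (z.1 * (2 * A) ^+ j, 2 ^+ j *: x).
  have aQ : annular Q.
    move=> j x; rewrite mulf_eq0 negb_or => /andP[_ Dj].
    by rewrite -usq2X; exact: (@ann_derive_vthz (tlift j (0, basis_vec i)) (z.1 * (2 * A) ^+ j)).
  exact (@psum_mul _ _ (vp i) Q J z.2 (annular_vp (i := i)) aQ).
under eq_bigr do rewrite E.
rewrite D exchange_big /= -big_split /= big1// => j _.
pose y := 2 ^+ j *: z.2; pose la := z.1 * (2 * A) ^+ j.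
have T := vthz_transport la y.
have -> : tlift j (1, 0) = (2 * A) ^+ j *: ((1, 0) : R * V).
  by rewrite /tlift /= mul1r scaler0; congr pair; rewrite ?scaler0//; rewrite /GRing.scale /= mulr1.
have E0 i : tlift j (0, basis_vec i) = 2 ^+ j *: ((0, basis_vec i) : R * V).
  by rewrite /tlift /= mul0r; congr pair; rewrite /GRing.scale /= mulr0.
under eq_bigr do rewrite E0 derive_vthz_scale.
rewrite derive_vthz_scale -[tlift j z]/(la, y).
have S : \sum_i vp i j z.2 * (B ^+ j * (2 ^+ j * 'D_((0, basis_vec i) : R * V) vthz (la, y))) =
    B ^+ j * (2 * A) ^+ j * (G (usq y) * \sum_i lrot i y * 'D_((0, basis_vec i) : R * V) vthz (la, y)).
  rewrite !mulr_sumr; apply: eq_bigr => i _.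
  rewrite /vp /dil /psi -/y exprMn; move: ('D_ _ _ _) (lrot _ _) (G _) => D' L g.
  by ring.
rewrite S; move: T; move: ('D_ _ _ _) (G _ * _) => d0 s0 T.
by rewrite mulrA -mulrDr T mulr0.
Qed.

Lemma is_derive_psi i (y w : V) : is_derive y w (psi i)
  (lrot i y * ('D_1 G (usq y) * (2 * dot y w)) + lrot i w * G (usq y)).
Proof.
apply: is_deriveMR; last exact: is_derive_Gusq.
by apply: is_derive_linR; exact: lrot_linear.
Qed.

Lemma psi_div_free (y : V) : \sum_i 'D_(basis_vec i) (psi i) y = 0.
Proof.
have E i : 'D_(basis_vec i) (psi i) y = 2 * 'D_1 G (usq y) * (lrot i y * y 0 i).
  have [_ ->] := is_derive_psi i y (basis_vec i).
  have -> : dot y (basis_vec i) = y 0 i.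
    rewrite /dot (bigD1 i)//= !mxE !eqxx mulr1 big1 ?addr0// => j ji.
    by rewrite !mxE eqxx (negbTE ji) mulr0.
  by rewrite lrot_basis; ring.
by under eq_bigr do rewrite E; rewrite -mulr_sumr sum_lrot_orth mulr0.
Qed.

Lemma is_derive_dilate (F : V -> R) (k : R) x w : smooth F ->
  is_derive x w (fun x => F (k *: x)) (k * 'D_w F (k *: x)).
Proof.
move=> sF; apply/is_derive_line0.
have dF : is_derive (0 : R) 1 (fun h : R => F (h *: w + k *: x)) ('D_w F (k *: x)).
  by apply/is_derive_line0; exact: smooth_is_derive.
have dk : is_derive (0 : R) 1 (fun h : R => k * h) k.
  by apply: (is_derive_eq (is_deriveZR k (is_derive_id (0 : R) 1))); rewrite mulr1.
rewrite -[X in is_derive X _ _ _](mulr0 k) in dF.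
have := is_derive_compR (f := fun h : R => k * h) dF dk.
rewrite [X in is_derive _ _ _ X]mulrC.
by under eq_fun do rewrite -scalerA -scalerDr.
Qed.

Lemma vJ_div_free J x : \sum_i 'D_(basis_vec i) (vJ J i) x = 0.
Proof.
have E i : 'D_(basis_vec i) (vJ J i) x =
    \sum_(j < J) A ^+ j * 2 ^+ j * 'D_(basis_vec i) (psi i) (2 ^+ j *: x).
  have H (j : 'I_J) : is_derive x (basis_vec i) (vp i j)
      (A ^+ j * 2 ^+ j * 'D_(basis_vec i) (psi i) (2 ^+ j *: x)).
    by rewrite -mulrA; apply: is_deriveZR; apply: is_derive_dilate; exact: smooth_psi.
  by have [_ ->] := is_derive_sumR (index_enum 'I_J) xpredT H.
under eq_bigr do rewrite E.
rewrite exchange_big /= big1// => j _.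
by rewrite -mulr_sumr psi_div_free mulr0.
Qed.

End vortex.

(** * Summation of dyadic pieces in L^p *)

Section dyadic.
Context {R : realType} {n : nat}.
Local Notation V := 'rV[R]_n.
Local Notation mu := (lebesgue_rV n).

Lemma geometric_partial (r : R) J : 0 <= r < 1 -> \sum_(j < J) r ^+ j <= (1 - r)^-1.
Proof.
move=> /andP[r0 r1]; have r1' : 0 < 1 - r by rewrite subr_gt0.
have E : (1 - r) * \sum_(j < J) r ^+ j = 1 - r ^+ J.
  elim: J => [|J IH]; first by rewrite big_ord0 mulr0 expr0 subrr.
  by rewrite big_ord_recr /= mulrDr IH exprS; ring.
rewrite -[leRHS]div1r ler_pdivlMr// mulrC E lerBlDr lerDl exprn_ge0//.
Qed.

Lemma nneseries_le (u : nat -> R) (M : R) : (forall j, 0 <= u j) ->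
  (forall J, \sum_(j < J) u j <= M) -> (\sum_(0 <= j <oo) (u j)%:E <= M%:E)%E.
Proof.
move=> u0 uM; apply: lime_le.
  by apply: is_cvg_nneseries => j _ _; rewrite lee_fin.
by apply: nearW => J; rewrite sumEFin big_mkord lee_fin.
Qed.

Lemma measurable_dilate (f : V -> R) (k : R) : measurable_fun setT f ->
  measurable_fun setT (fun x : V => f (k *: x)).
Proof.
move=> mf; apply: (measurableT_comp mf); apply: measurable_fun_rV => i.
by under eq_fun do rewrite mxE; apply: measurable_funM => //; exact: measurable_coord.
Qed.

Lemma ge0_integral_scale (f : V -> R) (k : R) : 0 < k -> measurable_fun setT f ->
  (forall x, 0 <= f x) ->
  (\int[mu]_x (f (k *: x))%:E = (k ^- n)%:E * \int[mu]_x (f x)%:E)%E.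
Proof.
move=> k0 mf f0.
have := ge0_integral_affine (0 : V) (f := fun x => (f x)%:E) (lt0r_neq0 k0).
rewrite gtr0_norm// => <-.
- by apply: eq_integral => x _; rewrite addr0.
- exact/measurable_EFinP.
- by move=> x; rewrite lee_fin.
Qed.

(** The j-th term has integral (d rho^(- n))^j times that of F. The factor rho is 2 for sums in
    space and 1 / 2 for their transforms. *)
Lemma integral_dyadic_sum (d rho : R) (F : V -> R) : 0 <= d -> 0 < rho -> d * rho ^- n < 1 ->
  measurable_fun setT F -> (forall x, 0 <= F x) -> (\int[mu]_x (F x)%:E < +oo)%E ->
  (\int[mu]_x (\sum_(0 <= j <oo) (d ^+ j * F (rho ^+ j *: x))%:E) < +oo)%E.
Proof.
move=> d0 rho0 drho mF F0 Foo.
have rp j : 0 < rho ^+ j by rewrite exprn_gt0.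
have mj j : measurable_fun setT (fun x : V => (d ^+ j * F (rho ^+ j *: x))%:E).
  by apply/measurable_EFinP; apply: measurable_funM => //; exact: measurable_dilate.
rewrite integral_nneseries//; last first.
  by move=> j x _; rewrite lee_fin mulr_ge0// exprn_ge0.
pose I := fine (\int[mu]_x (F x)%:E)%E.
have IE : (\int[mu]_x (F x)%:E = I%:E)%E.
  rewrite /I fineK// ge0_fin_numE//.
  by apply: integral_ge0 => x _; rewrite lee_fin.
have I0 : 0 <= I by rewrite fine_ge0//; apply: integral_ge0 => x _; rewrite lee_fin.
have E j : (\int[mu]_x (d ^+ j * F (rho ^+ j *: x))%:E = ((d * rho ^- n) ^+ j * I)%:E)%E.
  under eq_integral do rewrite EFinM.
  rewrite ge0_integralZl//; first last.
  - by rewrite lee_fin exprn_ge0.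
  - by move=> x _; rewrite lee_fin.
  - by apply/measurable_EFinP; exact: measurable_dilate.
  rewrite ge0_integral_scale// IE -!EFinM; congr EFin.
  by rewrite exprMn mulrA exprVn -!exprM mulnC.
apply: (@le_lt_trans _ _ (((1 - d * rho ^- n)^-1 * I)%:E)); last exact: ltry.
rewrite (eq_eseriesr (g := fun j => ((d * rho ^- n) ^+ j * I)%:E)); last by move=> j _; rewrite E.
have r0 : 0 <= d * rho ^- n by rewrite mulr_ge0// invr_ge0 ltW.
apply: nneseries_le => [j|J]; first by rewrite mulr_ge0// exprn_ge0.
by rewrite -mulr_suml ler_wpM2r// geometric_partial// r0.
Qed.

(* Weighted: [(sum_j q^j a_j)^p <= (1 - q)^(- p) sup_j a_j^p <= (1 - q)^(- p) sum_j a_j^p]. *)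
Lemma dyadic_Lp (p d rho : R) (F f : V -> R) : 1 <= p -> 0 < d -> 0 < rho ->
  d `^ p * rho ^- n < 1 ->
  measurable_fun setT F -> (forall x, 0 <= F x) ->
  (\int[mu]_x (F x `^ p)%:E < +oo)%E ->
  measurable_fun setT f -> (forall x, 0 <= f x) ->
  (forall x, ((f x)%:E <= \sum_(0 <= j <oo) (d ^+ j * F (rho ^+ j *: x))%:E)%E) ->
  (\int[mu]_x (f x `^ p)%:E < +oo)%E.
Proof.
move=> p1 d0 rho0 drho mF F0 Foo mf f0 fF.
have p0 : 0 < p by rewrite (lt_le_trans ltr01).
pose de := d `^ p * rho ^- n.
have de0 : 0 < de by rewrite mulr_gt0 ?powR_gt0// invr_gt0 exprn_gt0.
(* Any value strictly between [de] and 1 would do: below 1 it makes the weights q^j summable, above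
   [de] it makes the series with ratio d^p / qp integrable. *)
pose qp := (1 + de) / 2; have qp0 : 0 < qp by rewrite divr_gt0// addr_gt0.
have qp1 : qp < 1 by rewrite /qp; have := drho; rewrite -/de; lra.
have deqp : de < qp by rewrite /qp; have := drho; rewrite -/de; lra.
pose q := qp `^ p^-1.
have q0 : 0 < q by exact: powR_gt0.
have qpE : q `^ p = qp by rewrite -powRrM mulVf ?gt_eqF// powRr1// ltW.
have q1 : q < 1.
  rewrite ltNge; apply/negP => q1; have : 1 <= q `^ p.
    by have := ge0_ler_powR (ltW p0) ler01 (ltW q0) q1; rewrite powR1.
  by rewrite qpE leNgt qp1.
pose D := d `^ p / qp.
have powX (x : R) j : 0 < x -> (x ^+ j) `^ p = (x `^ p) ^+ j.
  by move=> x0; rewrite -powR_mulrn ?ltW// -powRrM mulrC powRrM powR_mulrn// ltW// powR_gt0.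
pose S x : \bar R := (\sum_(0 <= j <oo) (D ^+ j * F (rho ^+ j *: x) `^ p)%:E)%E.
have D0 : 0 <= D by rewrite divr_ge0 ?powR_ge0// ltW.
have Soo : (\int[mu]_x S x < +oo)%E.
  apply: (@integral_dyadic_sum D rho (fun x => F x `^ p)) => //.
  - by rewrite /D mulrAC -/de ltr_pdivrMr// mul1r.
  - exact: (measurableT_comp (measurable_powR p) mF).
  - by move=> x; exact: powR_ge0.
have mS : measurable_fun setT S.
  apply: ge0_emeasurable_sum => [j x _ _|j _].
    by rewrite lee_fin mulr_ge0 ?exprn_ge0 ?powR_ge0.
  apply/measurable_EFinP; apply: measurable_funM => //.
  by apply: (measurableT_comp (measurable_powR p)); exact: measurable_dilate.
have S0 x : (0 <= S x)%E.
  by apply: nneseries_ge0 => j _ _; rewrite lee_fin mulr_ge0 ?exprn_ge0 ?powR_ge0.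
pose c := ((1 - q)^-1) `^ p.
have c0 : 0 <= c by exact: powR_ge0.
have key x : ((f x `^ p)%:E <= c%:E * S x)%E.
  have [Sx|Sx] := eqVneq (S x) +oo%E.
    rewrite Sx gt0_muley ?leey// lte_fin powR_gt0// invr_gt0 subr_gt0//.
  have Sfin : S x \is a fin_num by rewrite ge0_fin_numE// ltey.
  pose s := fine (S x); have SE : S x = s%:E by rewrite fineK.
  have s0 : 0 <= s by rewrite fine_ge0.
  have aj j : d ^+ j * F (rho ^+ j *: x) <= q ^+ j * s `^ p^-1.
    have H : D ^+ j * F (rho ^+ j *: x) `^ p <= s.
      rewrite -lee_fin -SE.
      apply: (@le_trans _ _ (\sum_(0 <= i < j.+1) (D ^+ i * F (rho ^+ i *: x) `^ p)%:E)%E).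
        rewrite big_nat_recr //= leeDr// sume_ge0// => i _.
        by rewrite lee_fin mulr_ge0 ?exprn_ge0 ?powR_ge0.
      by apply: nneseries_lim_ge => i _ _; rewrite lee_fin mulr_ge0 ?exprn_ge0 ?powR_ge0.
    have E : D ^+ j * F (rho ^+ j *: x) `^ p = (q ^- j * (d ^+ j * F (rho ^+ j *: x))) `^ p.
      have qj : 0 < q ^- j by rewrite invr_gt0 exprn_gt0.
      rewrite powRM ?(ltW qj)//; last by rewrite mulr_ge0 ?exprn_ge0// ltW.
      rewrite powRM ?exprn_ge0 ?(ltW d0)// powX// -exprVn powX ?invr_gt0//.
      have -> : q^-1 `^ p = qp^-1.
        by rewrite -[q^-1]powR_inv1 ?ltW// -powRrM mulrC powRrM qpE powR_inv1// ltW.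
      by rewrite mulrA -exprMn [_^-1 * _]mulrC.
    rewrite E in H.
    have := @ge0_ler_powR R p^-1 _ _ _ _ _ H; rewrite -powRrM mulfV ?gt_eqF//.
    rewrite powRr1; last by rewrite !mulr_ge0 ?invr_ge0 ?exprn_ge0 ?(ltW q0) ?(ltW d0).
    rewrite invr_ge0 (ltW p0) ?nnegrE powR_ge0 s0 => /(_ isT isT isT).
    by rewrite ler_pdivrMl// exprn_gt0.
  have fb : f x <= (1 - q)^-1 * s `^ p^-1.
    rewrite -lee_fin; apply: (le_trans (fF x)); apply: nneseries_le => [j|J].
      by rewrite mulr_ge0// exprn_ge0// ltW.
    apply: (@le_trans _ _ (\sum_(j < J) q ^+ j * s `^ p^-1)).
      by apply: ler_sum => j _; exact: aj.
    by rewrite -mulr_suml ler_wpM2r ?powR_ge0// geometric_partial// (ltW q0).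
  rewrite SE -EFinM lee_fin.
  have := @ge0_ler_powR R p _ _ _ _ _ fb; rewrite (ltW p0) ?nnegrE f0.
  rewrite mulr_ge0 ?powR_ge0 ?invr_ge0 ?subr_ge0 ?(ltW q1)// => /(_ isT isT isT) h.
  apply: (le_trans h); rewrite powRM ?powR_ge0 ?invr_ge0 ?subr_ge0 ?(ltW q1)//.
  by rewrite -powRrM mulVf ?gt_eqF// powRr1.
apply: (@le_lt_trans _ _ (\int[mu]_x (c%:E * S x))%E).
  apply: ge0_le_integral => //.
  - by move=> x _; rewrite lee_fin powR_ge0.
  - by apply/measurable_EFinP; exact: (measurableT_comp (measurable_powR p) mf).
  - by apply: measurable_funeM.
rewrite ge0_integralZl//.
by apply: lte_mul_pinfty.
Qed.

Lemma dyadic_L1 (d rho : R) (F f : V -> R) : 0 < d -> 0 < rho ->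
  d * rho ^- n < 1 -> L1 mu F -> (forall x, 0 <= F x) ->
  measurable_fun setT f ->
  (forall x, (`|f x|%:E <= \sum_(0 <= j <oo) (d ^+ j * F (rho ^+ j *: x))%:E)%E) ->
  L1 mu f.
Proof.
move=> d0 rho0 drho F1 F0 mf fF; apply: L1P => //.
have E (g : V -> R) : (forall x, 0 <= g x) ->
    (\int[mu]_x (g x `^ 1)%:E = \int[mu]_x (g x)%:E)%E.
  by move=> g0; apply: eq_integral => x _; rewrite powRr1.
have H := @dyadic_Lp 1 d rho F (fun x => `|f x|) (lexx 1) d0 rho0.
rewrite powRr1 ?(ltW d0)// !E// in H; apply: H => //.
- exact: L1_measurable F1.
- have := L1_lty F1; by under eq_integral do rewrite ger0_norm//.
- exact: measurableT_comp.
Qed.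

End dyadic.

(** * Measurability and integration on space-time *)

Section space_time.
Context {R : realType} {n : nat}.
Local Notation V := 'rV[R]_n.
Local Notation mu := (lebesgue_rV n).
Local Notation mu1 := (@lebesgue_measure R).
Let mR := measurableTypeR R.

Lemma continuous_rV m (X : topologicalType) (f : X -> 'rV[R]_m) :
  (forall i, continuous (fun x => f x 0 i)) -> continuous f.
Proof.
move=> cf x; apply/cvgrPdist_le => e e0.
have H : \forall y \near x, forall i, `|f x 0 i - f y 0 i| <= e.
  by apply: filter_forall => i; have /cvgrPdist_le := cf i x; apply.
near=> y; apply: norm_rV_le (ltW e0) _ => i; rewrite !mxE.
by move: i; near: y.
Unshelve. all: by end_near. Qed.

(** The product sigma-algebra is compared with that of R^(n + 1) through [vcons]; on R^(n + 1)
    continuity already gives measurability. *)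
Lemma continuous_measurable_RV (f : R * V -> R) : continuous f ->
  measurable_fun setT (f : mR * V -> R).
Proof.
move=> cf; pose u (z : 'rV[R]_n.+1) : R * V := (z 0 ord0, \row_j z 0 (lift ord0 j)).
have -> : f = (fun z => f (u z)) \o vcons.
  apply/funext => -[a y] /=; congr f; rewrite /u !mxE unlift_none /=; congr pair.
  by apply/rowP => j; rewrite !mxE liftK.
apply: measurableT_comp measurable_vcons; apply: continuous_measurable_rV => z.
apply: (@continuous_comp _ _ _ u f); last exact: cf.
apply: (@cvg_pair _ _ _ (nbhs z) (nbhs (u z).1) (nbhs (u z).2) _ _ _
  (fun z => (u z).1) (fun z => (u z).2)).
  exact: coord_continuous.
apply: (@continuous_rV n _ (fun z : 'rV[R]_n.+1 => \row_j z 0 (lift ord0 j))) => i.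
by under eq_fun do rewrite mxE; exact: coord_continuous.
Qed.

Lemma compact_support_weight (f : R * V -> R) (K : set (R * V)) : continuous f -> compact K ->
  (forall z, ~ K z -> f z = 0) -> exists2 C : R, 0 <= C & forall z, `|f z| <= C * weight z.2.
Proof.
move=> cf cK fK; pose g (z : R * V) := (1 + `|z.2|) ^+ (2 * n) * f z.
have cg : continuous g.
  apply: C0M => // z.
  apply: (@continuous_comp _ _ _ (fun z : R * V => 1 + `|z.2|) (fun y : R => y ^+ (2 * n))).
    apply: continuousD; first exact: cst_continuous.
    apply: (@continuous_comp _ _ _ snd (fun y : V => `|y|)); first exact: cvg_snd.
    exact: norm_continuous.
  exact: exprn_continuous.
have [M [Mr HM]] := compact_bounded (continuous_compact (continuous_subspaceT cg) cK).
exists (`|M| + 1) => [|z]; first by rewrite addr_ge0.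
have [Kz|/fK ->] := pselect (K z); last by rewrite normr0 mulr_ge0 ?addr_ge0 ?weight_ge0.
have Hz : `|g z| <= `|M| + 1.
  by apply: (HM (`|M| + 1)); [rewrite (le_lt_trans (ler_norm _))// ltrDl|exists z].
apply: le_trans (ler_wpM2r (weight_ge0 z.2) Hz).
rewrite normrM ger0_norm ?exprn_ge0 ?addr_ge0// mulrAC -[leLHS]mul1r ler_wpM2r//.
exact: weight_lower.
Qed.

(** As a real factor, the indicator turns integrals over the slab into integrals over the whole
    product, where the Fubini lemmas apply. *)
Definition ind (T t : R) : R := \1_(`[0, T] : set R) t.

Lemma indE (T t : R) : ind T t = (0 <= t <= T)%R%:R.
Proof. by rewrite /ind indicE mem_setE in_itv. Qed.

Lemma L1_ind (T : R) : L1 mu1 (ind T).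
Proof.
apply: L1P; first by apply: measurable_indic; exact: measurable_itv.
under eq_integral do rewrite ger0_norm//.
rewrite /ind integral_indic// setIT.
have : (@lebesgue_measure R [set` `[0%R, T]] < +oo)%E.
  by rewrite lebesgue_measure_itv; case: ifP => _; rewrite ltry.
exact.
Qed.

Lemma Rintegral_slab (T : R) (F : R * V -> R) :
  \int[(mu1 \x mu)%E]_(z in (`[0%R, T] : set R) `*` [set: V]) F z =
  \int[(mu1 \x mu)%E]_z (ind T z.1 * F z).
Proof.
rewrite Rintegral_mkcond; apply: eq_Rintegral => z _; rewrite patchE indE.
have -> : (z \in (`[0%R, T] : set R) `*` [set: V]) = (0 <= z.1 <= T).
  apply/idP/idP => [|h]; first by rewrite inE /= in_itv /= => -[].
  by rewrite inE /= in_itv.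
by case: ifP => _; rewrite ?mul1r ?mul0r.
Qed.

Lemma L1_slab (T : R) (F : R * V -> R) (g : V -> R) :
  measurable_fun setT (F : mR * V -> R) -> L1 mu g ->
  (forall z, `|F z| <= g z.2) -> L1 (mu1 \x mu)%E (fun z => ind T z.1 * F z).
Proof.
move=> mF g1 Fg; apply: (@L1_dominated _ _ R _ (fun z : mR * V => ind T z.1 * g z.2)).
- apply: measurable_funM => //; apply: measurableT_comp measurable_fst.
  exact: L1_measurable (L1_ind T).
- exact: L1_prod (L1_ind T) g1.
- by move=> z; rewrite normrM ger0_norm ?ler_wpM2l// indE.
Qed.

End space_time.

Section annular_more.
Context {R : realType} {n : nat}.
Local Notation V := 'rV[R]_n.
Local Notation mu := (lebesgue_rV n).
Implicit Types (P : nat -> V -> R) (x : V).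

Lemma asum_le_bound P x (M : R) : annular P -> (forall j, `|P j x| <= M) -> `|asum P x| <= M.
Proof.
move=> aP PM; have M0 : 0 <= M := le_trans (normr_ge0 _) (PM 0).
rewrite /asum /psum.
have [/existsP[j Pj]|/existsPn H] := boolP [exists j : 'I_(aidx x), P j x != 0]; last first.
  by rewrite big1 ?normr0// => j _; apply/eqP; have := H j; rewrite negbK.
rewrite (bigD1 j)//= big1 ?addr0// => i ij.
have /eqP := annular_disjoint x aP aP (i := i) (j := j) ij.
by rewrite mulf_eq0 (negbTE Pj) orbF => /eqP.
Qed.

Lemma psum_le_bound P J x (M : R) : annular P -> (forall j, `|P j x| <= M) -> `|psum P J x| <= M.
Proof.
move=> aP PM; apply: (le_trans (psum_norm_le J x aP)).
have aN : annular (fun j x => `|P j x|) by move=> j y; rewrite normr_eq0 => /aP.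
apply: (le_trans (ler_norm _)); apply: asum_le_bound => // j.
by rewrite normr_id.
Qed.

Lemma test_function_schw (phi : V -> R) : test_function setT phi -> schw phi.
Proof.
move=> [/smooth_on_smooth sm [K [cK _ hK]]].
have /compact_bounded[M [Mr HM]] := cK.
apply: (@schw_of_supported _ _ (`|M| + 1) phi sm) => x xM.
apply: hK => Kx; have : `|x| <= `|M| + 1.
  by apply: (HM (`|M| + 1)) => //; rewrite (le_lt_trans (ler_norm _))// ltrDl.
by rewrite leNgt xM.
Qed.

Lemma smooth_on_row (E : normedModType R) m (f : E -> 'rV[R]_m) :
  (forall i, smooth (fun z : E => f z 0 i)) -> smooth_on_open setT f.
Proof.
move=> sf ws x _; have H us : iter_derive us f =
    fun y => \row_i iter_derive us (fun z : E => f z 0 i) y.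
  elim: us => [|w us IH] /=.
    by apply/funext => y; apply/rowP => i; rewrite mxE.
  apply/funext => y; rewrite IH derive_mx.
    apply/rowP => i; rewrite !mxE; congr ('D_w _ y).
    by apply/funext => z; rewrite mxE.
  apply/derivable_mxP => k i; rewrite ord1.
  under eq_fun do rewrite mxE.
  by apply: smooth_derivable; exact: smooth_iter_derive.
rewrite H; split.
  apply: continuous_rV => i; under eq_fun do rewrite mxE.
  by apply: smooth_continuous; exact: smooth_iter_derive.
move=> w; apply/derivable_mxP => k i; rewrite ord1.
under eq_fun do rewrite mxE.
by apply: smooth_derivable; exact: smooth_iter_derive.
Qed.

Lemma compact_measurable_rV (K : set V) : compact K -> measurable K.
Proof.
move=> cK; rewrite -(setCK K); apply: measurableC; apply: measurable_open_rV.
by apply: closed_openC; apply: compact_closed.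
Qed.

Lemma L1_locally_integrable (f : V -> R) : L1 mu f -> locally_integrable_rV f.
Proof.
move=> f1 K cK; apply: (integrableS measurableT) => //.
exact: compact_measurable_rV.
Qed.

End annular_more.

(** * The continuity equation *)

Section slices.
Context {R : realType} {n : nat}.
Local Notation V := 'rV[R]_n.
Implicit Types (f : R * V -> R).

Lemma is_derive_slice1 f (t : R) (x : V) : smooth f ->
  is_derive t 1 (fun s => f (s, x)) ('D_((1, 0) : R * V) f (t, x)).
Proof.
move=> sf; apply/is_derive_line0.
have /is_derive_line0 := smooth_is_derive ((1, 0) : R * V) (t, x) sf.
congr (is_derive _ _ _ _); apply/funext => h; congr f; apply: injective_projections => //=.
by rewrite scaler0 add0r.
Qed.

Lemma is_derive_slice2 f (t : R) (x w : V) : smooth f ->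
  is_derive x w (fun y => f (t, y)) ('D_((0, w) : R * V) f (t, x)).
Proof.
move=> sf; apply/is_derive_line0.
have /is_derive_line0 := smooth_is_derive ((0, w) : R * V) (t, x) sf.
congr (is_derive _ _ _ _); apply/funext => h; congr f; apply: injective_projections => //=.
by rewrite scaler0 add0r.
Qed.

Lemma continuous_pair_l (t : R) : continuous (fun y : V => (t, y)).
Proof.
by move=> y; apply: (@cvg_pair _ _ _ (nbhs y) (nbhs t) (nbhs y)); [exact: cvg_cst|exact: cvg_id].
Qed.

Lemma continuous_pair_r (x : V) : continuous (fun t : R => (t, x)).
Proof.
by move=> y; apply: (@cvg_pair _ _ _ (nbhs y) (nbhs y) (nbhs x)); [exact: cvg_id|exact: cvg_cst].
Qed.

Lemma smooth_slice2 f (t : R) : smooth f -> smooth (fun y : V => f (t, y)).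
Proof.
apply: (smooth_affine_comp (l := fun y : V => (t, y)) (lin := fun y : V => ((0 : R), y))).
  by move=> h w x; apply: injective_projections => //=; rewrite scaler0 add0r.
exact: continuous_pair_l.
Qed.

Lemma derive_off_compact (E : normedModType R) (g : E -> R) (K : set E) (w z : E) : compact K ->
  (forall z, ~ K z -> g z = 0) -> ~ K z -> 'D_w g z = 0.
Proof.
move=> cK gK Kz; rewrite -(derive_cst (0 : R) z w); apply: near_eq_derive.
have oK : open (~` K) by apply: closed_openC; exact: compact_closed.
by near=> y; apply: gK; near: y; exact: open_nbhs_nbhs.
Unshelve. all: by end_near. Qed.

End slices.

Section vortex_solution.
Context {R : realType} {m : nat}.
Local Notation n := m.+2.
Local Notation V := 'rV[R]_n.
Local Notation mu := (lebesgue_rV n).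
Local Notation mu1 := (@lebesgue_measure R).
Let mR := measurableTypeR R.
Implicit Types (x y w : V).
Variables (G : R -> R).
Hypotheses (sG : smooth G) (aG : ann G).
Variables (A B : R).
Hypotheses (A01 : 0 < A <= 1) (B0 : 0 < B) (Bn : B * 2 ^- n < 1).
Local Notation i0 := (ord0 : 'I_n).
Local Notation i1 := (lift ord0 ord0 : 'I_n).

Local Notation vpG := (vp (m := m) G A).
Local Notation vfieldG := (vfield (m := m) G A).
Local Notation vJG := (vJ (m := m) G A).
Local Notation tpG := (tp (m := m) G A B).
Local Notation thetaG := (theta (m := m) G A B).
Local Notation thetaJG := (thetaJ (m := m) G A B).

(** A bound for the profile at every angle. Its dyadic sum [env] dominates theta and all its partial
    sums at all times, and [B * 2 ^- n < 1] makes it integrable. *)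
Let env1 (y : V) : R := `|G (usq y)| * (`|y 0 i0| + `|y 0 i1|).
Let env (x : V) : R := asum (dil B (fun=> env1)) x.

Lemma ann_env1 : ann_supp env1.
Proof. by move=> y; rewrite mulf_eq0 negb_or normr_eq0 => /andP[/(G_eq0 aG)]. Qed.

Lemma vth_le (la : R) y : `|vth G la y| <= env1 y.
Proof.
rewrite normrM ler_wpM2l// (le_trans (ler_normD _ _))// !normrM.
by rewrite lerD// ler_piMr// ?norm_cos_le1// ler_norml sin_le1 sin_geN1.
Qed.

Lemma env1_ge0 y : 0 <= env1 y.
Proof. by rewrite mulr_ge0// addr_ge0. Qed.

Lemma L1_env1 : L1 mu env1.
Proof.
apply: rapid_L1; apply: (@supported_rapid _ _ 2); split.
  apply: C0M => [y|].
    apply: (@continuous_comp _ _ _ (fun y : V => G (usq y)) Num.norm); last exact: norm_continuous.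
    by apply: smooth_continuous; exact: smooth_Gusq.
  apply: C0D => y; apply: (@continuous_comp _ _ _ (fun y : V => y 0 _) Num.norm);
    by [exact: coord_continuous|exact: norm_continuous].
by move=> x x2; exact: ann_supp_norm ann_env1 x2.
Qed.

Lemma annular_env : annular (dil B (fun=> env1)).
Proof. by apply: annular_dil => _; exact: ann_env1. Qed.

Lemma dil_env_ge0 j x : 0 <= dil B (fun=> env1) j x.
Proof. by rewrite mulr_ge0 ?env1_ge0// exprn_ge0// ltW. Qed.

Lemma env_ge0 x : 0 <= env x.
Proof. by apply: sumr_ge0 => j _; exact: dil_env_ge0. Qed.

Lemma L1_env : L1 mu env.
Proof.
apply: (@dyadic_L1 _ _ B 2 env1) => //; [exact: L1_env1|exact: env1_ge0| |].
  apply: measurable_asum; first exact: annular_env.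
  by move=> j; apply: measurable_funM => //; apply: measurable_dilate; exact: L1_measurable L1_env1.
move=> x; rewrite ger0_norm ?env_ge0//; apply: asum_le_nneseries => j.
exact: dil_env_ge0.
Qed.

Lemma tp_le t j x : `|tpG t j x| <= dil B (fun=> env1) j x.
Proof.
by rewrite /tp /dil normrM ger0_norm ?exprn_ge0 ?(ltW B0)// ler_wpM2l ?exprn_ge0 ?(ltW B0)// vth_le.
Qed.

Lemma thetaJ_le J (z : R * V) : `|thetaJG J z| <= env z.2.
Proof.
apply: (le_trans (psum_norm_le _ _ (@annular_tp _ _ _ aG A B z.1))).
by apply: le_asum => j; exact: tp_le.
Qed.

Lemma theta_le t x : `|thetaG t x| <= env x.
Proof.
rewrite /theta (asum_norm _ (@annular_tp _ _ _ aG A B t)).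
by apply: le_asum => j; exact: tp_le.
Qed.

Lemma measurable_theta t : measurable_fun setT (thetaG t).
Proof.
apply: measurable_asum; first exact: annular_tp.
move=> j; apply: continuous_measurable_rV.
have := smooth_continuous (smooth_tp sG A B j) => c y.
apply: (@continuous_comp _ _ _ (fun y : V => (t, y)) (fun z : R * V => tpG z.1 j z.2)); last exact: c.
by apply: (@cvg_pair _ _ _ (nbhs y) (nbhs t) (nbhs y)); [exact: cvg_cst|exact: cvg_id].
Qed.

Lemma L1_theta t : L1 mu (thetaG t).
Proof.
by apply: (L1_dominated (g := env)); [exact: measurable_theta|exact: L1_env|exact: theta_le].
Qed.

Lemma psi_bounded : exists2 C : R, 0 <= C & forall i y, `|psi G i y| <= C.
Proof.
have H i : exists C : R, forall y, `|psi G i y| <= C.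
  have /rapid_le_weight[C C0 h] : rapid (psi G i).
    apply: (@supported_rapid _ _ 2); split; first exact: smooth_continuous (smooth_psi sG i).
    by move=> x x2; exact: ann_supp_norm (ann_psi aG (i := i)) x2.
  by exists C => y; rewrite (le_trans (h y))// ler_piMr// weight_le1.
have [c hc] := choice H.
exists (\sum_i `|c i|) => [|i y]; first exact: sumr_ge0.
rewrite (le_trans (hc i y))// (le_trans (ler_norm _))// (bigD1 i)//= lerDl.
exact: sumr_ge0.
Qed.

Lemma vp_bounded : exists2 C : R, 0 <= C & forall i j x, `|vpG i j x| <= C.
Proof.
have [C C0 h] := psi_bounded; exists C => // i j x.
have /andP[A0 A1] := A01.
rewrite /vp /dil normrM -[leRHS]mul1r ler_pM//.
by rewrite ger0_norm ?exprn_ge0 ?(ltW A0)// exprn_ile1 ?(ltW A0).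
Qed.

Lemma vfield_bounded : exists2 C : R, 0 <= C &
  (forall i x, `|vfieldG x 0 i| <= C) /\ (forall J i x, `|vJG J i x| <= C).
Proof.
have [C C0 h] := vp_bounded; exists C => //; split=> [i x|J i x].
- rewrite /vfield mxE; apply: asum_le_bound; [exact: annular_vp|move=> j; exact (h i j x)].
- by apply: psum_le_bound; [exact: annular_vp|move=> j; exact (h i j x)].
Qed.

Lemma measurable_vfield i : measurable_fun setT (fun x => vfieldG x 0 i).
Proof.
under eq_fun do rewrite mxE.
apply: measurable_asum; first exact: annular_vp.
move=> j; apply: continuous_measurable_rV; apply: smooth_continuous; exact: smooth_vp.
Qed.

Lemma vfield_bounded_field T : bounded_field T (fun=> vfieldG).
Proof.
split=> [i|].
  apply: measurable_funTS; exact: (measurableT_comp (measurable_vfield i) measurable_snd).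
have [C C0 [h _]] := vfield_bounded.
exists (Num.sqrt n%:R * C) => t x _.
by rewrite (le_trans (enorm_le_norm _))// ler_wpM2l ?sqrtr_ge0// norm_rV_le.
Qed.

Lemma vJ_outside J i x : 2 < `|x| -> vJG J i x = 0.
Proof.
move=> x2; rewrite /vJ /psum big1// => j _.
by apply: dil_outside => // _; exact: ann_psi.
Qed.

Lemma schw_vJ J i : schw (vJG J i).
Proof. by apply: (@schw_of_supported _ _ 2); [exact: smooth_vJ|exact: vJ_outside]. Qed.

Lemma vJE J i x : (aidx x <= J)%N -> vJG J i x = vfieldG x 0 i.
Proof. by move=> xJ; rewrite /vfield mxE; apply: psumE => //; exact: annular_vp. Qed.

Lemma thetaJE J (z : R * V) : (aidx z.2 <= J)%N -> thetaJG J z = thetaG z.1 z.2.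
Proof. by move=> xJ; apply: psumE => //; exact: annular_tp. Qed.

Lemma vJ_divergence_free J (phi : V -> R) : schw phi ->
  \int[mu]_x (\sum_i vJG J i x * 'D_(basis_vec i) phi x) = 0.
Proof.
move=> sphi.
have m1 i : reg moderate 1 (vJG J i).
  by apply: reg_mono (schw_vJ J i 1); exact: rapid_moderate.
rewrite Int_sum; last first.
  move=> i; apply: rapid_L1; apply: moderate_rapid; first exact: reg_base (m1 i).
  exact: reg_base (reg_derive _ (sphi 1)).
under eq_bigr => i _ do rewrite (Int_by_parts _ (m1 i) (sphi 1)).
rewrite sumrN -Int_sum; last first.
  move=> i; apply: rapid_L1; apply: moderate_rapid; first exact: reg_base (reg_derive _ (m1 i)).
  exact: reg_base (sphi 0).
have -> : (fun x => \sum_i 'D_(basis_vec i) (vJG J i) x * phi x) = fun=> 0.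
  by apply/funext => x; rewrite -mulr_suml vJ_div_free// mul0r.
by rewrite Int0 oppr0.
Qed.

Lemma vfield_divergence_free T : divergence_free T (fun=> vfieldG).
Proof.
move=> t phi _ /test_function_schw sphi.
have [C C0 [_ hJ]] := vfield_bounded.
have d1 i : L1 mu ('D_(basis_vec i) phi).
  by apply: rapid_L1; exact: reg_base (reg_derive _ (sphi 1)).
have [] := @Int_cvg _ _ _ mu (fun J x => \sum_i vJG J i x * 'D_(basis_vec i) phi x)
  (fun x => \sum_i vfieldG x 0 i * 'D_(basis_vec i) phi x)
  (fun x => \sum_i C * `|'D_(basis_vec i) phi x|).
- move=> J; apply: measurable_sum => i; apply: measurable_funM.
    by apply: continuous_measurable_rV; apply: smooth_continuous; exact: smooth_vJ.
  exact: L1_measurable (d1 i).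
- by apply: L1_sum => i; apply: L1Z; exact: L1_abs.
- move=> J x; rewrite (le_trans (ler_norm_sum _ _ _))// ler_sum// => i _.
  by rewrite normrM ler_wpM2r.
- move=> x; apply: cvg_near_cst; exists (aidx x) => // J /= xJ.
  by apply: eq_bigr => i _; rewrite vJE.
move=> _; under eq_fun do rewrite vJ_divergence_free//.
by move/cvg_lim => /= <- //; rewrite lim_cst.
Qed.

Lemma continuous_measurable_theta2 :
  measurable_fun setT ((fun z => thetaG z.1 z.2) : mR * V -> R).
Proof.
apply/measurable_EFinP.
apply: (@emeasurable_fun_cvg _ _ _ _ (fun J => EFin \o (thetaJG J : mR * V -> R))) => [J|z _].
  apply/measurable_EFinP; apply: continuous_measurable_RV; apply: smooth_continuous.
  exact: smooth_thetaJ.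
apply: cvg_EFin; first exact: nearW.
by apply: cvg_near_cst; exists (aidx z.2) => // J /= xJ; exact: thetaJE.
Qed.

Lemma theta_integrable_slab T (K : set V) : compact K ->
  (mu1 \x mu)%E.-integrable ((`[0, T] : set R) `*` K) (fun z => (thetaG z.1 z.2)%:E).
Proof.
move=> cK.
have h := L1_slab T (F := fun z => thetaG z.1 z.2) continuous_measurable_theta2 L1_env
  (fun z => theta_le z.1 z.2).
have mI : measurable ((`[0, T] : set mR) `*` K).
  by apply: measurableX; [exact: measurable_itv|exact: compact_measurable_rV].
have := integrableS measurableT mI (@subsetT _ _) h.
apply: eq_integrable => // z /set_mem[/= t0T _]; rewrite indE.
by move: t0T; rewrite in_itv /= => ->; rewrite mul1r.
Qed.

Lemma continuous_theta_t x : continuous (fun t => thetaG t x).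
Proof.
move=> t; apply: (@continuous_comp _ _ _ (fun t : R => (t, x)) (thetaJG (aidx x))).
  exact: continuous_pair_r.
by apply: smooth_continuous; exact: smooth_thetaJ.
Qed.

Lemma continuous_Int_theta T (phi : V -> R) : test_function setT phi ->
  {within `[0, T], continuous (fun t => \int[mu]_x (thetaG t x * phi x))}.
Proof.
move=> /test_function_schw sphi; apply: continuous_subspaceT => t.
have rphi := reg_base (sphi 0); have [C C0 hC] := rapid_le_weight rphi.
have hC' x : `|phi x| <= C by rewrite (le_trans (hC x))// ler_piMr// weight_le1.
have L s : L1 mu (fun x => thetaG s x * phi x).
  apply: (L1_dominated (g := fun x => C * env x)); last 2 first.
  - exact: L1Z L1_env.
  - by move=> x; rewrite normrM mulrC ler_pM// theta_le.
  apply: measurable_funM; first exact: measurable_theta.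
  exact: L1_measurable (rapid_L1 rphi).
have := @continuity_under_integral R _ V mu (fun s x => thetaG s x * phi x) setT measurableT
  (t - 1) (t + 1) _ _ (fun x => C * env x) _ _ t.
apply => //; first by move=> s _; exact: L.
- apply: aeW => x _ s _; apply: (@continuousM _ _ (fun s => thetaG s x) (fun=> phi x)).
    exact: continuous_theta_t.
  exact: cst_continuous.
- exact: L1Z L1_env.
- by move=> s _; apply: aeW => x _; rewrite normrM mulrC ler_pM// theta_le.
- by rewrite inE /= in_itv /= ltrBlDr ltrDl ltr01.
Qed.

Section weak_form.
Variables (T : R) (phi : R * V -> R) (K : set (R * V)).
Hypotheses (T0 : 0 < T) (sphi : smooth phi) (cK : compact K)
  (KT : forall z, K z -> z.1 < T) (phiK : forall z, ~ K z -> phi z = 0).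

Let e0 : R * V := (1, 0).
Let e (i : 'I_n) : R * V := (0, basis_vec i).

Let fJ J (z : R * V) : R :=
  thetaJG J z * ('D_e0 phi z + \sum_i vJG J i z.2 * 'D_(e i) phi z).
Let Phi J (z : R * V) : R := thetaJG J z * phi z.

Let sth J : smooth (thetaJG J) := smooth_thetaJ sG A B J.

Let sPhi J : smooth (Phi J). Proof. exact: smoothM. Qed.

Let PhiK J z : ~ K z -> Phi J z = 0.
Proof. by move=> Kz; rewrite /Phi phiK// mulr0. Qed.

Let H J z : R := \sum_i vJG J i z.2 * 'D_(e i) (Phi J) z.

(** The transport equation turns the weak integrand into derivatives of the product [Phi J] alone:
    the terms in which the density is differentiated add up to 0. *)
Let fJE J z : fJ J z = 'D_e0 (Phi J) z + H J z.
Proof.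
have D (w : R * V) : 'D_w (Phi J) z = thetaJG J z * 'D_w phi z + 'D_w (thetaJG J) z * phi z.
  by have [_ ->] := is_deriveMR (smooth_is_derive w z (sth J)) (smooth_is_derive w z sphi).
rewrite /H D; under eq_bigr do rewrite D.
have T1 : 'D_e0 (thetaJG J) z + \sum_i vJG J i z.2 * 'D_(e i) (thetaJG J) z = 0.
  exact: thetaJ_transport.
rewrite /fJ mulrDr mulr_sumr.
have -> : \sum_i vJG J i z.2 * (thetaJG J z * 'D_(e i) phi z + 'D_(e i) (thetaJG J) z * phi z) =
   \sum_i thetaJG J z * (vJG J i z.2 * 'D_(e i) phi z) +
   (\sum_i vJG J i z.2 * 'D_(e i) (thetaJG J) z) * phi z.
  by rewrite mulr_suml -big_split /=; apply: eq_bigr => i _; ring.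
have alg (a b u s p : R) : a + b = 0 -> u + s = u + a * p + (s + b * p).
  by move=> ab; transitivity (u + s + (a + b) * p); [rewrite ab mul0r addr0|ring].
exact: (alg _ _ _ _ _ T1).
Qed.

Let cH J : continuous (H J).
Proof.
apply: C0_sum => i; apply: C0M; apply: smooth_continuous.
  by apply: smooth_comp_snd; exact: smooth_vJ.
by apply: smooth_derive.
Qed.

Let HK J z : ~ K z -> H J z = 0.
Proof.
move=> Kz; rewrite /H big1// => i _.
by rewrite (derive_off_compact _ cK (PhiK J) Kz) mulr0.
Qed.

Let cD J : continuous ('D_e0 (Phi J)).
Proof. by apply: smooth_continuous; exact: smooth_derive. Qed.

Let DK J z : ~ K z -> 'D_e0 (Phi J) z = 0.
Proof. by move=> Kz; rewrite (derive_off_compact _ cK (PhiK J) Kz). Qed.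

Let L1_off (F : R * V -> R) : continuous F -> (forall z, ~ K z -> F z = 0) ->
  [/\ L1 (mu1 \x mu)%E (fun z => ind T z.1 * F z),
   forall t, L1 mu (fun x => ind T t * F (t, x)) & forall x, L1 mu1 (fun t => ind T t * F (t, x))].
Proof.
move=> cF FK; have [C C0 hC] := compact_support_weight cF cK FK.
have mF := continuous_measurable_RV cF; split.
- by apply: (@L1_slab R n T F (fun x => C * weight x)) => //; apply: L1Z; exact: L1_weight.
- move=> t; apply: L1Z; apply: (L1_dominated (g := fun x => C * weight x)).
  + exact: (measurableT_comp mF (pair1_measurable t)).
  + by apply: L1Z; exact: L1_weight.
  + by move=> x; exact: hC.
- move=> x; apply: (@L1_dominated _ _ R mu1 (fun t => ind T t * (C * weight x))).
  + apply: measurable_funM; first exact: L1_measurable (L1_ind T).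
    exact: (measurableT_comp mF (pair2_measurable x)).
  + by apply: L1Zr; exact: L1_ind.
  + move=> t; have i0 : 0 <= ind T t by rewrite indE.
    by rewrite normrM ger0_norm// ler_wpM2l//; exact: (hC (t, x)).
Qed.

(** On each time slice this pairs a divergence-free field with a gradient. *)
Let Int_H J : \int[(mu1 \x mu)%E]_z (ind T z.1 * H J z) = 0.
Proof.
have [h1 h2 _] := L1_off (@cH J) (@HK J).
rewrite Int_prod12//= (_ : (fun t => _) = fun=> 0) ?Int0//.
apply/funext => t; have HE x : H J (t, x) = \sum_i vJG J i x * 'D_(basis_vec i) (fun y => Phi J (t, y)) x.
  apply: eq_bigr => i _; congr (_ * _).
  by have [_ ->] := is_derive_slice2 t x (basis_vec i) (sPhi J).
have sl : schw (fun y => Phi J (t, y)).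
  apply: (@schw_of_supported _ _ 2); first exact: smooth_slice2.
  move=> x x2; rewrite /Phi /thetaJ /psum big1 ?mul0r// => j _.
  by apply: dil_outside => // k; exact: ann_vth.
have [C C0 hC] := compact_support_weight (@cH J) cK (@HK J).
rewrite IntZ; last first.
  apply: (L1_dominated (g := fun x => C * weight x)).
  + exact: (measurableT_comp (continuous_measurable_RV (@cH J)) (pair1_measurable t)).
  + by apply: L1Z; exact: L1_weight.
  + by move=> x; exact: (hC (t, x)).
rewrite (_ : (fun x => H J (t, x)) =
  fun x => \sum_i vJG J i x * 'D_(basis_vec i) (fun y => Phi J (t, y)) x); last exact/funext.
by rewrite vJ_divergence_free// mulr0.
Qed.

Let Int_D J : \int[(mu1 \x mu)%E]_z (ind T z.1 * 'D_e0 (Phi J) z) = - \int[mu]_x Phi J (0, x).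
Proof.
have [h1 _ h2] := L1_off (@cD J) (@DK J).
rewrite Int_prod21//=.
have E x : \int[mu1]_t (ind T t * 'D_e0 (Phi J) (t, x)) = - Phi J (0, x).
  have -> : \int[mu1]_t (ind T t * 'D_e0 (Phi J) (t, x)) =
      \int[mu1]_(t in `[0, T]) 'D_e0 (Phi J) (t, x).
    rewrite [RHS]Rintegral_mkcond; apply: eq_Rintegral => t _.
    by rewrite patchE /ind indicE; case: ifP => _; rewrite ?mul1r ?mul0r.
  rewrite /Rintegral (@continuous_FTC2 R _ (fun t => Phi J (t, x)))//=.
  (* The test function is supported in times smaller than T, so only the endpoint 0 contributes. *)
  - by rewrite {1}/Phi phiK ?mulr0 ?sub0r// => /KT /=; rewrite ltxx.
  - apply: continuous_subspaceT => t.
    apply: (@continuous_comp _ _ _ (fun t : R => (t, x)) ('D_e0 (Phi J))); last exact: cD.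
    exact: continuous_pair_r.
  - have c t : {for t, continuous (fun t => Phi J (t, x))}.
      apply: (@continuous_comp _ _ _ (fun t : R => (t, x)) (Phi J)); last exact: smooth_continuous.
      exact: continuous_pair_r.
    split; [|exact: cvg_at_right_filter (c 0)|exact: cvg_at_left_filter (c T)].
    by move=> t _; have [] := is_derive_slice1 t x (sPhi J).
  - by move=> t _; rewrite derive1E; have [_ ->] := is_derive_slice1 t x (sPhi J).
under eq_Rintegral do rewrite E.
have cP : continuous (Phi J) by exact: smooth_continuous.
have [C C0 hC] := compact_support_weight cP cK (@PhiK J).
rewrite IntN//; apply: (L1_dominated (g := fun x => C * weight x)).
- exact: (measurableT_comp (continuous_measurable_RV cP) (pair1_measurable (0 : mR))).
- by apply: L1Z; exact: L1_weight.
- by move=> x; exact: (hC (0, x)).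
Qed.

Let Int_fJ J : \int[(mu1 \x mu)%E]_z (ind T z.1 * fJ J z) = - \int[mu]_x Phi J (0, x).
Proof.
under eq_Rintegral do rewrite fJE mulrDr.
have [d1 _ _] := L1_off (@cD J) (@DK J); have [h1 _ _] := L1_off (@cH J) (@HK J).
by rewrite IntD// Int_H Int_D addr0.
Qed.

(** At each point the partial sums are eventually constant in J, and they stay below [env], so the
    identity for smooth partial sums passes to the limit by dominated convergence. *)
Lemma weak_form_compact :
  \int[(mu1 \x mu)%E]_(z in (`[0%R, T] : set R) `*` [set: V])
    (thetaG z.1 z.2 * ('D_e0 phi z + \sum_i vfieldG z.2 0 i * 'D_(e i) phi z))
    + \int[mu]_x (thetaG 0 x * phi (0, x)) = 0.
Proof.
have bnd (F : R * V -> R) : continuous F -> (forall z, ~ K z -> F z = 0) ->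
    exists C : R, forall z, `|F z| <= C.
  move=> cF FK; have [C C0 hC] := compact_support_weight cF cK FK.
  by exists C => z; rewrite (le_trans (hC z))// ler_piMr// weight_le1.
have cd (w : R * V) : continuous ('D_w phi) by apply: smooth_continuous; exact: smooth_derive.
have dK (w z : R * V) : ~ K z -> 'D_w phi z = 0 by exact: derive_off_compact.
have [c0 hc0] := bnd _ (cd e0) (dK e0).
have /choice[c hc] i := bnd _ (cd (e i)) (dK (e i)).
have [cp hcp] := bnd _ (smooth_continuous sphi) phiK.
have [M M0 [hM hMJ]] := vfield_bounded.
pose Ct := c0 + \sum_i M * c i.
have fJ_le J z : `|fJ J z| <= env z.2 * Ct.
  rewrite /fJ normrM ler_pM// ?thetaJ_le// (le_trans (ler_normD _ _))// lerD//.
  rewrite (le_trans (ler_norm_sum _ _ _))// ler_sum// => i _.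
  by rewrite normrM ler_pM.
have ci (F : R * V -> R) : continuous F -> measurable_fun setT (F : mR * V -> R).
  exact: continuous_measurable_RV.
have mi : measurable_fun setT (fun z : mR * V => ind T z.1).
  exact: measurableT_comp (L1_measurable (L1_ind T)) measurable_fst.
have [|||z|_ lim1] := @Int_cvg _ _ R (mu1 \x mu)%E
  (fun J z => ind T z.1 * fJ J z)
  (fun z => ind T z.1 * (thetaG z.1 z.2 * ('D_e0 phi z + \sum_i vfieldG z.2 0 i * 'D_(e i) phi z)))
  (fun z : mR * V => ind T z.1 * (env z.2 * Ct)).
- move=> J; apply: measurable_funM => //; apply: ci; apply: C0M.
    by apply: smooth_continuous; exact: sth.
  apply: C0D => //; apply: C0_sum => i; apply: C0M => //.
  by apply: smooth_continuous; apply: smooth_comp_snd; exact: smooth_vJ.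
- exact: (L1_prod (L1_ind T) (L1Zr Ct L1_env)).
- move=> J z; have i0 : 0 <= ind T z.1 by rewrite indE.
  by rewrite normrM ger0_norm// ler_wpM2l.
- apply: cvg_near_cst; exists (aidx z.2) => // J /= xJ.
  by rewrite /fJ thetaJE//; congr (_ * (_ * (_ + _))); apply: eq_bigr => i _; rewrite vJE.
have [|||x|_ lim2] := @Int_cvg _ _ R mu (fun J x => Phi J (0, x)) (fun x => thetaG 0 x * phi (0, x))
  (fun x => env x * cp).
- move=> J; apply: (measurableT_comp (ci _ _) (pair1_measurable (0 : mR))).
  by apply: smooth_continuous; exact: sPhi.
- by apply: L1Zr; exact: L1_env.
- by move=> J x; rewrite normrM ler_pM// (thetaJ_le J (0, x)).
- by apply: cvg_near_cst; exists (aidx x) => // J /= xJ; rewrite /Phi thetaJE.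
rewrite Rintegral_slab.
have lim3 : (fun J => \int[(mu1 \x mu)%E]_z (ind T z.1 * fJ J z)) @ \oo -->
    - \int[mu]_x (thetaG 0 x * phi (0, x)).
  by under eq_fun do rewrite Int_fJ; apply: cvgN; apply: lim2.
rewrite (cvg_unique _ lim1 lim3) ?addNr//.
Qed.

End weak_form.

Lemma vortex_weak_solution T : 0 < T -> weak_solution T (fun=> vfieldG) thetaG.
Proof.
move=> T0; split.
- by move=> K; exact: theta_integrable_slab.
- by move=> t _; apply: L1_locally_integrable; exact: L1_theta.
- by move=> phi; exact: continuous_Int_theta.
- move=> phi [/smooth_on_smooth sphi [K [cK KT phiK]]].
  exact: (@weak_form_compact T phi K).
Qed.

Lemma vortex_compact_support t x : 2 < `|x| -> vfieldG x = 0 /\ thetaG t x = 0.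
Proof.
move=> x2; split.
  apply/rowP => i; rewrite !mxE; apply: asum_outside => j.
  by apply: dil_outside => // _; exact: ann_psi.
by apply: asum_outside => j; apply: dil_outside => // k; exact: ann_vth.
Qed.

Lemma open_punctured : open [set z : R * V | z.2 != 0].
Proof.
have -> : [set z : R * V | z.2 != 0] = snd @^-1` (~` [set 0 : V]).
  by apply/seteqP; split=> z /= /eqP.
apply: open_comp; first by move=> z _; exact: cvg_snd.
apply: closed_openC; apply: compact_closed; [exact: norm_hausdorff|exact: compact_set1].
Qed.

Lemma locally_aidx (z : R * V) : z.2 != 0 -> exists J, \near z, (aidx z.2 <= J)%N.
Proof.
move=> /aidx_locally[J HJ]; exists J.
have H : snd x @[x --> z] --> z.2 by exact: cvg_snd.
exact: (H _ HJ).
Qed.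

Lemma smooth_theta_punctured T :
  smooth_on_set ((`[0, T] : set R) `*` ~` [set (0 : V)]) (fun z : R * V => thetaG z.1 z.2).
Proof.
exists [set z : R * V | z.2 != 0], (fun z => thetaG z.1 z.2); split=> //.
- exact: open_punctured.
- by move=> z [_ /= /eqP].
- apply: smooth_on_local => z /locally_aidx[J HJ]; exists (thetaJG J); split.
    by apply: filterS HJ => y yJ; rewrite thetaJE.
  by apply: smooth_smooth_on; exact: smooth_thetaJ.
Qed.

Lemma smooth_vfield_punctured T :
  smooth_on_set ((`[0, T] : set R) `*` ~` [set (0 : V)]) (fun z : R * V => vfieldG z.2).
Proof.
exists [set z : R * V | z.2 != 0], (fun z => vfieldG z.2); split=> //.
- exact: open_punctured.
- by move=> z [_ /= /eqP].
- apply: smooth_on_local => z /locally_aidx[J HJ].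
  exists (fun z => \row_i vJG J i z.2); split.
    by apply: filterS HJ => y yJ; apply/rowP => i; rewrite [RHS]mxE vJE.
  apply: smooth_on_row => i; under eq_fun do rewrite mxE.
  by apply: smooth_comp_snd; exact: smooth_vJ.
Qed.

End vortex_solution.

(** * Tempered distributions *)

Section complex_functions.
Context {R : realType} {n : nat}.
Local Notation V := 'rV[R]_n.
Local Notation C := R[i].
Local Notation mu := (lebesgue_rV n).
Local Notation reC := (@complex.Re R).
Local Notation imC := (@complex.Im R).
Implicit Types (f F : V -> R) (g phi psi : V -> C) (z : C).

Lemma cReM z1 z2 : reC (z1 * z2) = reC z1 * reC z2 - imC z1 * imC z2.
Proof. by case: z1 z2 => a b [c d]. Qed.

Lemma cImM z1 z2 : imC (z1 * z2) = reC z1 * imC z2 + imC z1 * reC z2.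
Proof. by case: z1 z2 => a b [c d]. Qed.

Lemma cReD z1 z2 : reC (z1 + z2) = reC z1 + reC z2.
Proof. by case: z1 z2 => a b [c d]. Qed.

Lemma cImD z1 z2 : imC (z1 + z2) = imC z1 + imC z2.
Proof. by case: z1 z2 => a b [c d]. Qed.

Lemma complexP z1 z2 : reC z1 = reC z2 -> imC z1 = imC z2 -> z1 = z2.
Proof. by case: z1 z2 => a b [c d] /= -> ->. Qed.

Lemma normc_sqr z : normc z ^+ 2 = reC z ^+ 2 + imC z ^+ 2.
Proof. by case: z => a b /=; rewrite sqr_sqrtr// addr_ge0 ?sqr_ge0. Qed.

Lemma Re_le_normc z : `|reC z| <= normc z.
Proof. by case: z => a b /=; rewrite -sqrtr_sqr ler_sqrt ?addr_ge0 ?sqr_ge0// lerDl sqr_ge0. Qed.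

Lemma Im_le_normc z : `|imC z| <= normc z.
Proof. by case: z => a b /=; rewrite -sqrtr_sqr ler_sqrt ?addr_ge0 ?sqr_ge0// lerDr sqr_ge0. Qed.

Lemma normc_le_ReIm z : normc z <= `|reC z| + `|imC z|.
Proof.
case: z => a b /=; rewrite -[leRHS]ger0_norm ?addr_ge0// -sqrtr_sqr.
rewrite ler_sqrt ?sqr_ge0// sqrrD !real_normK ?num_real//.
have := normr_ge0 a; have := normr_ge0 b; set u := `|a|; set v := `|b|; nra.
Qed.

Lemma normc_ge0 z : 0 <= normc z.
Proof. by case: z => a b /=; exact: sqrtr_ge0. Qed.

Lemma bracket_le_enorm (x : V) K : (1 + `|x|) ^+ K <= 2 ^+ K * (1 + enorm x ^+ K).
Proof.
have e0 := enorm_ge0 x; have h := norm_le_enorm x.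
apply: (@le_trans _ _ ((2 * Num.max 1 (enorm x)) ^+ K)).
  rewrite lerXn2r ?nnegrE ?addr_ge0 ?mulr_ge0//; first by rewrite le_max ler01.
  have : 1 <= Num.max 1 (enorm x) by rewrite le_max lexx.
  have : enorm x <= Num.max 1 (enorm x) by rewrite le_max lexx orbT.
  by set M := Num.max _ _; lra.
rewrite exprMn ler_wpM2l ?exprn_ge0//.
rewrite maxEle; case: ifP => _; first by rewrite lerDr.
by rewrite expr1n lerDl exprn_ge0.
Qed.

(** Covers at once the two kinds of densities that occur: integrable functions, such as theta, and
    measurable functions of polynomial growth, such as their weighted transforms. *)
Definition tempered_growth (f : V -> R) := measurable_fun setT f /\
  exists F K, L1 mu F /\ forall x, `|f x| <= F x * (1 + `|x|) ^+ K.

Lemma tempered_growth_L1 f : L1 mu f -> tempered_growth f.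
Proof.
move=> f1; split; first exact: (L1_measurable f1).
exists (fun x => `|f x|), 0%N; split; first exact: L1_abs.
by move=> x; rewrite expr0 mulr1.
Qed.

Lemma tempered_growth_poly f (c : R) K : measurable_fun setT f ->
  (forall x, `|f x| <= c * (1 + `|x|) ^+ K) -> tempered_growth f.
Proof.
move=> mf fc; split=> //; exists (fun x => c * weight x), (K + 2 * n)%N; split.
  by apply: L1Z; exact: L1_weight.
have c0 : 0 <= c.
  by have := le_trans (normr_ge0 _) (fc 0); rewrite normr0 addr0 expr1n mulr1.
move=> x; apply: (le_trans (fc x)); rewrite exprD -!mulrA ler_wpM2l//.
rewrite mulrCA -[leLHS]mulr1 ler_wpM2l ?exprn_ge0 ?addr_ge0//.
by rewrite mulrC weight_lower.
Qed.

Lemma tempered_growth_loc f : tempered_growth f -> locally_integrable_rV f.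
Proof.
move=> [mf [F [K [F1 fF]]]] Q cQ; have mQ := compact_measurable_rV cQ.
have [M [Mr HM]] := compact_bounded cQ.
apply: (@le_integrable _ _ _ mu Q mQ _ (EFin \o (fun x => F x * (1 + (`|M| + 1)) ^+ K))).
- by apply/measurable_EFinP; exact: measurable_funTS.
- move=> x Qx /=; rewrite lee_fin.
  have F0 : 0 <= F x.
    by have := le_trans (normr_ge0 _) (fF x); rewrite pmulr_lge0// bracketX_gt0.
  rewrite [leRHS]ger0_norm ?mulr_ge0 ?exprn_ge0 ?addr_ge0//.
  apply: (le_trans (fF x)); rewrite ler_wpM2l// lerXn2r ?nnegrE ?addr_ge0// lerD2l.
  by apply: (HM (`|M| + 1)) => //; rewrite (le_lt_trans (ler_norm _))// ltrDl.
- by apply: (integrableS measurableT) => //; exact: (L1Zr _ F1).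
Qed.

Lemma growth_L1 f (h : V -> R) F K c : measurable_fun setT f -> L1 mu F ->
  (forall x, `|f x| <= F x * (1 + `|x|) ^+ K) -> measurable_fun setT h ->
  (forall x, (1 + `|x|) ^+ K * `|h x| <= c) ->
  L1 mu (fun x => f x * h x) /\ (`|\int[mu]_x (f x * h x)| <= c * \int[mu]_x F x).
Proof.
move=> mf F1 fF mh hc.
have b x : `|f x * h x| <= c * F x.
  have p0 : 0 < (1 + `|x|) ^+ K by rewrite exprn_gt0// (lt_le_trans ltr01)// lerDl.
  have F0 : 0 <= F x by have := le_trans (normr_ge0 _) (fF x); rewrite pmulr_lge0.
  rewrite normrM (le_trans (ler_wpM2r _ (fF x)))//.
  by rewrite -mulrA mulrC ler_wpM2r.
have m : measurable_fun setT (fun x => f x * h x) by exact: measurable_funM.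
have cF : L1 mu (fun x => c * F x) by exact: L1Z.
split; first by apply: (L1_dominated (g := fun x => c * F x)).
by rewrite -IntZ//; apply: le_norm_Int_dom.
Qed.

Lemma schwartz_Re phi : schwartz phi -> measurable_fun setT (reC \o phi).
Proof.
move=> [[s _] _]; apply: continuous_measurable_rV.
exact: smooth_continuous (smooth_on_smooth s).
Qed.

Lemma schwartz_Im phi : schwartz phi -> measurable_fun setT (imC \o phi).
Proof.
move=> [[_ s] _]; apply: continuous_measurable_rV.
exact: smooth_continuous (smooth_on_smooth s).
Qed.

Lemma seminorm_bracket phi K (M : R) :
  (forall k, (k <= K)%N -> forall x, enorm x ^+ k * normc (phi x) <= M) ->
  forall x, (1 + `|x|) ^+ K * normc (phi x) <= 2 ^+ K * (M + M).
Proof.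
move=> h x; have h0 := h 0%N (leq0n _) x; have hK := h K (leqnn _) x.
rewrite expr0 mul1r in h0.
apply: (le_trans (ler_wpM2r (normc_ge0 _) (bracket_le_enorm x K))).
by rewrite -mulrA ler_wpM2l ?exprn_ge0// mulrDl mul1r lerD.
Qed.

Lemma cpartial_nil phi : cpartial [::] phi = phi.
Proof. by apply/funext => x; rewrite /cpartial /=; case: (phi x). Qed.

Lemma schwartz_bracket phi K : schwartz phi ->
  exists c : R, forall x, (1 + `|x|) ^+ K * normc (phi x) <= c.
Proof.
move=> [_ h]; have [M0 h0] := h 0%N [::]; have [MK hK] := h K [::].
rewrite cpartial_nil in h0 hK.
exists (2 ^+ K * (M0 + MK)) => x.
have h0' := h0 x; rewrite expr0 mul1r in h0'.
apply: (le_trans (ler_wpM2r (normc_ge0 _) (bracket_le_enorm x K))).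
by rewrite -mulrA ler_wpM2l ?exprn_ge0// mulrDl mul1r lerD.
Qed.

Definition ctempered_growth g := tempered_growth (reC \o g) /\ tempered_growth (imC \o g).

Lemma tempered_growth_joint f1 f2 : tempered_growth f1 -> tempered_growth f2 ->
  exists F K, [/\ L1 mu F, forall x, `|f1 x| <= F x * (1 + `|x|) ^+ K &
    forall x, `|f2 x| <= F x * (1 + `|x|) ^+ K].
Proof.
move=> [_ [F1 [K1 [hF1 h1]]]] [_ [F2 [K2 [hF2 h2]]]].
exists (fun x => `|F1 x| + `|F2 x|), (maxn K1 K2); split.
- by apply: L1D; exact: L1_abs.
- move=> x; apply: (le_trans (h1 x)).
  apply: (le_trans (ler_wpM2r _ (ler_norm _))); first by rewrite exprn_ge0.
  by rewrite ler_pM ?exprn_ge0 ?lerDl// ler_weXn2l ?bracket_ge1// leq_maxl.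
- move=> x; apply: (le_trans (h2 x)).
  apply: (le_trans (ler_wpM2r _ (ler_norm _))); first by rewrite exprn_ge0.
  by rewrite ler_pM ?exprn_ge0 ?lerDr// ler_weXn2l ?bracket_ge1// leq_maxr.
Qed.

Lemma tempered_dist_of g : ctempered_growth g -> tempered (dist_of g).
Proof.
move=> [tr ti]; have [F [K [F1 hr hi]]] := tempered_growth_joint tr ti.
have [mr _] := tr; have [mi _] := ti.
have P (f : V -> R) (h : V -> R) phi c : measurable_fun setT f ->
    (forall x, `|f x| <= F x * (1 + `|x|) ^+ K) -> measurable_fun setT h ->
    (forall x, `|h x| <= normc (phi x)) ->
    (forall x, (1 + `|x|) ^+ K * normc (phi x) <= c) ->
    L1 mu (fun x => f x * h x) /\ (`|\int[mu]_x (f x * h x)| <= c * \int[mu]_x F x).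
  move=> mf fF mh hphi hc; apply: (@growth_L1 _ _ F K) => // x.
  by apply: le_trans (hc x); rewrite ler_wpM2l ?exprn_ge0.
have uE phi : schwartz phi -> dist_of g phi =
    Complex (\int[mu]_x (reC (g x) * reC (phi x)) - \int[mu]_x (imC (g x) * imC (phi x)))
            (\int[mu]_x (reC (g x) * imC (phi x)) + \int[mu]_x (imC (g x) * reC (phi x))).
  move=> sphi; have [c hc] := schwartz_bracket K sphi.
  have mR := schwartz_Re sphi; have mI := schwartz_Im sphi.
  have R1 x : `|reC (phi x)| <= normc (phi x) := Re_le_normc _.
  have I1 x : `|imC (phi x)| <= normc (phi x) := Im_le_normc _.
  rewrite /dist_of /cintegral; congr Complex.
    under eq_Rintegral do rewrite cReM.
    by rewrite IntB//; [have [] := P _ _ phi c mr hr mR R1 hc|have [] := P _ _ phi c mi hi mI I1 hc].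
  under eq_Rintegral do rewrite cImM.
  by rewrite IntD//; [have [] := P _ _ phi c mr hr mI I1 hc|have [] := P _ _ phi c mi hi mR R1 hc].
split.
  move=> a phi psi sphi spsi.
  have [c hc] := schwartz_bracket K sphi; have [c' hc'] := schwartz_bracket K spsi.
  have mR := schwartz_Re sphi; have mI := schwartz_Im sphi.
  have mR' := schwartz_Re spsi; have mI' := schwartz_Im spsi.
  have R1 x : `|reC (phi x)| <= normc (phi x) := Re_le_normc _.
  have I1 x : `|imC (phi x)| <= normc (phi x) := Im_le_normc _.
  have R1' x : `|reC (psi x)| <= normc (psi x) := Re_le_normc _.
  have I1' x : `|imC (psi x)| <= normc (psi x) := Im_le_normc _.
  have [rr _] := P _ _ phi c mr hr mR R1 hc; have [ri _] := P _ _ phi c mr hr mI I1 hc.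
  have [ir _] := P _ _ phi c mi hi mR R1 hc; have [ii _] := P _ _ phi c mi hi mI I1 hc.
  have [rr' _] := P _ _ psi c' mr hr mR' R1' hc'; have [ri' _] := P _ _ psi c' mr hr mI' I1' hc'.
  have [ir' _] := P _ _ psi c' mi hi mR' R1' hc'; have [ii' _] := P _ _ psi c' mi hi mI' I1' hc'.
  rewrite (uE phi)// (uE psi)// /dist_of /cintegral.
  case: a => a b; apply: complexP => /=.
    transitivity (\int[mu]_x
      (a * (reC (g x) * reC (phi x) - imC (g x) * imC (phi x)) -
       b * (reC (g x) * imC (phi x) + imC (g x) * reC (phi x)) +
       (reC (g x) * reC (psi x) - imC (g x) * imC (psi x)))).
      by apply: eq_Int => x; rewrite cReM cReD cImD cReM cImM /=; ring.
    rewrite IntD; [|by apply: L1B; apply: L1Z; [exact: L1B|exact: L1D]|exact: L1B].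
    rewrite IntB; [|by apply: L1Z; exact: L1B|by apply: L1Z; exact: L1D].
    rewrite !IntZ; [|exact: L1D|exact: L1B].
    by rewrite IntB// IntD// IntB//; ring.
  transitivity (\int[mu]_x
      (a * (reC (g x) * imC (phi x) + imC (g x) * reC (phi x)) +
       b * (reC (g x) * reC (phi x) - imC (g x) * imC (phi x)) +
       (reC (g x) * imC (psi x) + imC (g x) * reC (psi x)))).
    by apply: eq_Int => x; rewrite cImM cReD cImD cReM cImM /=; ring.
  rewrite IntD; [|by apply: L1D; apply: L1Z; [exact: L1D|exact: L1B]|exact: L1D].
  rewrite IntD; [|by apply: L1Z; exact: L1D|by apply: L1Z; exact: L1B].
  rewrite !IntZ; [|exact: L1B|exact: L1D].
  by rewrite IntD// IntB// IntD//; ring.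
(* Four real pairings, each at most 2^K (M + M) times the integral of F. *)
exists K, (2 ^+ K * 8 * \int[mu]_x F x) => phi M sphi hM.
have hc : forall x, (1 + `|x|) ^+ K * normc (phi x) <= 2 ^+ K * (M + M).
  apply: seminorm_bracket => k kK x.
  by have := hM k [::] x kK (leq0n _); rewrite cpartial_nil.
have mR := schwartz_Re sphi; have mI := schwartz_Im sphi.
have R1 x : `|reC (phi x)| <= normc (phi x) := Re_le_normc _.
have I1 x : `|imC (phi x)| <= normc (phi x) := Im_le_normc _.
have [_ rr] := P _ _ phi _ mr hr mR R1 hc; have [_ ri] := P _ _ phi _ mr hr mI I1 hc.
have [_ ir] := P _ _ phi _ mi hi mR R1 hc; have [_ ii] := P _ _ phi _ mi hi mI I1 hc.
rewrite uE//; apply: (le_trans (normc_le_ReIm _)) => /=.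
apply: (le_trans (lerD (ler_normB _ _) (ler_normD _ _))).
apply: (le_trans (lerD (lerD rr ii) (lerD ri ir))).
by rewrite le_eqVlt; apply/orP; left; apply/eqP; ring.
Qed.

Lemma tempered_dist_of_real f : L1 mu f -> tempered (dist_of_real f).
Proof.
move=> f1; apply: tempered_dist_of; split; apply: tempered_growth_L1 => //.
exact: L1_0.
Qed.

(** The imaginary part of exp(- i x . xi) is cos(x . xi + pi / 2), so the phase pi / 2 already
    contains the sign of the convention. *)
Lemma fourier_funE phi (xi : V) : schw (reC \o phi) -> schw (imC \o phi) ->
  fourier_fun phi xi = Complex (Tr 0 (reC \o phi) xi - Tr (pi / 2) (imC \o phi) xi)
                               (Tr 0 (imC \o phi) xi + Tr (pi / 2) (reC \o phi) xi).
Proof.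
move=> /schw_L1 r1 /schw_L1 i1.
rewrite /fourier_fun /cintegral /Tr; congr Complex.
  rewrite -IntB; try exact: L1_cos.
  apply: eq_Int => x; rewrite cReM /= cosN sinN addr0 cosD_pihalf; ring.
rewrite -IntD; try exact: L1_cos.
apply: eq_Int => x; rewrite cImM /= cosN sinN addr0 cosD_pihalf; ring.
Qed.

Lemma Tr_growth al f : L1 mu f -> tempered_growth (Tr al f).
Proof.
move=> f1; apply: (@tempered_growth_poly _ (\int[mu]_x `|f x|) 0); first exact: measurable_Tr.
by move=> x; rewrite expr0 mulr1; exact: Tr_bound.
Qed.

Lemma ctest_schw phi : ctest_function phi -> schw (reC \o phi) /\ schw (imC \o phi).
Proof. by move=> [/test_function_schw ? /test_function_schw ?]. Qed.

Lemma ctempered_growth_loc g : ctempered_growth g -> clocally_integrable g.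
Proof. by move=> [tr ti]; split; exact: tempered_growth_loc. Qed.

(** The transform is moved from the test function to f by the symmetry [Tr_swap], in each of the
    four real pairings. *)
Lemma represents_fourier_real f : L1 mu f ->
  represents (fun xi => Complex (Tr 0 f xi) (Tr (pi / 2) f xi)) (fourier (dist_of_real f)).
Proof.
move=> f1; split.
  by apply: ctempered_growth_loc; split; exact: Tr_growth.
move=> phi /ctest_schw[sr si].
have r1 := schw_L1 sr; have i1 := schw_L1 si.
have L al h : schw h -> L1 mu (fun x => f x * Tr al h x).
  move=> sh; rewrite (_ : (fun x => _) = (fun x => Tr al h x * f x)); last first.
    by apply/funext => x; rewrite mulrC.
  by apply: L1_Tr_mul => //; exact: schw_L1.
rewrite /fourier /dist_of_real /dist_of /cintegral; congr Complex.
  transitivity (\int[mu]_x (f x * Tr 0 (reC \o phi) x - f x * Tr (pi / 2) (imC \o phi) x)).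
    by apply: eq_Int => x; rewrite fourier_funE// cReM /=; ring.
  rewrite IntB ?L//; try exact: L.
  rewrite -!Tr_swap// -IntB; try exact: L1_Tr_mul.
  by apply: eq_Int => x; rewrite cReM.
transitivity (\int[mu]_x (f x * Tr 0 (imC \o phi) x + f x * Tr (pi / 2) (reC \o phi) x)).
  by apply: eq_Int => x; rewrite fourier_funE// cImM /=; ring.
rewrite IntD; try exact: L.
rewrite -!Tr_swap// -IntD; try exact: L1_Tr_mul.
by apply: eq_Int => x; rewrite cImM.
Qed.

End complex_functions.

(** * Regularity of the initial datum *)

Section dyadic_transform.
Context {R : realType} {n : nat}.
Local Notation V := 'rV[R]_n.
Local Notation mu := (lebesgue_rV n).
Implicit Types (F f eta : V -> R) (x xi : V).

Lemma cvg_norm_le_nneseries (u a : nat -> R) (l : R) : (forall j, 0 <= a j) ->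
  (forall J, `|u J| <= \sum_(j < J) a j) -> u @ \oo --> l ->
  (`|l|%:E <= \sum_(0 <= j <oo) (a j)%:E)%E.
Proof.
move=> a0 ua ul.
have S0 : (0 <= \sum_(0 <= j <oo) (a j)%:E)%E by apply: nneseries_ge0 => j _ _; rewrite lee_fin.
have [->|Soo] := eqVneq (\sum_(0 <= j <oo) (a j)%:E)%E +oo%E; first by rewrite leey.
have Sfin : (\sum_(0 <= j <oo) (a j)%:E)%E \is a fin_num by rewrite ge0_fin_numE// ltey.
rewrite -(fineK Sfin) lee_fin.
have ul' : `|u J| @[J --> \oo] --> `|l| by exact: cvg_norm.
rewrite -(cvg_lim _ ul')//; apply: limr_le; first by apply/cvg_ex; exists `|l|.
apply: nearW => J; apply: (le_trans (ua J)).
rewrite -lee_fin fineK// -sumEFin -(big_mkord xpredT (fun j => (a j)%:E)).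
by apply: nneseries_lim_ge => j _ _; rewrite lee_fin.
Qed.

Lemma L1_asum_dil (c : R) F : 0 < c -> c * 2 ^- n < 1 -> ann_supp F -> L1 mu F ->
  L1 mu (asum (dil c (fun=> F))).
Proof.
move=> c0 cn aF F1.
have aP : annular (dil c (fun=> F)) by apply: annular_dil.
apply: (@dyadic_L1 _ _ c 2 (fun y => `|F y|)) => //; first exact: L1_abs.
  apply: measurable_asum => // j; apply: measurable_funM => //.
  by apply: measurable_dilate; exact: (L1_measurable F1).
move=> x; rewrite asum_norm//.
rewrite (_ : asum _ x = asum (fun j x => c ^+ j * `|F (2 ^+ j *: x)|) x).
  by apply: asum_le_nneseries => j; rewrite mulr_ge0// exprn_ge0// ltW.
by apply: eq_bigr => j _; rewrite /dil normrM ger0_norm// exprn_ge0// ltW.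
Qed.

Lemma ann_supp_absf F : ann_supp F -> ann_supp (fun y => `|F y|).
Proof. by move=> aF y; rewrite normr_eq0 => /aF. Qed.

Section series.
Variables (c : R) (eta : V -> R).
Hypotheses (c0 : 0 < c) (cn : c * 2 ^- n < 1) (aeta : ann_supp eta) (eta1 : L1 mu eta).

Let P := dil c (fun=> eta).
Let aP : annular P. Proof. exact: annular_dil. Qed.

Let cX0 j : 0 <= c ^+ j. Proof. by rewrite exprn_ge0// ltW. Qed.

Lemma L1_dil_env : L1 mu (asum (fun j x => `|P j x|)).
Proof.
rewrite (_ : (fun j x => _) = dil c (fun=> (fun y => `|eta y|))).
  by apply: L1_asum_dil => //; [exact: ann_supp_absf|exact: L1_abs].
by apply/funext => j; apply/funext => x; rewrite /P /dil normrM ger0_norm.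
Qed.

Lemma L1_dil j : L1 mu (P j).
Proof. by apply: L1Z; apply: L1_scale => //; rewrite expf_neq0// pnatr_eq0. Qed.

Lemma Tr_dil al j xi :
  Tr al (P j) xi = (c * 2 ^- n) ^+ j * Tr al eta (2^-1 ^+ j *: xi).
Proof.
rewrite /P /dil TrZ; last by apply: L1_scale => //; rewrite expf_neq0// pnatr_eq0.
rewrite Tr_scale ?exprn_gt0// mulrA exprMn exprVn; congr (_ * _ * _).
by rewrite exprVn -!exprM mulnC.
Qed.

Lemma cvg_Tr_asum al xi :
  (fun J => \sum_(j < J) (c * 2 ^- n) ^+ j * Tr al eta (2^-1 ^+ j *: xi)) @ \oo -->
  Tr al (asum P) xi.
Proof.
have [|||x|_ h] := @Int_cvg _ _ R mu (fun J x => cos (dot x xi + al) * psum P J x)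
  (fun x => cos (dot x xi + al) * asum P x) (asum (fun j x => `|P j x|)).
- move=> J; apply: L1_measurable (L1_cos _ _ _).
  by apply: L1_sum => j; exact: L1_dil.
- exact: L1_dil_env.
- move=> J x; rewrite normrM -[leRHS]mul1r ler_pM// ?norm_cos_le1//.
  exact: psum_norm_le.
- by apply: cvg_near_cst; exists (aidx x) => // J /= xJ; rewrite psumE.
move: h; under eq_fun => J.
  rewrite -/(Tr al (psum P J) xi) /psum Tr_sum; last by move=> j; exact: L1_dil.
  under eq_bigr do rewrite Tr_dil.
  over.
by [].
Qed.

Lemma norm_Tr_asum_le al xi : (`|Tr al (asum P) xi|%:E <=
  \sum_(0 <= j <oo) ((c * 2 ^- n) ^+ j * `|Tr al eta (2^-1 ^+ j *: xi)|)%:E)%E.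
Proof.
have q0 : 0 <= c * 2 ^- n by rewrite mulr_ge0 ?invr_ge0 ?exprn_ge0// ltW.
have H := @cvg_Tr_asum al xi.
apply: (cvg_norm_le_nneseries _ _ H) => [j|J].
  by rewrite mulr_ge0// exprn_ge0.
rewrite (le_trans (ler_norm_sum _ _ _))// ler_sum// => j _.
by rewrite normrM ger0_norm// exprn_ge0.
Qed.

End series.

Lemma powR_expn (a s : R) j : 0 < a -> (a `^ s) ^+ j = (a ^+ j) `^ s.
Proof.
move=> a0; rewrite -powR_mulrn ?powR_ge0// -powRrM mulrC powRrM powR_mulrn// ltW//.
Qed.

Lemma enorm_powR_dyadic (s : R) j xi :
  enorm xi `^ s = (2 `^ s) ^+ j * enorm (2^-1 ^+ j *: xi) `^ s.
Proof.
rewrite enormZ ger0_norm ?exprn_ge0 ?invr_ge0// powRM ?exprn_ge0 ?invr_ge0 ?enorm_ge0//.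
rewrite powR_expn// mulrA -powRM ?exprn_ge0 ?invr_ge0// -exprMn divff ?pnatr_eq0//.
by rewrite expr1n powR1 mul1r.
Qed.

Lemma enorm_powR_le (s : R) : 0 <= s ->
  exists2 c : R, 0 <= c & exists K, forall xi, enorm xi `^ s <= c * (1 + `|xi|) ^+ K.
Proof.
move=> s0; pose K := (Num.truncn s).+1; exists ((1 + Num.sqrt n%:R) ^+ K).
  by rewrite exprn_ge0// addr_ge0// sqrtr_ge0.
exists K => xi; rewrite -exprMn.
have e1 : enorm xi <= (1 + Num.sqrt n%:R) * (1 + `|xi|).
  have := enorm_le_norm xi; have := sqrtr_ge0 (n%:R : R); have := normr_ge0 xi.
  set a := Num.sqrt _; set b := `|xi|; nra.
have b1 : 1 <= (1 + Num.sqrt n%:R) * (1 + `|xi|).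
  have := sqrtr_ge0 (n%:R : R); have := normr_ge0 xi.
  set a := Num.sqrt _; set b := `|xi|; nra.
apply: (@le_trans _ _ (((1 + Num.sqrt n%:R) * (1 + `|xi|)) `^ s)).
  by apply: ge0_ler_powR => //; rewrite ?nnegrE ?enorm_ge0// (le_trans ler01).
rewrite -powR_mulrn ?(le_trans ler01)// ler_powR// ltW//; exact: truncnS_gt.
Qed.

Lemma measurable_enorm_powR (s : R) : measurable_fun setT (fun xi : V => enorm xi `^ s).
Proof. exact: measurableT_comp (measurable_powR s) (@measurable_enorm R n). Qed.

(** Since [weight] is at most 1, its power with exponent p >= 1 is at most [weight]. *)
Lemma powR_weight_lty (p C : R) F : 1 <= p -> measurable_fun setT F -> (forall x, 0 <= F x) ->
  (forall x, F x <= C * weight x) -> (\int[mu]_x (F x `^ p)%:E < +oo)%E.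
Proof.
move=> p1 mF F0 FC; have p0 : 0 <= p := le_trans ler01 p1.
have C0 : 0 <= C.
  by have := le_trans (F0 0) (FC 0); rewrite pmulr_lge0// weight_gt0.
apply: (@le_lt_trans _ _ (\int[mu]_x (C `^ p * weight x)%:E)%E); last first.
  rewrite (L1_EFin (L1Z (C `^ p) (@L1_weight R n))) ltry//.
apply: ge0_le_integral => //.
- by move=> x _; rewrite lee_fin powR_ge0.
- by apply/measurable_EFinP; exact: (measurableT_comp (measurable_powR p) mF).
- by apply/measurable_EFinP; exact: L1_measurable (L1Z (C `^ p) (@L1_weight R n)).
- move=> x _; rewrite lee_fin.
  apply: (@le_trans _ _ ((C * weight x) `^ p)).
    by apply: ge0_ler_powR; rewrite ?nnegrE ?mulr_ge0 ?weight_ge0.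
  rewrite powRM ?weight_ge0// ler_wpM2l ?powR_ge0//.
  rewrite -[leRHS]powRr1 ?weight_ge0//.
  by rewrite ger_powR// weight_gt0 weight_le1.
Qed.

(** This is [dyadic_Lp] in frequency, with p = 2 and dilation factor 1 / 2: the j-th piece is d^j
    F(2^(- j) xi) with d = c 2^(s - n), and d^2 2^n = c^2 2^(2 s) 2^(- n) is the ratio of the
    hypothesis. *)
Lemma Tr_asum_Hdot (c s al : R) eta : 0 < c -> c * 2 ^- n < 1 -> ann_supp eta -> schw eta ->
  0 <= s -> c `^ 2 * 2 `^ (2 * s) * 2 ^- n < 1 ->
  (\int[mu]_xi ((enorm xi `^ s * `|Tr al (asum (dil c (fun=> eta))) xi|) `^ 2)%:E < +oo)%E.
Proof.
move=> c0 cn aeta seta s0 cs; have eta1 := schw_L1 seta.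
pose F xi := enorm xi `^ s * `|Tr al eta xi|.
pose d := c * 2 ^- n * 2 `^ s.
have d0 : 0 < d by rewrite !mulr_gt0 ?powR_gt0// invr_gt0 exprn_gt0.
have mF : measurable_fun setT F.
  apply: measurable_funM; first exact: measurable_enorm_powR.
  by apply: measurableT_comp => //; exact: measurable_Tr.
have F0 xi : 0 <= F xi by rewrite mulr_ge0 ?powR_ge0.
have [k k0 [K hK]] := enorm_powR_le s0.
have [_ /(_ (K + 2 * n)%N)[D hD]] := rapid_Tr al seta.
have FC xi : F xi <= (k * D) * weight xi.
  rewrite /F; apply: (le_trans (ler_wpM2r _ (hK xi))) => //.
  rewrite -!mulrA ler_wpM2l//; apply: le_trans (ler_wpM2r (weight_ge0 xi) (hD xi)).
  rewrite exprD -mulrA mulrAC -!mulrA ler_wpM2l ?exprn_ge0 ?addr_ge0//.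
  by rewrite mulrCA mulrA -[leLHS]mul1r ler_wpM2r// weight_lower.
apply: (@dyadic_Lp _ _ 2 d 2^-1 F) => //.
- by rewrite ler1n.
- rewrite /d powRM ?powR_ge0//; last by rewrite mulr_ge0 ?invr_ge0 ?exprn_ge0 ?ltW.
  rewrite powRM ?invr_ge0 ?exprn_ge0 ?(ltW c0)//.
  move: cs; rewrite -powRrM [s * 2]mulrC.
  rewrite exprVn invrK; set x := c `^ 2; set y := 2 `^ (2 * s).
  have -> : (2 ^- n : R) `^ 2 = 2 ^- n * 2 ^- n by rewrite -[2 in LHS]/(2%:R) powR_mulrn ?invr_ge0 ?exprn_ge0// expr2.
  have E : 2 ^- n * 2 ^+ n = 1 :> R by rewrite mulVf// expf_neq0// pnatr_eq0.
  move: E; move: (2 ^+ n) (2 ^- n) => w u E.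
  have -> : x * (u * u) * y * w = x * y * u * (u * w) by ring.
  by rewrite E mulr1.
- by apply: (powR_weight_lty _ mF F0 FC); rewrite ler1n.
- apply: measurable_funM; first exact: measurable_enorm_powR.
  apply: measurableT_comp => //; apply: measurable_Tr; exact: L1_asum_dil.
- by move=> x; rewrite mulr_ge0 ?powR_ge0.
- move=> xi; rewrite EFinM.
  apply: (le_trans (lee_wpmul2l _ (norm_Tr_asum_le c0 cn aeta eta1 al xi))).
    by rewrite lee_fin powR_ge0.
  rewrite -nneseriesZl; last first.
    by move=> j _; rewrite lee_fin mulr_ge0// exprn_ge0// mulr_ge0 ?invr_ge0 ?exprn_ge0 ?ltW.
  rewrite (eq_eseriesr (g := fun j => (d ^+ j * F (2^-1 ^+ j *: xi))%:E))// => j _.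
  rewrite -EFinM; congr EFin; rewrite (enorm_powR_dyadic s j) /F /d.
  by rewrite [in RHS]exprMn; ring.
Qed.

End dyadic_transform.

Section initial_datum.
Context {R : realType} {m : nat}.
Local Notation n := m.+2.
Local Notation V := 'rV[R]_n.
Local Notation mu := (lebesgue_rV n).
Variables (G : R -> R).
Hypotheses (sG : smooth G) (aG : ann G).
Variables (A B : R).
Hypotheses (B0 : 0 < B) (Bn : B * 2 ^- n < 1).

Lemma schw_vth la : schw (vth (m := m) G la).
Proof.
apply: (@schw_of_supported _ _ 2) => [|x x2]; last by apply: ann_supp_norm x2; exact: ann_vth.
exact: (@smooth_slice2 _ _ (vthz (m := m) G) la (smooth_vthz sG)).
Qed.

(** At time 0 all phases vanish, so the pieces are dilates of a single profile. For B = 2^(- b) the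
    condition on [B] reads s < b + n / 2. *)
Lemma theta0_in_Hdot (s : R) : 0 <= s -> B `^ 2 * 2 `^ (2 * s) * 2 ^- n < 1 ->
  in_Hdot s (dist_of_real (theta (m := m) G A B 0)).
Proof.
move=> s0 Bs; have t1 := L1_theta (m := m) sG aG A B0 Bn 0.
split; first exact: tempered_dist_of_real.
exists (fun xi => Complex (Tr 0 (theta G A B 0) xi) (Tr (pi / 2) (theta G A B 0) xi)).
split; first exact: represents_fourier_real.
have tE : theta (m := m) G A B 0 = asum (dil B (fun=> vth G 0)).
  apply/funext => x; rewrite /theta; congr (asum _ x).
  by apply/funext => j; apply/funext => y; rewrite /tp /dil mul0r.
have H al := @Tr_asum_Hdot R n B s al _ B0 Bn (ann_vth aG (la := 0)) (schw_vth 0) s0 Bs.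
have mH al : measurable_fun setT (fun xi : V => ((enorm xi `^ s *
    `|Tr al (asum (dil B (fun=> vth G 0))) xi|) `^ 2)%:E).
  apply/measurable_EFinP; apply: (measurableT_comp (measurable_powR 2)).
  apply: measurable_funM; first exact: measurable_enorm_powR.
  by apply: measurableT_comp => //; apply: measurable_Tr; rewrite -tE.
rewrite (eq_integral (fun xi : V => ((enorm xi `^ s * `|Tr 0 (asum (dil B (fun=> vth G 0))) xi|) `^ 2)%:E +
   ((enorm xi `^ s * `|Tr (pi / 2) (asum (dil B (fun=> vth G 0))) xi|) `^ 2)%:E)%E).
  rewrite ge0_integralD//; first exact: lte_add_pinfty.
  - by move=> x _; rewrite lee_fin powR_ge0.
  - by move=> x _; rewrite lee_fin powR_ge0.
move=> xi _; rewrite -EFinD; congr EFin.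
rewrite -tE !powR_mulrn ?mulr_ge0 ?powR_ge0// !exprMn !real_normK ?num_real//.
have -> : enorm xi `^ (2 * s) = (enorm xi `^ s) ^+ 2.
  by rewrite mulrC powRrM powR_mulrn ?powR_ge0.
by rewrite normc_sqr /= mulrDr.
Qed.

End initial_datum.

(** * Loss of regularity *)

Section lower_bounds.
Context {R : realType} {n : nat}.
Local Notation V := 'rV[R]_n.
Local Notation mu := (lebesgue_rV n).
Local Notation reC := (@complex.Re R).
Local Notation imC := (@complex.Im R).
Implicit Types (f g h eta : V -> R) (x w xi : V).

Lemma locally_integrable_measurable f : locally_integrable_rV f -> measurable_fun setT f.
Proof.
move=> lf; apply/measurable_EFinP.
pose D (k : nat) : set V := [set x | `|x| <= k%:R].
apply: (@emeasurable_fun_cvg _ _ _ _ (fun k => (EFin \o f) \_ (D k))) => [k|x _].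
  have cD : compact (D k) by exact: norm_bounded_compact.
  have /integrableP[mf _] := lf _ cD.
  apply/(measurable_restrictT _ _).1 => //.
  exact: compact_measurable_rV.
apply: cvg_near_cst; exists (Num.truncn `|x|).+1 => // k /= xk.
rewrite patchE ifT// inE /D /= ltW// (lt_le_trans (truncnS_gt _))// ler_nat//.
Qed.

Lemma cvg_mulrl (c l : R) (u : nat -> R) : u @ \oo --> l -> (fun k => c * u k) @ \oo --> c * l.
Proof. by move=> h; apply: cvgM; [exact: cvg_cst|exact: h]. Qed.

Lemma cvg_mulrr (c l : R) (u : nat -> R) : u @ \oo --> l -> (fun k => u k * c) @ \oo --> l * c.
Proof. by move=> h; rewrite mulrC; under eq_fun do rewrite mulrC; exact: (@cvg_mulrl c l u h). Qed.

Lemma cvg_norm_le (u : nat -> R) (l M : R) : (forall k, `|u k| <= M) -> u @ \oo --> l -> `|l| <= M.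
Proof.
move=> uM ul; have ul' : `|u k| @[k --> \oo] --> `|l| by exact: cvg_norm.
rewrite -(cvg_lim _ ul')//; apply: limr_le; first by apply/cvg_ex; exists `|l|.
exact: nearW.
Qed.

(** The Fourier transform of a distribution is given by a function only against compactly supported
    tests, so Schwartz tests have to be truncated first. The factor exp(1) makes the value at the
    origin 1. *)
Definition cutoff (k : nat) xi : R := expR 1 * flat 0 (1 - usq (k.+1%:R^-1 *: xi)).

Lemma smooth_cutoff k : smooth (cutoff k).
Proof.
have su : smooth (@usq R n).
  apply: smooth_sum => i; apply: smoothM; apply: smooth_linear => [a u v|y];
    by rewrite ?mxE//; exact: coord_continuous.
have sk : smooth (fun xi : V => 1 - usq (k.+1%:R^-1 *: xi)).
  have -> : (fun xi : V => 1 - usq (k.+1%:R^-1 *: xi)) =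
     (fun xi => 1 + (- (k.+1%:R^-1 ^+ 2)) * usq xi).
    by apply/funext => xi; rewrite usqZ mulNr.
  by apply: smoothD; [exact: smooth_cst|exact: smoothZ].
apply: smoothZ; exact: (smooth_comp 0 (@tower_flat R) sk).
Qed.

Lemma cutoff_outside k xi : k.+1%:R < `|xi| -> cutoff k xi = 0.
Proof.
move=> xk; rewrite /cutoff /flat ifF ?mulr0//; apply/negbTE; rewrite -leNgt subr_le0.
rewrite /usq -enorm_sqr enormZ ger0_norm ?invr_ge0// exprn_ege1//.
by rewrite mulrC ler_pdivlMr// mul1r (le_trans (ltW xk))// norm_le_enorm.
Qed.

Lemma cutoff_bounds k xi : 0 <= cutoff k xi <= 1.
Proof.
rewrite /cutoff /flat; case: ifP => h; last by rewrite mulr0 lexx ler01.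
have -> : (flat_poly 0 : {poly R}) = 1 by [].
rewrite hornerC mul1r mulr_ge0 ?expR_ge0//= -expRD -[leRHS]expR0 ler_expR.
rewrite subr_le0 -[leLHS]invr1 lef_pV2 ?posrE// lerBlDr lerDl usq_ge0//.
Qed.

Lemma cvg_cutoff xi : (fun k => cutoff k xi) @ \oo --> (1 : R).
Proof.
have h0 : (fun k : nat => k.+1%:R^-1 : R) @ \oo --> (0 : R) by exact: cvg_harmonic.
have c : continuous (fun s : R => expR 1 * flat 0 (1 - s ^+ 2 * usq xi)).
  apply: smooth_continuous; apply: smoothZ.
  apply: (smooth_comp 0 (@tower_flat R) (f := fun s : R => 1 - s ^+ 2 * usq xi)).
  have -> : (fun s : R => 1 - s ^+ 2 * usq xi) = fun s => 1 + (- usq xi) * (s * s).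
    by apply/funext => s; ring.
  apply: smoothD; first exact: smooth_cst.
  by apply: smoothZ; apply: smoothM; exact: smooth_id.
have := cvg_comp _ _ h0 (c 0).
rewrite expr0n mul0r subr0 {2}/flat ltr01.
have -> : (flat_poly 0 : {poly R}) = 1 by [].
rewrite hornerC mul1r invr1 -expRD subrr expR0.
apply: cvg_trans; apply: near_eq_cvg; apply: nearW => k /=.
by rewrite /cutoff usqZ.
Qed.

Lemma schw_derive w f : schw f -> schw ('D_w f).
Proof. by move=> sf k; exact: reg_derive (sf k.+1). Qed.

Definition dirD w k f := iter k (fun g : V -> R => 'D_w g) f.

Lemma dirDS w k f : dirD w k.+1 f = 'D_w (dirD w k f).
Proof. by []. Qed.

Lemma dirDSr w k f : dirD w k.+1 f = dirD w k ('D_w f).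
Proof. by rewrite /dirD iterSr. Qed.

Lemma dirDD w k l f : dirD w (k + l) f = dirD w k (dirD w l f).
Proof. by rewrite /dirD iterD. Qed.

Lemma schw_dirD w k f : schw f -> schw (dirD w k f).
Proof. by move=> sf; elim: k => // k IH; exact: schw_derive. Qed.

Lemma schwM f g : schw f -> schw g -> schw (fun x => f x * g x).
Proof.
move=> sf sg k; apply: reg_mul (sf k) (sg k).
- by move=> u v ru rv; apply: moderate_rapid => //; exact: rapid_moderate.
- exact: rapidD.
Qed.

Lemma Int_dirD w k f g : schw f -> schw g ->
  \int[mu]_x (f x * dirD w k g x) = (-1) ^+ k * \int[mu]_x (dirD w k f x * g x).
Proof.
move=> sf sg; elim: k f sf => [|k IH] f sf; first by rewrite expr0 mul1r.
rewrite dirDS Int_by_parts; last 2 first.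
- by apply: reg_mono (sf 1); exact: rapid_moderate.
- exact: (schw_dirD w k sg 1).
by rewrite IH; [rewrite dirDSr exprS mulN1r mulNr|exact: schw_derive].
Qed.

Lemma L1_mul_schw f g : schw f -> schw g -> L1 mu (fun x => f x * g x).
Proof. by move=> sf sg; apply: schw_L1; exact: schwM. Qed.

Lemma Int_CauchySchwarz f g : schw f -> schw g ->
  (\int[mu]_x (f x * g x)) ^+ 2 <= (\int[mu]_x (f x * f x)) * \int[mu]_x (g x * g x).
Proof.
move=> sf sg.
have ff := L1_mul_schw sf sf; have fg := L1_mul_schw sf sg; have gg := L1_mul_schw sg sg.
set a := \int[mu]_x (f x * f x); set b := \int[mu]_x (f x * g x); set c := \int[mu]_x (g x * g x).
have H (s : R) : 0 <= a + 2 * s * b + s ^+ 2 * c.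
  have -> : a + 2 * s * b + s ^+ 2 * c = \int[mu]_x ((f x + s * g x) * (f x + s * g x)).
    rewrite -!IntZ// -!IntD//; first by apply: eq_Int => x; ring.
    - by apply: L1D => //; exact: L1Z.
    - exact: L1Z.
    - exact: L1Z.
  by apply: Int_ge0 => x; rewrite -expr2 sqr_ge0.
have c0 : 0 <= c by apply: Int_ge0 => x; rewrite -expr2 sqr_ge0.
have [c1|c1] := ltP 0 c.
  have := H (- b / c).
  have -> : a + 2 * (- b / c) * b + (- b / c) ^+ 2 * c = a - b ^+ 2 / c.
    by field; rewrite gt_eqF.
  by rewrite subr_ge0 ler_pdivrMr.
have c2 : c = 0 by apply/eqP; rewrite eq_le c0 c1.
have [->|b0] := eqVneq b 0; first by rewrite c2 mulr0 expr0n.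
have := H (- (a + 1) / (2 * b)); rewrite c2 mulr0 addr0.
have -> : a + 2 * (- (a + 1) / (2 * b)) * b = -1 by field.
by rewrite lerNr oppr0 ler10.
Qed.

(** Cauchy-Schwarz after moving k derivatives from one factor to the other. Passing from k to 2 k is
    the form of log-convexity that can be iterated from the first derivative. *)
Lemma doubling w k f : schw f ->
  (\int[mu]_x (dirD w k f x ^+ 2)) ^+ 2 <=
  (\int[mu]_x (f x ^+ 2)) * \int[mu]_x (dirD w (k + k) f x ^+ 2).
Proof.
move=> sf; have sk := schw_dirD w k sf; have skk := schw_dirD w (k + k) sf.
have := Int_CauchySchwarz sf skk.
rewrite dirDD Int_dirD// exprMn -exprM mulnC exprM sqrrN expr1n expr1n mul1r.
have E (g : V -> R) : \int[mu]_x (g x ^+ 2) = \int[mu]_x (g x * g x).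
  by apply: eq_Int => x; rewrite expr2.
by rewrite !E.
Qed.

Lemma is_derive_scale (k : R) f x w : smooth f ->
  is_derive x w (fun x => f (k *: x)) (k * 'D_w f (k *: x)).
Proof.
move=> sf; apply/is_derive_line0.
have df : is_derive (0 : R) 1 (fun h : R => f (h *: w + k *: x)) ('D_w f (k *: x)).
  by apply/is_derive_line0; exact: smooth_is_derive.
have dk : is_derive (0 : R) 1 (fun h : R => k * h) k.
  by apply: (is_derive_eq (is_deriveZR k (is_derive_id (0 : R) 1))); rewrite mulr1.
rewrite -[X in is_derive X _ _ _](mulr0 k) in df.
have := is_derive_compR (f := fun h : R => k * h) df dk.
rewrite [X in is_derive _ _ _ X]mulrC.
by under eq_fun do rewrite -scalerA -scalerDr.
Qed.

Lemma smooth_dirD w k f : smooth f -> smooth (dirD w k f).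
Proof. by move=> sf; elim: k => // k IH; exact: smooth_derive. Qed.

Lemma dirD_scale (c a : R) w k f : smooth f ->
  dirD w k (fun x => c * f (a *: x)) = fun x => c * a ^+ k * dirD w k f (a *: x).
Proof.
move=> sf; elim: k => [|k IH]; first by apply/funext => x; rewrite expr0 mulr1.
rewrite dirDS IH; apply/funext => x.
have [_ ->] := is_deriveZR (c * a ^+ k) (is_derive_scale a x w (smooth_dirD w k sf)).
by rewrite exprSr !mulrA.
Qed.

Lemma derive_odd2 w f : smooth f -> (forall x, f (- x) = - f x) ->
  forall x, 'D_w ('D_w f) (- x) = - 'D_w ('D_w f) x.
Proof.
move=> sf of_ x.
have E (g : V -> R) (e : R) : smooth g -> (forall x, g (- x) = e * g x) ->
    forall x, 'D_w g (- x) = - e * 'D_w g x.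
  move=> sg og y; have [_] := is_derive_scale (-1) y w sg.
  rewrite (_ : (fun x => g (-1 *: x)) = fun x => e * g x); last first.
    by apply/funext => z; rewrite scaleN1r og.
  have [_ ->] := is_deriveZR e (smooth_is_derive w y sg).
  by rewrite scaleN1r mulN1r mulNr => ->; rewrite opprK.
have e1 := E f (-1) sf (fun x => ltac:(by rewrite mulN1r of_)).
have := E _ _ (smooth_derive w sf) e1 x.
by rewrite opprK mulN1r.
Qed.

Lemma dirD_odd w M f : smooth f -> (forall x, f (- x) = - f x) ->
  forall x, dirD w (M + M) f (- x) = - dirD w (M + M) f x.
Proof.
move=> sf of_; elim: M => // M IH; rewrite addSn addnS !dirDS.
by apply: derive_odd2 => //; exact: smooth_dirD.
Qed.

Lemma Tr_dirD al i M f xi : schw f ->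
  Tr al (dirD (basis_vec i) (M + M) f) xi = (-1) ^+ M * xi 0 i ^+ (M + M) * Tr al f xi.
Proof.
move=> sf; elim: M => [|M IH]; first by rewrite !expr0 !mul1r.
have db : dot (basis_vec i) xi = xi 0 i.
  rewrite /dot (bigD1 i)//= !mxE !eqxx mul1r big1 ?addr0// => j ji.
  by rewrite !mxE eqxx (negbTE ji) mul0r.
rewrite addSn addnS !dirDS.
have sM := schw_dirD (basis_vec i) (M + M) sf.
rewrite (Tr_derive_fun _ _ _ (schw_derive _ sM 1)) (Tr_derive_fun _ _ _ (sM 1)) db.
have -> : Tr (al + pi / 2 + pi / 2) (dirD (basis_vec i) (M + M) f) xi =
   - Tr al (dirD (basis_vec i) (M + M) f) xi.
  rewrite -mulN1r -TrZ; last exact: schw_L1.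
  apply: eq_Int => x; rewrite -addrA -splitr addrA cosDpi; ring.
by rewrite IH !exprS; ring.
Qed.

(* [|xi|^(-2 s) xi_i^(4 M) <= L^(-2 s) (xi_i^(4 M) + L^(4 M))], with denominators cleared. *)
Lemma frequency_split (s L : R) (M : nat) i xi : 0 < L -> 0 <= s -> s <= (M + M)%:R ->
  (xi 0 i ^+ (M + M)) ^+ 2 * L `^ (2 * s) <=
  enorm xi `^ (2 * s) * ((xi 0 i ^+ (M + M)) ^+ 2 + (L ^+ (M + M)) ^+ 2).
Proof.
move=> L0 s0 sM; have e0 := enorm_ge0 xi.
have x0 : 0 <= (xi 0 i ^+ (M + M)) ^+ 2 by exact: sqr_ge0.
have L1' : 0 <= (L ^+ (M + M)) ^+ 2 by exact: sqr_ge0.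
have s2 : 0 <= 2 * s by rewrite mulr_ge0.
have [Le|eL] := leP L (enorm xi).
  rewrite mulrC ler_pM ?powR_ge0// ?lerDl//.
  by apply: ge0_ler_powR; rewrite ?nnegrE ?(ltW L0).
have xe : (xi 0 i ^+ (M + M)) ^+ 2 <= enorm xi ^+ (M + M) ^+ 2.
  rewrite -(real_normK (num_real (xi 0 i ^+ (M + M)))) ler_sqr ?nnegrE ?exprn_ge0//.
  by rewrite normrX lerXn2r ?nnegrE// coord_le_enorm.
have [e00|ene] := eqVneq (enorm xi) 0.
  have [M0|M0] := posnP M.
    have s00 : s = 0 by apply/eqP; rewrite eq_le s0 andbT; move: sM; rewrite M0.
    by rewrite s00 mulr0 !powRr0 mulr1 mul1r lerDl.
  have -> : (xi 0 i ^+ (M + M)) ^+ 2 = 0.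
    apply/eqP; rewrite eq_le x0 andbT (le_trans xe)// e00 expr0n addn_eq0.
    by rewrite (gtn_eqF M0) /= expr0n.
  by rewrite mul0r add0r mulr_ge0 ?powR_ge0.
have ep : 0 < enorm xi by rewrite lt_neqAle eq_sym ene.
apply: (@le_trans _ _ (enorm xi `^ (2 * s) * (L ^+ (M + M)) ^+ 2)); last first.
  by rewrite ler_wpM2l ?powR_ge0// lerDr.
apply: (@le_trans _ _ (enorm xi ^+ (M + M) ^+ 2 * L `^ (2 * s))).
  by rewrite ler_wpM2r ?powR_ge0.
rewrite -!exprM -!powR_mulrn ?(ltW L0) ?(ltW ep)//.
set N := ((M + M) * 2)%:R; have sN : 2 * s <= N.
  by rewrite /N natrM mulrC ler_wpM2r.
have [D NE D0] : exists2 D, N = 2 * s + D & 0 <= D.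
  by exists (N - 2 * s); [rewrite addrC subrK|rewrite subr_ge0].
rewrite NE !powRD; try by rewrite (gt_eqF ep) implybT.
  rewrite -!mulrA ler_wpM2l ?powR_ge0// mulrC ler_wpM2l ?powR_ge0//.
  by apply: ge0_ler_powR; rewrite ?nnegrE ?(ltW L0) ?(ltW eL).
by rewrite (gt_eqF L0) implybT.
Qed.

(** Fourier inversion moves the pairing to frequency. There Young's inequality with parameter e
    separates f, whose weighted norm is a, from the test, whose weight |xi|^(- 2 s) is handled by
    [frequency_split]; Plancherel brings the norms of the test back to space. The constant a does
    not depend on the test, and e and L stay free to be adapted to it. *)
Lemma Hdot_test (f : V -> R) (s : R) : L1 mu f -> 0 <= s -> in_Hdot s (dist_of_real f) ->
  exists2 a : R, 0 <= a & forall eta i M (e L : R), schw eta -> (forall x, eta (- x) = - eta x) ->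
    0 < e -> 0 < L -> s <= (M + M)%:R ->
    (2 * pi) ^+ n * `|\int[mu]_x (f x * dirD (basis_vec i) (M + M) eta x)| <=
    2^-1 * (e * a + e^-1 * L `^ (- (2 * s)) * (2 * pi) ^+ n *
      (\int[mu]_x (dirD (basis_vec i) (M + M) eta x ^+ 2) +
       L ^+ (M + M) ^+ 2 * \int[mu]_x (eta x ^+ 2))).
Proof.
move=> f1 s0 [_ [g [[lg gE] gfin]]].
(* The tests in frequency are real, so the imaginary part of the pairing involves only the imaginary
   part of g. For odd functions in space this is the sine transform. *)
pose h xi := imC (g xi).
have mh : measurable_fun setT h by case: lg => _; exact: locally_integrable_measurable.
have mr : measurable_fun setT (reC \o g) by case: lg => + _; exact: locally_integrable_measurable.
pose W xi := enorm xi `^ (2 * s) * h xi ^+ 2.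
have mW : measurable_fun setT W.
  apply: measurable_funM; first exact: measurable_enorm_powR.
  by under eq_fun do rewrite expr2; exact: measurable_funM.
have W0 xi : 0 <= W xi by rewrite mulr_ge0 ?powR_ge0 ?sqr_ge0.
have W1 : L1 mu W.
  apply: L1P => //; apply: le_lt_trans gfin; apply: ge0_le_integral => //.
  - by apply/measurable_EFinP; exact: measurableT_comp.
  - apply/measurable_EFinP; apply: measurable_funM; first exact: measurable_enorm_powR.
    under eq_fun do rewrite normc_sqr !expr2.
    by apply: measurable_funD; exact: measurable_funM.
  - move=> xi _; rewrite lee_fin ger0_norm// ler_wpM2l ?powR_ge0//.
    by rewrite normc_sqr lerDr sqr_ge0.
exists (\int[mu]_xi W xi); first exact: Int_ge0.
move=> eta i M e L seta oeta e0 L0 sM.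
pose N := (M + M)%N; pose zeta := dirD (basis_vec i) N eta.
have szeta : schw zeta by exact: schw_dirD.
have ozeta x : zeta (- x) = - zeta x by apply: dirD_odd => //; exact: schw_smooth.
pose Z := Tr (pi / 2) zeta; pose H := Tr (pi / 2) eta.
have sZ : schw Z by exact: schw_Tr.
have sH : schw H by exact: schw_Tr.
have ZE xi : Z xi = (-1) ^+ M * xi 0 i ^+ N * H xi by exact: Tr_dirD.
pose phi k xi := cutoff k xi * Z xi.
have tphi k : test_function setT (phi k).
  split; first by apply: smooth_smooth_on; apply: smoothM; [exact: smooth_cutoff|exact: schw_smooth].
  exists [set xi : V | `|xi| <= k.+1%:R]; split => //; first exact: norm_bounded_compact.
  by move=> xi /= /negP; rewrite -ltNge => hk; rewrite /phi cutoff_outside// mul0r.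
have phiZ k xi : `|phi k xi| <= `|Z xi|.
  have /andP[c0 c1] := cutoff_bounds k xi.
  by rewrite /phi normrM ger0_norm// ler_piMl.
have sphi k := test_function_schw (tphi k).
have Z1 : L1 mu (fun xi => `|Z xi|) by apply: L1_abs; exact: schw_L1.
have pair k : \int[mu]_x (f x * Tr (pi / 2) (phi k) x) = \int[mu]_xi (h xi * phi k xi).
  have ct : ctest_function (fun xi => Complex (phi k xi) 0).
    split=> /=; first exact: tphi.
    split; first by apply: smooth_smooth_on; exact: smooth_cst.
    by exists set0; split=> //; exact: compact0.
  have E : \int[mu]_x imC (Complex (f x) 0 * fourier_fun (fun xi => Complex (phi k xi) 0) x) =
    \int[mu]_xi imC (g xi * Complex (phi k xi) 0) := congr1 (@complex.Im R) (gE _ ct).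
  transitivity (\int[mu]_x imC (Complex (f x) 0 * fourier_fun (fun xi => Complex (phi k xi) 0) x)).
    apply: eq_Int => x; have s00 : schw (imC \o (fun xi => Complex (phi k xi) 0)).
      exact: (@schw_of_supported _ _ 0 (fun=> 0) (smooth_cst 0)).
    rewrite (fourier_funE _ (sphi k : schw (reC \o (fun xi => Complex (phi k xi) 0))) s00) /=.
    rewrite (_ : Tr 0 (imC \o _) x = 0); first by rewrite add0r mul0r addr0.
    by rewrite /Tr (_ : (fun y => _) = fun=> 0) ?Int0//; apply/funext => y; rewrite /= mulr0.
  rewrite E; apply: eq_Int => xi; rewrite cImM /= /h; ring.
have lim1 : (fun k => \int[mu]_x (f x * Tr (pi / 2) (phi k) x)) @ \oo -->
    \int[mu]_x (f x * ((2 * pi) ^+ n * zeta x)).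
  pose c := \int[mu]_xi `|Z xi|.
  have [|||x|_] := @Int_cvg _ _ R mu (fun k x => f x * Tr (pi / 2) (phi k) x)
    (fun x => f x * ((2 * pi) ^+ n * zeta x)) (fun x => `|f x| * c).
  - move=> k; apply: measurable_funM; first exact: (L1_measurable f1).
    by apply: measurable_Tr; exact: schw_L1.
  - by apply: L1Zr; exact: L1_abs.
  - move=> k x; rewrite normrM ler_wpM2l//.
    have p1 := schw_L1 (sphi k).
    apply: (le_trans (Tr_bound _ _ p1)); apply: le_Int => //; exact: L1_abs.
  - have : (fun k => Tr (pi / 2) (phi k) x) @ \oo --> (2 * pi) ^+ n * zeta x.
      rewrite -Tr_inversion_odd//.
      have [|||xi|_] := @Int_cvg _ _ R mu (fun k xi => cos (dot xi x + pi / 2) * phi k xi)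
        (fun xi => cos (dot xi x + pi / 2) * Z xi) (fun xi => `|Z xi|).
      + by move=> k; apply: L1_measurable (L1_cos _ _ _); exact: schw_L1.
      + exact: Z1.
      + by move=> k xi; rewrite normrM -[leRHS]mul1r ler_pM// norm_cos_le1.
      + apply: (@cvg_mulrl _ _ (fun k => phi k xi)).
        have := @cvg_mulrr (Z xi) 1 (fun k => cutoff k xi) (@cvg_cutoff xi).
        by rewrite mul1r.
      + by [].
    move=> hx; exact: (@cvg_mulrl (f x) _ (fun k => Tr (pi / 2) (phi k) x) hx).
  - by [].
have bound k : `|\int[mu]_x (f x * Tr (pi / 2) (phi k) x)| <=
    2^-1 * (e * \int[mu]_xi W xi + e^-1 * L `^ (- (2 * s)) *
      (\int[mu]_xi Z xi ^+ 2 + L ^+ N ^+ 2 * \int[mu]_xi H xi ^+ 2)).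
  rewrite pair.
  have ZZ := L1_mul_schw sZ sZ; have HH := L1_mul_schw sH sH.
  have E2 (u : V -> R) : (fun xi => u xi ^+ 2) = (fun xi => u xi * u xi).
    by apply/funext => xi; rewrite expr2.
  have L1Z2 : L1 mu (fun xi => Z xi ^+ 2) by rewrite E2.
  have L1H2 : L1 mu (fun xi => H xi ^+ 2) by rewrite E2.
  pose D xi := 2^-1 * (e * W xi + e^-1 * L `^ (- (2 * s)) * (Z xi ^+ 2 + L ^+ N ^+ 2 * H xi ^+ 2)).
  have -> : 2^-1 * (e * \int[mu]_xi W xi + e^-1 * L `^ (- (2 * s)) *
      (\int[mu]_xi Z xi ^+ 2 + L ^+ N ^+ 2 * \int[mu]_xi H xi ^+ 2)) = \int[mu]_xi D xi.
    rewrite /D -[in LHS](IntZ _ W1) -[X in _ + _ * (_ + X)](IntZ _ L1H2) -IntD//; last exact: L1Z.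
    rewrite -[X in _ + X]IntZ; last by apply: L1D => //; exact: L1Z.
    rewrite -IntD; [|exact: L1Z|by apply: L1Z; apply: L1D => //; exact: L1Z].
    rewrite -IntZ//; apply: L1D; first exact: L1Z.
    by apply: L1Z; apply: L1D => //; exact: L1Z.
  apply: le_norm_Int_dom.
  - apply: L1Z; apply: L1D; first exact: L1Z.
    by apply: L1Z; apply: L1D => //; exact: L1Z.
  - by apply: measurable_funM => //; exact: L1_measurable (schw_L1 (sphi k)).
  move=> xi; rewrite normrM; apply: (le_trans (ler_wpM2l _ (phiZ k xi))) => //.
  rewrite /D ler_pdivlMl//.
  have FS := frequency_split i xi L0 s0 sM; rewrite -/N in FS.
  have Z2 : Z xi ^+ 2 = (xi 0 i ^+ N) ^+ 2 * H xi ^+ 2.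
    have s1 : (-1) ^+ M ^+ 2 = 1 :> R by rewrite -exprM mulnC exprM sqrrN expr1n expr1n.
    by rewrite ZE !exprMn s1 mul1r.
  have Lp : 0 < L `^ (2 * s) by exact: powR_gt0.
  rewrite powRN; set X := enorm xi `^ (2 * s); set Y := L `^ (2 * s) in Lp FS *.
  have X0 : 0 <= X by exact: powR_ge0.
  have eV : 0 < e^-1 by rewrite invr_gt0.
  have Q : Z xi ^+ 2 * Y <= X * (Z xi ^+ 2 + L ^+ N ^+ 2 * H xi ^+ 2).
    rewrite Z2 -mulrDl mulrAC [X * _]mulrA ler_wpM2r ?sqr_ge0//.
  have Q' : Z xi ^+ 2 <= X * (Y^-1 * (Z xi ^+ 2 + L ^+ N ^+ 2 * H xi ^+ 2)).
    by rewrite mulrCA ler_pdivlMl// mulrC.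
  set T := Y^-1 * _ in Q'; rewrite -mulrA -/T.
  have T0 : 0 <= T.
    apply: mulr_ge0; first by rewrite invr_ge0 ltW.
    by apply: addr_ge0; [|apply: mulr_ge0]; exact: sqr_ge0.
  rewrite /W -/X -!(real_normK (num_real (h xi))) in Q' *.
  rewrite -(real_normK (num_real (Z xi))) in Q'.
  set u := `|h xi|; set z := `|Z xi| in Q' *.
  have u0 : 0 <= u by exact: normr_ge0.
  have z0 : 0 <= z by exact: normr_ge0.
  (* [2 u z <= e X u^2 + T / e] because [z^2 <= X T] *)
  have K : (2 * (u * z)) ^+ 2 <= (e * (X * u ^+ 2) + e^-1 * T) ^+ 2.
    apply: (@le_trans _ _ (4 * (e * (X * u ^+ 2)) * (e^-1 * T))).
      have -> : 4 * (e * (X * u ^+ 2)) * (e^-1 * T) = 4 * u ^+ 2 * (X * T) * (e * e^-1) by ring.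
      rewrite mulfV ?gt_eqF// mulr1.
      have -> : (2 * (u * z)) ^+ 2 = 4 * u ^+ 2 * z ^+ 2 by ring.
      by rewrite ler_wpM2l// mulr_ge0// sqr_ge0.
    set p := e * _; set q := e^-1 * _; rewrite -subr_ge0.
    have -> : (p + q) ^+ 2 - 4 * p * q = (p - q) ^+ 2 by ring.
    exact: sqr_ge0.
  rewrite ler_sqr ?nnegrE in K => //.
  - by rewrite mulr_ge0// mulr_ge0.
  - apply: addr_ge0; apply: mulr_ge0 => //; try exact: ltW.
    by apply: mulr_ge0 => //; exact: sqr_ge0.
have B := cvg_norm_le bound lim1.
move: B.
rewrite (Plancherel_odd szeta ozeta) (Plancherel_odd seta oeta).
have -> : \int[mu]_x (f x * ((2 * pi) ^+ n * zeta x)) = (2 * pi) ^+ n * \int[mu]_x (f x * zeta x).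
  rewrite -IntZ; first by apply: eq_Int => x; ring.
  have rz := reg_base (szeta 0%N); have [C C0 hC] := rapid_le_weight rz.
  under eq_fun do rewrite mulrC.
  apply: (L1_bounded (C := C)) => //; first exact: L1_measurable (rapid_L1 rz).
  by move=> x; rewrite (le_trans (hC x))// ler_piMr// weight_le1.
rewrite normrM ger0_norm ?exprn_ge0 ?mulr_ge0 ?pi_ge0//.
move=> B; apply: (le_trans B); rewrite le_eqVlt; apply/orP; left; apply/eqP.
by rewrite /zeta /N; ring.
Qed.

End lower_bounds.

Section support.
Context {R : realType} {n : nat}.
Local Notation V := 'rV[R]_n.
Local Notation mu := (lebesgue_rV n).
Implicit Types (f F : V -> R) (x y w : V).

Lemma ann_supp_derive w F : ann_supp F -> ann_supp ('D_w F).
Proof.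
move=> aF y; apply: contraR => h.
rewrite -(derive_cst (0 : R) y w); apply/eqP; apply: near_eq_derive.
move: h; rewrite negb_and -!ltNge => /orP[h|h].
  near=> z; apply/eqP; apply: contraT => /aF/andP[+ _]; rewrite leNgt => /negP; case.
  by near: z; have /cvgr_lt := @continuous_usq R n y; apply.
near=> z; apply/eqP; apply: contraT => /aF/andP[_]; rewrite leNgt => /negP; case.
by near: z; have /cvgr_gt := @continuous_usq R n y; apply.
Unshelve. all: by end_near. Qed.

Lemma ann_supp_dirD w k F : ann_supp F -> ann_supp (dirD w k F).
Proof. by move=> aF; elim: k => // k IH; exact: ann_supp_derive. Qed.

Lemma ann_supp_weight F : continuous F -> ann_supp F ->
  exists2 C : R, 0 <= C & forall y, `|F y| <= C * weight y.
Proof.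
move=> cF aF; apply: rapid_le_weight; apply: (@supported_rapid _ _ 2); split=> // x x2.
exact: ann_supp_norm aF x2.
Qed.

Lemma Int_gt0 f x (d e : R) : L1 mu f -> (forall y, 0 <= f y) -> 0 < d -> 0 < e ->
  (forall y, `|y - x| <= e -> d <= f y) -> 0 < \int[mu]_y f y.
Proof.
move=> f1 f0 d0 e0 fd.
have mB : measurable [set z : V | `|z| <= e].
  by apply: compact_measurable_rV; exact: norm_bounded_compact.
have I : (\int[mu]_z (\1_[set z : V | (`|z| <= e)%R] z)%:E = ((2 * e) ^+ n)%:E)%E.
  by rewrite integral_indic// setIT; exact: box_measure (ltW e0).
have i1 : L1 mu (\1_[set z : V | `|z| <= e]).
  apply: L1P; first exact: measurable_indic.
  under eq_integral do rewrite ger0_norm//.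
  by rewrite I ltry.
rewrite -(Int_shift x f1).
apply: (@lt_le_trans _ _ (\int[mu]_y (d * \1_[set z : V | `|z| <= e] y))).
  by rewrite IntZ// mulr_gt0// /Rintegral I /= exprn_gt0// mulr_gt0.
apply: le_Int; [exact: L1Z|exact: L1_shift|move=> y].
rewrite indicE; case: (boolP (y \in _)) => [|_]; last by rewrite mulr0.
by rewrite inE /= mulr1 => ye; apply: fd; rewrite addrK.
Qed.

End support.

(** * Growth of derivatives under rotation, and loss of regularity *)

Section oscillation.
Context {R : realType} {m : nat}.
Local Notation n := m.+2.
Local Notation V := 'rV[R]_n.
Local Notation mu := (lebesgue_rV n).
Implicit Types (x y w : V).
Variables (G : R -> R).
Hypotheses (sG : smooth G) (aG : ann G).
Local Notation i0 := (ord0 : 'I_n).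
Local Notation i1 := (lift ord0 ord0 : 'I_n).
Local Notation vth := (vth (m := m) G).
Let g y := G (usq y).
Let sg : smooth g := smooth_Gusq sG.

(* Functions of [(la, y)] which are [O(la^k)], stably under differentiation in [y]. *)
Inductive osc : nat -> (R -> V -> R) -> Prop :=
| osc_term k l al a : (l <= k)%N -> smooth a -> ann_supp a ->
    osc k (fun la y => la ^+ l * (a y * cos (la * g y + al)))
| osc_add k F1 F2 : osc k F1 -> osc k F2 -> osc k (fun la y => F1 la y + F2 la y).

Lemma osc_derive w k F : osc k F ->
  (forall la, smooth (F la)) /\ osc k.+1 (fun la => 'D_w (F la)).
Proof.
elim=> {k F} [k l al a lk sa aa|k F1 F2 _ [s1 o1] _ [s2 o2]].
  have sc la : smooth (fun y => cos (la * g y + al)).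
    apply: (smooth_comp1 smooth_cos); apply: smoothD; last exact: smooth_cst.
    exact: smoothZ.
  have sF la : smooth (fun y => la ^+ l * (a y * cos (la * g y + al))).
    by apply: smoothZ; apply: smoothM.
  split=> //.
  have -> : (fun la => 'D_w (fun y => la ^+ l * (a y * cos (la * g y + al)))) =
     (fun la y => la ^+ l * ('D_w a y * cos (la * g y + al)) +
       la ^+ l.+1 * ((a y * 'D_w g y) * cos (la * g y + (al + pi / 2)))).
    apply/funext => la; apply/funext => y.
    have dg := is_deriveZR la (smooth_is_derive w y sg).
    have dc := is_derive_compR (f := fun y => la * g y) (is_derive_cos_shift al (la * g y)) dg.
    have [_ ->] := is_deriveZR (la ^+ l) (is_deriveMR (smooth_is_derive w y sa) dc).
    by rewrite exprS; move: ('D_w a y) ('D_w g y) => u v; ring.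
  apply: osc_add; apply: osc_term.
  - exact: leq_trans lk (leqnSn k).
  - exact: smooth_derive.
  - exact: ann_supp_derive.
  - by [].
  - by apply: smoothM => //; exact: smooth_derive.
  - by move=> y; rewrite mulf_eq0 negb_or => /andP[/aa].
split=> [la|]; first exact: smoothD.
have -> : (fun la => 'D_w (fun y => F1 la y + F2 la y)) = (fun la y => 'D_w (F1 la) y + 'D_w (F2 la) y).
  apply/funext => la; apply/funext => y.
  by have [_ ->] := is_deriveDR (smooth_is_derive w y (s1 la)) (smooth_is_derive w y (s2 la)).
exact: osc_add.
Qed.

Lemma osc_bound k F : osc k F -> exists2 C : R, 0 <= C &
  forall la y, 1 <= la -> `|F la y| <= C * la ^+ k * weight y.
Proof.
elim=> {k F} [k l al a lk sa aa|k F1 F2 _ [C1 C10 h1] _ [C2 C20 h2]].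
  have [C C0 hC] := ann_supp_weight (smooth_continuous sa) aa.
  exists C => // la y la1; have la0 : 0 <= la := le_trans ler01 la1.
  rewrite normrM ger0_norm ?exprn_ge0// [C * _]mulrC -mulrA ler_pM ?exprn_ge0//.
    by rewrite ler_weXn2l.
  rewrite normrM -[leRHS]mulr1; apply: ler_pM => //; exact: norm_cos_le1.
exists (C1 + C2) => [|la y la1]; first exact: addr_ge0.
by rewrite (le_trans (ler_normD _ _))// !mulrDl lerD ?h1 ?h2.
Qed.

Lemma osc_vth : osc 0 vth.
Proof.
have -> : vth = (fun la y => la ^+ 0 * ((g y * y 0 i0) * cos (la * g y + 0)) +
    la ^+ 0 * ((-1 * (g y * y 0 i1)) * cos (la * g y + pi / 2))).
  apply/funext => la; apply/funext => y; rewrite addr0 cosD_pihalf expr0 /vth -/(g y); ring.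
apply: osc_add; apply: osc_term => //.
- by apply: smoothM => //; exact: smooth_coord.
- by move=> y; rewrite mulf_eq0 negb_or => /andP[/(G_eq0 aG)].
- by apply: smoothZ; apply: smoothM => //; exact: smooth_coord.
- by move=> y; rewrite !mulf_eq0 !negb_or => /andP[_ /andP[/(G_eq0 aG)]].
Qed.

Lemma osc_dirD_vth w k : osc k (fun la => dirD w k (vth la)).
Proof. by elim: k => [|k IH]; [exact: osc_vth|have [_] := osc_derive w IH]. Qed.

(** Each derivative brings out at most one factor la, and la >= 1 absorbs the lower powers. The
    constant does not depend on la. *)
Lemma vth_upper w k : exists2 C : R, 0 <= C &
  forall la, 1 <= la -> \int[mu]_y (dirD w k (vth la) y ^+ 2) <= C * (la ^+ k) ^+ 2.
Proof.
have [C C0 hC] := osc_bound (osc_dirD_vth w k).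
have w1 := @L1_weight R n.
exists (C ^+ 2 * \int[mu]_y weight y) => [|la la1].
  by rewrite mulr_ge0 ?sqr_ge0// Int_ge0// => y; exact: weight_ge0.
rewrite mulrAC -exprMn -IntZ//.
have sk : schw (dirD w k (vth la)) by apply: schw_dirD; exact: schw_vth.
apply: le_Int; [|exact: L1Z|].
  by apply: eq_L1 (L1_mul_schw sk sk) => y; rewrite expr2.
move=> y; rewrite -(real_normK (num_real (dirD w k (vth la) y))).
apply: (@le_trans _ _ ((C * la ^+ k * weight y) ^+ 2)).
  by rewrite ler_sqr ?nnegrE ?hC// (le_trans _ (hC la y la1)).
have -> : (C * la ^+ k * weight y) ^+ 2 = (C * la ^+ k) ^+ 2 * weight y ^+ 2 by rewrite exprMn.
by rewrite ler_wpM2l ?sqr_ge0// expr2 ler_piMl ?weight_ge0// weight_le1.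
Qed.

Lemma usq_rot01 y : usq (rot01 y) = usq y.
Proof.
rewrite /usq /dot !big_ord_recl !rot01E0 !rot01E1.
under eq_bigr do rewrite !rot01E2.
by rewrite !addrA; congr (_ + _); ring.
Qed.

Let g' y : R := 'D_(1 : R) G (usq y).
(** Sum over the two directions of the plane of the squared coefficients of la [vphase] in the
    gradient of the rotated profile; see [derive_vth]. *)
Let Q y : R := (2 * (g y * g' y)) ^+ 2 * (y 0 i0 ^+ 2 + y 0 i1 ^+ 2).

Let cg' : continuous g'.
Proof.
exact: (smooth_continuous (smooth_comp1 (smooth_derive (1 : R) sG) (@smooth_usq R m))).
Qed.

Let cc i : continuous (fun y : V => y 0 i). Proof. exact: coord_continuous. Qed.

Let cQ : continuous Q.
Proof.
have cgg : continuous (fun y => 2 * (g y * g' y)).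
  by apply: C0Z; apply: C0M; [exact: smooth_continuous|exact: cg'].
have -> : Q = fun y => 2 * (g y * g' y) * (2 * (g y * g' y)) * (y 0 i0 * y 0 i0 + y 0 i1 * y 0 i1).
  by apply/funext => y; rewrite /Q !expr2.
by apply: C0M; [exact: C0M|apply: C0D; exact: C0M].
Qed.

Let aQ : ann_supp Q.
Proof.
move=> y; rewrite /Q mulf_eq0 negb_or expf_eq0 /= => /andP[+ _].
by rewrite !mulf_eq0 !negb_or => /andP[_ /andP[/(G_eq0 aG)]].
Qed.

Let Q0 y : 0 <= Q y. Proof. by rewrite mulr_ge0 ?addr_ge0 ?sqr_ge0. Qed.

Let L1_ann (f : V -> R) : continuous f -> ann_supp f -> L1 mu f.
Proof.
move=> cf af; apply: rapid_L1; apply: (@supported_rapid _ _ 2); split=> // x x2.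
exact: ann_supp_norm af x2.
Qed.

Let rho2 y : R := y 0 i0 ^+ 2 + y 0 i1 ^+ 2.

Let crho2 : continuous rho2.
Proof.
have -> : rho2 = fun y => y 0 i0 * y 0 i0 + y 0 i1 * y 0 i1 by apply/funext => y; rewrite /rho2 !expr2.
by apply: C0D; exact: C0M.
Qed.

Let ann_M f1 f2 : ann_supp f1 -> ann_supp (fun y : V => f1 y * f2 y :> R).
Proof. by move=> a1 y; rewrite mulf_eq0 negb_or => /andP[/a1]. Qed.

Let cphase la : continuous (vphase (m := m) G la).
Proof.
have ca : smooth (fun y => la * g y) by exact: smoothZ.
apply: C0D; apply: C0M.
- by move=> y; apply: continuousN; exact: cc.
- exact: smooth_continuous (smooth_comp1 smooth_sin ca).
- exact: cc.
- exact: smooth_continuous (smooth_comp1 smooth_cos ca).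
Qed.

Let cmain la : continuous (vmain (m := m) G la).
Proof.
have ca : smooth (fun y => la * g y) by exact: smoothZ.
apply: C0D; apply: C0M; try exact: cc.
- exact: smooth_continuous (smooth_comp1 smooth_cos ca).
- exact: smooth_continuous (smooth_comp1 smooth_sin ca).
Qed.

Let Csq (f : V -> R) : continuous f -> continuous (fun y => f y ^+ 2).
Proof. by move=> cf; under eq_fun do rewrite expr2; exact: C0M. Qed.

Let LQ (f : V -> R) : continuous f -> L1 mu (fun y => Q y * f y ^+ 2).
Proof.
move=> cf; apply: L1_ann; last exact: ann_M.
by apply: C0M; [exact: cQ|exact: Csq].
Qed.

(** The quarter turn preserves Q and carries [vphase] into [vmain], so the two have equal energy,
    and their squares add up to [rho2]. The energy of the oscillating factor is thus independent of
    la, without any stationary phase argument. *)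
Lemma phase_energy la :
  2 * \int[mu]_y (Q y * vphase G la y ^+ 2) = \int[mu]_y (Q y * rho2 y).
Proof.
have Lp : L1 mu (fun y => Q y * vphase G la y ^+ 2).
  exact: (LQ (@cphase la)).
have Lm : L1 mu (fun y => Q y * vmain G la y ^+ 2).
  exact: (LQ (@cmain la)).
have E : \int[mu]_y (Q y * vphase G la y ^+ 2) = \int[mu]_y (Q y * vmain G la y ^+ 2).
  rewrite -[LHS]ge0_Int_rot01; last 2 first.
  - exact: L1_measurable Lp.
  - by move=> y; rewrite mulr_ge0 ?Q0 ?sqr_ge0.
  apply: eq_Int => y; rewrite /Q /vphase /vmain /g /g' usq_rot01 rot01E0 rot01E1.
  by move: (2 * _) (sin _) (cos _) => a s c; ring.
rewrite mulr_natl mulr2n {2}E -IntD//; apply: eq_Int => y.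
rewrite -mulrDr; congr (_ * _); rewrite /vphase /vmain /rho2 -/(g y).
have := cos2Dsin2 (la * g y); set c := cos _; set s := sin _ => cs.
transitivity ((y 0 i0 ^+ 2 + y 0 i1 ^+ 2) * (c ^+ 2 + s ^+ 2)); last by rewrite cs mulr1.
ring.
Qed.

(** The integrand is continuous and is positive at the point of the first axis with |x|^2 = u. *)
Lemma Q_energy_gt0 : (exists2 u, 0 < u & G u * 'D_1 G u != 0) -> 0 < \int[mu]_y (Q y * rho2 y).
Proof.
move=> [u u0 Gu].
pose x : V := Num.sqrt u *: basis_vec i0.
have x0 : x 0 i0 = Num.sqrt u by rewrite !mxE !eqxx mulr1.
have x1 : x 0 i1 = 0 by rewrite !mxE /= mulr0.
have xu : usq x = u.
  rewrite usqZ sqr_sqrtr ?(ltW u0)// /usq /dot (bigD1 i0)//= !mxE !eqxx mulr1.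
  by rewrite big1 ?addr0 ?mulr1// => j /negbTE j0; rewrite !mxE j0 /= mulr0.
pose f y := Q y * rho2 y.
have cf : continuous f by exact: C0M.
have fx : 0 < f x.
  rewrite /f /Q /rho2 x0 x1 /g /g' xu expr0n /= addr0 sqr_sqrtr ?(ltW u0)//.
  have e2 : 0 < (2 * (G u * 'D_(1 : R) G u)) ^+ 2.
    by rewrite exprn_even_gt0//= mulf_neq0// pnatr_eq0.
  exact: mulr_gt0 (mulr_gt0 e2 u0) u0.
have [e e0 he] : exists2 e : R, 0 < e & forall y, `|y - x| <= e -> f x / 2 <= f y.
  have fx2 : f x / 2 < f x by rewrite ltr_pdivrMr// ltr_pMr// ltr1n.
  have : \forall z \near x, f x / 2 < f z by have /cvgr_gt := cf x; apply.
  move=> /nbhs_ballP[e /= e0 he]; exists (e / 2); first by rewrite divr_gt0.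
  move=> y ye; apply: ltW; apply: he; rewrite -ball_normE /= distrC (le_lt_trans ye)//.
  by rewrite ltr_pdivrMr// ltr_pMr// ltr1n.
apply: (@Int_gt0 _ _ f x (f x / 2) e) => //.
- by apply: L1_ann => //; exact: ann_M.
- by move=> y; rewrite mulr_ge0 ?Q0// addr_ge0 ?sqr_ge0.
- by rewrite divr_gt0.
Unshelve. all: by end_near. Qed.

(** The first term, due to the shear, is the only one that grows with la. *)
Lemma derive_vth la y i : 'D_(basis_vec i) (vth la) y =
  la * (2 * (g y * g' y) * y 0 i * vphase G la y) +
  (g' y * (2 * y 0 i) * vmain G la y +
   g y * ((i0 == i)%:R * cos (la * g y) + (i1 == i)%:R * sin (la * g y))).
Proof.
have [_ ->] := is_derive_slice2 la y (basis_vec i) (smooth_vthz (m := m) sG).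
have [_ ->] := is_derive_vthz sG (la, y) (0, basis_vec i) => /=.
have -> : dot y (basis_vec i) = y 0 i.
  rewrite /dot (bigD1 i)//= !mxE !eqxx mulr1 big1 ?addr0// => j ji.
  by rewrite !mxE eqxx (negbTE ji) mulr0.
rewrite !mxE eqxx /= -/(g y) -/(g' y); ring.
Qed.

Lemma pick2 (I : 'I_n -> R) (u : R) : u + u <= I i0 + I i1 ->
  exists i, (i == i0) || (i == i1) /\ u <= I i.
Proof.
move=> P; have [h|h] := leP u (I i0); first by exists i0; rewrite eqxx.
by exists i1; rewrite eqxx orbT; split=> //; lra.
Qed.

(** Over the two directions of the plane the shear terms have total energy la^2 q / 2 by
    [phase_energy], and the other terms are bounded in la. One direction carries at least half of
    the total; which one may depend on la. *)
Lemma vth_lower : (exists2 u, 0 < u & G u * 'D_1 G u != 0) ->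
  exists2 c : R, 0 < c & exists la0 : R, forall la, la0 <= la -> 0 <= la -> exists i,
    (i == i0) || (i == i1) /\ c * la ^+ 2 <= \int[mu]_y ('D_(basis_vec i) (vth la) y ^+ 2).
Proof.
move=> /Q_energy_gt0; set q := \int[mu]_y (Q y * rho2 y) => q0.
pose bb la i y := g' y * (2 * y 0 i) * vmain G la y +
   g y * ((i0 == i)%:R * cos (la * g y) + (i1 == i)%:R * sin (la * g y)).
have bE i : exists2 C : R, 0 <= C & forall la y, `|bb la i y| <= C * weight y.
  pose e y := `|g' y * (2 * y 0 i)| * (`|y 0 i0| + `|y 0 i1|) + `|g y| * 2.
  have cn (f : V -> R) : continuous f -> continuous (fun y => `|f y|).
    by move=> cf y; apply: (@continuous_comp _ _ _ f Num.norm); [exact: cf|exact: norm_continuous].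
  have cg : continuous g by exact: smooth_continuous.
  have ce : continuous e.
    apply: C0D; apply: C0M.
    - by apply: cn; apply: C0M => //; apply: C0Z; exact: cc.
    - by apply: C0D; apply: cn; exact: cc.
    - exact: cn.
    - exact: C0_cst.
  have ae : ann_supp e.
    move=> y; apply: contraR => h; have hu : (usq y < 2) || (3 < usq y).
      by move: h; rewrite negb_and -!ltNge.
    by rewrite /e /g /g' (aG hu) (ann_derive aG hu) !mul0r normr0 !mul0r addr0.
  have [C C0 hC] := ann_supp_weight ce ae; exists C => // la y.
  apply: le_trans (hC y); rewrite [leRHS]ger0_norm; last first.
    by rewrite addr_ge0 ?mulr_ge0 ?addr_ge0.
  rewrite (le_trans (ler_normD _ _))// lerD//.
    rewrite normrM ler_wpM2l// (le_trans (ler_normD _ _))// !normrM.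
    by rewrite lerD// ler_piMr// ?norm_cos_le1// ler_norml sin_le1 sin_geN1.
  rewrite normrM ler_wpM2l// (le_trans (ler_normD _ _))// !normrM.
  have n1 (b : bool) : `|b%:R : R| <= 1 by case: b; rewrite ?normr1 ?normr0.
  rewrite -[leRHS]/(1 + 1) -[X in _ <= X + _]mulr1 -[X in _ <= _ + X]mulr1.
  by rewrite lerD// ler_pM// ?norm_cos_le1// ler_norml sin_le1 sin_geN1.
have [C0 C00 h0] := bE i0; have [C1 C10 h1] := bE i1.
have w1 := @L1_weight R n.
pose K := (C0 ^+ 2 + C1 ^+ 2) * \int[mu]_y weight y.
have K0 : 0 <= K.
  by rewrite mulr_ge0 ?addr_ge0 ?sqr_ge0// Int_ge0// => y; exact: weight_ge0.
(* From (x + b)^2 >= x^2 / 2 - b^2 the two energies sum to at least la^2 q / 4 - K. For la >= 1 + 8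
   K / q the error K is at most la^2 q / 8, and half of the remaining q / 8 is q / 16. *)
exists (q / 16); first by rewrite divr_gt0.
exists (1 + 8 * K / q) => la lala la0.
have sv i : schw ('D_(basis_vec i) (vth la)) by apply: schw_derive; exact: schw_vth.
have L i : L1 mu (fun y => 'D_(basis_vec i) (vth la) y ^+ 2).
  by apply: eq_L1 (L1_mul_schw (sv i) (sv i)) => y; rewrite expr2.
have Lp : L1 mu (fun y => Q y * vphase G la y ^+ 2).
  exact: (LQ (@cphase la)).
have S : la ^+ 2 / 2 * (q / 2) - K <=
   \int[mu]_y ('D_(basis_vec i0) (vth la) y ^+ 2) + \int[mu]_y ('D_(basis_vec i1) (vth la) y ^+ 2).
  have -> : q / 2 = \int[mu]_y (Q y * vphase G la y ^+ 2).
    by rewrite /q -(phase_energy la); field.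
  rewrite /K -!IntZ// -IntB; [|exact: L1Z|exact: L1Z]; rewrite -IntD//.
  apply: le_Int; [by apply: L1B; exact: L1Z|exact: L1D|move=> y].
  rewrite !derive_vth -/(bb la i0 y) -/(bb la i1 y).
  have b2 i (C : R) : 0 <= C -> (forall la y, `|bb la i y| <= C * weight y) ->
      bb la i y ^+ 2 <= C ^+ 2 * weight y.
    move=> CC h; rewrite -(real_normK (num_real (bb la i y))).
    apply: (@le_trans _ _ ((C * weight y) ^+ 2)).
      by rewrite ler_sqr ?nnegrE ?h// (le_trans _ (h la y)).
    by rewrite exprMn ler_wpM2l ?sqr_ge0// expr2 ler_piMl ?weight_ge0// weight_le1.
  have B0 := b2 _ _ C00 h0; have B1 := b2 _ _ C10 h1.
  move: (bb la i0 y) (bb la i1 y) B0 B1 => b0 b1 B0 B1.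
  rewrite /Q; move: (y 0 i0) (y 0 i1) (vphase G la y) (g y * g' y) (weight y) B0 B1.
  move=> y0 y1 p e w B0 B1.
  have A0 (x b : R) : x ^+ 2 / 2 - b ^+ 2 <= (x + b) ^+ 2.
    rewrite -subr_ge0; have -> : (x + b) ^+ 2 - (x ^+ 2 / 2 - b ^+ 2) = 2^-1 * (x + 2 * b) ^+ 2 by field.
    by rewrite mulr_ge0 ?invr_ge0// sqr_ge0.
  apply: le_trans (lerD (A0 _ _) (A0 _ _)).
  apply: (@le_trans _ _ (la ^+ 2 / 2 * ((2 * e) ^+ 2 * (y0 ^+ 2 + y1 ^+ 2) * p ^+ 2) - (b0 ^+ 2 + b1 ^+ 2))).
    by rewrite lerD2l lerN2 mulrDl lerD.
  by rewrite le_eqVlt; apply/orP; left; apply/eqP; field.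
have P : q / 16 * la ^+ 2 + q / 16 * la ^+ 2 <=
   \int[mu]_y ('D_(basis_vec i0) (vth la) y ^+ 2) + \int[mu]_y ('D_(basis_vec i1) (vth la) y ^+ 2).
  apply: le_trans S.
  have la1 : 1 <= la by rewrite (le_trans _ lala)// lerDl divr_ge0 ?(ltW q0)// mulr_ge0.
  have Kq : 8 * K <= q * la.
    by rewrite -ler_pdivrMl// (le_trans _ lala)// mulrC lerDr.
  have : 8 * K <= q * la ^+ 2.
    apply: (le_trans Kq); rewrite ler_wpM2l ?(ltW q0)// expr2 ler_peMl//.
  by set l2 := la ^+ 2; lra.
exact: (@pick2 (fun i => \int[mu]_y ('D_(basis_vec i) (vth la) y ^+ 2)) _ P).
Qed.

(** Each use of [doubling] turns the constant c into c^2 / C, which is why the orders are powers of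
    2. The constants are uniform in the angle and in the direction. *)
Lemma vth_lower_pow (c C : R) k : 0 < c -> 0 < C -> exists2 c' : R, 0 < c' &
  forall w la, \int[mu]_y (vth la y ^+ 2) <= C ->
    c * la ^+ 2 <= \int[mu]_y ('D_w (vth la) y ^+ 2) ->
    c' * (la ^+ (2 ^ k)) ^+ 2 <= \int[mu]_y (dirD w (2 ^ k) (vth la) y ^+ 2).
Proof.
move=> c0 C0; elim: k => [|k [c' c'0 IH]].
  by exists c => // w la _ h; rewrite expn0 expr1.
exists (c' ^+ 2 / C) => [|w la hC hc]; first by rewrite divr_gt0 ?exprn_gt0.
have := doubling w (2 ^ k) (schw_vth sG aG la); rewrite addnn -mul2n -expnS => D.
have X0 : 0 <= \int[mu]_y (dirD w (2 ^ k.+1) (vth la) y ^+ 2).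
  by apply: Int_ge0 => y; exact: sqr_ge0.
have h := IH w la hC hc.
have h2 : (c' * (la ^+ (2 ^ k)) ^+ 2) ^+ 2 <= (\int[mu]_y (dirD w (2 ^ k) (vth la) y ^+ 2)) ^+ 2.
  by rewrite ler_sqr ?nnegrE ?(le_trans _ h)// mulr_ge0 ?(ltW c'0)// sqr_ge0.
rewrite mulrAC ler_pdivrMr//.
have -> : c' ^+ 2 * (la ^+ (2 ^ k.+1)) ^+ 2 = (c' * (la ^+ (2 ^ k)) ^+ 2) ^+ 2.
  by rewrite exprMn expnS mulnC exprM -!exprM.
apply: (le_trans h2); apply: (le_trans D); rewrite mulrC ler_wpM2l//.
Qed.

Variables (A B : R).
Hypotheses (A0 : 0 < A) (B0 : 0 < B) (Bn : B * 2 ^- n < 1).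
Local Notation tp := (tp (m := m) G A B).
Local Notation theta := (theta (m := m) G A B).

Lemma vthN la y : vth la (- y) = - vth la y.
Proof.
have uN : usq (- y) = usq y by rewrite -scaleN1r usqZ sqrrN expr1n mul1r.
by rewrite /vth uN !mxE; ring.
Qed.

Lemma tpN t j y : tp t j (- y) = - tp t j y.
Proof. by rewrite /tp /dil scalerN vthN mulrN. Qed.

Lemma schw_tp t j : schw (tp t j).
Proof.
apply: (@schw_of_supported _ _ 2) => [|x x2].
  apply: smoothZ; apply: (smooth_dilate (F := vth (t * (2 * A) ^+ j))).
  exact: schw_smooth (schw_vth sG aG _).
by apply: dil_outside => // k; exact: ann_vth.
Qed.

Lemma dirD_tp t j w k : dirD w k (tp t j) =
  fun x => B ^+ j * (2 ^+ j) ^+ k * dirD w k (vth (t * (2 * A) ^+ j)) (2 ^+ j *: x).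
Proof. exact: (dirD_scale (B ^+ j) (2 ^+ j) w k (schw_smooth (schw_vth sG aG _))). Qed.

Lemma energy_tp t j w k : \int[mu]_x (dirD w k (tp t j) x ^+ 2) =
  (B ^+ 2 * 2 ^- n) ^+ j * ((2 ^+ j) ^+ k) ^+ 2 *
  \int[mu]_y (dirD w k (vth (t * (2 * A) ^+ j)) y ^+ 2).
Proof.
set F := dirD w k (vth _).
have sF : schw F by apply: schw_dirD; exact: schw_vth.
have F2 : L1 mu (fun y => F y ^+ 2) by apply: eq_L1 (L1_mul_schw sF sF) => y; rewrite expr2.
have p2 : (0 : R) < 2 ^+ j by rewrite exprn_gt0.
have E : \int[mu]_x (dirD w k (tp t j) x ^+ 2) =
    \int[mu]_x ((B ^+ j * (2 ^+ j) ^+ k) ^+ 2 * F (2 ^+ j *: x) ^+ 2).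
  by apply: eq_Int => x; rewrite dirD_tp exprMn.
rewrite E IntZ; last exact: (L1_scale (lt0r_neq0 p2) F2).
rewrite (Int_scale (lt0r_neq0 p2) F2) ger0_norm ?(ltW p2)//.
rewrite mulrA; congr (_ * _).
have -> : (2 ^+ j) ^- n = (2 ^- n) ^+ j :> R by rewrite exprVn -!exprM mulnC.
rewrite [in RHS]exprMn (exprAC B 2 j).
by move: (B ^+ j) (2 ^+ j ^+ k) ((2 ^- n) ^+ j) => b p z; rewrite exprMn; ring.
Qed.

(** Differentiation keeps the test function in its own annulus, so the whole density can be replaced
    by its j-th piece before k integrations by parts. *)
Lemma Int_theta_tp t j w k : \int[mu]_x (theta t x * dirD w (k + k) (tp t j) x) =
  (-1) ^+ k * \int[mu]_x (dirD w k (tp t j) x ^+ 2).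
Proof.
have aQ' : annular (fun j => dirD w (k + k) (tp t j)).
  move=> i x; rewrite dirD_tp mulf_eq0 negb_or => /andP[_].
  by move/(ann_supp_dirD (ann_vth aG (la := _))); rewrite usq2X.
transitivity (\int[mu]_x (tp t j x * dirD w (k + k) (tp t j) x)).
  by apply: eq_Int => x; exact: (asum_single j x (annular_tp aG (t := t)) aQ').
rewrite dirDD (Int_dirD w k (schw_tp t j) (schw_dirD w k (schw_tp t j))).
by congr (_ * _); apply: eq_Int => x; rewrite expr2.
Qed.

Lemma expr_unbounded (q M : R) : 1 < q -> exists j0, forall j, (j0 <= j)%N -> M < q ^+ j.
Proof.
move=> q1; exists (Num.truncn (`|M| / (q - 1))).+1 => j hj.
have q0 : 0 < q - 1 by rewrite subr_gt0.
have B1 : 1 + j%:R * (q - 1) <= q ^+ j.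
  elim: {hj} j => [|j IH]; first by rewrite mul0r addr0 expr0.
  rewrite exprS; apply: (@le_trans _ _ (q * (1 + j%:R * (q - 1)))); last by rewrite ler_wpM2l// ltW// (lt_trans ltr01).
  rewrite -subr_ge0 -natr1.
  have -> : q * (1 + j%:R * (q - 1)) - (1 + (j%:R + 1) * (q - 1)) = j%:R * (q - 1) ^+ 2 by ring.
  by rewrite mulr_ge0 ?sqr_ge0.
apply: lt_le_trans B1; apply: (le_lt_trans (ler_norm _)).
have : `|M| < j%:R * (q - 1).
  rewrite -ltr_pdivrMr// (lt_le_trans (truncnS_gt _))// ler_nat//.
lra.
Qed.

(** For e = Y / (a + 1) the first term on the right is at most Y / 2 and is absorbed on the left; a
    + 1 is used because a may vanish. Multiplying the rest by Y and dividing by P K l^2 eliminates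
    l. *)
Lemma absorb (a P c K l D Ls : R) : 0 <= a -> 0 < P -> 0 < c -> 0 < K -> 0 < l -> 0 < D -> 0 < Ls ->
  let Y := P * c * K * l in
  Y <= 2^-1 * (Y / (a + 1) * a + (Y / (a + 1))^-1 * Ls * P * (K * D * l ^+ 2)) ->
  P * c ^+ 2 * K <= (a + 1) * D * Ls.
Proof.
move=> a0 P0 c0 K0 l0 D0 Ls0 Y H.
have Y0 : 0 < Y by rewrite /Y !mulr_gt0.
have a1 : 0 < a + 1 by rewrite ltr_wpDl.
have h1 : Y / (a + 1) * a <= Y.
  by rewrite mulrAC ler_pdivrMr// ler_wpM2l ?(ltW Y0)// lerDl.
have h2 : Y <= (Y / (a + 1))^-1 * Ls * P * (K * D * l ^+ 2).
  move: H; set z := (Y / (a + 1))^-1 * _ * _ * _ => H.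
  move: H; rewrite ler_pdivlMl// => H; lra.
have h3 : Y ^+ 2 <= (a + 1) * Ls * P * (K * D * l ^+ 2).
  have := ler_wpM2l (ltW Y0) h2; rewrite -expr2 => h; apply: (le_trans h).
  rewrite le_eqVlt; apply/orP; left; apply/eqP; field.
  by rewrite !gt_eqF.
have z0 : 0 < P * K * l ^+ 2 by rewrite !mulr_gt0// exprn_gt0.
rewrite -(ler_pM2r z0).
apply: (@le_trans _ _ (Y ^+ 2)); first by rewrite le_eqVlt; apply/orP; left; apply/eqP; rewrite /Y; ring.
by apply: (le_trans h3); rewrite le_eqVlt; apply/orP; left; apply/eqP; ring.
Qed.

(** Testing with the j-th piece bounds its scaling factor K = (B^2 2^(- n))^j by a constant times
    L^(- 2 s), where L = t (4 A)^j is its typical frequency. So rho^j would stay bounded for rho =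
    B^2 2^(- n) (4 A)^(2 s) > 1. For A = 2^(- a) and B = 2^(- b) the condition rho > 1 reads (2 - a)
    s > b + n / 2. *)
Lemma theta_not_Hdot (t s : R) : (exists2 u, 0 < u & G u * 'D_1 G u != 0) -> 0 < t -> 0 <= s ->
  1 < 2 * A -> 1 < B ^+ 2 * 2 ^- n * (2 * (2 * A)) `^ (2 * s) ->
  ~ in_Hdot s (dist_of_real (theta t)).
Proof.
move=> Gu t0 s0 A2 rho1 tH.
have t1 := L1_theta (m := m) sG aG A B0 Bn t.
have [a a0 HT] := Hdot_test t1 s0 tH.
have [c c0 [la0 low]] := vth_lower Gu.
(* M is a power of 2 for the sake of [vth_lower_pow], and large enough for s <= 2 M in
   [frequency_split]. *)
pose k := (Num.truncn s).+1; pose M := (2 ^ k)%N.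
have sM : s <= (M + M)%:R.
  rewrite (@le_trans _ _ k%:R)//; first by rewrite ltW// truncnS_gt.
  by rewrite ler_nat (leq_trans (ltnW (ltn_expl k (ltnSn 1))))// leq_addr.
(* Order 0: no derivative is taken, so the direction is arbitrary, and the bound is on the L^2 norm
   of the profile itself. *)
have [C0 C00 hC0] := vth_upper (0 : V) 0.
pose C := C0 + 1; have Cp : 0 < C by rewrite ltr_wpDl.
have [c' c'0 low'] := vth_lower_pow k c0 Cp.
have [U0 U00 hU0] := vth_upper (basis_vec i0) (M + M).
have [U1 U10 hU1] := vth_upper (basis_vec i1) (M + M).
pose D := U0 + U1 + C; have D0 : 0 < D by rewrite ltr_wpDl// addr_ge0.
pose P : R := (2 * pi) ^+ n; have P0 : 0 < P by rewrite exprn_gt0// mulr_gt0// pi_gt0.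
pose a' := a + 1; have a'0 : 0 < a' by rewrite ltr_wpDl.
pose rho := B ^+ 2 * 2 ^- n * (2 * (2 * A)) `^ (2 * s).
(* [j1] makes the angle large enough for [vth_lower]; [j2] makes rho^j exceed the bound that
   membership would impose. *)
have [j1 hj1] := @expr_unbounded (2 * A) (Num.max 1 la0 / t) A2.
have [j2 hj2] := @expr_unbounded rho (a' * D / (P * c' ^+ 2) / t `^ (2 * s)) rho1.
pose j := maxn j1 j2; pose la := t * (2 * A) ^+ j.
have la_ge : Num.max 1 la0 < la.
  by rewrite /la mulrC -ltr_pdivrMr// hj1// leq_maxl.
have la1 : 1 <= la by rewrite (le_trans _ (ltW la_ge))// le_max lexx.
have lal : la0 <= la by rewrite (le_trans _ (ltW la_ge))// le_max lexx orbT.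
have lap : 0 < la := lt_le_trans ltr01 la1.
have [i [hi hc]] := low la lal (ltW lap).
have X0 : \int[mu]_y (vth la y ^+ 2) <= C.
  by have := hC0 la la1; rewrite expr0 expr1n mulr1 => h; rewrite (le_trans h)// lerDl.
have XM := low' (basis_vec i) la X0 hc; rewrite -/M in XM.
have X2M : \int[mu]_y (dirD (basis_vec i) (M + M) (vth la) y ^+ 2) <= (U0 + U1) * (la ^+ (M + M)) ^+ 2.
  have := hU0 la la1; have := hU1 la la1; have l0 := sqr_ge0 (la ^+ (M + M)).
  move: hi => /orP[] /eqP -> h h'.
    by apply: (le_trans h'); apply: ler_wpM2r; [exact: l0|rewrite lerDl].
  by apply: (le_trans h); apply: ler_wpM2r; [exact: l0|rewrite lerDr].
pose L := 2 ^+ j * la; have Lp : 0 < L by rewrite mulr_gt0// exprn_gt0.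
pose K := (B ^+ 2 * 2 ^- n) ^+ j.
have Kp : 0 < K by rewrite exprn_gt0// mulr_gt0 ?exprn_gt0// invr_gt0 exprn_gt0.
pose l := (L ^+ M) ^+ 2; have lp : 0 < l by rewrite exprn_gt0// exprn_gt0.
pose Y := P * c' * K * l.
have Yp : 0 < Y by exact: (mulr_gt0 (mulr_gt0 (mulr_gt0 P0 c'0) Kp) lp).
have e0 : 0 < Y / a' by rewrite divr_gt0.
have l2 : (L ^+ (M + M)) ^+ 2 = l ^+ 2 by rewrite /l exprD -expr2.
pose E k := \int[mu]_x (dirD (basis_vec i) k (tp t j) x ^+ 2).
have EM : c' * K * l <= E M.
  rewrite /E energy_tp -/la -/K /l /L [(2 ^+ j * la) ^+ M]exprMn.
  have := ler_wpM2l (mulr_ge0 (ltW Kp) (sqr_ge0 ((2 ^+ j) ^+ M))) XM.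
  by apply: le_trans; rewrite le_eqVlt; apply/orP; left; apply/eqP; rewrite exprMn; ring.
have E2M : E (M + M)%N <= (U0 + U1) * K * l ^+ 2.
  rewrite -l2 /E energy_tp -/la -/K /L [(2 ^+ j * la) ^+ (M + M)]exprMn.
  have := ler_wpM2l (mulr_ge0 (ltW Kp) (sqr_ge0 ((2 ^+ j) ^+ (M + M)))) X2M.
  move/le_trans; apply; rewrite le_eqVlt; apply/orP; left; apply/eqP.
  by rewrite [in RHS]exprMn; ring.
have E0 : E 0%N <= K * C.
  rewrite /E energy_tp -/la -/K expr0 expr1n mulr1 ler_wpM2l ?(ltW Kp)//.
have := HT (tp t j) i M (Y / a') L (schw_tp t j) (tpN t j) e0 Lp sM.
rewrite Int_theta_tp normrM normrX normrN1 expr1n mul1r ger0_norm; last first.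
  by apply: Int_ge0 => x; exact: sqr_ge0.
rewrite -/P -/(E M) -/(E (M + M)%N) -/(E 0%N) l2; set Ls := L `^ (- (2 * s)) => HE.
have Lsp : 0 < Ls by exact: powR_gt0.
have H1 : Y <= 2^-1 * (Y / a' * a + (Y / a')^-1 * Ls * P * (K * D * l ^+ 2)).
  apply: (@le_trans _ _ (P * E M)).
    have -> : Y = P * (c' * K * l) by rewrite /Y; ring.
    by rewrite ler_wpM2l ?(ltW P0).
  apply: (le_trans HE); rewrite ler_wpM2l ?invr_ge0// lerD2l.
  have c1 : 0 <= (Y / a')^-1 * Ls * P.
    by apply: mulr_ge0; [apply: mulr_ge0; [rewrite invr_ge0|]|]; exact: ltW.
  apply: ler_wpM2l => //.
  apply: (le_trans (lerD E2M (ler_wpM2l (sqr_ge0 l) E0))).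
  by rewrite le_eqVlt; apply/orP; left; apply/eqP; rewrite /D; ring.
have H2 : P * c' ^+ 2 * K <= a' * D * Ls.
  exact: (absorb a0 P0 c'0 Kp lp D0 Lsp H1).
have := hj2 j (leq_maxr _ _).
rewrite ltr_pdivrMr ?powR_gt0// ltNge => /negP; apply.
rewrite ler_pdivlMr; last by exact: mulr_gt0 P0 (exprn_gt0 2 c'0).
have KE : rho ^+ j * t `^ (2 * s) * Ls = K.
  rewrite /Ls /L /la powRN /rho exprMn -/K.
  have -> : (2 ^+ j * (t * (2 * A) ^+ j)) `^ (2 * s) = t `^ (2 * s) * ((2 * (2 * A)) `^ (2 * s)) ^+ j.
    rewrite powR_expn ?mulr_gt0// -powRM ?exprn_ge0 ?(ltW t0) ?mulr_ge0 ?(ltW A0)//.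
    by congr (_ `^ _); rewrite mulrCA -exprMn.
  have x0 : 0 < t `^ (2 * s) by exact: powR_gt0.
  have r0 : 0 < ((2 * (2 * A)) `^ (2 * s)) ^+ j by rewrite exprn_gt0// powR_gt0// !mulr_gt0.
  move: (t `^ (2 * s)) (((2 * (2 * A)) `^ (2 * s)) ^+ j) x0 r0 => x r x0 r0.
  by field; rewrite !gt_eqF.
rewrite -(ler_pM2r Lsp) mulrAC KE mulrC; exact: H2.
Qed.

End oscillation.

Lemma cvg_abs_series (R : realType) (u : nat -> R) (M : R) : (forall J, \sum_(j < J) `|u j| <= M) ->
  exists l : R, (fun J => \sum_(j < J) u j) @ \oo --> l.
Proof.
move=> uM; have E (w : nat -> R) : series w = fun J => \sum_(j < J) w j.
  by apply/funext => J; rewrite /series /= big_mkord.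
have : cvgn (series (fun k => `|u k|)).
  apply: nondecreasing_is_cvgn.
    apply/nondecreasing_seqP => k; by rewrite seriesSr lerDl.
  exists M => _ [J _ <-]; by have := uM J; rewrite /series /= big_mkord.
move=> /(@normed_cvg _ _ u); rewrite E => /cvg_ex[l hl]; exists l; exact: hl.
Qed.

(** * Sobolev norm of the vortex for p > 1 *)

Section parity.
Context {R : realType} {n : nat}.
Local Notation V := 'rV[R]_n.
Local Notation mu := (lebesgue_rV n).
Implicit Types (f : V -> R) (xi : V).

Lemma Int_odd f : L1 mu f -> (forall x, f (- x) = - f x) -> \int[mu]_x f x = 0.
Proof.
move=> f1 of_; have n1 : (-1 : R) != 0 by rewrite oppr_eq0 oner_eq0.
have := Int_scale n1 f1; rewrite normrN1 expr1n invr1 mul1r.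
under eq_Rintegral do rewrite scaleN1r of_.
rewrite IntN// => /eqP; rewrite eq_sym -subr_eq0 opprK -mulr2n mulrn_eq0 /= => /eqP//.
Qed.

Lemma dotNr (x y : V) : dot x (- y) = - dot x y.
Proof. by rewrite -scaleN1r dotZr mulN1r. Qed.

Lemma Tr_pihalfN f xi : L1 mu f -> Tr (pi / 2) f (- xi) = - Tr (pi / 2) f xi.
Proof.
move=> f1; rewrite /Tr -IntN; last exact: L1_cos.
by apply: eq_Int => x; rewrite dotNr !cosD_pihalf sinN; ring.
Qed.

Lemma Tr0N f xi : Tr 0 f (- xi) = Tr 0 f xi.
Proof. by apply: eq_Int => x; rewrite dotNr !addr0 cosN. Qed.

Lemma Tr0_odd f xi : L1 mu f -> (forall x, f (- x) = - f x) -> Tr 0 f xi = 0.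
Proof.
move=> f1 of_; apply: Int_odd => [|x]; first exact: L1_cos.
by rewrite of_ dotC dotNr dotC !addr0 cosN mulrN.
Qed.

Lemma enormN xi : enorm (- xi) = enorm xi.
Proof. by rewrite -scaleN1r enormZ normrN1 mul1r. Qed.

Lemma usqN xi : usq (- xi) = usq xi.
Proof. by rewrite -scaleN1r usqZ sqrrN expr1n mul1r. Qed.

Lemma asum_odd (P : nat -> V -> R) x : (forall j y, P j (- y) = - P j y) ->
  asum P (- x) = - asum P x.
Proof.
move=> oP; rewrite /asum /psum /aidx usqN -sumrN; apply: eq_bigr => j _; exact: oP.
Qed.

Lemma inv_fourier_funE (phi : V -> R[i]) x :
  schw (@complex.Re R \o phi) -> schw (@complex.Im R \o phi) ->
  inv_fourier_fun phi x =
  Complex (((2 * pi) ^+ n)^-1 * (Tr 0 (@complex.Re R \o phi) x + Tr (pi / 2) (@complex.Im R \o phi) x))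
          (((2 * pi) ^+ n)^-1 * (Tr 0 (@complex.Im R \o phi) x - Tr (pi / 2) (@complex.Re R \o phi) x)).
Proof.
move=> /schw_L1 r1 /schw_L1 i1.
have -> : Tr 0 (@complex.Re R \o phi) x + Tr (pi / 2) (@complex.Im R \o phi) x =
    complex.Re (cintegral (fun xi => cis (dot x xi) * phi xi)).
  rewrite /cintegral /= /Tr -IntD; try exact: L1_cos.
  by apply: eq_Int => y; rewrite cReM /= addr0 cosD_pihalf dotC; ring.
have -> : Tr 0 (@complex.Im R \o phi) x - Tr (pi / 2) (@complex.Re R \o phi) x =
    complex.Im (cintegral (fun xi => cis (dot x xi) * phi xi)).
  rewrite /cintegral /= /Tr -IntB; try exact: L1_cos.
  by apply: eq_Int => y; rewrite cImM /= addr0 cosD_pihalf dotC; ring.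
by apply: complexP; rewrite /inv_fourier_fun ?cReM ?cImM /=; ring.
Qed.

Lemma enorm_powR_rapid (s : R) f : 0 <= s -> rapid f ->
  exists2 C : R, 0 <= C & forall xi, enorm xi `^ s * `|f xi| <= C * weight xi.
Proof.
move=> s0 [_ hf]; have [k k0 [K hK]] := enorm_powR_le (n := n) s0.
have [D hD] := hf (K + 2 * n)%N; exists (k * Num.max 0 D).
  by rewrite mulr_ge0// le_max lexx.
move=> xi; apply: (le_trans (ler_wpM2r _ (hK xi))) => //.
rewrite -!mulrA ler_wpM2l//.
have hD' : (1 + `|xi|) ^+ (K + 2 * n) * `|f xi| <= Num.max 0 D by rewrite le_max hD orbT.
apply: le_trans (ler_wpM2r (weight_ge0 xi) hD').
rewrite exprD -mulrA mulrAC -!mulrA ler_wpM2l ?exprn_ge0 ?addr_ge0//.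
by rewrite mulrCA mulrA -[leLHS]mul1r ler_wpM2r// weight_lower.
Qed.

Lemma L1_enorm_powR (s : R) f : 0 <= s -> rapid f -> L1 mu (fun xi => enorm xi `^ s * f xi).
Proof.
move=> s0 rf; have [C C0 hC] := enorm_powR_rapid s0 rf.
apply: (L1_dominated (g := fun x => C * weight x)).
- apply: measurable_funM; first exact: measurable_enorm_powR.
  by apply: continuous_measurable_rV; case: rf.
- by apply: L1Z; exact: L1_weight.
- by move=> x; rewrite normrM ger0_norm ?powR_ge0.
Qed.

End parity.

Section riesz_potential.
Context {R : realType} {n : nat}.
Local Notation V := 'rV[R]_n.
Local Notation mu := (lebesgue_rV n).
Variables (r p A : R) (eta : V -> R).
Hypotheses (r0 : 0 <= r) (p1 : 1 <= p) (A0 : 0 < A) (An : A * 2 ^- n < 1).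
Hypotheses (dn : A * 2 `^ r * 2 ^- n < 1) (dp : (A * 2 `^ r) `^ p * 2 ^- n < 1).
Hypotheses (seta : schw eta) (aeta : ann_supp eta) (oeta : forall y, eta (- y) = - eta y).

Local Notation T' := (Tr (pi / 2)).
Let kap xi := enorm xi `^ r * T' eta xi.
Hypothesis kapw : exists C : R, forall x, `|T' kap x| <= C * weight x.

Let d := A * 2 `^ r.
Let c : R := ((2 * pi) ^+ n)^-1.
Let P := dil A (fun=> eta).
Let v := asum P.
(** This is F^-1(|xi|^r F eta): for odd eta both transforms reduce to sine transforms, and the
    product of their factors i is the sign in cos(t + pi / 2) = - sin t. *)
Let Psi x := c * T' kap x.
Let H x : \bar R := (\sum_(0 <= j <oo) (d ^+ j * `|Psi (2 ^+ j *: x)|)%:E)%E.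
(** Partial sums of the series for F^-1(|xi|^r F v), set to 0 where it does not converge absolutely.
    They then converge at every point and are dominated by the integrable [fine (H x)]. Unlike the
    pieces of v, these terms have no disjoint supports to rely on. *)
Let u J x : R := if (H x < +oo)%E then \sum_(j < J) d ^+ j * Psi (2 ^+ j *: x) else 0.

Let d0 : 0 < d. Proof. by rewrite mulr_gt0// powR_gt0. Qed.

Let eta1 : L1 mu eta. Proof. exact: schw_L1. Qed.

Let aP : annular P. Proof. exact: annular_dil. Qed.

Let v1 : L1 mu v. Proof. exact: L1_asum_dil. Qed.

Let vN x : v (- x) = - v x.
Proof. by apply: asum_odd => j y; rewrite /P /dil scalerN oeta mulrN. Qed.

Let kap1 : L1 mu kap.
Proof. by apply: L1_enorm_powR => //; exact: rapid_Tr. Qed.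

Let mPsi : measurable_fun setT Psi.
Proof. by apply: measurable_funM => //; exact: measurable_Tr. Qed.

Let PsiC : exists2 C : R, 0 <= C & forall x, `|Psi x| <= C * weight x.
Proof.
have [C hC] := kapw; have c0 : 0 <= c.
  by rewrite invr_ge0 exprn_ge0// mulr_ge0// pi_ge0.
have C0 : 0 <= C.
  by have := le_trans (normr_ge0 _) (hC 0); rewrite pmulr_lge0// weight_gt0.
exists (c * C) => [|x]; first by rewrite mulr_ge0.
by rewrite normrM ger0_norm// -mulrA ler_wpM2l.
Qed.

Let Psi1 : L1 mu (fun x => `|Psi x|).
Proof.
have [C C0 hC] := PsiC; apply: L1_abs.
apply: (L1_dominated (g := fun x => C * weight x)) => //.
by apply: L1Z; exact: L1_weight.
Qed.

Let term_ge0 j x : 0 <= d ^+ j * `|Psi (2 ^+ j *: x)|.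
Proof. by rewrite mulr_ge0// exprn_ge0// ltW. Qed.

Let H0 x : (0 <= H x)%E.
Proof. by apply: nneseries_ge0 => j _ _; rewrite lee_fin. Qed.

Let mH : measurable_fun setT H.
Proof.
apply: ge0_emeasurable_sum => [j x _ _|j _]; first by rewrite lee_fin.
apply/measurable_EFinP; apply: measurable_funM => //.
by apply: measurableT_comp => //; exact: measurable_dilate.
Qed.

Let Hoo : (\int[mu]_x H x < +oo)%E.
Proof.
apply: (@integral_dyadic_sum _ _ d 2 (fun x => `|Psi x|)) => //.
- exact: ltW.
- exact: measurableT_comp.
- by have := L1_lty Psi1; under eq_integral do rewrite normr_id.
Qed.

Let H_ae : {ae mu, forall x, setT x -> H x \is a fin_num}.
Proof.
apply: integrable_ae => //; apply/integrableP; split=> //.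
by under eq_integral do rewrite gee0_abs//.
Qed.

Let fineH1 : L1 mu (fun x => fine (H x)).
Proof.
apply: L1P; first by apply: (measurableT_comp (@fine_measurable R setT measurableT)).
apply: le_lt_trans Hoo; apply: ge0_le_integral => //.
- apply/measurable_EFinP; apply: measurableT_comp => //.
  by apply: (measurableT_comp (@fine_measurable R setT measurableT)).
- move=> x _; rewrite ger0_norm ?fine_ge0//.
  by have := H0 x; case: (H x) => [s| |] //= _; rewrite leey.
Qed.

Let u_le J x : `|u J x| <= fine (H x).
Proof.
rewrite /u; case: ifP => hx; last by rewrite normr0 fine_ge0.
have Hf : H x \is a fin_num by rewrite ge0_fin_numE.
rewrite -lee_fin fineK//; apply: (@le_trans _ _ (\sum_(j < J) d ^+ j * `|Psi (2 ^+ j *: x)|)%:E).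
  rewrite lee_fin (le_trans (ler_norm_sum _ _ _))// ler_sum// => j _.
  by rewrite normrM ger0_norm// exprn_ge0// ltW.
rewrite -sumEFin -(big_mkord xpredT (fun j => (d ^+ j * `|Psi (2 ^+ j *: x)|)%:E)).
by apply: nneseries_lim_ge => j _ _; rewrite lee_fin.
Qed.

Let ex_h x : exists l : R, (u ^~ x) @ \oo --> l.
Proof.
have [hx|hx] := boolP (H x < +oo)%E; last first.
  by exists 0; rewrite /u (negbTE hx); exact: cvg_cst.
have [|l hl] := @cvg_abs_series _ (fun j => d ^+ j * Psi (2 ^+ j *: x)) (fine (H x)); last first.
  by exists l; rewrite /u hx; exact: hl.
move=> J; have Hf : H x \is a fin_num by rewrite ge0_fin_numE.
rewrite -lee_fin fineK// -sumEFin.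
under eq_bigr do rewrite normrM ger0_norm ?exprn_ge0 ?(ltW d0)//.
rewrite -(big_mkord xpredT (fun j => (d ^+ j * `|Psi (2 ^+ j *: x)|)%:E)).
by apply: nneseries_lim_ge => j _ _; rewrite lee_fin.
Qed.

Let mu_ J : measurable_fun setT (u J).
Proof.
apply: measurable_fun_ifT.
- exact: measurable_fun_lte mH (measurable_cst _).
- apply: measurable_sum => j; apply: measurable_funM => //; exact: measurable_dilate.
- exact: measurable_cst.
Qed.

Let pairing j (phi : V -> R) : schw phi ->
  \int[mu]_x (d ^+ j * Psi (2 ^+ j *: x) * phi x) =
  c * \int[mu]_xi (enorm xi `^ r * ((A * 2 ^- n) ^+ j * T' eta (2^-1 ^+ j *: xi)) * T' phi xi).
Proof.
move=> sphi.
have k0 : (0 : R) < 2^-1 ^+ j by rewrite exprn_gt0 ?invr_gt0.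
have kapj : L1 mu (fun xi => kap (2^-1 ^+ j *: xi)) by apply: L1_scale => //; exact: lt0r_neq0.
have S x : T' kap (2 ^+ j *: x) = (2 ^- n) ^+ j * T' (fun xi => kap (2^-1 ^+ j *: xi)) x.
  have E1 : (2^-1 ^+ j)^-1 = 2 ^+ j :> R by rewrite exprVn invrK.
  have n0 : 2 ^+ n != 0 :> R by rewrite expf_neq0// pnatr_eq0.
  have E2 : (2 ^- n) ^+ j * (2 ^+ j) ^+ n = 1 :> R.
    by rewrite [(2 ^+ j) ^+ n]exprAC -exprMn (mulVf n0) expr1n.
  by rewrite Tr_scale// mulrA -[(2^-1 ^+ j) ^- n]exprVn E1 E2 mul1r.
have -> : \int[mu]_x (d ^+ j * Psi (2 ^+ j *: x) * phi x) =
    \int[mu]_x (c * d ^+ j * (2 ^- n) ^+ j * (T' (fun xi => kap (2^-1 ^+ j *: xi)) x * phi x)).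
  by apply: eq_Int => x; rewrite /Psi S; ring.
rewrite IntZ; last by apply: L1_Tr_mul => //; exact: schw_L1.
rewrite Tr_swap//; last exact: schw_L1.
rewrite -!mulrA; congr (c * _).
rewrite mulrA -IntZ; last first.
  rewrite (_ : (fun x => _) = fun x => T' phi x * kap (2^-1 ^+ j *: x)); last first.
    by apply/funext => x; rewrite mulrC.
  by apply: L1_Tr_mul => //; exact: schw_L1.
apply: eq_Int => xi; rewrite /kap (enorm_powR_dyadic r j xi) /d !exprMn.
by ring.
Qed.

Let tail_bound J xi : `|\sum_(j < J) (A * 2 ^- n) ^+ j * T' eta (2^-1 ^+ j *: xi)| <=
  (1 - A * 2 ^- n)^-1 * \int[mu]_x `|eta x|.
Proof.
have q0 : 0 <= A * 2 ^- n by rewrite mulr_ge0 ?invr_ge0 ?exprn_ge0// ltW.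
apply: (le_trans (ler_norm_sum _ _ _)).
apply: (@le_trans _ _ (\sum_(j < J) (A * 2 ^- n) ^+ j * \int[mu]_x `|eta x|)).
  apply: ler_sum => j _; rewrite normrM ger0_norm ?exprn_ge0// ler_wpM2l ?exprn_ge0//.
  exact: Tr_bound.
rewrite -mulr_suml ler_wpM2r ?Int_ge0// geometric_partial// q0//.
Qed.

Let L1_rho_Tr (phi : V -> R) (g : V -> R) (M : R) al : schw phi -> measurable_fun setT g ->
  (forall x, `|g x| <= M) -> L1 mu (fun xi => enorm xi `^ r * g xi * Tr al phi xi).
Proof.
move=> sphi mg gM.
apply: (@eq_L1 _ _ _ mu (fun xi => g xi * (enorm xi `^ r * Tr al phi xi))).
  by move=> xi; ring.
apply: (L1_bounded (C := M)) => //.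
by apply: L1_enorm_powR => //; exact: rapid_Tr.
Qed.

(** For partial sums the identity is the symmetry of the sine transform, scale by scale. Dominated
    convergence carries it to the limit on both sides, under [fine (H x)] in space and under a
    geometric bound for the transforms in frequency. *)
Lemma riesz_pairing : exists h : V -> R, [/\ L1 mu h, (forall x, (`|h x|%:E <= H x)%E) &
  forall phi, schw phi ->
    \int[mu]_x (h x * phi x) = c * \int[mu]_xi (enorm xi `^ r * T' v xi * T' phi xi)].
Proof.
have [h hh] := choice ex_h; exists h.
have [h1 _] := @Int_cvg _ _ R mu u h (fun x => fine (H x)) mu_ fineH1 u_le hh.
split=> // [x|phi sphi].
  have hf : `|h x| <= fine (H x) by exact: (cvg_norm_le (u_le ^~ x) (hh x)).
  have [hx|hx] := boolP (H x < +oo)%E.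
    by rewrite -(@fineK _ (H x)) ?lee_fin// ge0_fin_numE.
  by move: hx; rewrite ltey negbK => /eqP ->; rewrite leey.
have [M M0 hM] : exists2 M : R, 0 <= M & forall x, `|phi x| <= M.
  have [M M0 hM] := rapid_le_weight (reg_base (sphi 0%N)).
  by exists M => // x; rewrite (le_trans (hM x))// ler_piMr// weight_le1.
have mphi : measurable_fun setT phi := L1_measurable (schw_L1 sphi).
have [|||x|_ lim1] := @Int_cvg _ _ R mu (fun J x => u J x * phi x) (fun x => h x * phi x)
  (fun x => fine (H x) * M).
- by move=> J; exact: measurable_funM (mu_ J) mphi.
- exact: L1Zr.
- by move=> J x; rewrite normrM ler_pM.
- exact: (@cvg_mulrr _ _ _ (u ^~ x) (hh x)).
pose w J xi := \sum_(j < J) (A * 2 ^- n) ^+ j * T' eta (2^-1 ^+ j *: xi).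
have mw J : measurable_fun setT (w J).
  apply: measurable_sum => j; apply: measurable_funM => //; apply: measurable_dilate.
  exact: measurable_Tr.
pose M1 := (1 - A * 2 ^- n)^-1 * \int[mu]_x `|eta x|.
have [|||xi|_ lim2] := @Int_cvg _ _ R mu
  (fun J xi => enorm xi `^ r * w J xi * T' phi xi) (fun xi => enorm xi `^ r * T' v xi * T' phi xi)
  (fun xi => M1 * `|enorm xi `^ r * T' phi xi|).
- by move=> J; apply: L1_measurable (L1_rho_Tr _ sphi (mw J) (tail_bound J)).
- by apply: L1Z; apply: L1_abs; apply: L1_enorm_powR => //; exact: rapid_Tr.
- move=> J xi; rewrite mulrAC normrM mulrC ler_wpM2r//; exact: tail_bound.
- apply: (@cvg_mulrr _ _ _ (fun J => enorm xi `^ r * w J xi)).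
  apply: (@cvg_mulrl _ _ _ (fun J => w J xi)).
  exact: (@cvg_Tr_asum _ _ A eta A0 An aeta eta1).
have E J : \int[mu]_x (u J x * phi x) = c * \int[mu]_xi (enorm xi `^ r * w J xi * T' phi xi).
  pose s J x := \sum_(j < J) d ^+ j * Psi (2 ^+ j *: x).
  have L j : L1 mu (fun x => d ^+ j * Psi (2 ^+ j *: x) * phi x).
    apply: (@eq_L1 _ _ _ mu (fun x => phi x * (d ^+ j * Psi (2 ^+ j *: x)))).
      by move=> x; rewrite mulrC.
    apply: (L1_bounded (C := M)) => //; apply: L1Z; apply: L1_scale.
      by rewrite expf_neq0// pnatr_eq0.
    by apply: (L1_dominated (g := fun x => `|Psi x|)).
  have -> : \int[mu]_x (u J x * phi x) = \int[mu]_x (s J x * phi x).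
    rewrite /Rintegral; congr fine; apply: ae_eq_integral => //.
    - by apply/measurable_EFinP; exact: measurable_funM.
    - apply/measurable_EFinP; apply: measurable_funM => //.
      by apply: measurable_sum => j; apply: measurable_funM => //; exact: measurable_dilate.
    - apply: filterS H_ae => x /(_ I); rewrite ge0_fin_numE// => hx _.
      by rewrite /u hx.
  have -> : \int[mu]_x (s J x * phi x) =
      \int[mu]_x (\sum_(j < J) d ^+ j * Psi (2 ^+ j *: x) * phi x).
    by apply: eq_Int => x; rewrite /s mulr_suml.
  rewrite Int_sum//.
  under eq_bigr do rewrite pairing//.
  rewrite -mulr_sumr -Int_sum; last first.
    move=> j; apply: (L1_rho_Tr (M := \int[mu]_x `|eta x|)) => //.
      by apply: measurable_funM => //; apply: measurable_dilate; exact: measurable_Tr.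
    move=> x; have q0 : 0 <= A * 2 ^- n by rewrite mulr_ge0 ?invr_ge0 ?exprn_ge0// ltW.
    rewrite normrM ger0_norm ?exprn_ge0// -[leRHS]mul1r ler_pM ?exprn_ge0//.
      by rewrite exprn_ile1// ltW.
    exact: Tr_bound.
  by congr (_ * _); apply: eq_Int => xi; rewrite /w mulr_sumr mulr_suml.
have lim3 : (fun J => \int[mu]_x (u J x * phi x)) @ \oo -->
    c * \int[mu]_xi (enorm xi `^ r * T' v xi * T' phi xi).
  by under eq_fun do rewrite E; exact: (@cvg_mulrl _ c _ _ lim2).
by rewrite (cvg_unique _ lim1 lim3).
Qed.

(** As v is odd, F v = i T' v, and [riesz_pairing] identifies h with F^-1(|xi|^r F v): the cosine
    transform of a test function is even and pairs to 0 with the odd function |xi|^r T' v. The L^p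
    bound is [dyadic_Lp] for the kernel [Psi], with [dp] as its ratio condition. *)
Lemma Wdot_norm_gt1_dyadic : (Wdot_norm_gt1 r p (dist_of_real v) < +oo)%E.
Proof.
have [h [h1 hH hphi]] := riesz_pairing.
have p0 : 0 < p := lt_le_trans ltr01 p1.
pose g xi : R[i] := Complex 0 (T' v xi).
pose w := dist_of (fun xi => Complex (enorm xi `^ r) 0 * g xi).
have Tgrow : tempered_growth (fun xi => enorm xi `^ r * T' v xi).
  have [k k0 [K hK]] := enorm_powR_le (n := n) r0.
  apply: (@tempered_growth_poly _ _ _ (k * \int[mu]_x `|v x|) K).
    by apply: measurable_funM; [exact: measurable_enorm_powR|exact: measurable_Tr].
  move=> xi; rewrite normrM ger0_norm ?powR_ge0// mulrAC ler_pM ?powR_ge0//.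
  exact: Tr_bound.
have cg : ctempered_growth (fun xi : V => Complex (enorm xi `^ r) 0 * g xi).
  split.
    rewrite (_ : _ \o _ = fun=> 0); first by apply: tempered_growth_L1; exact: L1_0.
    by apply/funext => xi; rewrite /= mulr0 mul0r subr0.
  rewrite (_ : _ \o _ = fun xi => enorm xi `^ r * T' v xi)//.
  by apply/funext => xi; rewrite /= mul0r addr0.
have hr : riesz_derivative r (dist_of_real v) (fun x => Complex (h x) 0).
  exists g, w; split.
  - have := represents_fourier_real v1; congr (represents _ _).
    by apply/funext => xi; rewrite Tr0_odd.
  - exact: tempered_dist_of.
  - by split=> //; exact: ctempered_growth_loc.
  - split.
      by apply: ctempered_growth_loc; split; apply: tempered_growth_L1 => //; exact: L1_0.
    move=> phi /ctest_schw[sr si].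
    have mTv : measurable_fun setT (T' v) by exact: measurable_Tr.
    have bTv xi : `|T' v xi| <= \int[mu]_x `|v x| by exact: Tr_bound.
    have Lx al f : schw f -> L1 mu (fun xi => enorm xi `^ r * T' v xi * Tr al f xi).
      by move=> sf; exact: (L1_rho_Tr _ sf mTv bTv).
    have Z f : schw f -> \int[mu]_xi (enorm xi `^ r * T' v xi * Tr 0 f xi) = 0.
      move=> sf; apply: Int_odd => [|xi]; first exact: Lx.
      by rewrite enormN Tr_pihalfN// Tr0N; ring.
    rewrite /inv_fourier /w /dist_of /cintegral; congr Complex.
      transitivity (\int[mu]_xi (c * (enorm xi `^ r * T' v xi * T' (@complex.Re R \o phi) xi)
          - c * (enorm xi `^ r * T' v xi * Tr 0 (@complex.Im R \o phi) xi))).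
        by apply: eq_Int => xi; rewrite inv_fourier_funE// !cReM cImM /= -/c; ring.
      rewrite IntB; [|by apply: L1Z; exact: Lx|by apply: L1Z; exact: Lx].
      rewrite !IntZ; [|exact: Lx|exact: Lx].
      rewrite Z// mulr0 subr0 -hphi//; apply: eq_Int => x.
      by rewrite cReM /= mul0r subr0.
    transitivity (\int[mu]_xi (c * (enorm xi `^ r * T' v xi * T' (@complex.Im R \o phi) xi)
        + c * (enorm xi `^ r * T' v xi * Tr 0 (@complex.Re R \o phi) xi))).
      by apply: eq_Int => xi; rewrite inv_fourier_funE// !cImM cReM /= -/c; ring.
    rewrite IntD; [|by apply: L1Z; exact: Lx|by apply: L1Z; exact: Lx].
    rewrite !IntZ; [|exact: Lx|exact: Lx].
    rewrite Z// mulr0 addr0 -hphi//; apply: eq_Int => x.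
    by rewrite cImM /= mul0r addr0.
apply: (@le_lt_trans _ _ (Lnorm mu p%:E (fun x => (normc (Complex (h x) 0))%:E))).
  apply: ereal_inf_lbound; split; first exact: tempered_dist_of_real.
  by exists (fun x => Complex (h x) 0).
rewrite unlock; apply: poweR_lty.
rewrite (eq_integral (fun x => (`|h x| `^ p)%:E)); last first.
  move=> x _; rewrite /= expr0n /= addr0 sqrtr_sqr.
  by rewrite normr_id.
have [C C0 hC] := PsiC.
apply: (@dyadic_Lp _ _ p d 2 (fun x => `|Psi x|)) => //.
- exact: measurableT_comp.
- by apply: (@powR_weight_lty _ _ p C) => //; exact: measurableT_comp.
- by apply: measurableT_comp => //; exact: L1_measurable h1.
Qed.

End riesz_potential.

(** * Smoothness of powers of |xi| and decay of the kernel *)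

Section power.
Context {R : realType}.

(* [u `^ q] on the right half line, extended by [0] (the library's powR is [1] for a negative base). *)
Definition ppow (q u : R) : R := if 0 < u then u `^ q else 0.

(** At 0, q >= 2 bounds the function by h^2, so its derivative there is 0. *)
Lemma is_derive_ppow (q t : R) : 2 <= q -> is_derive t 1 (ppow q) (q * ppow (q - 1) t).
Proof.
move=> q2; have [t0|t0|t0] := ltgtP t 0.
- have F : \near t, 0 = ppow q t.
    near=> y; rewrite /ppow ifF//; apply/negbTE; rewrite -leNgt ltW//.
    by near: y; exact: lt_nbhsl.
  rewrite {2}/ppow ltNge ltW//= mulr0.
  exact: near_eq_is_derive F (is_derive_cst (0 : R) t 1).
- have F : \near t, t `^ q = ppow q t.
    near=> y; rewrite /ppow ifT//.
    by near: y; exact: lt_nbhsr.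
  by apply: (near_eq_is_derive F); rewrite /ppow t0; exact: is_derive1_powR.
- rewrite t0 {2}/ppow ltxx mulr0.
  have L (h : R) : `|h| <= 1 -> `|ppow q h| <= h ^+ 2.
    move=> h1; rewrite /ppow; case: ifPn => h0; last by rewrite normr0 sqr_ge0.
    rewrite gtr0_norm in h1 => //.
    by rewrite ger0_norm ?powR_ge0// -powR_mulrn ?(ltW h0)// ger_powR// h0.
  have lim : (fun h : R => h^-1 *: ((ppow q \o shift (0 : R)) (h *: 1) - ppow q 0)) @ 0^' --> (0 : R).
    apply/norm_cvg0P.
    apply: (@squeeze_cvgr _ _ _ _ (cst 0) (fun h : R => `|h|)).
    + near=> h; rewrite normr_ge0 /= addr0 [h *: 1]mulr1.
      have -> : ppow q 0 = 0 by rewrite /ppow ltxx.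
      have hn : h != 0 by near: h; exact: nbhs_dnbhs_neq.
      rewrite subr0 normrM normfV ler_pdivrMl ?normr_gt0// -expr2 real_normK ?num_real//.
      apply: L; near: h; apply: nbhs_dnbhs.
      by exists 1 => //= z /=; rewrite sub0r normrN => /ltW.
    + exact: cvg_cst.
    + rewrite -[X in _ --> X](normr0 R); apply: cvg_norm; exact: cvg_within_filter.
  apply: DeriveDef; first by apply/cvg_ex; exists 0.
  by apply: cvg_lim => //; exact: lim.
Unshelve. all: by end_near. Qed.

End power.

Section power_usq.
Context {R : realType} {n : nat}.
Local Notation V := 'rV[R]_n.
Implicit Types (f : V -> R) (x w xi : V).

Lemma ppow_usq (q : R) xi : 0 < q -> ppow q (usq xi) = enorm xi `^ (2 * q).
Proof.
move=> q0; rewrite powRrM /ppow /usq -enorm_sqr powR_mulrn ?enorm_ge0//.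
case: ifPn => //; rewrite -leNgt => h.
have -> : enorm xi ^+ 2 = 0 by apply/eqP; rewrite eq_le h sqr_ge0.
by rewrite powR0// gt_eqF.
Qed.

Lemma is_derive_usq_rV x w : is_derive x w (@usq R n) (2 * dot x w).
Proof.
have H : is_derive x w (fun y => \sum_i y 0 i * y 0 i) (\sum_i (x 0 i * w 0 i + w 0 i * x 0 i)).
  by apply: is_derive_sumR => i; apply: is_deriveMR; apply: is_derive_linR => h u v; rewrite !mxE.
by apply: (is_derive_eq H); rewrite /dot mulr_sumr; apply: eq_bigr => i _; ring.
Qed.

Lemma moderateZ (c : R) f : moderate f -> moderate (fun x => c * f x).
Proof. by move=> mf; apply: moderateM => //; exact: moderate_cst. Qed.

Lemma moderate_ppow (q : R) : 2 <= q -> moderate (fun x => ppow q (usq x)).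
Proof.
move=> q2; have q0 : 0 < q by rewrite (lt_le_trans _ q2).
split.
  move=> x; apply: (@continuous_comp _ _ _ (@usq R n) (ppow q)); first exact: continuous_usq.
  apply/differentiable_continuous/derivable1_diffP.
  by have [] := is_derive_ppow (usq x) q2.
have [c c0 [K hK]] := enorm_powR_le (n := n) (s := 2 * q) (mulr_ge0 (ler0n _ 2) (ltW q0)).
by exists K, c => x; rewrite ppow_usq// ger0_norm ?powR_ge0.
Qed.

Lemma reg_ppow (k : nat) (q : R) : k%:R + 2 <= q -> reg moderate k (fun x => ppow q (usq x)).
Proof.
elim: k q => [|k IH] q kq.
  by split=> //; apply: moderate_ppow; rewrite add0r in kq.
have q2 : 2 <= q by rewrite (le_trans _ kq)// lerDr.
apply: (reg_intro (df := fun w x => (q * ppow (q - 1) (usq x)) * (2 * dot x w))).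
- exact: moderate_ppow.
- by move=> w x; exact: is_derive_compR (is_derive_ppow (usq x) q2) (is_derive_usq_rV x w).
- move=> w; apply: (reg_mul moderateM moderateD).
    apply: (reg_scale q moderateZ); apply: IH.
    by move: kq; rewrite -natr1; lra.
  apply: (reg_scale 2 moderateZ); apply: reg_linear; [exact: dot_linear|exact: moderate_dot|exact: moderate_cst].
Qed.

(** |xi|^s is the power s / 2 of |xi|^2 and loses one unit of this exponent per derivative, so s / 2
    >= k + 2 gives k derivatives of polynomial growth. Smoothness in frequency then becomes decay in
    space. *)
Lemma Tr_powR_decay (k : nat) (s al be : R) f : (2 * k)%:R + 4 <= s -> schw f ->
  exists C : R, forall x, (1 + `|x|) ^+ k * `|Tr al (fun xi => enorm xi `^ s * Tr be f xi) x| <= C.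
Proof.
move=> ks sf; apply: Tr_decay.
have s2 : k%:R + 2 <= s / 2 by move: ks; rewrite natrM; lra.
have s0 : 0 < s / 2 by rewrite (lt_le_trans _ s2)// ltr_wpDl.
apply: (reg_ext (f := fun xi => ppow (s / 2) (usq xi) * Tr be f xi)).
  by move=> xi; rewrite ppow_usq//; congr (_ `^ _ * _); field.
apply: (reg_mul moderate_rapid (@rapidD _ _) (reg_ppow s2)).
exact: schw_Tr sf k.
Qed.

End power_usq.

Section laplacian.
Context {R : realType} {m : nat}.
Local Notation n := m.+2.
Local Notation V := 'rV[R]_n.
Implicit Types (f : R -> R) (x w y xi : V).

Lemma lrot_expand i y : \sum_j lrot i (basis_vec j) * y 0 j = lrot i y.
Proof.
have S k (e : R) : \sum_j e * basis_vec j 0 k * y 0 j = e * y 0 k.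
  rewrite (bigD1 k)//= !mxE !eqxx mulr1 big1 ?addr0// => j jk.
  by rewrite !mxE eqxx [k == j]eq_sym (negbTE jk) mulr0 mul0r.
rewrite /lrot; case: eqP => _; [|case: eqP => _].
- by under eq_bigr do rewrite -mulN1r; rewrite S mulN1r.
- by under eq_bigr do rewrite -[basis_vec _ _ _]mul1r; rewrite S mul1r.
- by rewrite big1// => j _; rewrite mul0r.
Qed.

Let L f i y : R := lrot i y * f (usq y).

Lemma derive2_lrot f i j y : smooth f ->
  dirD (basis_vec j) 2 (L f i) y =
  4 * (lrot i (basis_vec j) * y 0 j) * 'D_1 f (usq y) +
  lrot i y * (4 * y 0 j ^+ 2 * 'D_1 ('D_1 f) (usq y) + 2 * 'D_1 f (usq y)).
Proof.
move=> sf; have sf1 := smooth_derive (1 : R) sf.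
have dj x : dot x (basis_vec j) = x 0 j.
  rewrite /dot (bigD1 j)//= !mxE !eqxx mulr1 big1 ?addr0// => k kj.
  by rewrite !mxE eqxx (negbTE kj) mulr0.
have E : 'D_(basis_vec j) (L f i) =
    fun x => lrot i x * ('D_1 f (usq x) * (2 * x 0 j)) + lrot i (basis_vec j) * f (usq x).
  by apply/funext => x; have [_ ->] := is_derive_psi sf i x (basis_vec j); rewrite dj.
rewrite /dirD /= E.
have dl : is_derive y (basis_vec j) (lrot i) (lrot i (basis_vec j)).
  by apply: is_derive_linR; exact: lrot_linear.
have dc : is_derive y (basis_vec j) (fun x : V => x 0 j) 1.
  apply: (is_derive_eq (is_derive_linR (f := fun x : V => x 0 j) _ _ _)); last by rewrite mxE !eqxx.
  by move=> h u v; rewrite !mxE.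
have d1 := is_derive_Gusq sf y (basis_vec j); have d2 := is_derive_Gusq sf1 y (basis_vec j).
have [_ ->] := is_deriveDR (is_deriveMR dl (is_deriveMR d2 (is_deriveZR 2 dc)))
  (is_deriveZR (lrot i (basis_vec j)) d1).
rewrite dj; move: ('D_1 ('D_1 f) _) ('D_1 f _) => a b; ring.
Qed.

(** The second derivatives of the linear factor vanish, and the cross terms add up to a multiple of
    it by [lrot_expand]; they produce the 4 next to 2 d in [lap]. *)
Lemma laplacian_lrot f i y : smooth f ->
  \sum_j dirD (basis_vec j) 2 (L f i) y = L (lap n f) i y.
Proof.
move=> sf; under eq_bigr do rewrite derive2_lrot//.
rewrite big_split /= -mulr_sumr.
have S1 : \sum_j 4 * (lrot i (basis_vec j) * y 0 j) * 'D_1 f (usq y) = 4 * lrot i y * 'D_1 f (usq y).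
  rewrite -mulr_suml -mulr_sumr; congr (4 * _ * _).
  exact: lrot_expand.
rewrite S1 big_split /= -!mulr_suml -!mulr_sumr.
have -> : \sum_(j < n) (2 : R) = n%:R * 2 by rewrite sumr_const card_ord mulr_natl.
have -> : \sum_j y 0 j ^+ 2 = usq y by apply: eq_bigr => j _; rewrite expr2.
rewrite /L /lap; move: ('D_1 ('D_1 f) _) ('D_1 f _) => a b; ring.
Qed.

Lemma schw_psi f i : smooth f -> ann f -> schw (psi (m := m) f i).
Proof.
move=> sf af; apply: (@schw_of_supported _ _ 2); first exact: smooth_psi.
by move=> x x2; exact: ann_supp_norm (ann_psi af (i := i)) x2.
Qed.

Lemma Tr_psi_lap al f i xi : smooth f -> ann f ->
  Tr al (psi (m := m) (lap n f) i) xi = - usq xi * Tr al (psi (m := m) f i) xi.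
Proof.
move=> sf af; have sp := schw_psi i sf af.
have -> : psi (m := m) (lap n f) i = fun y => \sum_j dirD (basis_vec j) 2 (psi f i) y.
  by apply/funext => y; rewrite [RHS]laplacian_lrot.
rewrite Tr_sum; last by move=> j; exact: (schw_L1 (schw_dirD (basis_vec j) 2 sp)).
have E j : Tr al (dirD (basis_vec j) 2 (psi f i)) xi = - (xi 0 j * xi 0 j * Tr al (psi f i) xi).
  by rewrite (Tr_dirD al j 1 xi sp) expr1 expr2; ring.
by under eq_bigr do rewrite E; rewrite sumrN -mulr_suml mulNr.
Qed.

Lemma Tr_psi_prof al N i xi :
  Tr al (psi (m := m) (prof n N) i) xi = (-1) ^+ N * enorm xi ^+ (2 * N) * Tr al (psi (m := m) bumpf i) xi.
Proof.
elim: N => [|N IH]; first by rewrite muln0 !expr0 !mul1r.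
rewrite [prof n N.+1]/(lap n (prof n N)) Tr_psi_lap ?IH; [|exact: smooth_prof|exact: ann_prof].
by rewrite /usq -enorm_sqr mulnS exprD !exprS; ring.
Qed.

(** N Laplacians in the profile multiply the transform of the bump by |xi|^(2 N) up to sign, so
    |xi|^r is replaced by |xi|^(r + 2 N). Decay of order 2 n, as needed for [weight], asks for r + 2
    N >= 2 (2 n) + 4, and N = 2 n + 2 achieves it for every r >= 0. *)
Lemma psi_kernel_decay (r : R) i : 0 <= r -> exists C : R, forall x,
  `|Tr (pi / 2) (fun xi => enorm xi `^ r * Tr (pi / 2) (psi (m := m) (prof n (2 * n + 2)) i) xi) x|
  <= C * weight x.
Proof.
move=> r0; pose N := (2 * n + 2)%N; pose s := r + (2 * N)%:R.
have sb : schw (psi (R := R) (m := m) bumpf i) by exact: (schw_psi i (@smooth_bump R) (@ann_bump R)).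
have sp : schw (psi (R := R) (m := m) (prof n N) i) by exact: (schw_psi i (smooth_prof _ _) (ann_prof _ _)).
have ks : (2 * (2 * n))%:R + 4 <= s.
  have -> : (2 * (2 * n))%:R + 4 = (2 * N)%:R :> R by rewrite /N mulnDr natrD.
  by rewrite /s lerDr.
have [C hC] := Tr_powR_decay (pi / 2) (pi / 2) ks sb.
have C0 : 0 <= C.
  by apply: le_trans (hC 0); rewrite mulr_ge0// exprn_ge0// addr_ge0.
exists C => x.
have s1 : s != 0 by rewrite gt_eqF// (lt_le_trans _ ks)// ltr_wpDl.
have E xi : enorm xi `^ r * Tr (pi / 2) (psi (m := m) (prof n N) i) xi =
   (-1) ^+ N * (enorm xi `^ s * Tr (pi / 2) (psi (m := m) bumpf i) xi).
  rewrite Tr_psi_prof /s powRD; last by apply/implyP => /eqP h; move: s1; rewrite /s h eqxx.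
  by rewrite powR_mulrn ?enorm_ge0//; ring.
under [fun xi => _]eq_fun do rewrite E.
rewrite TrZ; last first.
  apply: L1_enorm_powR; last exact: rapid_Tr.
  by rewrite addr_ge0.
rewrite normrM normrX normrN1 expr1n mul1r.
rewrite -[leLHS]mul1r; apply: le_trans (ler_wpM2r _ (weight_lower x)) _ => //.
by rewrite mulrAC ler_wpM2r// ?weight_ge0.
Qed.

Lemma vfield_Wdot_gt1 (r p A : R) : 0 <= r -> 1 < p -> 0 < A -> A * 2 ^- n < 1 ->
  A * 2 `^ r * 2 ^- n < 1 -> (A * 2 `^ r) `^ p * 2 ^- n < 1 ->
  (Wdot_norm_vec r p (vfield (m := m) (prof n (2 * n + 2)) A) < +oo)%E.
Proof.
move=> r0 p1 A0 An dn dp; apply: lte_sum_pinfty => i _.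
rewrite /Wdot_norm gt_eqF//.
have -> : (fun x => vfield (prof n (2 * n + 2)) A x 0 i) = asum (dil A (fun=> psi (prof n (2 * n + 2)) i)).
  by apply/funext => x; rewrite mxE.
apply: Wdot_norm_gt1_dyadic => //.
- exact: ltW.
- exact: (schw_psi i (smooth_prof _ _) (ann_prof _ _)).
- by apply: ann_psi; exact: ann_prof.
- by move=> y; rewrite /psi lrotN usqN mulNr.
- exact: psi_kernel_decay.
Qed.

End laplacian.

Lemma integral_EFinZl d (T : measurableType d) (R : realType)
    (m : {measure set T -> \bar R}) (k : R) (g : T -> R) :
  0 <= k -> measurable_fun setT g -> (forall x, 0 <= g x) ->
  (\int[m]_x (k * g x)%:E = k%:E * \int[m]_x (g x)%:E)%E.
Proof.
move=> k0 mg g0; under eq_integral do rewrite EFinM.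
apply: ge0_integralZl_EFin => //; first by move=> x _; rewrite lee_fin.
exact/measurable_EFinP.
Qed.

(** * Sobolev norm of the vortex for p = 1 *)

Section kernel.
Context {R : realType} {n : nat}.
Local Notation V := 'rV[R]_n.
Local Notation mu := (lebesgue_rV n).
Implicit Types (f F W chi : V -> R) (x y z : V).

Lemma nneseries_term_le (a : nat -> R) j : (forall j, 0 <= a j) ->
  ((a j)%:E <= \sum_(0 <= i <oo) (a i)%:E)%E.
Proof.
move=> a0; apply: (@le_trans _ _ (\sum_(0 <= i < j.+1) (a i)%:E)%E).
  by rewrite big_nat_recr //= leeDr// sume_ge0// => i _; rewrite lee_fin.
by apply: nneseries_lim_ge => i _ _; rewrite lee_fin.
Qed.

Lemma pow2_lt (a b : R) : a < b -> 2 `^ a < 2 `^ b :> R.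
Proof. by move=> ab; rewrite /powR gt_eqF// ltr_expR ltr_pM2r// ln_gt0// ltr1n. Qed.

Lemma dyadic_up (t : R) : 0 < t -> t <= 1 -> exists j, 2^-1 < 2 ^+ j * t <= 1.
Proof.
move=> t0 t1; have ex : exists j, 2^-1 < 2 ^+ j * t.
  have [j0 hj] := @expr_unbounded R 2 (2^-1 / t) (ltr1n R 2).
  by exists j0; rewrite -ltr_pdivrMr// hj.
case: (ex_minnP ex) => j hj mj; exists j; rewrite hj /=.
case: j hj mj => [|j] hj mj; first by rewrite mul1r.
rewrite leNgt; apply/negP => h; have : 2^-1 < 2 ^+ j * t by move: h; rewrite exprS; lra.
by move/mj; rewrite ltnn.
Qed.

Lemma dyadic_down (t : R) : 1 < t -> exists j, 2^-1 < 2^-1 ^+ j * t <= 1.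
Proof.
move=> t1; have ex : exists j, 2^-1 ^+ j * t <= 1.
  have [j0 hj] := @expr_unbounded R 2 t (ltr1n R 2).
  exists j0; rewrite exprVn mulrC ler_pdivrMr ?exprn_gt0// mul1r ltW// hj//.
case: (ex_minnP ex) => j hj mj; exists j; rewrite hj andbT.
case: j hj mj => [|j] hj mj; first by move: hj; rewrite mul1r leNgt t1.
rewrite ltNge; apply/negP => h; have : 2^-1 ^+ j * t <= 1 by move: h; rewrite exprS; lra.
by move/mj; rewrite ltnn.
Qed.

Section finite.
Variable al : R.
Hypothesis al01 : 0 < al < 1.
Let s := n%:R + al.
Let s0 : 0 < s. Proof. by have /andP[a0 _] := al01; rewrite /s ltr_wpDl. Qed.

(** Up to a constant, a majorant of the Gagliardo quotient of a bounded Lipschitz function. It is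
    integrable near 0 because al < 1 and at infinity because al > 0. *)
Definition kern z : R := Num.min 1 (enorm z) / enorm z `^ s.

Lemma kern_ge0 z : 0 <= kern z.
Proof. by rewrite divr_ge0 ?powR_ge0// le_min ler01 enorm_ge0. Qed.

Lemma kernN z : kern (- z) = kern z.
Proof. by rewrite /kern enormN. Qed.

Lemma measurable_kern : measurable_fun setT kern.
Proof.
apply: measurable_funM; first by apply: measurable_minr => //; exact: measurable_enorm.
by under eq_fun do rewrite -powRN; exact: measurable_enorm_powR.
Qed.

Let E : R := 2 `^ s.
Let E0 : 0 < E. Proof. exact: powR_gt0. Qed.

(** On the shell 1 / 2 < |y| <= 1 the function |y|^(- s) is at most E = 2^s. Both series of
    [kern_le] consist of dilates of this block; after integration their ratios are 2^(al - 1)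
    towards the origin and 2^(- al) towards infinity. *)
Let F y : R := if (2^-1 < enorm y) && (enorm y <= 1) then E else 0.

Let F0 y : 0 <= F y. Proof. by rewrite /F; case: ifP => // _; exact: ltW. Qed.

Let mF : measurable_fun setT F.
Proof.
apply: measurable_fun_ifT => //; apply: measurable_and.
- by apply: measurable_fun_ltr => //; exact: measurable_enorm.
- by apply: measurable_fun_ler => //; exact: measurable_enorm.
Qed.

Let F1 : (\int[mu]_y (F y)%:E < +oo)%E.
Proof.
have := @powR_weight_lty R n 1 (E * 2 ^+ (2 * n)) F (lexx 1) mF F0.
under eq_integral do rewrite powRr1//.
apply=> y; rewrite /F; case: ifPn => [/andP[_ y1]|_]; last first.
  by rewrite !mulr_ge0 ?(ltW E0) ?exprn_ge0 ?weight_ge0.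
rewrite -mulrA -[leLHS]mulr1 ler_wpM2l ?(ltW E0)//.
apply: (le_trans (weight_lower y)); rewrite ler_wpM2r ?weight_ge0// lerXn2r ?nnegrE ?addr_ge0//.
have := norm_le_enorm y; lra.
Qed.

Let E1 : E = 2 ^+ n * 2 `^ al.
Proof. by rewrite /E /s powRD ?pnatr_eq0 ?implybT// powR_mulrn. Qed.

Let lowtau (t : R) : 2^-1 < t -> E^-1 <= t `^ s.
Proof.
move=> t2; have t0 : 0 < t by rewrite (lt_trans _ t2)// invr_gt0.
have -> : E^-1 = 2^-1 `^ s.
  by rewrite /E -[2^-1 in RHS]powR_inv1// -powRrM mulN1r powRN.
by apply: ge0_ler_powR; rewrite ?nnegrE ?invr_ge0 ?(ltW s0) ?(ltW t0) ?(ltW t2).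
Qed.

Lemma kern_le z : ((kern z)%:E <=
  \sum_(0 <= j <oo) ((2^-1 * E) ^+ j * F (2 ^+ j *: z))%:E +
  \sum_(0 <= j <oo) (E^-1 ^+ j * F (2^-1 ^+ j *: z))%:E)%E.
Proof.
have a0 j : 0 <= (2^-1 * E) ^+ j * F (2 ^+ j *: z).
  by rewrite mulr_ge0// exprn_ge0// mulr_ge0 ?invr_ge0 ?(ltW E0).
have b0 j : 0 <= E^-1 ^+ j * F (2^-1 ^+ j *: z).
  by rewrite mulr_ge0// exprn_ge0// invr_ge0 ltW.
have S1 : (0 <= \sum_(0 <= j <oo) ((2^-1 * E) ^+ j * F (2 ^+ j *: z))%:E)%E.
  by apply: nneseries_ge0 => j _ _; rewrite lee_fin.
have S2 : (0 <= \sum_(0 <= j <oo) (E^-1 ^+ j * F (2^-1 ^+ j *: z))%:E)%E.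
  by apply: nneseries_ge0 => j _ _; rewrite lee_fin.
have e0 := enorm_ge0 z.
have [z0|z0] := eqVneq (enorm z) 0.
  by rewrite /kern z0 min_r ?ler01// mul0r adde_ge0.
have ep : 0 < enorm z by rewrite lt_neqAle eq_sym z0.
have [z1|z1] := leP (enorm z) 1.
  have [j /andP[j1 j2]] := dyadic_up ep z1.
  apply: le_trans (leeDl _ S2); apply: le_trans (nneseries_term_le j a0); rewrite lee_fin.
  rewrite /F enormZ ger0_norm ?exprn_ge0// j1 j2 /=.
  set tau := 2 ^+ j * enorm z in j1 j2.
  have ez : enorm z = 2^-1 ^+ j * tau by rewrite /tau mulrA -exprMn mulVf ?expr1n ?mul1r// pnatr_eq0.
  have tp : 0 < tau by rewrite mulr_gt0// exprn_gt0.
  rewrite /kern min_r// {2}ez powRM ?exprn_ge0 ?invr_ge0 ?(ltW tp)//.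
  have -> : (2^-1 ^+ j) `^ s = (E ^+ j)^-1.
    by rewrite -powR_expn ?invr_gt0// -[2^-1]powR_inv1// -powRrM mulN1r powRN exprVn.
  have h := lowtau j1; have sp : 0 < tau `^ s by exact: powR_gt0.
  rewrite ez invfM invrK exprMn.
  have -> : 2^-1 ^+ j * tau * (E ^+ j * (tau `^ s)^-1) =
    2^-1 ^+ j * E ^+ j * (tau * (tau `^ s)^-1) by ring.
  rewrite ler_wpM2l ?mulr_ge0 ?exprn_ge0 ?invr_ge0 ?(ltW E0)//.
  rewrite ler_pdivrMr//; apply: (le_trans j2).
  by rewrite -ler_pdivrMl// mulr1.
have [j /andP[j1 j2]] := dyadic_down z1.
apply: le_trans (leeDr _ S1); apply: le_trans (nneseries_term_le j b0); rewrite lee_fin.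
rewrite /F enormZ ger0_norm ?exprn_ge0 ?invr_ge0// j1 j2 /=.
set tau := 2^-1 ^+ j * enorm z in j1 j2.
have ez : enorm z = 2 ^+ j * tau by rewrite /tau mulrA -exprMn mulfV ?expr1n ?mul1r// pnatr_eq0.
have tp : 0 < tau by rewrite mulr_gt0// exprn_gt0// invr_gt0.
rewrite /kern minEle (ltW z1) {1}ez powRM ?exprn_ge0 ?(ltW tp)//.
rewrite -powR_expn// -/E invfM exprVn mul1r ler_wpM2l ?invr_ge0 ?exprn_ge0 ?(ltW E0)//.
have h := lowtau j1; have sp : 0 < tau `^ s by exact: powR_gt0.
by rewrite -[leRHS]invrK lef_pV2 ?posrE ?invr_gt0.
Qed.

Lemma kern_lty : (\int[mu]_z (kern z)%:E < +oo)%E.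
Proof.
have /andP[al0 al1] := al01.
have mk : measurable_fun setT (fun z => (kern z)%:E) by apply/measurable_EFinP; exact: measurable_kern.
have ms (d rho : R) : 0 <= d ->
    measurable_fun setT (fun z : V => \sum_(0 <= j <oo) (d ^+ j * F (rho ^+ j *: z))%:E)%E.
  move=> d0; apply: ge0_emeasurable_sum => [j x _ _|j _].
    by rewrite lee_fin mulr_ge0// exprn_ge0.
  by apply/measurable_EFinP; apply: measurable_funM => //; exact: measurable_dilate.
have sp (d rho : R) z : 0 <= d -> (0 <= \sum_(0 <= j <oo) (d ^+ j * F (rho ^+ j *: z))%:E)%E.
  by move=> d0; apply: nneseries_ge0 => j _ _; rewrite lee_fin mulr_ge0// exprn_ge0.
have d1 : 0 <= 2^-1 * E by rewrite mulr_ge0 ?invr_ge0 ?(ltW E0).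
have d2 : 0 <= E^-1 by rewrite invr_ge0 ltW.
apply: (@le_lt_trans _ _ (\int[mu]_z (\sum_(0 <= j <oo) ((2^-1 * E) ^+ j * F (2 ^+ j *: z))%:E +
  \sum_(0 <= j <oo) (E^-1 ^+ j * F (2^-1 ^+ j *: z))%:E))%E).
  apply: ge0_le_integral => //.
  - by move=> z _; rewrite lee_fin kern_ge0.
  - by apply: emeasurable_funD; exact: ms.
  - by move=> z _; exact: kern_le.
have n0 : 2 ^+ n != 0 :> R by rewrite expf_neq0// pnatr_eq0.
rewrite ge0_integralD//; last 4 first.
- by move=> z _; exact: sp.
- exact: ms.
- by move=> z _; exact: sp.
- exact: ms.
apply: lte_add_pinfty; apply: integral_dyadic_sum => //.
- rewrite E1; have -> : 2^-1 * (2 ^+ n * 2 `^ al) / 2 ^+ n = 2 `^ al / 2 :> R by field.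
  rewrite ltr_pdivrMr// mul1r -[ltRHS]powRr1//.
  exact: pow2_lt.
- rewrite exprVn invrK E1 invfM mulrAC mulVf// mul1r invf_lt1 ?powR_gt0//.
  by rewrite -[ltLHS](powRr0 2) pow2_lt.
Qed.

End finite.

End kernel.

Section schw_lipschitz.
Context {R : realType} {n : nat}.
Local Notation V := 'rV[R]_n.
Local Notation mu := (lebesgue_rV n).
Implicit Types (chi : V -> R) (x y z : V).

Lemma Tr_lipschitz al chi : schw chi -> exists2 L : R, 0 <= L &
  forall x y, `|Tr al chi x - Tr al chi y| <= L * `|x - y|.
Proof.
move=> sc; pose c i := \int[mu]_z `|z 0 i * chi z|.
have rz i : rapid (fun z => z 0 i * chi z).
  by apply: moderate_rapid; [exact: moderate_coord|exact: reg_base (sc 0%N)].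
have Lz i : L1 mu (fun z => `|z 0 i * chi z|) by apply: L1_abs; exact: rapid_L1.
have c0 i : 0 <= c i by apply: Int_ge0.
exists (\sum_i c i) => [|x y]; first exact: sumr_ge0.
have c1 := schw_L1 sc.
rewrite /Tr -IntB; try exact: L1_cos.
rewrite mulr_suml.
have -> : \sum_i c i * `|x - y| = \int[mu]_z (\sum_i `|z 0 i * chi z| * `|x - y|).
  rewrite Int_sum; last by move=> i; exact: L1Zr.
  apply: eq_bigr => i _; rewrite mulrC -IntZ//; apply: eq_Int => z; exact: mulrC.
apply: le_norm_Int_dom.
- by apply: L1_sum => i; exact: L1Zr.
- by apply: measurable_funB; apply: L1_measurable (L1_cos _ _ c1).
- move=> z; rewrite -mulrBl normrM.
  apply: (le_trans (ler_wpM2r _ (cos_lipschitz _ _))) => //.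
  have -> : dot z x + al - (dot z y + al) = dot z (x - y) by rewrite dotBr; ring.
  apply: (@le_trans _ _ ((\sum_i `|z 0 i| * `|x - y|) * `|chi z|)).
    rewrite ler_wpM2r// (le_trans (ler_norm_sum _ _ _))// ler_sum// => i _.
    by rewrite normrM ler_wpM2l// coord_le_norm.
  by rewrite mulr_suml; apply: ler_sum => i _; rewrite normrM mulrAC.
Qed.

(** By inversion chi is itself a combination of transforms of rapidly decaying functions, and a
    transform is Lipschitz with a constant given by first moments. *)
Lemma schw_lipschitz chi : schw chi -> exists2 L : R, 0 <= L &
  forall x y, `|chi x - chi y| <= L * `|x - y|.
Proof.
move=> sc; pose P : R := (2 * pi) ^+ n.
have P0 : 0 < P by rewrite exprn_gt0// mulr_gt0// pi_gt0.
have E x : chi x = P^-1 * (Tr 0 (Tr 0 chi) x + Tr (pi / 2) (Tr (pi / 2) chi) x).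
  rewrite !Tr_inversion// -/P !subrr addr0 cos0 -splitr cospi.
  by field; rewrite gt_eqF.
have [L0 L00 h0] := Tr_lipschitz 0 (schw_Tr 0 sc).
have [L1' L10 h1] := Tr_lipschitz (pi / 2) (schw_Tr (pi / 2) sc).
exists (P^-1 * (L0 + L1')) => [|x y].
  by rewrite mulr_ge0 ?invr_ge0 ?(ltW P0)// addr_ge0.
rewrite !E -mulrBr normrM ger0_norm ?invr_ge0 ?(ltW P0)// -mulrA ler_wpM2l ?invr_ge0 ?(ltW P0)//.
have -> : forall a b c d : R, a + b - (c + d) = (a - c) + (b - d) by move=> a b c d; ring.
by rewrite [leRHS]mulrDl; apply: (le_trans (ler_normD _ _)); exact: lerD (h0 x y) (h1 x y).
Qed.

End schw_lipschitz.

Section gagliardo.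
Context {R : realType} {n : nat}.
Local Notation V := 'rV[R]_n.
Local Notation mu := (lebesgue_rV n).
Implicit Types (f chi : V -> R) (x y : V).
Variable al : R.
Hypothesis al01 : 0 < al < 1.
Let s := n%:R + al.

Definition quot f (z : V * V) : R := `|f z.1 - f z.2| / enorm (z.1 - z.2) `^ s.

Lemma quot_ge0 f (z : V * V) : 0 <= quot f z.
Proof. by rewrite divr_ge0 ?powR_ge0. Qed.

Lemma measurable_subV : measurable_fun setT (fun z : V * V => z.1 - z.2).
Proof.
apply: measurable_fun_rV => i; under eq_fun do rewrite !mxE.
apply: measurable_funB.
  exact: (measurableT_comp (measurable_coord i) measurable_fst).
exact: (measurableT_comp (measurable_coord i) measurable_snd).
Qed.

Lemma measurable_quot f : measurable_fun setT f -> measurable_fun setT (quot f).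
Proof.
move=> mf; apply: measurable_funM.
  apply: measurableT_comp => //; apply: measurable_funB.
    exact: (measurableT_comp mf measurable_fst).
  exact: (measurableT_comp mf measurable_snd).
under eq_fun do rewrite -powRN.
exact: (measurableT_comp (measurable_enorm_powR _) measurable_subV).
Qed.

Lemma Int2_prod (F : V * V -> R) : measurable_fun setT F -> (forall z, 0 <= F z) ->
  (\int[mu]_x \int[mu]_y (F (x, y))%:E = \int[mu \x mu]_z (F z)%:E)%E.
Proof.
move=> mF F0; apply/esym; apply: (fubini_tonelli1 (fun z => (F z)%:E)).
  exact/measurable_EFinP.
by move=> z; rewrite lee_fin.
Qed.

Lemma measurable_kern_sub : measurable_fun setT (fun z : V * V => kern al (z.1 - z.2)).
Proof. exact: (measurableT_comp (measurable_kern al) measurable_subV). Qed.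

(** By reflection and translation the inner integral of [kern] does not depend on x. *)
Lemma convolution_lty (W : V -> R) : L1 mu W -> (forall x, 0 <= W x) ->
  (\int[mu]_x \int[mu]_y (W x * kern al (x - y))%:E < +oo)%E.
Proof.
move=> W1 W0; have mk : measurable_fun setT (fun z : V => (kern al z)%:E).
  by apply/measurable_EFinP; exact: measurable_kern.
have E x : (\int[mu]_y (W x * kern al (x - y))%:E = (W x)%:E * \int[mu]_z (kern al z)%:E)%E.
  have n1 : (-1 : R) != 0 by rewrite oppr_eq0 oner_eq0.
  have := ge0_integral_affine x n1 mk (fun z => kern_ge0 al z : (0 <= (kern al z)%:E)%E).
  rewrite normrN1 expr1n invr1 mul1e => <-.
  have mx : measurable_fun setT (fun y : V => kern al (x - y)).
    exact: (measurableT_comp measurable_kern_sub (pair1_measurable x)).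
  rewrite (@integral_EFinZl _ V R mu (W x) (fun y => kern al (x - y)) (W0 x) mx); last first.
    by move=> y; exact: kern_ge0.
  apply: (f_equal (mule (W x)%:E)); apply: eq_integral => y _.
  by rewrite scaleN1r addrC.
under eq_integral do rewrite E.
rewrite ge0_integralZr//.
- apply: lte_mul_pinfty; last exact: kern_lty.
  + by apply: integral_ge0 => x _; rewrite lee_fin.
  + by rewrite (L1_EFin W1).
- by apply/measurable_EFinP; exact: L1_measurable W1.
- by move=> x _; rewrite lee_fin.
- by apply: integral_ge0 => z _; rewrite lee_fin kern_ge0.
Qed.

(** The numerator is at most M min(1, |x - y|) and vanishes unless one of the points lies in the
    cube |x| <= 2. Charging the quotient to that point leaves two integrals of [kern] against an
    integrable W. *)
Lemma quot_schw_lty chi : schw chi -> (forall x, 2 < `|x| -> chi x = 0) ->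
  (\int[mu \x mu]_z (quot chi z)%:E < +oo)%E.
Proof.
move=> sc chi0; have [L L0 hL] := schw_lipschitz sc.
have [C C0 hC] := rapid_le_weight (reg_base (sc 0%N)).
have hC' x : `|chi x| <= C by rewrite (le_trans (hC x))// ler_piMr// weight_le1.
pose M := L + (C + C).
pose W x : R := M * \1_[set x : V | `|x| <= 2] x.
have M0 : 0 <= M by rewrite !addr_ge0.
have mB : measurable [set x : V | `|x| <= 2].
  by apply: compact_measurable_rV; exact: norm_bounded_compact.
have W1 : L1 mu W.
  apply: L1Z; apply: L1P; first exact: measurable_indic.
  under eq_integral do rewrite ger0_norm//.
  rewrite (_ : (\int[mu]_x _)%E = ((2 * 2) ^+ n)%:E) ?ltry//.
  by rewrite integral_indic// setIT; exact: (box_measure n (ler0n R 2)).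
have W0 x : 0 <= W x by rewrite mulr_ge0.
have le z : quot chi z <= W z.1 * kern al (z.1 - z.2) + W z.2 * kern al (z.2 - z.1).
  have -> : kern al (z.2 - z.1) = kern al (z.1 - z.2) by rewrite -[in LHS]opprB kernN.
  rewrite -mulrDl /quot /kern mulrA ler_wpM2r ?invr_ge0 ?powR_ge0//.
  have key : `|chi z.1 - chi z.2| <= M * Num.min 1 (enorm (z.1 - z.2)).
    rewrite minEle; case: ifP => _.
      rewrite mulr1 (le_trans (ler_normB _ _))//.
      by rewrite (le_trans (lerD (hC' z.1) (hC' z.2)))// lerDr.
    apply: (le_trans (hL _ _)); apply: ler_pM => //; last exact: norm_le_enorm.
    by rewrite lerDl addr_ge0.
  have m0 : 0 <= Num.min 1 (enorm (z.1 - z.2)) by rewrite le_min ler01 enorm_ge0.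
  have [h1|h1] := leP `|z.1| 2.
    apply: (le_trans key); rewrite ler_wpM2r//.
    by rewrite /W indicE mem_set//= mulr1 lerDl; exact: W0.
  have [h2|h2] := leP `|z.2| 2.
    apply: (le_trans key); rewrite ler_wpM2r//.
    by rewrite /W [X in _ <= _ + _ * X]indicE mem_set//= mulr1 lerDr; exact: W0.
  by rewrite !chi0// subrr normr0 mulr_ge0// addr_ge0.
have mW1 : measurable_fun setT (fun z : V * V => W z.1 * kern al (z.1 - z.2)).
  apply: measurable_funM; last exact: measurable_kern_sub.
  exact: (measurableT_comp (L1_measurable W1) measurable_fst).
have mW2 : measurable_fun setT (fun z : V * V => W z.2 * kern al (z.2 - z.1)).
  under eq_fun do rewrite -opprB kernN.
  apply: measurable_funM; last exact: measurable_kern_sub.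
  exact: (measurableT_comp (L1_measurable W1) measurable_snd).
have mE1 : measurable_fun setT (fun z : V * V => (W z.1 * kern al (z.1 - z.2))%:E).
  by move/measurable_EFinP: mW1.
have mE2 : measurable_fun setT (fun z : V * V => (W z.2 * kern al (z.2 - z.1))%:E).
  by move/measurable_EFinP: mW2.
have p1 (z : V * V) : 0 <= W z.1 * kern al (z.1 - z.2) by rewrite mulr_ge0 ?W0 ?kern_ge0.
have p2 (z : V * V) : 0 <= W z.2 * kern al (z.2 - z.1) by rewrite mulr_ge0 ?W0 ?kern_ge0.
apply: (@le_lt_trans _ _ (\int[mu \x mu]_z ((W z.1 * kern al (z.1 - z.2))%:E +
   (W z.2 * kern al (z.2 - z.1))%:E))%E).
  apply: ge0_le_integral => //.
  - by move=> z _; rewrite lee_fin quot_ge0.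
  - by apply/measurable_EFinP; apply: measurable_quot; exact: L1_measurable (schw_L1 sc).
  - exact: emeasurable_funD mE1 mE2.
  - by move=> z _; rewrite -EFinD lee_fin.
have e1 (z : V * V) : [set: V * V] z -> (0 <= (W z.1 * kern al (z.1 - z.2))%:E)%E.
  by move=> _; rewrite lee_fin.
have e2 (z : V * V) : [set: V * V] z -> (0 <= (W z.2 * kern al (z.2 - z.1))%:E)%E.
  by move=> _; rewrite lee_fin.
have -> := ge0_integralD (mu \x mu)%E measurableT e1 mE1 e2 mE2.
apply: lte_add_pinfty.
  have := Int2_prod mW1 p1.
  by move=> /= <-; exact: convolution_lty.
have := fubini_tonelli (m1 := mu) (m2 := mu) _ mE2 (fun z => e2 z I).
have := Int2_prod mW2 p2.
by move=> /= <- ->; exact: convolution_lty.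
Qed.

(** The quotient contributes k^(n + al) and each of the two integrations k^(- n). *)
Lemma quot_dilate chi (k : R) : 0 < k -> measurable_fun setT chi ->
  (\int[mu \x mu]_z (quot (fun x => chi (k *: x)) z)%:E =
   (k `^ al * k ^- n)%:E * \int[mu \x mu]_z (quot chi z)%:E)%E.
Proof.
move=> k0 mchi.
have mq := measurable_quot mchi.
have qE z : quot (fun x => chi (k *: x)) z = k `^ s * quot chi (k *: z.1, k *: z.2).
  rewrite /quot /= -scalerBr enormZ (gtr0_norm k0) powRM ?enorm_ge0 ?(ltW k0)//.
  have kp : 0 < k `^ s by exact: powR_gt0.
  rewrite invfM mulrCA; congr (_ * _).
  by rewrite mulrA mulfV ?mul1r// gt_eqF.
have mqk : measurable_fun setT (quot (fun x => chi (k *: x))).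
  by apply: measurable_quot; exact: measurable_dilate.
rewrite -!Int2_prod//; [|exact: quot_ge0|exact: quot_ge0].
have msl x : measurable_fun setT (fun y => (quot chi (x, y))%:E).
  by apply/measurable_EFinP; exact: (measurableT_comp mq (pair1_measurable x)).
have inner x : (\int[mu]_y (quot (fun x => chi (k *: x)) (x, y))%:E =
    (k `^ s * k ^- n)%:E * \int[mu]_y (quot chi (k *: x, y))%:E)%E.
  have := ge0_integral_affine (0 : V) (lt0r_neq0 k0) (msl (k *: x))
    (fun y => quot_ge0 chi (k *: x, y) : (0 <= (quot chi (k *: x, y))%:E)%E).
  rewrite (gtr0_norm k0) => h.
  have mx : measurable_fun setT (fun y : V => quot chi (k *: x, k *: y)).
    apply: (@measurable_dilate _ _ (fun y => quot chi (k *: x, y))).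
    exact: (measurableT_comp mq (pair1_measurable (k *: x))).
  have ks : 0 <= k `^ s by exact: powR_ge0.
  rewrite EFinM -muleA -h.
  transitivity (\int[mu]_y (k `^ s * quot chi (k *: x, k *: y))%:E)%E.
    by apply: eq_integral => y _; rewrite qE.
  rewrite (@integral_EFinZl _ V R mu (k `^ s) (fun y => quot chi (k *: x, k *: y)) ks mx).
    by apply: (f_equal (mule (k `^ s)%:E)); apply: eq_integral => y _; rewrite addr0.
  by move=> y; exact: quot_ge0.
under eq_integral do rewrite inner.
pose F x : \bar R := (\int[mu]_y (quot chi (x, y))%:E)%E.
have mF : measurable_fun setT F.
  apply: (measurable_fun_fubini_tonelli_F (fun z => (quot chi z)%:E)).
    exact/measurable_EFinP.
  by move=> z; rewrite lee_fin quot_ge0.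
have F0 x : (0 <= F x)%E by apply: integral_ge0 => y _; rewrite lee_fin quot_ge0.
have h := ge0_integral_affine (0 : V) (lt0r_neq0 k0) mF F0.
have {}h : (\int[mu]_y F (k *: y) = (k ^- n)%:E * \int[mu]_y F y)%E.
  rewrite (gtr0_norm k0) in h; rewrite -h.
  by apply: eq_integral => y _; rewrite addr0.
have c0 : 0 <= k `^ s * k ^- n by rewrite mulr_ge0 ?powR_ge0// invr_ge0 exprn_ge0// ltW.
have mFk : measurable_fun setT (fun x => F (k *: x)).
  have := measurableT_comp mF (measurable_affine_rV k (0 : V)).
  by under eq_fun do rewrite addr0.
have F0k x : setT x -> (0 <= F (k *: x))%E by move=> _; exact: F0.
have -> := ge0_integralZl_EFin mu measurableT F0k mFk c0.
have kE : k `^ s / k ^+ n * k ^- n = k `^ al * k ^- n.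
  rewrite /s powRD; last by rewrite (gt_eqF k0) implybT.
  rewrite powR_mulrn ?(ltW k0)//; field.
  by rewrite expf_neq0// gt_eqF.
rewrite -kE [in RHS]EFinM -muleA; apply: (f_equal (mule (k `^ s / k ^+ n)%:E)); exact: h.
Qed.

(** The seminorm is subadditive, and its scaling makes the series geometric with ratio e 2^al 2^(-
    n). At two given points only finitely many terms occur, so the triangle inequality is used on a
    finite sum. *)
Lemma gagliardo_dyadic (e : R) chi : 0 < e -> e * 2 `^ al * 2 ^- n < 1 ->
  schw chi -> ann_supp chi ->
  (\int[mu]_x \int[mu]_y (quot (asum (dil e (fun=> chi))) (x, y))%:E < +oo)%E.
Proof.
move=> e0 en sc ac; have mchi := L1_measurable (schw_L1 sc).
pose P := dil e (fun=> chi); have aP : annular P by exact: annular_dil.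
have mP : measurable_fun setT (asum P).
  apply: measurable_asum => // j; apply: measurable_funM => //; exact: measurable_dilate.
rewrite Int2_prod; [|exact: measurable_quot|exact: quot_ge0].
pose T j z := e ^+ j * quot (fun x => chi (2 ^+ j *: x)) z.
have T0 j z : 0 <= T j z by rewrite mulr_ge0 ?quot_ge0// exprn_ge0// ltW.
have mT j : measurable_fun setT (fun z => (T j z)%:E).
  apply/measurable_EFinP; apply: measurable_funM => //.
  by apply: measurable_quot; exact: measurable_dilate.
have qT z : ((quot (asum P) z)%:E <= \sum_(0 <= j <oo) (T j z)%:E)%E.
  pose J := maxn (aidx z.1) (aidx z.2).
  apply: (@le_trans _ _ (\sum_(0 <= j < J) (T j z)%:E)%E); last first.
    by apply: nneseries_lim_ge => j _ _; rewrite lee_fin.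
  rewrite sumEFin lee_fin big_mkord /quot.
  rewrite -(psumE aP (leq_maxl (aidx z.1) (aidx z.2))) -(psumE aP (leq_maxr (aidx z.1) (aidx z.2))).
  rewrite -/J /psum -sumrB.
  have -> : \sum_(j < J) T j z =
    (\sum_(j < J) `|P j z.1 - P j z.2|) / enorm (z.1 - z.2) `^ s.
    rewrite mulr_suml; apply: eq_bigr => j _; rewrite /T /quot /P /dil -mulrBr normrM.
    by rewrite ger0_norm ?mulrA// exprn_ge0// ltW.
  by rewrite ler_wpM2r ?invr_ge0 ?powR_ge0// ler_norm_sum.
apply: (@le_lt_trans _ _ (\int[mu \x mu]_z (\sum_(0 <= j <oo) (T j z)%:E))%E).
  apply: ge0_le_integral => //.
  - by move=> z _; rewrite lee_fin quot_ge0.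
  - by apply/measurable_EFinP; exact: measurable_quot.
  - by apply: ge0_emeasurable_sum => [j z _ _|j _]; rewrite ?lee_fin.
rewrite integral_nneseries//; last by move=> j z _; rewrite lee_fin.
have I := quot_schw_lty sc (fun x => ann_supp_norm ac).
have I0 : (0 <= \int[mu \x mu]_z (quot chi z)%:E)%E.
  by apply: integral_ge0 => z _; rewrite lee_fin quot_ge0.
have If : (\int[mu \x mu]_z (quot chi z)%:E)%E \is a fin_num by rewrite ge0_fin_numE.
have p2 j : (0 : R) < 2 ^+ j by rewrite exprn_gt0.
have E j : (\int[mu \x mu]_z (T j z)%:E = ((e * 2 `^ al * 2 ^- n) ^+ j *
    fine (\int[mu \x mu]_z (quot chi z)%:E)%E)%:E)%E.
  rewrite integral_EFinZl.
  - rewrite quot_dilate// -(fineK If) -!EFinM; congr EFin; rewrite fineK//.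
    rewrite !exprMn mulrA; congr (_ * _); rewrite -mulrA; congr (_ * _).
    rewrite -powR_expn//; congr (_ * _).
    by rewrite exprVn -!exprM mulnC.
  - by rewrite exprn_ge0// ltW.
  - by apply: measurable_quot; exact: measurable_dilate.
  - exact: quot_ge0.
rewrite (eq_eseriesr (g := fun j => ((e * 2 `^ al * 2 ^- n) ^+ j *
    fine (\int[mu \x mu]_z (quot chi z)%:E)%E)%:E)); last by move=> j _; rewrite E.
have q0 : 0 <= e * 2 `^ al * 2 ^- n by rewrite !mulr_ge0 ?powR_ge0 ?invr_ge0 ?exprn_ge0 ?(ltW e0).
apply: (@le_lt_trans _ _ ((1 - e * 2 `^ al * 2 ^- n)^-1 *
    fine (\int[mu \x mu]_z (quot chi z)%:E)%E)%:E); last exact: ltry.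
apply: nneseries_le => [j|J]; first by rewrite mulr_ge0 ?exprn_ge0 ?fine_ge0.
by rewrite -mulr_suml ler_wpM2r ?fine_ge0// geometric_partial// q0.
Qed.

End gagliardo.

(** * Weak derivatives of dyadic sums *)

Section iterated_derivatives.
Context {R : realType} {n : nat}.
Local Notation V := 'rV[R]_n.
Local Notation mu := (lebesgue_rV n).
Implicit Types (f g eta phi : V -> R) (x y w : V) (ws : seq V).

(** Integration by parts removes the derivatives of the test function from the outermost inwards, so
    they reach f in the order opposite to that of [iter_derive]. Keeping this order avoids commuting
    partial derivatives. *)
Definition dirs ws f := foldl (fun g w => 'D_w g) f ws.

Lemma schw_dirs ws f : schw f -> schw (dirs ws f).
Proof. by elim: ws f => // w ws IH f sf; apply: IH; exact: schw_derive. Qed.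

Lemma ann_supp_dirs ws f : ann_supp f -> ann_supp (dirs ws f).
Proof. by elim: ws f => // w ws IH f sf; apply: IH; exact: ann_supp_derive. Qed.

Lemma schw_iter_derive ws f : schw f -> schw (iter_derive ws f).
Proof. by move=> sf; elim: ws => // w ws IH; exact: schw_derive. Qed.

Lemma Int_iter_derive ws f g : schw f -> schw g ->
  \int[mu]_x (f x * iter_derive ws g x) =
  (-1) ^+ size ws * \int[mu]_x (dirs ws f x * g x).
Proof.
elim: ws f => [|w ws IH] f sf sg; first by rewrite mul1r.
rewrite /= Int_by_parts.
- by rewrite IH//; [rewrite exprS mulN1r mulNr|exact: schw_derive].
- by apply: reg_mono (sf 1); exact: rapid_moderate.
- exact: (schw_iter_derive ws sg 1).
Qed.

Lemma derive_dilate (c a : R) w f : smooth f ->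
  'D_w (fun x => c * f (a *: x)) = fun x => c * a * 'D_w f (a *: x).
Proof. by move=> sf; have := dirD_scale c a w 1 sf; rewrite /dirD /= expr1. Qed.

Lemma dirs_dilate (c a : R) ws f : smooth f ->
  dirs ws (fun x => c * f (a *: x)) = fun x => c * a ^+ size ws * dirs ws f (a *: x).
Proof.
elim: ws c f => [|w ws IH] c f sf /=; first by apply/funext => x; rewrite expr0 mulr1.
rewrite derive_dilate// (IH (c * a) ('D_w f)); last exact: smooth_derive.
by apply/funext => x; rewrite exprS !mulrA.
Qed.

Lemma dirs_dil (e : R) ws eta j : smooth eta ->
  dirs ws (dil e (fun=> eta) j) = dil (e * 2 ^+ size ws) (fun=> dirs ws eta) j.
Proof.
move=> se; rewrite dirs_dilate//; apply/funext => x; rewrite /dil exprMn.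
by congr (_ * _ * _); rewrite -!exprM mulnC.
Qed.

Lemma Int_psum_cvg (e C : R) eta g : 0 < e -> e * 2 ^- n < 1 -> ann_supp eta ->
  L1 mu eta -> measurable_fun setT g -> (forall x, `|g x| <= C) ->
  (fun J => \sum_(j < J) \int[mu]_x (dil e (fun=> eta) j x * g x)) @ \oo -->
  \int[mu]_x (asum (dil e (fun=> eta)) x * g x).
Proof.
move=> e0 en ae e1 mg gC.
pose P := dil e (fun=> eta); have aP : annular P by exact: annular_dil.
have PL j : L1 mu (P j) by exact: L1_dil.
have PgL j : L1 mu (fun x => P j x * g x).
  apply: (L1_dominated (g := fun x => C * `|P j x|)).
  - by apply: measurable_funM => //; exact: L1_measurable.
  - by apply: L1Z; exact: L1_abs.
  - by move=> x; rewrite normrM mulrC ler_wpM2r.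
have [|||x|_ h] := @Int_cvg _ _ R mu (fun J x => psum P J x * g x)
  (fun x => asum P x * g x) (fun x => C * asum (fun j x => `|P j x|) x).
- move=> J; apply: measurable_funM => //; apply: L1_measurable.
  by apply: L1_sum => j; exact: PL.
- by apply: L1Z; exact: L1_dil_env.
- move=> J x; rewrite normrM mulrC.
  apply: ler_pM => //; exact: psum_norm_le.
- by apply: cvg_mulrr; exact: cvg_psum.
rewrite (_ : (fun J => _) = fun J => \int[mu]_x (psum P J x * g x))//.
apply/funext => J; rewrite -Int_sum//; apply: eq_Int => x.
by rewrite /psum mulr_suml.
Qed.

(** Integration by parts is done term by term. The condition with 2^k makes the differentiated sum
    integrable, so the weak derivative has no singular part at the origin. *)
Lemma Int_asum_iter_derive (e : R) eta ws phi : 0 < e -> e * 2 ^- n < 1 ->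
  e * 2 ^+ size ws * 2 ^- n < 1 -> ann_supp eta -> schw eta -> schw phi ->
  \int[mu]_x (asum (dil e (fun=> eta)) x * iter_derive ws phi x) =
  (-1) ^+ size ws * \int[mu]_x (asum (dil (e * 2 ^+ size ws) (fun=> dirs ws eta)) x * phi x).
Proof.
move=> e0 en ekn ae se sphi.
have sm : smooth eta by exact: schw_smooth.
have bd f : schw f -> exists C : R, forall x, `|f x| <= C.
  move=> sf; have [C C0 hC] := rapid_le_weight (reg_base (sf 0%N)).
  by exists C => x; rewrite (le_trans (hC x))// ler_piMr// weight_le1.
have sd j : schw (dil e (fun=> eta) j).
  apply: (@schw_of_supported _ _ 2) => [|x x2]; last exact: dil_outside x2.
  by apply: smoothZ; exact: smooth_dilate.
have [C1 h1] := bd _ (schw_iter_derive ws sphi).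
have [C2 h2] := bd _ sphi.
have c1 := Int_psum_cvg e0 en ae (schw_L1 se) (L1_measurable (schw_L1 (schw_iter_derive ws sphi))) h1.
have ek0 : 0 < e * 2 ^+ size ws by rewrite mulr_gt0// exprn_gt0.
have c2 := Int_psum_cvg ek0 ekn (ann_supp_dirs (ws := ws) ae) (schw_L1 (schw_dirs ws se))
  (L1_measurable (schw_L1 sphi)) h2.
have c3 := cvg_mulrl (c := (-1) ^+ size ws) c2.
apply: (cvg_unique _ c1); first exact: Rhausdorff.
rewrite /mkset (_ : (fun J => _) = fun J => (-1) ^+ size ws * \sum_(j < J)
  \int[mu]_x (dil (e * 2 ^+ size ws) (fun=> dirs ws eta) j x * phi x))//.
apply/funext => J; rewrite mulr_sumr; apply: eq_bigr => j _.
by rewrite Int_iter_derive// dirs_dil.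
Qed.

End iterated_derivatives.

Section weak_derivatives.
Context {R : realType} {n : nat}.
Local Notation V := 'rV[R]_n.
Local Notation C := R[i].
Local Notation mu := (lebesgue_rV n).
Local Notation reC := (@complex.Re R).
Local Notation imC := (@complex.Im R).
Implicit Types (f g eta : V -> R) (phi : V -> C).

Lemma dist_of_realE f phi : dist_of_real f phi =
  Complex (\int[mu]_x (f x * reC (phi x))) (\int[mu]_x (f x * imC (phi x))).
Proof.
rewrite /dist_of_real /dist_of /cintegral; congr Complex; apply: eq_Int => x.
  by rewrite cReM /= mul0r subr0.
by rewrite cImM /= mul0r addr0.
Qed.

Lemma signC k (a b : R) : (-1 : C) ^+ k * Complex a b = Complex ((-1) ^+ k * a) ((-1) ^+ k * b).
Proof.
have -> : (-1 : C) ^+ k = Complex ((-1) ^+ k) 0.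
  by have := rmorphXn (real_complex R) k (-1); rewrite rmorphN1 => <-.
by apply/complexP; rewrite ?cReM ?cImM /= mul0r ?subr0 ?addr0.
Qed.

Lemma normc_real (a : R) : normc (Complex a 0 : C) = `|a|.
Proof. by rewrite /normc expr0n addr0 sqrtr_sqr. Qed.

Lemma size_multi_index k (beta : multi_index (n := n) k) :
  size (multi_index_seq beta) = (\sum_i beta i)%N.
Proof.
rewrite /multi_index_seq size_flatten /shape -map_comp sumnE big_map big_enum /=.
by apply: eq_bigr => i _; rewrite size_nseq.
Qed.

Lemma represents_dist_derive (e : R) eta (js : seq 'I_n) : 0 < e -> e * 2 ^- n < 1 ->
  e * 2 ^+ size js * 2 ^- n < 1 -> ann_supp eta -> schw eta ->
  represents (fun x => Complex (asum (dil (e * 2 ^+ size js)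
      (fun=> dirs [seq basis_vec i | i <- js] eta)) x) 0)
    (dist_derive js (dist_of_real (asum (dil e (fun=> eta))))).
Proof.
move=> e0 en ekn ae se; pose ws : seq V := [seq basis_vec i | i <- js].
have sw : size ws = size js by rewrite size_map.
split; [split|].
- apply: (@L1_locally_integrable R n (asum (dil (e * 2 ^+ size js) (fun=> dirs ws eta)))).
  apply: L1_asum_dil => //; first by rewrite mulr_gt0// exprn_gt0.
  + exact: ann_supp_dirs.
  + exact/schw_L1/schw_dirs.
- by apply: (@L1_locally_integrable R n (fun=> 0)); exact: L1_0.
move=> phi [tr ti].
have sr := test_function_schw tr; have si := test_function_schw ti.
rewrite -[RHS]/(dist_of_real _ phi) /dist_derive !dist_of_realE signC -sw.
have sgn : (-1 : R) ^+ size ws * (-1) ^+ size ws = 1.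
  by rewrite -exprMn mulrNN mulr1 expr1n.
have H f : schw f -> (-1) ^+ size ws *
    (\int[mu]_x (asum (dil e (fun=> eta)) x * iter_derive ws f x)) =
    \int[mu]_x (asum (dil (e * 2 ^+ size ws) (fun=> dirs ws eta)) x * f x).
  by move=> sf; rewrite Int_asum_iter_derive ?sw// mulrA -sw sgn mul1r.
by congr Complex; exact: H.
Qed.

(** The integer part k of s is spent on derivatives, which multiply e by 2^k, and the fractional
    part al on the seminorm, which brings 2^al. Their product is 2^s, so one ratio governs every
    s. *)
Lemma Wdot_norm_1_dyadic (s e : R) eta : 0 <= s -> 0 < e -> e * 2 ^- n < 1 ->
  e * 2 `^ s * 2 ^- n < 1 -> ann_supp eta -> schw eta ->
  (Wdot_norm_1 s (dist_of_real (asum (dil e (fun=> eta)))) < +oo)%E.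
Proof.
move=> s0 e0 en esn ae se; rewrite /Wdot_norm_1.
have /andP[ks sk1] := truncn_itv s0.
set k := Num.truncn s in ks sk1 *; set al := s - k%:R.
have al0 : 0 <= al by rewrite subr_ge0.
have al1 : al < 1 by rewrite ltrBlDr addrC -natr1 in sk1 *.
have sE : 2 `^ s = 2 ^+ k * 2 `^ al :> R.
  rewrite -powR_mulrn// -powRD ?pnatr_eq0 ?implybT//.
  by congr (_ `^ _); rewrite /al addrC subrK.
have ekn : e * 2 ^+ k * 2 ^- n < 1.
  apply: le_lt_trans esn; rewrite ler_wpM2r ?invr_ge0 ?exprn_ge0// ler_wpM2l ?(ltW e0)//.
  rewrite sE ler_peMr ?exprn_ge0// -[leLHS](powRr0 2); apply: ler_powR => //.
  by rewrite ler1n.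
pose js (beta : multi_index (n := n) k) := multi_index_seq beta.
pose ws beta : seq V := [seq basis_vec i | i <- js beta].
pose F beta := asum (dil (e * 2 ^+ size (js beta)) (fun=> dirs (ws beta) eta)).
pose g beta x : C := Complex (F beta x) 0.
have szE (beta : multi_index k) : (\sum_i beta i)%N = k -> size (js beta) = k.
  by move=> bk; rewrite size_multi_index.
have ek0 : 0 < e * 2 ^+ k by rewrite mulr_gt0// exprn_gt0.
apply: (@le_lt_trans _ _ (\sum_(beta : multi_index k | (\sum_i beta i)%N == k)
          (if al == 0%R then L1_norm (g beta) else gagliardo1 al (g beta)))%E).
  apply: ereal_inf_lbound; split.
    by apply: tempered_dist_of_real; apply: L1_asum_dil => //; exact: schw_L1.
  exists g => // beta bk; have sz := szE _ bk.
  by apply: represents_dist_derive; rewrite ?sz.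
apply: lte_sum_pinfty => beta /eqP bk; have sz := szE _ bk.
case: eqVneq => [_|aln0].
  rewrite /L1_norm; under eq_integral do rewrite normc_real.
  have F1 : L1 mu (F beta).
    rewrite /F sz; apply: L1_asum_dil => //; first exact: ann_supp_dirs.
    exact/schw_L1/schw_dirs.
  by rewrite (L1_EFin (L1_abs F1)) ltry.
have al01 : 0 < al < 1 by rewrite al1 lt_neqAle eq_sym aln0 al0.
have := @gagliardo_dyadic R n al al01 (e * 2 ^+ k) (dirs (ws beta) eta) ek0.
rewrite -(mulrA e) -sE => /(_ esn (schw_dirs (ws beta) se) (@ann_supp_dirs R n (ws beta) eta ae)).
have E x y : normc (g beta x - g beta y) / enorm (x - y) `^ (n%:R + al) =
    quot al (asum (dil (e * 2 ^+ k) (fun=> dirs (ws beta) eta))) (x, y).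
  have -> : g beta x - g beta y = Complex (F beta x - F beta y) 0.
    by apply/complexP; rewrite /= ?subrr.
  by rewrite normc_real /F sz.
rewrite /gagliardo1.
by under [X in _ -> (X < _)%E]eq_integral do under eq_integral do rewrite E.
Qed.

End weak_derivatives.

Section vortex.
Context {R : realType} {m : nat}.
Let n := m.+2.

Lemma vfield_Wdot_1 (r A : R) : 0 <= r -> 0 < A -> A * 2 ^- n < 1 ->
  A * 2 `^ r * 2 ^- n < 1 ->
  (Wdot_norm_vec r 1 (vfield (m := m) (prof n (2 * n + 2)) A) < +oo)%E.
Proof.
move=> r0 A0 An dn; apply: lte_sum_pinfty => i _.
rewrite /Wdot_norm eqxx.
have -> : (fun x => vfield (prof n (2 * n + 2)) A x 0 i) = asum (dil A (fun=> psi (prof n (2 * n + 2)) i)).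
  by apply/funext => x; rewrite mxE.
apply: Wdot_norm_1_dyadic => //.
- by apply: ann_psi; exact: ann_prof.
- exact: (schw_psi i (smooth_prof _ _) (ann_prof _ _)).
Qed.

End vortex.

(** * Choice of the exponents and conclusion *)

Section powers_of_two.
Context {R : realType}.
Implicit Types a b : R.

Lemma pow2_lt1 a : a < 0 -> 2 `^ a < 1 :> R.
Proof. by move=> a0; rewrite -[ltRHS](powRr0 2) pow2_lt. Qed.

Lemma pow2_gt1 a : 0 < a -> 1 < 2 `^ a :> R.
Proof. by move=> a0; rewrite -[ltLHS](powRr0 2) pow2_lt. Qed.

Lemma pow2D a b : 2 `^ a * 2 `^ b = 2 `^ (a + b) :> R.
Proof. by rewrite powRD ?pnatr_eq0 ?implybT. Qed.

Lemma pow2VX k : 2 ^- k = 2 `^ (- k%:R) :> R.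
Proof. by rewrite powRN powR_mulrn. Qed.

Lemma pow2_S a : 2 * 2 `^ a = 2 `^ (1 + a) :> R.
Proof. by rewrite -pow2D powRr1. Qed.

End powers_of_two.

(** The exponent is the midpoint of max(0, r - n / p) and 1; the bound on p says precisely that this
    maximum is below 1. *)
Lemma regularity_exponent (R : realType) (n : nat) (r p : R) : 1 < r -> 1 <= p ->
  p < n%:R / (r - 1) -> exists2 a : R, 0 < a < 1 & (r - a) * p < n%:R.
Proof.
move=> r1 p1 pn; have p0 : 0 < p by rewrite (lt_le_trans _ p1).
have rp : (r - 1) * p < n%:R by rewrite mulrC -ltr_pdivlMr ?subr_gt0.
pose l := Num.max 0 (r - n%:R / p).
have l1 : l < 1.
  by rewrite gt_max ltr01 /= ltrBlDr addrC -ltrBlDr ltr_pdivlMr.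
exists ((l + 1) / 2).
  have l0 : 0 <= l by rewrite le_max lexx.
  lra.
rewrite -ltr_pdivlMr// ltrBlDr -ltrBlDl.
have : r - n%:R / p <= l by rewrite le_max lexx orbT.
lra.
Qed.

Theorem theorem4 (R : realType) (d : nat) (r p : R)
    (hd : (2 <= d)%N) (hr : 1 < r) (hp : 1 <= p) (hpd : p < d%:R / (r - 1)) :
  exists mubar : R, mubar < 1 /\
  forall T sigma : R, 0 < T -> 0 < sigma ->
  exists (v : R -> 'rV[R]_d -> 'rV[R]_d) (theta : R -> 'rV[R]_d -> R),
    bounded_field T v /\
    divergence_free T v /\
    weak_solution T v theta /\
    (ereal_sup [set Wdot_norm_vec r p (v t) | t in `[0%R, T]] < +oo)%E /\
    in_Hdot sigma (dist_of_real (theta 0)) /\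
    (forall t : R, 0 < t <= T -> ~ in_Hdot sigma (dist_of_real (theta t))) /\
    (exists K : set 'rV[R]_d, compact K /\
       forall t x, t \in `[0, T] -> ~ K x -> v t x = 0 /\ theta t x = 0) /\
    (exists x0 : 'rV[R]_d,
       smooth_on_set (`[0, T] `*` ~` [set x0])
         (fun z : R * 'rV[R]_d => v z.1 z.2) /\
       smooth_on_set (`[0, T] `*` ~` [set x0])
         (fun z : R * 'rV[R]_d => theta z.1 z.2)) /\
    (forall mu : R, mubar < mu ->
       ~ in_Hdot (mu * sigma) (dist_of_real (theta T))).
Proof.
have [a /andP[a0 a1] rap] := regularity_exponent hr hp hpd.
case: d hd hpd rap => [//|[//|m]] _ hpd rap; set n := m.+2 in hpd rap *.
(* At a time t > 0 the j-th piece oscillates at frequency t 2^(j q), against 2^j at time 0. *)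
pose q := 2 - a; have q1 : 1 < q by rewrite /q; lra.
have q0 : 0 < q by lra.
have qV : q^-1 < 1 by rewrite invf_lt1.
(* The midpoint of 1 / q and 1, so that both mubar < 1 and mubar q > 1 hold. It is fixed before T
   and sigma. *)
pose mubar := (q^-1 + 1) / 2.
have mu1 : mubar < 1 by rewrite /mubar; lra.
have qV0 : 0 < q^-1 by rewrite invr_gt0.
have mu0 : 0 < mubar by rewrite /mubar; lra.
have muq : 1 < mubar * q by rewrite -ltr_pdivrMr// mul1r /mubar; lra.
exists mubar; split => // T sigma T0 sigma0.
have n2 : (2 : R) <= n%:R by rewrite ler_nat.
have p0 : 0 < p by rewrite (lt_le_trans _ hp).
(* This puts the threshold of regularity at mubar q sigma > sigma for the datum, and at mubar sigma
   < sigma for positive times. *)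
pose b := mubar * q * sigma - n%:R / 2.
pose A : R := 2 `^ (- a); pose B : R := 2 `^ (- b).
have A0 : 0 < A by exact: powR_gt0.
have B0 : 0 < B by exact: powR_gt0.
have A1 : 0 < A <= 1 by rewrite A0 ltW// pow2_lt1// oppr_lt0.
have An : A * 2 ^- n < 1 by rewrite pow2VX pow2D pow2_lt1//; lra.
have ms : 0 < mubar * q * sigma by exact: mulr_gt0 (mulr_gt0 mu0 q0) sigma0.
have Bn : B * 2 ^- n < 1 by rewrite pow2VX pow2D pow2_lt1// /b; lra.
have ra : 0 < r - a by lra.
(* As p >= 1, the condition for L^1 summability follows from the one for L^p. *)
have Ar : A * 2 `^ r * 2 ^- n < 1.
  rewrite pow2VX !pow2D pow2_lt1//.
  have : r - a <= (r - a) * p by rewrite ler_peMr// ltW.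
  lra.
have Arp : (A * 2 `^ r) `^ p * 2 ^- n < 1.
  rewrite pow2D -powRrM pow2VX pow2D pow2_lt1//.
  have -> : (- a + r) * p = (r - a) * p by ring.
  lra.
(* This is a < 1: the angular velocity grows as the annuli shrink. *)
have A2 : 1 < 2 * A by rewrite pow2_S pow2_gt1//; lra.
pose N := (2 * n + 2)%N; pose G : R -> R := prof n N.
have sG : smooth G by exact: smooth_prof.
have aG : ann G by exact: ann_prof.
have dG := @prof_derive_neq0 R n N.
have Hs : B `^ 2 * 2 `^ (2 * sigma) * 2 ^- n < 1.
  rewrite -powRrM pow2VX !pow2D pow2_lt1//.
  have : sigma < mubar * q * sigma by rewrite ltr_pMl.
  rewrite /b; lra.
(* One statement for both losses: s = sigma at every positive time, and s = mu sigma at the final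
   time. *)
have not_in t s : 0 < t -> mubar * sigma < s ->
    ~ in_Hdot s (dist_of_real (theta (m := m) G A B t)).
  move=> t0 st; apply: theta_not_Hdot => //.
    by rewrite ltW// (le_lt_trans _ st)// ltW// mulr_gt0.
  rewrite pow2_S pow2_S -powRrM -(powR_mulrn 2 (ltW B0)) -powRrM pow2VX !pow2D pow2_gt1//.
  have -> : - b * 2%:R + - n%:R + (1 + (1 - a)) * (2 * s) = 2 * (q * (s - mubar * sigma)).
    by rewrite /b /q; field.
  by rewrite !mulr_gt0// subr_gt0.
exists (fun=> vfield (m := m) G A), (theta (m := m) G A B).
split; first exact: vfield_bounded_field.
split; first exact: vfield_divergence_free.
split; first exact: vortex_weak_solution.
split.
  apply: (@le_lt_trans _ _ (Wdot_norm_vec r p (vfield (m := m) G A))).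
    by apply: ge_ereal_sup => _ [t _ <-].
  have [p1|p1] := eqVneq p 1.
    by rewrite p1; apply: vfield_Wdot_1 => //; lra.
  by apply: vfield_Wdot_gt1 => //; [lra|rewrite lt_neqAle eq_sym p1].
split; first exact: theta0_in_Hdot (ltW sigma0) Hs.
split.
  by move=> t /andP[t0 _]; apply: not_in => //; rewrite gtr_pMl.
split.
  exists [set x | `|x| <= 2]; split; first exact: norm_bounded_compact.
  by move=> t x _ /negP; rewrite -ltNge; exact: vortex_compact_support.
split.
  by exists 0; split; [exact: smooth_vfield_punctured|exact: smooth_theta_punctured].
by move=> mu hmu; apply: not_in => //; rewrite ltr_pM2r.
Qed.
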